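(* Let $E\subset\mathbb{R}^d$, $\mu$, $A$, $B$, $(\mathcal{E}^0,D(\mathcal{E}^0))$, $(L^0,D(L^0))$ and $D(\mathcal{E}^{0,E})$ be as in the context. There exists a closed operator $(\overline{L},D(\overline{L}))$ on $L^1(E,\mu)$ which is the generator of a sub-Markovian $C_0$-semigroup of contractions $(\overline{T}_t)_{t>0}$ satisfying the following properties: (a) $(\overline{L},D(\overline{L}))$ is a closed extension of $Lu=L^0u+\langle B,\nabla u\rangle$, $u\in D(L^0)_{0,b}$, on $L^1(E,\mu)$. (b) $D(\overline{L})_b\subset D(\mathcal{E}^0)$, and for $u\in D(\overline{L})_b$, $v\in D(\mathcal{E}^{0,E})_b$ we have $$\mathcal{E}^0(u,v)-\int_E\langle B,\nabla u\rangle v\,d\mu=-\int_E\overline{L}u\,v\,d\mu$$ and $$\mathcal{E}^0(u,u)\le-\int_E\overline{L}u\,u\,d\mu.$$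
   Context: Setting. $E\subset\mathbb{R}^d$ is either open or closed; if $E$ is closed, $dx(\partial E)=0$. $\varphi\in L^1_{loc}(E,dx)$, $\varphi>0$ $dx$-a.e., and $d\mu:=\varphi\,dx$, a $\sigma$-finite measure on $\mathcal{B}(E)$ with full support; $(\cdot,\cdot)$ is the inner product of $L^2(E,\mu)$. $C_0^\infty(E)$ is the set of smooth functions with compact support in $E$ if $E$ is open, and the set of restrictions to $E$ of functions in $C_0^\infty(\mathbb{R}^d)$ if $E$ is closed. $\langle\cdot,\cdot\rangle$ and $|\cdot|$ are the Euclidean inner product and norm. $V\subset\subset E$ means $V$ is relatively open in $E$ with compact closure contained in $E$. $A=(a_{ij})_{1\le i,j\le d}$ with $a_{ij}\in L^1_{loc}(E,\mu)$ is a possibly non-symmetric matrix with symmetric part $\tilde a_{ij}=\frac12(a_{ij}+a_{ji})$, and for each $V\subset\subset E$ there is $\nu_V>0$ with $\nu_V^{-1}|\xi|^2\le\sum_{i,j}\tilde a_{ij}(x)\xi_i\xi_j\le\nu_V|\xi|^2$ for all $\xi\in\mathbb{R}^d$, $x\in V$. The form $\mathcal{E}^0(f,g):=\int_E\langle A\nabla f,\nabla g\rangle\,d\mu$, $f,g\in C_0^\infty(E)$, is assumed closable on $L^2(E,\mu)$ and to satisfy the strong sector condition $|\mathcal{E}^0(f,g)|\le K\mathcal{E}^0(f,f)^{1/2}\mathcal{E}^0(g,g)^{1/2}$ for some $K>0$; its closure is $(\mathcal{E}^0,D(\mathcal{E}^0))$, with generator $(L^0,D(L^0))$ (so $\mathcal{E}^0(f,g)=(-L^0f,g)$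 for $f\in D(L^0)$, $g\in D(\mathcal{E}^0)$). $\nabla$ is the weak gradient, extended to $D(\mathcal{E}^0)$ as $L^2_{loc}(E,\mathbb{R}^d,\mu)$-limit along $\mathcal{E}^0_1$-approximating sequences in $C_0^\infty(E)$. For $V\subset\subset E$, $C_0^\infty(V):=\{u\in C_0^\infty(E):\mathrm{supp}(u)\subset V\}$, $(\mathcal{E}^{0,V},D(\mathcal{E}^{0,V}))$ is the closure of $(\mathcal{E}^0,C_0^\infty(V))$ on $L^2(V,\mu)$, and $D(\mathcal{E}^{0,E}):=\bigcup_{V\subset\subset E}D(\mathcal{E}^{0,V})\subset D(\mathcal{E}^0)$. For a function space $W$: $W_b$ is the set of $\mu$-a.e. bounded elements, $W_0$ the set of elements with compact support in $E$ (support of $|u|d\mu$), $W_{0,b}=W_0\cap W_b$. $B=(B_1,\dots,B_d)\in L^2_{loc}(E,\mathbb{R}^d,\mu)$ is $\mu$-divergence free: $\int_E\langle B,\nabla f\rangle\,d\mu=0$ for all $f\in C_0^\infty(E)$ (hence for all $f\in D(\mathcal{E}^{0,E})$). It is assumed that $D(L^0)_{0,b}$ is a dense subset of $L^1(E,\mu)$. Sub-Markovian means $0\le f\le1$ implies $0\le\overline{T}_tf\le1$. *)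

(* Defs.v *)
From HB Require Import structures.
From mathcomp Require Import all_boot all_order all_algebra.
From mathcomp Require Import all_classical all_reals all_analysis.
From mathcomp Require Import measurable_realfun.
Set Implicit Arguments.
Unset Strict Implicit.
Unset Printing Implicit Defensive.
Import Order.TTheory GRing.Theory Num.Theory.
Import numFieldNormedType.Exports.
Local Open Scope classical_set_scope.
Local Open Scope ring_scope.

(* Convention: a function on E, or an element of L^p(E, mu), is represented by
   a function on the whole space 'rV[R]_d, and mu by a measure on the Borel sets
   of 'rV[R]_d carried by E; the values off E are irrelevant.  Elements of L^p
   are functions in [Lfun mu p], and two functions are the same element when
   they are equal mu-a.e.  The domains of operators and of closed forms below
   are stable under a.e. equality of functions in Lfun. *)

Section borel_matrix.
Variables (R : realType) (m n : nat).
Let T : pointedType := 'M[R]_(m, n).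
HB.instance Definition _ := @isMeasurable.Build (sigma_display (@open 'M[R]_(m, n)))
  'M[R]_(m, n) <<s (@open 'M[R]_(m, n)) >> (@sigma_algebra0 _ setT _)
  (@sigma_algebraC T _) (@sigma_algebra_bigcup _ setT _).
End borel_matrix.

Section measurable_rV.
Variable R : realType.

Lemma measurable_coord n j : measurable_fun [set: 'rV[R]_n] (fun x => x 0 j).
Proof.
apply: (measurability _ (RGenOpens.measurableE R)).
move=> _ [B [a [b ->]] <-]; rewrite setTI; apply: sub_sigma_algebra.
apply: open_comp; last exact: interval_open.
by move=> x _; exact: coord_continuous.
Qed.

Lemma measurable_fun_rV d (T : measurableType d) n (f : T -> 'rV[R]_n) :
  (forall j, measurable_fun [set: T] (fun t => f t 0 j)) ->
  measurable_fun [set: T] f.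
Proof.
move=> mf; apply: (measurability (@open 'rV[R]_n)) => //.
move=> _ [U oU <-]; rewrite setTI.
pose F (qk : 'rV[rat]_n * nat) :=
  [set y : 'rV[R]_n | forall j, `|y 0 j - ratr (qk.1 0 j)| < qk.2.+1%:R^-1].
have -> : U = \bigcup_(qk : 'rV[rat]_n * nat)
    (if `[< F qk `<=` U >] then F qk else set0).
  apply/seteqP; split=> [y Uy|y [qk _]]; last by case: ifPn => // /asboolP; exact.
  have := oU; rewrite openE => /(_ _ Uy) /nbhs_ballP[e /= e0 eU].
  have [k ke] : exists k : nat, k.+1%:R^-1 < e / 2.
    by have := near_infty_natSinv_lt (PosNum (divr_gt0 e0 (ltr0Sn _ 1))) => -[k _ /(_ k (leqnn _))]; exists k.
  have /choice[q hq] : forall j, exists r : rat, `|y 0 j - ratr r| < k.+1%:R^-1.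
    move=> j.
    have [r] : exists r : rat, ratr r \in `]y 0 j - k.+1%:R^-1, y 0 j + k.+1%:R^-1[.
      by apply: rat_in_itvoo; rewrite ltrD2l gtrN.
    by rewrite in_itv/= -ltr_distl distrC => ?; exists r.
  exists (\row_j q j, k) => //; have -> : `[< F (\row_j q j, k) `<=` U >].
    apply/asboolP => z /= hz; apply: eU; split=> // i j; rewrite !ord1.
    rewrite /ball/= -[y 0 j](subrK (ratr (q j))) -addrA.
    rewrite (le_lt_trans (ler_normD _ _))// [e]splitr ltrD//.
      exact: lt_trans (hq j) ke.
    by rewrite distrC; have := hz j; rewrite mxE => /lt_trans; exact.
  by move=> j /=; rewrite mxE.
rewrite preimage_bigcup; apply: countable_bigcupT_measurable => // qk.
case: ifPn => _; last by rewrite preimage_set0.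
have -> : f @^-1` F qk = \bigcap_(j in [set: 'I_n])
    [set t | `|f t 0 j - ratr (qk.1 0 j)| < qk.2.+1%:R^-1].
  by apply/seteqP; split=> t /= h j => [_|]; exact: h.
apply: fin_bigcap_measurable; first exact: finite_finset.
move=> j _; rewrite -[X in measurable X]setTI.
have -> : [set t | `|f t 0 j - ratr (qk.1 0 j)| < qk.2.+1%:R^-1] =
   (fun t => `|f t 0 j - ratr (qk.1 0 j)|) @^-1` `]-oo, qk.2.+1%:R^-1[%classic.
  by apply/seteqP; split=> t; rewrite /= in_itv.
apply: (measurableT_comp (@normr_measurable R setT)) => //.
apply: measurable_funB => //; exact: mf.
Qed.


Definition cons_rV n (p : R * 'rV[R]_n) : 'rV[R]_n.+1 := row_mx p.1%:M p.2.
Definition uncons_rV n (x : 'rV[R]_n.+1) : R * 'rV[R]_n :=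
  (x 0 ord0, \row_j x 0 (lift ord0 j)).

Lemma cons_rVK n : cancel (@cons_rV n) (@uncons_rV n).
Proof.
move=> [a y]; rewrite /uncons_rV /cons_rV /=; congr pair.
  have -> : (ord0 : 'I_n.+1) = lshift n (ord0 : 'I_1) by exact/val_inj.
  by rewrite (row_mxEl a%:M y) mxE eqxx.
apply/rowP => j; rewrite mxE (_ : lift ord0 j = rshift 1 j); last exact/val_inj.
by rewrite (row_mxEr a%:M y).
Qed.

Lemma measurable_cons_rV n : measurable_fun setT (@cons_rV n).
Proof.
apply: measurable_fun_rV => j; rewrite /cons_rV /=.
case: (@split_ordP 1 n j) => k ->.
  rewrite [X in measurable_fun _ X](_ : _ = fst)//.
  by apply/funext => -[a y]; rewrite (row_mxEl a%:M y) mxE !ord1 eqxx.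
rewrite [X in measurable_fun _ X](_ : _ = (fun x : 'rV[R]_n => x 0 k) \o snd).
  by apply: measurableT_comp => //; exact: measurable_coord.
by apply/funext => -[a y]; rewrite (row_mxEr a%:M y).
Qed.

Lemma measurable_uncons_rV n : measurable_fun setT (@uncons_rV n).
Proof.
apply/measurable_fun_pairP; split; first exact: measurable_coord.
apply: measurable_fun_rV => j /=.
by under eq_fun do rewrite mxE; exact: measurable_coord.
Qed.

End measurable_rV.

(* Lebesgue measure on R^n.+1 is the product of the Lebesgue measures on R
   and R^n, carried over by (a, y) |-> row_mx a y; on R^0 it is the unit mass. *)
Section lebesgue_rV_step.
Variables (R : realType) (n : nat).
Variable mu : {sigma_finite_measure set 'rV[R]_n -> \bar R}.

Definition lebesgue_cons : set 'rV[R]_n.+1 -> \bar R :=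
  pushforward (lebesgue_measure \x mu)%E (@cons_rV R n).

HB.instance Definition _ := Measure.copy lebesgue_cons
  (measure_function_pushforward__canonical__measure_function_Measure
     (lebesgue_measure \x mu)%E (@measurable_cons_rV R n)).

Let lebesgue_cons_sigma_finite : sigma_finite setT lebesgue_cons.
Proof.
have /sigma_finiteP[F [TF ndF Foo]] := sigma_finiteT (@lebesgue_measure R).
have /sigma_finiteP[G [TG ndG Goo]] := sigma_finiteT mu.
exists (fun i => @uncons_rV R n @^-1` (F i `*` G i)) => [|i].
  rewrite -preimage_bigcup; apply/esym/seteqP; split=> // x _ /=.
  have [[k _ Fk] [l _ Gl]] : (\bigcup_i F i) (uncons_rV x).1 /\
      (\bigcup_i G i) (uncons_rV x).2 by rewrite -TF -TG.
  exists (maxn k l) => //; split.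
    by move: Fk; exact/subsetPset/ndF/leq_maxl.
  by move: Gl; exact/subsetPset/ndG/leq_maxr.
have [mF Fi] := Foo i; have [mG Gi] := Goo i; split.
  rewrite -[X in measurable X]setTI.
  by apply: measurable_uncons_rV => //; exact: measurableX.
rewrite /lebesgue_cons /pushforward -comp_preimage.
have -> : @uncons_rV R n \o @cons_rV R n = id.
  by apply/funext => p; exact: cons_rVK.
by rewrite preimage_id product_measure1E// lte_mul_pinfty// ge0_fin_numE.
Qed.

HB.instance Definition _ :=
  @Measure_isSigmaFinite.Build _ _ _ lebesgue_cons lebesgue_cons_sigma_finite.

End lebesgue_rV_step.

Fixpoint lebesgue_rV (R : realType) (d : nat) :
    {sigma_finite_measure set 'rV[R]_d -> \bar R} :=
  match d with
  | 0 => \d_(0 : 'rV[R]_0)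
  | n.+1 => lebesgue_cons (lebesgue_rV R n)
  end.

Section calculus.
Variables (R : realType) (d : nat).
Local Notation X := 'rV[R]_d.
Implicit Types (E V : set X) (f g : X -> R).

Definition dotv (u v : X) : R := \sum_i u 0 i * v 0 i.

Definition partial (i : 'I_d) f : X -> R := fun x => 'D_(delta_mx 0 i) f x.

Definition grad f (x : X) : X := \row_i partial i f x.

Definition smooth f := forall s : seq 'I_d,
  let g := foldr partial f s in
  continuous g /\ forall i x, derivable g x (delta_mx 0 i).

(* C_0^oo(E).  If E is open, f is the extension by zero; if E is closed, f is a
   function in C_0^oo(R^d) whose restriction to E is meant.  The two readings
   agree when E is both open and closed. *)
Definition Ccoo E f :=
  [/\ smooth f, compact (closure [set x | f x != 0]) &
      open E -> closure [set x | f x != 0] `<=` E].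

Definition subsubset V E :=
  [/\ exists2 U : set X, open U & V = U `&` E,
      compact (closure V) & closure V `<=` E].

(* The support is taken in E, of the restriction of f to E. *)
Definition Ccoo_in E V f :=
  Ccoo E f /\ E `&` closure (E `&` [set x | f x != 0]) `<=` V.

End calculus.

Section function_spaces.
Variables (R : realType) (d : nat).
Local Notation X := 'rV[R]_d.
Variables (E : set X) (mu : {measure set X -> \bar R}).
Implicit Types (f g u : X -> R) (p : \bar R).

Definition Lloc p f := measurable_fun E f /\
  forall K, compact K -> K `<=` E -> f \_ K \in Lfun mu p.

Definition Lcvg p (u : nat -> X -> R) f :=
  'N[mu]_p[EFin \o (u n \- f)%R]%E @[n --> \oo] --> 0%E.

Definition ae_bounded f := exists M, \forall x \ae mu, `|f x| <= M.

(* The support in E of the measure |f| dmu. *)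
Definition msupp f : set X := [set x | E x /\
  forall U, open U -> U x -> (0 < \int[mu]_(y in U `&` E) `|f y|%:E)%E].

Definition dense_in_L1 (S : set (X -> R)) :=
  (forall g, S g -> g \in Lfun mu 1) /\
  forall f, f \in Lfun mu 1 -> forall e : R, 0 < e ->
    exists2 g, S g & ('N[mu]_1[EFin \o (f \- g)%R] < e%:E)%E.

End function_spaces.

Section forms.
Variables (R : realType) (d : nat).
Local Notation X := 'rV[R]_d.
Variables (E : set X) (mu : {measure set X -> \bar R}).
Variables (a : (X -> R) -> (X -> R) -> R) (D : set (X -> R)).
Implicit Types (f g h : X -> R) (u v : nat -> X -> R).

Definition approximates u f :=
  [/\ forall n, D (u n),
      forall e, 0 < e -> exists N, forall m n, (N <= m)%N -> (N <= n)%N ->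
        a (u m \- u n) (u m \- u n) < e &
      Lcvg mu 2%:E u f].

Definition closable := forall u, approximates u (cst 0) ->
  a (u n) (u n) @[n --> \oo] --> (0 : R).

Definition strong_sector := exists2 K, 0 < K & forall f g, D f -> D g ->
  `|a f g| <= K * Num.sqrt (a f f) * Num.sqrt (a g g).

Definition closure_dom : set (X -> R) :=
  [set f | f \in Lfun mu 2%:E /\ exists u, approximates u f].

(* For a closable form satisfying the strong sector condition and f, g in
   closure_dom, the limit exists and does not depend on u and v. *)
Definition closure_form f g : R :=
  xget 0 [set r | exists u v, [/\ approximates u f, approximates v g &
                                 a (u n) (v n) @[n --> \oo] --> r]].

Definition form_generator f h :=
  [/\ closure_dom f, h \in Lfun mu 2%:E & forall g, closure_dom g ->
      closure_form f g = - \int[mu]_(x in E) (h x * g x)].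

Definition generator_dom : set (X -> R) :=
  [set f | exists h, form_generator f h].

Definition generator f : X -> R := xget (cst 0) [set h | form_generator f h].

Definition is_weak_grad f (G : X -> X) := exists2 u, approximates u f &
  forall i, Lloc E mu 2%:E (fun x => G x 0 i) /\
    forall K, compact K -> K `<=` E ->
      'N[mu]_2%:E[EFin \o ((fun x => grad (u n) x 0 i - G x 0 i)%R \_ K)]%E
        @[n --> \oo] --> 0%E.

Definition weak_grad f : X -> X := xget (cst 0) [set G | is_weak_grad f G].

End forms.

Section L1_operators.
Variables (R : realType) (d : nat).
Local Notation X := 'rV[R]_d.
Variable mu : {measure set X -> \bar R}.
Implicit Types (D : set (X -> R)) (L : (X -> R) -> X -> R) (f g u v : X -> R).
Implicit Type T : R -> (X -> R) -> X -> R.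

(* A linear operator L with domain D on L^1; the values of L off D are
   irrelevant. *)
Definition L1_operator D L :=
  [/\ forall u, D u -> u \in Lfun mu 1 /\ L u \in Lfun mu 1,
      forall u v, D u -> v \in Lfun mu 1 -> u = v %[ae mu] ->
        D v /\ L u = L v %[ae mu],
      D (cst 0) &
      forall (c : R) u v, D u -> D v -> D (fun x => c * u x + v x) /\
        L (fun x => c * u x + v x) = (fun x => c * L u x + L v x) %[ae mu]].

Definition L1_closed D L := forall (u : nat -> X -> R) f g,
  (forall n, D (u n)) -> f \in Lfun mu 1 -> g \in Lfun mu 1 ->
  Lcvg mu 1 u f -> Lcvg mu 1 (fun n => L (u n)) g ->
  D f /\ L f = g %[ae mu].

Definition C0_contraction_semigroup T :=
  [/\ forall t, 0 < t -> L1_operator [set f | f \in Lfun mu 1] (T t),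
      forall t f, 0 < t -> f \in Lfun mu 1 ->
        ('N[mu]_1[EFin \o T t f] <= 'N[mu]_1[EFin \o f])%E,
      forall s t f, 0 < s -> 0 < t -> f \in Lfun mu 1 ->
        T (s + t) f = T s (T t f) %[ae mu] &
      forall f, f \in Lfun mu 1 ->
        'N[mu]_1[EFin \o (T t f \- f)%R]%E @[t --> 0^'+] --> 0%E].

Definition sub_Markovian T := forall t f, 0 < t -> f \in Lfun mu 1 ->
  (\forall x \ae mu, 0 <= f x <= 1) -> \forall x \ae mu, 0 <= T t f x <= 1.

Definition right_derivative0 T u g :=
  'N[mu]_1[EFin \o (fun x => t^-1 * (T t u x - u x) - g x)%R]%E @[t --> 0^'+]
    --> 0%E.

Definition is_generator T D L :=
  (forall u, D u <-> u \in Lfun mu 1 /\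
      exists2 g, g \in Lfun mu 1 & right_derivative0 T u g) /\
  (forall u, D u -> L u \in Lfun mu 1 /\ right_derivative0 T u (L u)).

End L1_operators.

Section dirichlet_form.
Variables (R : realType) (d : nat).
Local Notation X := 'rV[R]_d.
Variables (E : set X) (mu : {measure set X -> \bar R}) (A : X -> 'M[R]_d).

Definition sym_part (M : 'M[R]_d) : 'M[R]_d := 2^-1 *: (M + M^T).

Definition locally_elliptic := forall V, subsubset V E ->
  exists2 nu : R, 0 < nu & forall (xi x : X), V x ->
    nu^-1 * dotv xi xi <= dotv (xi *m sym_part (A x)) xi <= nu * dotv xi xi.

(* A acts on column vectors, hence the transpose. *)
Definition pre_form (f g : X -> R) : R :=
  \int[mu]_(x in E) dotv (grad f x *m (A x)^T) (grad g x).

Definition D_E0 : set (X -> R) := closure_dom mu pre_form (Ccoo E).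

Definition E0 : (X -> R) -> (X -> R) -> R := closure_form mu pre_form (Ccoo E).

Definition D_L0 : set (X -> R) := generator_dom E mu pre_form (Ccoo E).

Definition L0 : (X -> R) -> X -> R := generator E mu pre_form (Ccoo E).

Definition nabla : (X -> R) -> X -> X := weak_grad E mu pre_form (Ccoo E).

Definition D_L0_0b : set (X -> R) :=
  [set u | [/\ D_L0 u, compact (msupp E mu u) & ae_bounded mu u]].

(* Approximants from C_0^oo(V) vanish on E \ V, so that their L^2(E, mu)-limits
   are the zero extensions of their L^2(V, mu)-limits. *)
Definition D_E0V (V : set X) : set (X -> R) :=
  closure_dom mu pre_form (Ccoo_in E V).

Definition D_E0E : set (X -> R) :=
  [set u | exists2 V, subsubset V E & D_E0V V u].

End dirichlet_form.

(* Main.v *)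
From HB Require Import structures.
From mathcomp Require Import all_boot all_order all_algebra.
From mathcomp Require Import all_classical all_reals all_analysis.
From mathcomp Require Import ring lra measurable_realfun.
Require Import Defs.
(* For V relatively compact in E, the first-order term is, by the divergence-free
   condition, antisymmetric on the bounded part of D(E^{0,V}); Lions' projection
   theorem then solves (1 - h L)u = f there for f in L^1 and L^2, although
   v |-> \int <B, grad u> v is only bounded against bounded v.  Testing with
   flat smooth functions of u - c gives \int (u - c)^+ <= \int (f - c)^+, hence
   L^1-dissipativity, the sub-Markov property, and the monotonicity in V of the
   resolvents of nonnegative f.  The generator on L^1(E, mu) is the limit of the
   graphs of the realizations along an exhaustion of E: monotonicity makes the
   resolvents converge, so that 1 - h Lbar is onto, and Hille-Yosida (here by the
   exponential formula) yields the semigroup.  For (b), the resolvent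
   approximations of a bounded u are bounded and have bounded energy, so that
   convex combinations of them converge to u in D(E^0) (Mazur). *)

Set Implicit Arguments.
Unset Strict Implicit.
Unset Printing Implicit Defensive.
Import Order.TTheory GRing.Theory Num.Theory.
Import numFieldNormedType.Exports.
Local Open Scope classical_set_scope.
Local Open Scope ring_scope.

(** * The Hille-Yosida theorem *)

(** Two obstacles shape the argument. The drift pairs an energy element only with bounded functions
    living on a relatively compact set, so limits in the second argument must keep a uniform bound.
    Approximants are therefore truncated smoothly; this keeps their energies bounded but need not
    keep them convergent in energy, and midpoint hulls restore strong convergence while retaining
    bounds and supports. Secondly, the limit graph in $L^1$ remembers no energy: a bounded [u] in
    the domain of the generator is a limit of local solutions that need be neither bounded nor of
    bounded energy. They are replaced by the local resolvents $(1-hL_n)^{-1}u$, which inherit the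
    bound of [u]; density of the domain then shows that their images still converge to the image of
    [u]. The density of $D(L^0)_{0,b}$ also enters in the proof that $L^0u$ vanishes off a
    relatively compact set when [u] has compact support, which puts $L^0u$, a priori only in $L^2$,
    into $L^1$. Functions are not identified almost everywhere, so norms are seminorms and equality
    reads [N (u \- v) = 0]. *)

Section hille_yosida.
Variables (R : realType) (X : Type).
Local Notation V := (X -> R).
Variables (S : set V) (N : V -> R).
Implicit Types (u v w f g k : V) (a b c h t e : R).

Definition seminorm_on :=
  [/\ S (cst 0),
      forall c u v, S u -> S v -> S (fun x => c * u x + v x),
      forall u v, S u -> S v -> N (u \+ v) <= N u + N v &
      forall c u, S u -> N (fun x => c * u x) = `|c| * N u].

Definition Ncvg (s : nat -> V) u := forall e, 0 < e ->
  exists n0, forall n, (n0 <= n)%N -> N (s n \- u) < e.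

Definition Ncauchy (s : nat -> V) := forall e, 0 < e ->
  exists n0, forall m n, (n0 <= m)%N -> (n0 <= n)%N -> N (s m \- s n) < e.

Definition Ncomplete := forall s, (forall n, S (s n)) -> Ncauchy s ->
  exists2 u, S u & Ncvg s u.

Hypothesis HN : seminorm_on.

Lemma sn_lin c u v : S u -> S v -> S (fun x => c * u x + v x).
Proof. by case: HN => _ + _ _; apply. Qed.

Lemma sn0 : S (cst 0). Proof. by case: HN. Qed.

Lemma sn_scale c u : S u -> S (fun x => c * u x).
Proof.
move=> Su; rewrite (_ : (fun x => _) = (fun x => c * u x + (cst 0 : V) x)).
  by apply: sn_lin => //; exact: sn0.
by apply/funext => x /=; rewrite addr0.
Qed.

Lemma sn_add u v : S u -> S v -> S (u \+ v).
Proof.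
move=> Su Sv; rewrite (_ : _ \+ _ = (fun x => 1 * u x + v x)).
  exact: sn_lin.
by apply/funext => x /=; rewrite mul1r.
Qed.

Lemma sn_sub u v : S u -> S v -> S (u \- v).
Proof.
move=> Su Sv; rewrite (_ : _ \- _ = (fun x => (-1) * v x + u x)).
  exact: sn_lin.
by apply/funext => x /=; ring.
Qed.

Lemma N_scale c u : S u -> N (fun x => c * u x) = `|c| * N u.
Proof. by case: HN => _ _ _; apply. Qed.

Lemma N_add u v : S u -> S v -> N (u \+ v) <= N u + N v.
Proof. by case: HN => _ _ + _; apply. Qed.

Lemma N_eq_le u v : u =1 v -> N u <= N v.
Proof. by move=> /funext ->. Qed.

Lemma N0 : N (cst 0) = 0.
Proof.
rewrite (_ : cst 0 = (fun x => 0 * (cst 0 : V) x)); last first.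
  by apply/funext => x /=; rewrite mul0r.
by rewrite N_scale ?normr0 ?mul0r//; exact: sn0.
Qed.

Lemma Ndxx u : N (u \- u) = 0.
Proof. by rewrite -[RHS]N0; congr N; apply/funext => x /=; rewrite subrr. Qed.

Lemma NdC u v : S u -> S v -> N (u \- v) = N (v \- u).
Proof.
move=> Su Sv; rewrite -[LHS]mul1r -(normr1 R) -normrN -N_scale; last exact: sn_sub.
by congr N; apply/funext => x /=; ring.
Qed.

Lemma Nd_tri v u w : S u -> S v -> S w -> N (u \- w) <= N (u \- v) + N (v \- w).
Proof.
move=> Su Sv Sw; rewrite (_ : u \- w = (u \- v) \+ (v \- w)).
  by apply: N_add; exact: sn_sub.
by apply/funext => x /=; ring.
Qed.

Lemma N_ge0 u : S u -> 0 <= N u.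
Proof.
move=> Su; have := @Nd_tri u (cst 0) (cst 0) sn0 Su sn0.
rewrite Ndxx (@NdC (cst 0))//; last exact: sn0.
rewrite (_ : u \- cst 0 = u); last by apply/funext => x /=; rewrite subr0.
lra.
Qed.

Lemma Nd_ge0 u v : S u -> S v -> 0 <= N (u \- v).
Proof. by move=> Su Sv; apply: N_ge0; exact: sn_sub. Qed.

Lemma N_leD u v : S u -> S v -> N u <= N v + N (u \- v).
Proof.
move=> Su Sv; rewrite [X in N X <= _](_ : u = v \+ (u \- v)).
  by apply: N_add => //; exact: sn_sub.
by apply/funext => x /=; ring.
Qed.

Lemma N_dist u v : S u -> S v -> `|N u - N v| <= N (u \- v).
Proof.
move=> Su Sv; have := N_leD Su Sv; have := N_leD Sv Su.
rewrite (NdC Sv Su) ler_norml; lra.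
Qed.

Lemma le_eps (x y : R) : (forall e, 0 < e -> x <= y + e) -> x <= y.
Proof. by move=> h; apply/ler_addgt0Pr. Qed.

Lemma Ncvg_unique s u v : (forall n, S (s n)) -> S u -> S v ->
  Ncvg s u -> Ncvg s v -> N (u \- v) = 0.
Proof.
move=> Ss Su Sv su sv; apply/eqP; rewrite eq_le Nd_ge0// andbT.
apply: le_eps => e e0; rewrite add0r.
have e2 : 0 < e / 2 by lra.
have [n1 h1] := su _ e2; have [n2 h2] := sv _ e2.
have := h1 (maxn n1 n2) (leq_maxl _ _); have := h2 (maxn n1 n2) (leq_maxr _ _).
have := Nd_tri Su (Ss (maxn n1 n2)) Sv.
rewrite (NdC Su (Ss _)) (NdC Su Sv) (NdC Sv Su).
lra.
Qed.

Lemma Ncvg_cauchy s u : (forall n, S (s n)) -> S u -> Ncvg s u -> Ncauchy s.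
Proof.
move=> Ss Su su e e0; have e2 : 0 < e / 2 by lra.
have [n1 h1] := su _ e2; exists n1 => m n hm hn.
have := h1 _ hm; have := h1 _ hn; rewrite (NdC (Ss n))//.
have := Nd_tri (Ss m) Su (Ss n); lra.
Qed.

Lemma Ncvg_cst u : Ncvg (fun=> u) u.
Proof. by move=> e e0; exists 0%N => n _; rewrite Ndxx. Qed.

Lemma Ncvg_lin c s s' u v : (forall n, S (s n)) -> (forall n, S (s' n)) ->
  S u -> S v -> Ncvg s u -> Ncvg s' v ->
  Ncvg (fun n x => c * s n x + s' n x) (fun x => c * u x + v x).
Proof.
move=> Ss Ss' Su Sv su sv e e0.
have e2 : 0 < e / 2 by lra.
have c1 : 0 < `|c| + 1 by rewrite ltr_pwDr.
have ec : 0 < e / 2 / (`|c| + 1) by rewrite divr_gt0.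
have [n1 h1] := su _ ec; have [n2 h2] := sv _ e2.
exists (maxn n1 n2) => n; rewrite geq_max => /andP[/h1 {}h1 /h2 {}h2].
rewrite (_ : _ \- _ = (fun x => c * (s n \- u) x) \+ (s' n \- v)); last first.
  by apply/funext => x /=; ring.
apply: le_lt_trans (N_add _ _) _; [|exact: sn_sub|].
  by apply: sn_scale; exact: sn_sub.
rewrite N_scale; last exact: sn_sub.
have : `|c| * N (s n \- u) <= e / 2.
  apply: (@le_trans _ _ ((`|c| + 1) * N (s n \- u))).
    by rewrite ler_wpM2r// ?lerDl// Nd_ge0.
  by rewrite mulrC -ler_pdivlMr// ltW.
move=> ?; lra.
Qed.

Lemma Ncvg_le s u c : (forall n, S (s n)) -> S u -> Ncvg s u ->
  (exists n0, forall n, (n0 <= n)%N -> N (s n) <= c) -> N u <= c.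
Proof.
move=> Ss Su su [n1 hc]; apply: le_eps => e e0.
have [n0 hn] := su _ e0.
have := hn (maxn n0 n1) (leq_maxl _ _); rewrite NdC// => ?.
apply: le_trans (N_leD Su (Ss (maxn n0 n1))) _.
by apply: lerD; [exact/hc/leq_maxr|exact: ltW].
Qed.

Hypothesis compl : Ncomplete.
(** The generator is given by a graph because it will arise as a limit of graphs. That it is
    single-valued up to null elements is a consequence ([G_fun]). *)
Variable G : V -> V -> Prop.
Hypothesis G_S : forall u g, G u g -> S u /\ S g.
Hypothesis G_lin : forall c u g v k, G u g -> G v k ->
  G (fun x => c * u x + v x) (fun x => c * g x + k x).
Hypothesis G_closed : forall s r u g, (forall n, G (s n) (r n)) -> S u -> S g ->
  Ncvg s u -> Ncvg r g -> G u g.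
Hypothesis G_diss : forall h u g, 0 < h -> G u g -> N u <= N (fun x => u x - h * g x).
Hypothesis G_range : forall h f, 0 < h -> S f ->
  exists u, G u (fun x => h^-1 * (u x - f x)).
Hypothesis G_dense : forall f e, S f -> 0 < e ->
  exists u g, G u g /\ N (f \- u) < e.

Lemma G_null u g u' g' : G u g -> S u' -> S g' -> N (u \- u') = 0 ->
  N (g \- g') = 0 -> G u' g'.
Proof.
move=> Gu Su' Sg' uu' gg'; apply: (@G_closed (fun=> u) (fun=> g)) => //.
  by move=> e e0; exists 0%N => n _; rewrite uu'.
by move=> e e0; exists 0%N => n _; rewrite gg'.
Qed.

Lemma G_eq u g u' g' : G u g -> u =1 u' -> g =1 g' -> G u' g'.
Proof. by move=> + /funext <- /funext <-. Qed.

(** The resolvent $(1-hL)^{-1}$; the chosen value is unique up to elements of seminorm zero. *)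
Definition J h f : V := xget (cst 0) [set u | G u (fun x => h^-1 * (u x - f x))].

Lemma GJ h f : 0 < h -> S f -> G (J h f) (fun x => h^-1 * (J h f x - f x)).
Proof.
by move=> h0 Sf; rewrite /J; case: xgetP => // /(_ _)/= + ; have [u Gu] := G_range h0 Sf; move=> /(_ u).
Qed.

Lemma SJ h f : 0 < h -> S f -> S (J h f).
Proof. by move=> h0 Sf; have [] := G_S (GJ h0 Sf). Qed.

(** Dissipativity for the difference of [J h f] and [y]. Lipschitz bounds, uniqueness and the
    identities between resolvents follow by inserting an explicit [y]. *)
Lemma J_G h f y k : 0 < h -> S f -> G y k ->
  N (J h f \- y) <= N (fun x => f x - (y x - h * k x)).
Proof.
move=> h0 Sf Gy; have GJf := GJ h0 Sf.
have := G_lin (-1) Gy GJf => /(G_diss h0) /=.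
rewrite (_ : (fun x => -1 * y x + _) = J h f \- y); last first.
  by apply/funext => x /=; ring.
by move/le_trans; apply; apply: N_eq_le => x; field; rewrite gt_eqF.
Qed.

Lemma J_Lip h f g : 0 < h -> S f -> S g -> N (J h f \- J h g) <= N (f \- g).
Proof.
move=> h0 Sf Sg; apply: le_trans (J_G h0 Sf (GJ h0 Sg)) _.
by apply: N_eq_le => x /=; field; rewrite gt_eqF.
Qed.

Lemma J_uniq h f y k : 0 < h -> G y k -> f =1 (fun x => y x - h * k x) ->
  N (J h f \- y) = 0.
Proof.
move=> h0 Gy fE; have [Sy Sk] := G_S Gy.
have Sf : S f.
  rewrite (_ : f = (fun x => - h * k x + y x)); first exact: sn_lin.
  by apply/funext => x; rewrite fE; ring.
apply/eqP; rewrite eq_le Nd_ge0 ?andbT//; last exact: SJ.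
rewrite -[leRHS]N0 (le_trans (J_G h0 Sf Gy))//.
by apply: N_eq_le => x; rewrite fE subrr.
Qed.

Lemma J_contr h f : 0 < h -> S f -> N (J h f) <= N f.
Proof.
move=> h0 Sf; have := G_diss h0 (GJ h0 Sf); move/le_trans; apply.
by apply: N_eq_le => x /=; field; rewrite gt_eqF.
Qed.

Lemma J_near h u g : 0 < h -> G u g -> N (J h u \- u) <= h * N g.
Proof.
move=> h0 Gu; have [Su Sg] := G_S Gu.
apply: le_trans (J_G h0 Su Gu) _.
rewrite (_ : (fun x => _) = (fun x => h * g x)); last by apply/funext => x; ring.
by rewrite N_scale// gtr0_norm.
Qed.

Lemma eq0_le (x y : R) : y = 0 -> x <= y -> x <= 0. Proof. by move=> ->. Qed.

(** Since $LJ_hg=h^{-1}(J_hg-g)$, the image of $u+hJ_hg$ is $J_hg$, and therefore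
    $(1-hL)(u+hJ_hg)=u$. *)
Lemma J_expand h u g : 0 < h -> G u g ->
  G (fun x => h * J h g x + u x) (J h g) /\
  N (J h u \- (fun x => h * J h g x + u x)) = 0.
Proof.
move=> h0 Gu; have [Su Sg] := G_S Gu.
have GJg : G (fun x => h * J h g x + u x) (J h g).
  apply: G_eq (G_lin h (GJ h0 Sg) Gu) _ _ => x //=.
  by field; rewrite gt_eqF.
split=> //; apply: J_uniq h0 GJg _ => x /=; ring.
Qed.

Lemma J_dom h u g : 0 < h -> G u g -> G (J h u) (J h g).
Proof.
move=> h0 Gu; have [Su Sg] := G_S Gu; have [GJg JuE] := J_expand h0 Gu.
have [SJ1 SJ2] := G_S GJg.
apply: G_null GJg _ _ _ _ => //; [exact: SJ| |exact: Ndxx].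
by rewrite NdC//; exact: SJ.
Qed.

(** The domain of $L^2$ with the bound $\|L^2u\|\le M$: the regularity at which splitting a
    resolvent costs an error of second order. *)
Definition D2 (M : R) u := exists g k, [/\ G u g, G g k & N k <= M].

Lemma D2_S M u : D2 M u -> S u.
Proof. by move=> [g [k [/G_S[] //]]]. Qed.

Lemma D2_J M h u : 0 < h -> D2 M u -> D2 M (J h u).
Proof.
move=> h0 [g [k [Gu Gg kM]]]; exists (J h g), (J h k); split.
- exact: J_dom.
- exact: J_dom.
- by apply: le_trans kM; apply: J_contr => //; have [] := G_S Gg.
Qed.

(** The resolvent maps the domain of $L$ into that of $L^2$, and $J_hu-u=hJ_hLu$ is small with
    $h$. *)
Lemma D2_dense f e : S f -> 0 < e -> exists M u, D2 M u /\ N (f \- u) < e.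
Proof.
move=> Sf e0; have e2 : 0 < e / 2 by lra.
have [u [g [Gu fu]]] := G_dense Sf e2; have [Su Sg] := G_S Gu.
pose h := e / 2 / (N g + 1).
have g1 : 0 < N g + 1 by rewrite ltr_pwDr// N_ge0.
have h0 : 0 < h by rewrite divr_gt0.
have [GJg _] := J_expand h0 Gu; have [SJ1 SJ2] := G_S GJg.
have GG := GJ h0 Sg.
exists (N (fun x => h^-1 * (J h g x - g x))), (fun x => h * J h g x + u x); split.
  by exists (J h g), (fun x => h^-1 * (J h g x - g x)).
have := Nd_tri Sf Su SJ1.
suff : N (u \- (fun x => h * J h g x + u x)) <= e / 2 by move=> ? ?; lra.
rewrite NdC//.
rewrite (_ : _ \- _ = (fun x => h * J h g x)); last by apply/funext => x /=; ring.
rewrite N_scale// gtr0_norm//.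
apply: (@le_trans _ _ (h * (N g + 1))).
  by rewrite ler_pM2l// (le_trans (J_contr h0 Sg))// lerDl.
by rewrite /h divfK// gt_eqF.
Qed.

(** From $(1-aL)(1-bL)=1-(a+b)L+abL^2$: applied to $w=J_{a+b}u$ this gives $u+ab\,J_{a+b}L^2u$, and
    the contractions $J_b$ and $J_a$ turn the defect into the bound. *)
Lemma J_split M a b u : 0 < a -> 0 < b -> D2 M u ->
  N (J a (J b u) \- J (a + b) u) <= a * b * M.
Proof.
move=> a0 b0 [g [g2 [Gu Gg kM]]].
have ab0 : 0 < a + b by rewrite addr_gt0.
have [Su Sg] := G_S Gu; have [_ Sg2] := G_S Gg.
(* [z], [q] and [w] are $L^2w$, $Lw$ and $w=J_{a+b}u$, written out by [J_expand] so that the graph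
   relations between them hold exactly. *)
pose z := J (a + b) g2; have Sz : S z by exact: SJ.
pose q x := (a + b) * z x + g x.
pose w x := (a + b) * q x + u x.
have Gq : G q z by have [] := J_expand ab0 Gg.
have Gw : G w q.
  apply: G_eq (G_lin (a + b) Gq Gu) _ _ => x //=.
have [Sw Sq] := G_S Gw.
have zM : N z <= M by apply: le_trans kM; exact: J_contr.
have wE : N (J (a + b) u \- w) = 0.
  by apply: J_uniq ab0 Gw _ => x; rewrite /w; ring.
pose y x := (- a) * q x + w x.
have Gy : G y (fun x => - a * z x + q x) by exact: G_lin.
have [Sy _] := G_S Gy.
have Sp := SJ b0 Su.
have h1 : N (J b u \- y) <= a * b * M.
  apply: le_trans (J_G b0 Su Gy) _.
  rewrite (_ : (fun x => _) = (fun x => (- (a * b)) * z x)); last first.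
    by apply/funext => x; rewrite /y /w; ring.
  rewrite N_scale// normrN gtr0_norm ?mulr_gt0//.
  by rewrite ler_pM2l// mulr_gt0.
have h2 : N (J a (J b u) \- w) <= N (J b u \- y).
  apply: le_trans (J_G a0 Sp Gw) _.
  by apply: N_eq_le => x /=; rewrite /y; ring.
have := Nd_tri (SJ a0 Sp) Sw (SJ ab0 Su).
rewrite (NdC Sw); last exact: SJ.
rewrite wE; lra.
Qed.

(** For $p=J_bf$ the element $v=J_ap$ is explicit by [J_expand]. A computation identifies $(1-bL)v$
    with $J_af$, whence $J_bJ_af=v$. *)
Lemma J_comm a b f : 0 < a -> 0 < b -> S f ->
  N (J a (J b f) \- J b (J a f)) = 0.
Proof.
move=> a0 b0 Sf; pose p := J b f; have Sp : S p by exact: SJ.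
pose l x := b^-1 * (p x - f x).
have Gp : G p l := GJ b0 Sf.
have [_ Sl] := G_S Gp.
have [Gv vE] := J_expand a0 Gp.
pose k := J a l; pose v x := a * k x + p x.
have Gk : G k (fun x => a^-1 * (k x - l x)) := GJ a0 Sl.
have h1 : N (J a f \- (fun x => - b * k x + v x)) = 0.
  apply: (J_uniq a0 (G_lin (- b) Gk Gv)) => x /=.
  by rewrite /v -/k /l; field; rewrite !gt_eqF//=.
have [Sv Sk] := G_S Gv.
have SJf := SJ a0 Sf.
have h2 : N (J b (J a f) \- v) = 0.
  apply/eqP; rewrite eq_le Nd_ge0 ?andbT//; last exact: SJ.
  apply: eq0_le h1 _; apply: le_trans (J_G b0 SJf Gv) _.
  by apply: N_eq_le => x /=; rewrite -/k /v; ring.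
apply/eqP; rewrite eq_le (Nd_ge0 (SJ a0 Sp) (SJ b0 SJf)) andbT.
have := Nd_tri (SJ a0 Sp) Sv (SJ b0 SJf).
rewrite (NdC Sv); last exact: SJ.
by rewrite vE h2 addr0.
Qed.

Definition Jn h n f := iter n (J h) f.

Lemma SJn h n f : 0 < h -> S f -> S (Jn h n f).
Proof. by move=> h0 Sf; elim: n => //= n ih; exact: SJ. Qed.

Lemma Jn_Lip h n f g : 0 < h -> S f -> S g -> N (Jn h n f \- Jn h n g) <= N (f \- g).
Proof.
move=> h0 Sf Sg; elim: n => //= n ih.
by apply: le_trans ih; apply: J_Lip => //; exact: SJn.
Qed.

Lemma Jn_contr h n f : 0 < h -> S f -> N (Jn h n f) <= N f.
Proof.
move=> h0 Sf; elim: n => //= n ih.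
by apply: le_trans ih; apply: J_contr => //; exact: SJn.
Qed.

Lemma Jn_near h n u g : 0 < h -> G u g -> N (Jn h n u \- u) <= n%:R * h * N g.
Proof.
move=> h0 Gu; have [Su Sg] := G_S Gu; elim: n => [|n ih].
  by rewrite Ndxx !mul0r.
rewrite /=; have := Nd_tri (SJ h0 (SJn n h0 Su)) (SJ h0 Su) Su.
have := J_Lip h0 (SJn n h0 Su) Su; have := J_near h0 Gu.
rewrite -natr1; lra.
Qed.

Lemma Jn_near_S h n f w k : 0 < h -> S f -> G w k ->
  N (Jn h n f \- f) <= 2 * N (f \- w) + n%:R * h * N k.
Proof.
move=> h0 Sf Gw; have [Sw Sk] := G_S Gw.
have := Nd_tri (SJn n h0 Sf) (SJn n h0 Sw) Sf.
have := Nd_tri (SJn n h0 Sw) Sw Sf.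
have := Jn_Lip n h0 Sf Sw; have := Jn_near n h0 Gw; rewrite (NdC Sw Sf); lra.
Qed.

Lemma Jn_D2 M h n u : 0 < h -> D2 M u -> D2 M (Jn h n u).
Proof. by move=> h0 Du; elim: n => //= n ih; exact: D2_J. Qed.

Lemma Jn_commJ a b n f : 0 < a -> 0 < b -> S f ->
  N (J a (Jn b n f) \- Jn b n (J a f)) = 0.
Proof.
move=> a0 b0 Sf; elim: n => [|n ih]; first exact: Ndxx.
have S1 := SJn n b0 Sf; have S2 := SJn n b0 (SJ a0 Sf).
apply/eqP; rewrite eq_le Nd_ge0 ?andbT/=; [|exact: SJ a0 (SJ b0 S1)|exact: SJ].
apply: le_trans (Nd_tri _ (SJ b0 (SJ a0 S1)) _) _; [exact: SJ a0 (SJ b0 S1)|exact: SJ|].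
rewrite J_comm// add0r -ih; apply: J_Lip => //; exact: SJ.
Qed.

(** Telescoping. Commuting one factor $J_b$ to the front reduces each step to one splitting error,
    evaluated at $J_{a+b}^nu$, which stays in [D2 M]. *)
Lemma Jn_split M a b n u : 0 < a -> 0 < b -> D2 M u ->
  N (Jn a n (Jn b n u) \- Jn (a + b) n u) <= n%:R * (a * b * M).
Proof.
move=> a0 b0 Du; have ab0 := addr_gt0 a0 b0; have Su := D2_S Du.
elim: n => [|n ih]; first by rewrite Ndxx mul0r.
pose x1 := J a (Jn a n (J b (Jn b n u))); pose x2 := J a (J b (Jn a n (Jn b n u))).
pose x3 := J a (J b (Jn (a + b) n u)).
have Sb := SJn n b0 Su; have Sab := SJn n a0 Sb; have Sc := SJn n ab0 Su.
have S1 : S x1 by apply: SJ => //; apply: SJn => //; exact: SJ.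
have S2 : S x2 by do 2 apply: SJ => //.
have S3 : S x3 by do 2 apply: SJ => //.
have d12 : N (x1 \- x2) <= 0.
  have <- := Jn_commJ n b0 a0 Sb; rewrite NdC//.
  by apply: J_Lip => //; [exact: SJ|apply: SJn => //; exact: SJ].
have d23 : N (x2 \- x3) <= n%:R * (a * b * M).
  apply: le_trans ih; apply: le_trans (J_Lip _ _ _) _ => //; try exact: SJ.
  exact: J_Lip.
have d34 := J_split a0 b0 (Jn_D2 n ab0 Du).
have S4 := SJ ab0 Sc.
have t1 := Nd_tri S1 S2 S4; have t2 := Nd_tri S2 S3 S4.
rewrite /= -/x1 -natr1 mulrDl mul1r; apply: le_trans t1 _.
rewrite -[leRHS]add0r; apply: lerD => //.
by apply: le_trans t2 _; apply: lerD.
Qed.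

(** The exponential formula along dyadic step sizes: passing from [n] to [n.+1] replaces each
    $J_{2h}$ by $J_h^2$, so that [Jn_split] with equal steps bounds the increment geometrically. *)
Definition P t n f := Jn (t / 2 ^+ n) (2 ^ n) f.

Lemma half_gt0 t n : 0 < t -> 0 < t / 2 ^+ n.
Proof. by move=> t0; rewrite divr_gt0// exprn_gt0. Qed.

Lemma SP t n f : 0 < t -> S f -> S (P t n f).
Proof. by move=> t0 Sf; apply: SJn => //; exact: half_gt0. Qed.

Lemma P_Lip t n f g : 0 < t -> S f -> S g -> N (P t n f \- P t n g) <= N (f \- g).
Proof. by move=> t0 Sf Sg; apply: Jn_Lip => //; exact: half_gt0. Qed.

Lemma P_step M t n u : 0 < t -> D2 M u ->
  N (P t n.+1 u \- P t n u) <= t ^+ 2 * M / 4 / 2 ^+ n.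
Proof.
move=> t0 Du; pose h := t / 2 ^+ n.+1; have h0 : 0 < h by exact: half_gt0.
have -> : P t n.+1 u = Jn h (2 ^ n) (Jn h (2 ^ n) u).
  by rewrite /P /Jn -iterD addnn -mul2n -expnS.
have -> : P t n u = Jn (h + h) (2 ^ n) u.
  by rewrite /P; congr Jn; rewrite /h exprS; field; rewrite expf_neq0.
apply: le_trans (Jn_split _ h0 h0 Du) _.
rewrite /h exprS natrX le_eqVlt; apply/orP; left; apply/eqP.
by field; rewrite expf_neq0.
Qed.

Lemma geo_cauchy (s : nat -> V) c : 0 <= c -> (forall n, S (s n)) ->
  (forall n, N (s n.+1 \- s n) <= c / 2 ^+ n) -> Ncauchy s.
Proof.
move=> c0 Ss hs.
have tail n m : N (s (n + m)%N \- s n) <= 2 * c / 2 ^+ n.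
  suff : N (s (n + m)%N \- s n) <= 2 * c / 2 ^+ n - 2 * c / 2 ^+ (n + m).
    by move/le_trans; apply; rewrite gerBl divr_ge0 ?mulr_ge0// exprn_ge0.
  elim: m => [|m ih]; first by rewrite addn0 Ndxx subrr.
  have := Nd_tri (Ss (n + m.+1)%N) (Ss (n + m)%N) (Ss n).
  have := hs (n + m)%N; rewrite addnS.
  have -> : 2 * c / 2 ^+ (n + m).+1 = c / 2 ^+ (n + m).
    by rewrite exprS; field; rewrite expf_neq0.
  move: ih; set A := 2 * c / 2 ^+ n; rewrite (_ : 2 * c / 2 ^+ (n + m) = 2 * (c / 2 ^+ (n + m))); last by ring.
  lra.
move=> e e0.
have [n0 hn0] : exists n0, 2 * c / 2 ^+ n0 < e / 2.
  have e2 : 0 < e / 2 by lra.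
  pose n0 := Num.bound (2 * c / (e / 2)); exists n0.
  rewrite ltr_pdivrMr ?exprn_gt0// [ltRHS]mulrC -ltr_pdivrMr//.
  apply: lt_le_trans (archi_boundP _) _; first by rewrite divr_ge0 ?mulr_ge0// ltW.
  by rewrite -natrX ler_nat ltnW// ltn_expl.
exists n0 => m n /subnKC <- /subnKC <-.
have := tail n0 (m - n0)%N; have := tail n0 (n - n0)%N.
have := Nd_tri (Ss (n0 + (m - n0))%N) (Ss n0) (Ss (n0 + (n - n0))%N).
rewrite (NdC (Ss n0)); last by [].
lra.
Qed.

Lemma D2_ge0 M u : D2 M u -> 0 <= M.
Proof. by move=> [g [k [_ /G_S[_ Sk]]]]; apply: le_trans; exact: N_ge0. Qed.

Lemma P_cauchy t f : 0 < t -> S f -> Ncauchy (fun n => P t n f).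
Proof.
move=> t0 Sf e e0; have e3 : 0 < e / 3 by lra.
have [M [u [Du fu]]] := D2_dense Sf e3; have Su := D2_S Du.
have : Ncauchy (fun n => P t n u).
  apply: (@geo_cauchy _ (t ^+ 2 * M / 4)) => [|n|n]; last exact: P_step.
    by have M0 := D2_ge0 Du; rewrite divr_ge0// mulr_ge0// sqr_ge0.
  exact: SP.
move=> /(_ _ e3)[n0 hn0]; exists n0 => m n hm hn.
have := hn0 m n hm hn.
have Sm := SP m t0 Sf; have Sn := SP n t0 Sf.
have Um := SP m t0 Su; have Un := SP n t0 Su.
have := Nd_tri Sm Um Sn; have := Nd_tri Um Un Sn.
have := P_Lip m t0 Sf Su; have := P_Lip n t0 Su Sf; rewrite (NdC Su Sf); lra.
Qed.

Definition semi t f : V := xget (cst 0) [set u | S u /\ Ncvg (fun n => P t n f) u].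

Lemma semi_spec t f : 0 < t -> S f -> S (semi t f) /\ Ncvg (fun n => P t n f) (semi t f).
Proof.
move=> t0 Sf; rewrite /semi; case: xgetP => [u _ //|/= hN].
have [u Su uP] := compl (fun n => SP n t0 Sf) (P_cauchy t0 Sf).
by case: (hN u).
Qed.

Lemma semi_S t f : 0 < t -> S f -> S (semi t f).
Proof. by move=> t0 Sf; have [] := semi_spec t0 Sf. Qed.

Lemma semi_Lip t f g : 0 < t -> S f -> S g -> N (semi t f \- semi t g) <= N (f \- g).
Proof.
move=> t0 Sf Sg; have [S1 c1] := semi_spec t0 Sf; have [S2 c2] := semi_spec t0 Sg.
have E (x y : V) : x \- y = (fun z => (-1) * y z + x z) by apply/funext => z /=; ring.
rewrite [X in N X <= _]E.
apply: (Ncvg_le _ _ (Ncvg_lin (-1) _ _ _ _ c2 c1)) => //; try by move=> n; exact: SP.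
- by move=> n; apply: sn_lin; exact: SP.
- by apply: sn_lin.
- by exists 0%N => n _; rewrite -E; exact: P_Lip.
Qed.

Lemma semi_contr t f : 0 < t -> S f -> N (semi t f) <= N f.
Proof.
move=> t0 Sf; have [S1 c1] := semi_spec t0 Sf.
apply: (Ncvg_le _ S1 c1); first by move=> n; exact: SP.
by exists 0%N => n _; apply: Jn_contr => //; exact: half_gt0.
Qed.

Lemma J_lin h c f g : 0 < h -> S f -> S g ->
  N (J h (fun x => c * f x + g x) \- (fun x => c * J h f x + J h g x)) = 0.
Proof.
move=> h0 Sf Sg; apply: (J_uniq h0 (G_lin c (GJ h0 Sf) (GJ h0 Sg))) => x /=.
by field; rewrite gt_eqF.
Qed.

Lemma Jn_lin h c n f g : 0 < h -> S f -> S g ->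
  N (Jn h n (fun x => c * f x + g x) \- (fun x => c * Jn h n f x + Jn h n g x)) = 0.
Proof.
move=> h0 Sf Sg; elim: n => [|n ih]; first exact: Ndxx.
have Sfg : S (fun x => c * f x + g x) by exact: sn_lin.
have S1 := SJn n h0 Sf; have S2 := SJn n h0 Sg; have S3 := SJn n h0 Sfg.
have S4 : S (fun x => c * Jn h n f x + Jn h n g x) by exact: sn_lin.
have S5 : S (fun x => c * Jn h n.+1 f x + Jn h n.+1 g x).
  by apply: sn_lin; exact: SJn.
apply/eqP; rewrite eq_le Nd_ge0 ?andbT//; last exact: SJn.
have := J_Lip h0 S3 S4; rewrite ih => d1; have d2 := J_lin c h0 S1 S2.
have := Nd_tri (SJ h0 S3) (SJ h0 S4) S5; rewrite d2 addr0 => /le_trans; exact.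
Qed.

Lemma semi_lin t c f g : 0 < t -> S f -> S g ->
  N (semi t (fun x => c * f x + g x) \- (fun x => c * semi t f x + semi t g x)) = 0.
Proof.
move=> t0 Sf Sg; have [S1 c1] := semi_spec t0 Sf; have [S2 c2] := semi_spec t0 Sg.
have Sfg : S (fun x => c * f x + g x) by exact: sn_lin.
have [S3 c3] := semi_spec t0 Sfg.
have S4 : S (fun x => c * semi t f x + semi t g x) by exact: sn_lin.
apply: (Ncvg_unique _ S3 S4 c3); first by move=> n; exact: SP.
have := Ncvg_lin c (fun n => SP n t0 Sf) (fun n => SP n t0 Sg) S1 S2 c1 c2.
move=> c4 e /c4[n0 hn0]; exists n0 => n /hn0.
have h0 := half_gt0 n t0.
have S5 : S (fun x => c * P t n f x + P t n g x) by apply: sn_lin; exact: SP.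
have := Nd_tri (SP n t0 Sfg) S5 S4.
have := Jn_lin c (2 ^ n) h0 Sf Sg; rewrite -/(P t n _) -/(P t n f) -/(P t n g) => ->.
lra.
Qed.

(** [Jn_split] with the unequal steps $s2^{-n}$ and $t2^{-n}$ compares the approximants of $T_sT_t$
    and $T_{s+t}$ on [D2 M], with error $stM2^{-n}$; density and contractivity do the rest. *)
Lemma semi_add s t f : 0 < s -> 0 < t -> S f ->
  N (semi (s + t) f \- semi s (semi t f)) = 0.
Proof.
move=> s0 t0 Sf; have st0 := addr_gt0 s0 t0.
have Sst := semi_S st0 Sf; have St := semi_S t0 Sf; have Ss := semi_S s0 St.
apply/eqP; rewrite eq_le Nd_ge0 ?andbT//; apply: le_eps => e e0; rewrite add0r.
have e5 : 0 < e / 6 by lra.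
have [M [u [Du fu]]] := D2_dense Sf e5; have Su := D2_S Du.
have [Ust ust] := semi_spec st0 Su; have [Ut ut] := semi_spec t0 Su.
have [Us us] := semi_spec s0 Ut.
have := semi_Lip st0 Sf Su; have := semi_Lip s0 Ut St; have := semi_Lip t0 Su Sf.
rewrite (NdC Su Sf).
have := Nd_tri Sst Ust Ss; have := Nd_tri Ust Us Ss.
have [n1 h1] := ust _ e5; have [n2 h2] := ut _ e5; have [n3 h3] := us _ e5.
have M0 := D2_ge0 Du.
have [n4 h4] : exists n, s * t * M / 2 ^+ n < e / 6.
  pose n0 := Num.bound (s * t * M / (e / 6)); exists n0.
  rewrite ltr_pdivrMr ?exprn_gt0// [ltRHS]mulrC -ltr_pdivrMr//.
  apply: lt_le_trans (archi_boundP _) _.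
    by rewrite divr_ge0 ?mulr_ge0// ltW.
  by rewrite -natrX ler_nat ltnW// ltn_expl.
pose n := maxn (maxn n1 n2) (maxn n3 n4).
have l1 : (n1 <= n)%N by rewrite /n !leq_max leqnn.
have l2 : (n2 <= n)%N by rewrite /n !leq_max leqnn orbT.
have l3 : (n3 <= n)%N by rewrite /n !leq_max leqnn !orbT.
have l4 : (n4 <= n)%N by rewrite /n !leq_max leqnn !orbT.
have {}h1 := h1 _ l1; have {}h2 := h2 _ l2; have {}h3 := h3 _ l3.
have {}h4 : s * t * M / 2 ^+ n < e / 6.
  apply: le_lt_trans h4; apply: ler_wpM2l; first by rewrite !mulr_ge0// ltW.
  by rewrite lef_pV2 ?posrE ?exprn_gt0// ler_eXn2l// ltr1n.
have Pst := SP n st0 Su; have Pt := SP n t0 Su; have Pst' := SP n s0 Pt.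
have Ps := SP n s0 Ut.
have := Nd_tri Ust Pst Us; have := Nd_tri Pst Pst' Us; have := Nd_tri Pst' Ps Us.
have := P_Lip n s0 Pt Ut.
move: h1; rewrite (NdC Pst Ust).
have : N (P (s + t) n u \- P s n (P t n u)) <= s * t * M / 2 ^+ n.
  rewrite (NdC Pst Pst') /P mulrDl.
  apply: le_trans (Jn_split _ (half_gt0 n s0) (half_gt0 n t0) Du) _.
  rewrite natrX le_eqVlt; apply/orP; left; apply/eqP.
  by field; rewrite expf_neq0.
lra.
Qed.

(* From [J_h^n u - u = h (J_h + ... + J_h^n) L u]. *)
Lemma Jn_taylor h n u g w k : 0 < h -> G u g -> G w k ->
  N (Jn h n u \- (fun x => n%:R * h * g x + u x)) <=
  n%:R * h * (2 * N (g \- w) + n%:R * h * N k).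
Proof.
move=> h0 Gu Gw; have [Su Sg] := G_S Gu; have [Sw Sk] := G_S Gw.
have GJn j : G (Jn h j u) (Jn h j g) by elim: j => //= j ih; exact: J_dom.
have b0 : 0 <= 2 * N (g \- w) by rewrite mulr_ge0// Nd_ge0.
suff H j : (j <= n)%N -> N (Jn h j u \- (fun x => j%:R * h * g x + u x)) <=
  j%:R * h * (2 * N (g \- w) + n%:R * h * N k) by exact: H.
have k0 := N_ge0 Sk.
elim: j => [_|j ih jn].
  rewrite !mul0r (_ : Jn h 0 u \- _ = u \- u) ?Ndxx//.
  by apply/funext => x /=; ring.
have Sa := SJn j h0 Su; have Sb := SJn j.+1 h0 Sg; have SJu := SJn j.+1 h0 Su.
have {}ih := ih (ltnW jn).
have [_ E] := J_expand h0 (GJn j).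
pose y x := h * Jn h j.+1 g x + Jn h j u x.
have Sy : S y by exact: sn_lin.
have Sz : S (fun x => j.+1%:R * h * g x + u x) by exact: sn_lin.
have Sz' : S (fun x => j%:R * h * g x + u x) by exact: sn_lin.
have Sbg : S (Jn h j.+1 g \- g) by exact: sn_sub.
have := Nd_tri SJu Sy Sz; rewrite [X in _ <= X + _]E add0r => /le_trans; apply.
rewrite (_ : y \- _ = (fun x => h * (Jn h j.+1 g \- g) x) \+
    (Jn h j u \- (fun x => j%:R * h * g x + u x))); last first.
  by apply/funext => x /=; rewrite /y /= -natr1; ring.
apply: le_trans (N_add _ _) _; [exact: sn_scale|exact: sn_sub|].
rewrite N_scale// gtr0_norm//.
have := Jn_near_S j.+1 h0 Sg Gw.
have jn' : j.+1%:R * h * N k <= n%:R * h * N k.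
  by rewrite ler_wpM2r// ler_wpM2r ?(ltW h0)// ler_nat.
set A := N _ => hA; set C := 2 * _ + _ in ih *.
have : h * A <= h * C.
  by rewrite ler_pM2l//; apply: le_trans hA _; rewrite lerD2l.
rewrite -natr1; lra.
Qed.

Lemma semi_taylor t u g w k : 0 < t -> G u g -> G w k ->
  N (semi t u \- (fun x => t * g x + u x)) <= t * (2 * N (g \- w) + t * N k).
Proof.
move=> t0 Gu Gw; have [Su Sg] := G_S Gu.
have [St c1] := semi_spec t0 Su.
have Sz : S (fun x => t * g x + u x) by exact: sn_lin.
have E (x y : V) : x \- y = (fun z => (-1) * y z + x z) by apply/funext => z /=; ring.
rewrite [X in N X <= _]E.
apply: (Ncvg_le _ _ (Ncvg_lin (-1) _ _ _ _ (Ncvg_cst _) c1)) => //.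
- by move=> n; apply: sn_lin => //; exact: SP.
- exact: sn_lin.
- by move=> n; exact: SP.
exists 0%N => n _; rewrite -E /P.
have := Jn_taylor (2 ^ n) (half_gt0 n t0) Gu Gw.
have -> : (2 ^ n)%:R * (t / 2 ^+ n) = t by rewrite natrX; field; rewrite expf_neq0.
by [].
Qed.

Lemma semi_cont0 f e : S f -> 0 < e -> exists2 r, 0 < r &
  forall t, 0 < t -> t < r -> N (semi t f \- f) < e.
Proof.
move=> Sf e0; have e3 : 0 < e / 3 by lra.
have [u [g [Gu fu]]] := G_dense Sf e3; have [Su Sg] := G_S Gu.
have g1 : 0 < N g + 1 by rewrite ltr_pwDr// N_ge0.
exists (e / 3 / (N g + 1)) => [|t t0 tr]; first by rewrite divr_gt0.
have [St c1] := semi_spec t0 Sf; have [Ut c2] := semi_spec t0 Su.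
have := Nd_tri St Ut Sf; have := Nd_tri Ut Su Sf; have := semi_Lip t0 Sf Su.
rewrite (NdC Su Sf).
suff : N (semi t u \- u) <= t * N g.
  have : t * N g < e / 3.
    apply: (@le_lt_trans _ _ (t * (N g + 1))).
      by rewrite ler_pM2l// lerDl.
    by rewrite -ltr_pdivlMr.
  by move=> ? ? ? ? ?; lra.
have E (x y : V) : x \- y = (fun z => (-1) * y z + x z) by apply/funext => z /=; ring.
rewrite [X in N X <= _]E.
apply: (Ncvg_le _ _ (Ncvg_lin (-1) _ _ _ _ (Ncvg_cst _) c2)) => //.
- by move=> n; apply: sn_lin => //; exact: SP.
- exact: sn_lin.
- by move=> n; exact: SP.
exists 0%N => n _; rewrite -E /P.
have := Jn_near (2 ^ n) (half_gt0 n t0) Gu.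
have -> : (2 ^ n)%:R * (t / 2 ^+ n) = t by rewrite natrX; field; rewrite expf_neq0.
by [].
Qed.

Definition Nderiv0 (T : R -> V -> V) u g := forall e, 0 < e -> exists2 r, 0 < r &
  forall t, 0 < t -> t < r -> N (fun x => t^-1 * (T t u x - u x) - g x) < e.

Lemma semi_deriv u g : G u g -> Nderiv0 semi u g.
Proof.
move=> Gu e e0; have [Su Sg] := G_S Gu; have e4 : 0 < e / 4 by lra.
have [w [k [Gw gw]]] := G_dense Sg e4; have [Sw Sk] := G_S Gw.
have k1 : 0 < N k + 1 by rewrite ltr_pwDr// N_ge0.
exists (e / 4 / (N k + 1)) => [|t t0 tr]; first by rewrite divr_gt0.
have St := semi_S t0 Su.
have := semi_taylor t0 Gu Gw.
rewrite (_ : (fun x => t^-1 * _ - _) =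
   (fun x => t^-1 * (semi t u \- (fun x => t * g x + u x)) x)); last first.
  by apply/funext => x /=; field; rewrite gt_eqF.
rewrite N_scale; last by apply: sn_sub => //; exact: sn_lin.
rewrite gtr0_norm ?invr_gt0//.
rewrite -ler_pdivrMl// => /le_lt_trans; apply.
have : t * N k < e / 4.
  apply: (@le_lt_trans _ _ (t * (N k + 1))).
    by rewrite ler_pM2l// lerDl.
  by rewrite -ltr_pdivlMr.
move=> ?; lra.
Qed.

(** For small $t$ the function $u-g$ is close to $(1+t^{-1})u-t^{-1}T_tu$, whose norm is at least
    $(1+t^{-1})\|u\|-t^{-1}\|u\|$ by contractivity. Membership of $(u,g)$ in the graph is not
    presupposed. *)
Lemma semi_deriv_diss u g : S u -> S g -> Nderiv0 semi u g ->
  N u <= N (fun x => u x - g x).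
Proof.
move=> Su Sg ug; apply: le_eps => e e0.
have [r r0 hr] := ug _ e0.
have t0 : 0 < r / 2 by lra.
have tr : r / 2 < r by lra.
have {hr} := hr _ t0 tr; set t := r / 2 in t0 tr *.
have St := semi_S t0 Su.
have Sd : S (fun x => t^-1 * (semi t u x - u x)) by apply: sn_scale; exact: sn_sub.
move=> h1.
have ti0 : 0 < t^-1 by rewrite invr_gt0.
have S1 : S (fun x => (1 + t^-1) * u x) by exact: sn_scale.
have S2 : S (fun x => t^-1 * semi t u x) by exact: sn_scale.
have S3 : S (u \- g) by exact: sn_sub.
have S5 : S (u \- (fun x => t^-1 * (semi t u x - u x))) by exact: sn_sub.
have := N_leD S1 S2.
rewrite !N_scale// !gtr0_norm ?addr_gt0//.
have := semi_contr t0 Su; rewrite -(ler_pM2l ti0).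
rewrite (_ : (fun x => (1 + t^-1) * u x) \- _ =
   u \- (fun x => t^-1 * (semi t u x - u x))); last first.
  by apply/funext => x /=; ring.
have := N_leD S5 S3.
rewrite (_ : _ \- (u \- g) = (fun x => (-1) * (t^-1 * (semi t u x - u x) - g x))); last first.
  by apply/funext => x /=; ring.
rewrite N_scale; last exact: sn_sub.
rewrite normrN1 mul1r; lra.
Qed.

Lemma Nderiv0_sub u g v k : S u -> S g -> S v -> S k ->
  Nderiv0 semi u g -> Nderiv0 semi v k -> Nderiv0 semi (u \- v) (g \- k).
Proof.
move=> Su Sg Sv Sk ug vk e e0; have e2 : 0 < e / 2 by lra.
have [r1 r10 h1] := ug _ e2; have [r2 r20 h2] := vk _ e2.
exists (Num.min r1 r2) => [|t t0]; first by rewrite lt_min r10.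
rewrite lt_min => /andP[/(h1 _ t0) {}h1 /(h2 _ t0) {}h2].
have Suv : S (u \- v) by exact: sn_sub.
have S1 := semi_S t0 Su; have S2 := semi_S t0 Sv; have S3 := semi_S t0 Suv.
have q1 : S (fun x => t^-1 * (semi t u x - u x) - g x).
  by apply: sn_sub => //; apply: sn_scale; exact: sn_sub.
have q2 : S (fun x => t^-1 * (semi t v x - v x) - k x).
  by apply: sn_sub => //; apply: sn_scale; exact: sn_sub.
have q3 : S (fun x => t^-1 * (semi t (u \- v) x - (u \- v) x) - (g \- k) x).
  by apply: sn_sub; [apply: sn_scale; exact: sn_sub|exact: sn_sub].
have q4 := sn_sub q1 q2.
have E : N ((fun x => t^-1 * (semi t (u \- v) x - (u \- v) x) - (g \- k) x) \-
   ((fun x => t^-1 * (semi t u x - u x) - g x) \- (fun x => t^-1 * (semi t v x - v x) - k x))) = 0.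
  have := semi_lin (-1) t0 Sv Su.
  rewrite (_ : (fun x => -1 * v x + u x) = u \- v); last by apply/funext => x /=; ring.
  move=> E0; rewrite (_ : _ \- _ = (fun x => t^-1 * (semi t (u \- v) \-
     (fun x => -1 * semi t v x + semi t u x)) x)); last by apply/funext => x /=; ring.
  rewrite N_scale ?E0 ?mulr0//; apply: sn_sub => //; exact: sn_lin.
have := N_leD q3 q4; rewrite E addr0 => /le_lt_trans; apply.
have := Nd_tri q1 sn0 q2.
rewrite (NdC sn0 q2).
rewrite (_ : (fun x => t^-1 * (semi t u x - u x) - g x) \- cst 0 =
  (fun x => t^-1 * (semi t u x - u x) - g x)); last by apply/funext => x /=; rewrite subr0.
rewrite (_ : (fun x => t^-1 * (semi t v x - v x) - k x) \- cst 0 =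
  (fun x => t^-1 * (semi t v x - v x) - k x)); last by apply/funext => x /=; rewrite subr0.
move=> /le_lt_trans; apply; lra.
Qed.

(** Maximality: $v=J_1(u-g)$ satisfies $v-Lv=u-g$, so the dissipativity of the derivative at zero,
    applied to $u-v$, has right-hand side zero. *)
Lemma deriv_dom u g : S u -> S g -> Nderiv0 semi u g -> G u g.
Proof.
move=> Su Sg ug; have Sf : S (u \- g) by exact: sn_sub.
pose v := J 1 (u \- g); pose k := fun x => 1^-1 * (v x - (u \- g) x).
have Gv : G v k := GJ ltr01 Sf; have [Sv Sk] := G_S Gv.
have S1 := sn_sub Su Sv; have S2 := sn_sub Sg Sk.
have := semi_deriv_diss S1 S2 (Nderiv0_sub Su Sg Sv Sk ug (semi_deriv Gv)).
rewrite (_ : (fun x => _) = cst 0); last first.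
  by apply/funext => x /=; rewrite /k /= invr1; ring.
rewrite N0 => uv.
have uv0 : N (u \- v) = 0 by apply/eqP; rewrite eq_le uv Nd_ge0.
apply: G_null Gv _ _ _ _ => //; first by rewrite NdC.
by rewrite -uv0 NdC//; congr N; apply/funext => x /=; rewrite /k /= invr1; ring.
Qed.

(** With $r=g-k$, the pair $(0,r)$ is in the graph. For $(w,l)$ in the graph, dissipativity of
    $(hw,\,hl+r)$ divided by $h$ reads $\|w\|\le\|w-r-hl\|$; choosing $w$ near $r$ and then $h$
    small forces $\|r\|=0$. *)
Lemma G_fun u g k : G u g -> G u k -> N (g \- k) = 0.
Proof.
move=> Gu Gk; have [Su Sg] := G_S Gu; have [_ Sk] := G_S Gk.
have Sgk := sn_sub Sg Sk.
have G0k : G (cst 0) (g \- k).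
  by apply: G_eq (G_lin (-1) Gk Gu) _ _ => x /=; ring.
apply/eqP; rewrite eq_le N_ge0// andbT; apply: le_eps => e e0; rewrite add0r.
have e4 : 0 < e / 4 by lra.
have [w [l [Gw gw]]] := G_dense Sgk e4; have [Sw Sl] := G_S Gw.
have l1 : 0 < N l + 1 by rewrite ltr_pwDr// N_ge0.
pose h := e / 4 / (N l + 1); have h0 : 0 < h by rewrite divr_gt0.
have := G_diss h0 (G_lin h Gw G0k).
rewrite (_ : (fun x => h * w x + cst 0 x) = (fun x => h * w x)); last first.
  by apply/funext => x /=; ring.
rewrite (_ : (fun x => _ - _) = (fun x => (- h) *
   ((fun x => h * l x) \+ ((g \- k) \- w)) x)); last by apply/funext => x /=; ring.
have Shl : S (fun x => h * l x) by exact: sn_scale.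
have Sd := sn_sub Sgk Sw.
rewrite !N_scale//; last exact: sn_add.
rewrite normrN ler_pM2l; last by rewrite gtr0_norm.
have := N_add Shl Sd; rewrite N_scale//.
have := N_leD Sgk Sw.
have : `|h| * N l <= e / 4.
  rewrite gtr0_norm//; apply: (@le_trans _ _ (h * (N l + 1))).
    by rewrite ler_pM2l// lerDl.
  by rewrite /h divfK// gt_eqF.
lra.
Qed.

(** Invariance under the resolvent passes to its powers and, for closed [Q], to their limit. It
    serves for the order interval $[0,1]$. *)
Lemma semi_invariant (Q : set V) t f :
  (forall s u, (forall n, S (s n)) -> S u -> (forall n, Q (s n)) -> Ncvg s u -> Q u) ->
  (forall h u g, 0 < h -> G u g -> Q (fun x => u x - h * g x) -> Q u) ->
  0 < t -> S f -> Q f -> Q (semi t f).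
Proof.
move=> Qcl QJ t0 Sf Qf; have [St c1] := semi_spec t0 Sf.
apply: Qcl St _ c1 => n; first exact: SP.
have h0 := half_gt0 n t0.
rewrite /P; elim: (2 ^ n)%N => //= m ih; apply: QJ h0 (GJ h0 (SJn m h0 Sf)) _.
rewrite (_ : (fun x => _) = Jn (t / 2 ^+ n) m f)//; apply/funext => x.
by rewrite /= -/(Jn _ _ _); field; rewrite expf_neq0// gt_eqF.
Qed.

End hille_yosida.

(** * Spaces L^1 and L^2 *)

Section Lp_functions.
Context d (T : measurableType d) (R : realType).
Variable mu : {measure set T -> \bar R}.
Implicit Types (f g h : T -> R) (u : nat -> T -> R).

Local Notation mfun f := (measurable_fun [set: T] f).
Local Notation L1 f := (f \in Lfun mu 1).
Local Notation L2 f := (f \in Lfun mu 2%:E).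
Local Notation Int f := (Rintegral mu setT f).

Lemma Lfun_measurable p f : f \in Lfun mu p -> mfun f.
Proof. by rewrite inE => /andP[/[!inE]]. Qed.

Lemma L1_int f : L1 f -> mu.-integrable setT (EFin \o f).
Proof. by move/Lfun1_integrable. Qed.

Lemma L1_lin c f g : L1 f -> L1 g -> L1 (fun x => c * f x + g x).
Proof.
by move=> Lf Lg; have [_ /(_ c f g Lf Lg)] := @Lfun_submod_closed _ _ _ mu 1%E (lexx _).
Qed.

Lemma L2_lin c f g : L2 f -> L2 g -> L2 (fun x => c * f x + g x).
Proof.
move=> Lf Lg; have := @Lfun_submod_closed _ _ _ mu 2%:E.
by move=> /(_ (lee1n 2))[_ /(_ c f g Lf Lg)].
Qed.

Lemma Lfun0 p : (1 <= p)%E -> cst 0 \in Lfun mu p.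
Proof. by move=> p1; have [] := @Lfun_submod_closed _ _ _ mu p p1. Qed.

Lemma L1_0 : L1 (cst 0). Proof. exact: Lfun0. Qed.

Lemma L2_0 : L2 (cst 0). Proof. by apply: Lfun0; exact: lee1n. Qed.

Lemma Lfun_ext p f g : f =1 g -> f \in Lfun mu p -> g \in Lfun mu p.
Proof. by move=> /funext ->. Qed.

Lemma L1_scale c f : L1 f -> L1 (fun x => c * f x).
Proof. by move=> /(L1_lin c) /(_ L1_0); apply: Lfun_ext => x; rewrite addr0. Qed.

Lemma L1_add f g : L1 f -> L1 g -> L1 (fun x => f x + g x).
Proof. by move=> /(L1_lin 1)/[apply]; apply: Lfun_ext => x; rewrite mul1r. Qed.

Lemma L1_sub f g : L1 f -> L1 g -> L1 (fun x => f x - g x).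
Proof. by move=> Lf Lg; move: (L1_lin (-1) Lg Lf); apply: Lfun_ext => x; ring. Qed.

Lemma L1_abs f : L1 f -> L1 (fun x => `|f x|).
Proof. exact: Lfun_norm. Qed.

Lemma L2_scale c f : L2 f -> L2 (fun x => c * f x).
Proof. by move=> /(L2_lin c) /(_ L2_0); apply: Lfun_ext => x; rewrite addr0. Qed.

Lemma L2_sub f g : L2 f -> L2 g -> L2 (fun x => f x - g x).
Proof. by move=> Lf Lg; move: (L2_lin (-1) Lg Lf); apply: Lfun_ext => x; ring. Qed.

Lemma L1_dom f g : mfun f -> (\forall x \ae mu, `|f x| <= g x) -> L1 g -> L1 f.
Proof.
move=> mf fg /Lfun1_integrable /integrableP[mg ig].
apply/Lfun1_integrable/integrableP; split; first exact/measurable_EFinP.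
apply: le_lt_trans ig; apply: ae_ge0_le_integral => //.
- by apply: measurableT_comp => //; exact/measurable_EFinP.
- exact: measurableT_comp.
- apply: filterS fg => x fg _ /=; rewrite lee_fin.
  by apply: le_trans fg _; exact: ler_norm.
Qed.

Lemma L1_mulB f g M : L1 f -> mfun g -> (\forall x \ae mu, `|g x| <= M) ->
  L1 (fun x => f x * g x).
Proof.
move=> Lf mg gM; apply: (@L1_dom _ (fun x => M * `|f x|)).
- by apply: measurable_funM => //; exact: Lfun_measurable Lf.
- apply: filterS gM => x gM; rewrite normrM mulrC.
  by rewrite ler_wpM2r.
- by apply: L1_scale; exact: L1_abs.
Qed.

Lemma L2_mul f g : L2 f -> L2 g -> L1 (fun x => f x * g x).
Proof. exact: Lfun2_mul_Lfun1. Qed.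

Lemma L2P f : L2 f <-> mfun f /\ L1 (fun x => f x ^+ 2).
Proof.
split=> [Lf|[mf /Lfun1_integrable/integrableP[_ iff]]].
  split; first exact: Lfun_measurable Lf.
  by apply/Lfun1_integrable; exact: Lfun2_integrable_sqr.
rewrite inE; apply/andP; rewrite !inE; split=> //.
rewrite /= /finite_norm unlock /Lnorm; apply: poweR_lty.
rewrite (eq_integral (fun x : T => `|(f x ^+ 2)%:E|)%E)//.
move=> x _ /=; rewrite powR_mulrn// real_normK ?num_real//.
by rewrite ger0_norm// sqr_ge0.
Qed.

Lemma L2_dom f g : mfun f -> (\forall x \ae mu, `|f x| <= g x) -> L2 g -> L2 f.
Proof.
move=> mf fg /L2P[mg Lg]; apply/L2P; split=> //.
apply: L1_dom Lg; first exact: measurable_funX.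
apply: filterS fg => x fg; rewrite normrX.
by rewrite ler_sqr// nnegrE// (le_trans _ fg).
Qed.

Lemma L2_mulB f g M : L2 f -> mfun g -> (\forall x \ae mu, `|g x| <= M) ->
  L2 (fun x => f x * g x).
Proof.
move=> Lf mg gM; have M0 : L2 (fun x => M * `|f x|).
  apply: L2_scale; have /L2P[mf Lf2] := Lf; apply/L2P; split.
    exact: measurableT_comp.
  by under eq_fun do rewrite real_normK ?num_real//.
apply: L2_dom M0; first by apply: measurable_funM => //; exact: Lfun_measurable Lf.
by apply: filterS gM => x gM; rewrite normrM mulrC ler_wpM2r.
Qed.

Lemma L12_dom f M : L1 f -> (\forall x \ae mu, `|f x| <= M) -> L2 f.
Proof.
move=> Lf fg; apply/L2P; split; first exact: Lfun_measurable Lf.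
under eq_fun do rewrite expr2.
by apply: L1_mulB fg => //; exact: Lfun_measurable Lf.
Qed.

Lemma I_lin c f g : L1 f -> L1 g ->
  Int (fun x => c * f x + g x) = c * Int f + Int g.
Proof.
move=> Lf Lg; rewrite RintegralD//; last exact: L1_int.
  by rewrite RintegralZl//; exact: L1_int.
exact/L1_int/L1_scale.
Qed.

Lemma I_add f g : L1 f -> L1 g -> Int (fun x => f x + g x) = Int f + Int g.
Proof. by move=> Lf Lg; rewrite RintegralD//; exact: L1_int. Qed.

Lemma I_sub f g : L1 f -> L1 g -> Int (fun x => f x - g x) = Int f - Int g.
Proof. by move=> Lf Lg; rewrite RintegralB//; exact: L1_int. Qed.

Lemma I_scale c f : L1 f -> Int (fun x => c * f x) = c * Int f.
Proof. by move=> Lf; rewrite RintegralZl//; exact: L1_int. Qed.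

Lemma I_eq f g : mfun f -> mfun g -> f = g %[ae mu] -> Int f = Int g.
Proof.
move=> mf mg fg; congr fine; apply: ae_eq_integral => //.
- exact/measurable_EFinP.
- exact/measurable_EFinP.
- by apply: filterS fg => x fg xT; rewrite /= fg.
Qed.

Lemma L1_eq f g : L1 f -> mfun g -> f = g %[ae mu] -> L1 g.
Proof.
move=> Lf mg fg; apply: L1_dom (L1_abs Lf) => //.
by apply: filterS fg => x /= <-.
Qed.

Lemma L2_eq f g : L2 f -> mfun g -> f = g %[ae mu] -> L2 g.
Proof.
move=> /L2P[mf Lf] mg fg; apply/L2P; split=> //.
apply: (L1_eq Lf); first exact: measurable_funX.
by apply: filterS fg => x /= h ?; rewrite h.
Qed.

Lemma I_ge0 f : mfun f -> (\forall x \ae mu, 0 <= f x) -> 0 <= Int f.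
Proof.
move=> mf f0; rewrite (@I_eq f (fun x => `|f x|))//.
- by apply: Rintegral_ge0.
- exact: measurableT_comp.
- by apply: filterS f0 => x f0 _; rewrite ger0_norm.
Qed.

Lemma I_le f g : L1 f -> L1 g -> (\forall x \ae mu, f x <= g x) -> Int f <= Int g.
Proof.
move=> Lf Lg fg; rewrite -subr_ge0 -I_sub//; apply: I_ge0.
  exact: Lfun_measurable (L1_sub Lg Lf).
by apply: filterS fg => x; rewrite subr_ge0.
Qed.

Lemma I_abs f : L1 f -> `|Int f| <= Int (fun x => `|f x|).
Proof. by move=> Lf; apply: le_normr_Rintegral => //; exact: L1_int. Qed.

Lemma I_abs0 f : L1 f -> Int (fun x => `|f x|) = 0 -> f = cst 0 %[ae mu].
Proof.
move=> Lf I0; have /integrableP[mf iff] := L1_int Lf.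
have : (\int[mu]_(x in setT) `|(EFin \o f) x|)%E = 0%E.
  rewrite -[LHS]fineK//; last by rewrite ge0_fin_numE// integral_ge0.
  by congr EFin; rewrite -I0; congr fine.
move/(ae_eq_integral_abs mu measurableT mf).
by apply: filterS => x h /h [].
Qed.

Definition n1 f := Int (fun x => `|f x|).

Lemma n1_seminorm : seminorm_on [set f | L1 f] n1.
Proof.
split.
- exact: L1_0.
- by move=> c u v; exact: L1_lin.
- move=> u v Lu Lv; rewrite -I_add; [|exact: L1_abs..].
  apply: I_le; [exact/L1_abs/L1_add|by apply: L1_add; exact: L1_abs|].
  by apply: aeW => x; exact: ler_normD.
- move=> c u Lu; rewrite /n1 -I_scale; last exact: L1_abs.
  by congr Rintegral; apply/funext => x; rewrite normrM.
Qed.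

Lemma n1_Lnorm f : L1 f -> ('N[mu]_1[EFin \o f])%E = (n1 f)%:E.
Proof.
move=> Lf; rewrite Lnorm1 /n1 /Rintegral fineK//.
by rewrite ge0_fin_numE ?integral_ge0//; have /integrableP[] := L1_int Lf.
Qed.

Lemma n1_eq f g : L1 f -> L1 g -> n1 (f \- g) = 0 -> f = g %[ae mu].
Proof.
move=> Lf Lg /I_abs0 - /(_ (L1_sub Lf Lg)); apply: filterS => x /= h xT.
by apply/eqP; rewrite -subr_eq0; apply/eqP/h.
Qed.

Lemma eq_n1 f g : L1 f -> L1 g -> f = g %[ae mu] -> n1 (f \- g) = 0.
Proof.
move=> Lf Lg fg; rewrite -(@N0 _ _ _ _ n1_seminorm); apply: I_eq.
- exact: Lfun_measurable (L1_abs (L1_sub Lf Lg)).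
- exact: Lfun_measurable (L1_abs L1_0).
- by apply: filterS fg => x /= h xT; rewrite h// subrr.
Qed.

Definition n2 f := Num.sqrt (Int (fun x => f x ^+ 2)).

Lemma I_sqr_ge0 f : 0 <= Int (fun x => f x ^+ 2).
Proof. by apply: Rintegral_ge0 => x _; exact: sqr_ge0. Qed.

Lemma n2_sqr f : n2 f ^+ 2 = Int (fun x => f x ^+ 2).
Proof. by rewrite sqr_sqrtr// I_sqr_ge0. Qed.

Lemma n2_ge0 f : 0 <= n2 f. Proof. exact: sqrtr_ge0. Qed.

Lemma L2_sqr f : L2 f -> L1 (fun x => f x ^+ 2).
Proof. by move=> /L2P[]. Qed.

Lemma n2_CS f g : L2 f -> L2 g -> `|Int (fun x => f x * g x)| <= n2 f * n2 g.
Proof.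
move=> Lf Lg; have Lfg := L2_mul Lf Lg.
set a := Int (fun x => f x ^+ 2); set b := Int (fun x => f x * g x).
set c := Int (fun x => g x ^+ 2).
have q t : 0 <= a * t ^+ 2 + 2 * b * t + c.
  have : 0 <= Int (fun x => (t * f x + g x) ^+ 2) by exact: I_sqr_ge0.
  rewrite (_ : (fun x => _) = (fun x => t ^+ 2 * f x ^+ 2 +
     ((2 * t) * (f x * g x) + g x ^+ 2))); last by apply/funext => x; ring.
  rewrite I_lin; [|exact: L2_sqr|by apply: L1_lin => //; exact: L2_sqr].
  rewrite I_lin//; last exact: L2_sqr.
  by rewrite -/a -/b -/c; congr (0 <= _); ring.
have a0 : 0 <= a by exact: I_sqr_ge0.
have c0 : 0 <= c by exact: I_sqr_ge0.
have bac : b ^+ 2 <= a * c.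
  have [a00|a00] := eqVneq a 0.
    have : b = 0.
      apply/eqP/negPn/negP => b0.
      have := q (- (c + 1) / (2 * b)); rewrite a00 mul0r add0r.
      rewrite (_ : 2 * b * _ = - (c + 1)); first lra.
      by field; rewrite b0.
    by move=> ->; rewrite a00 mul0r expr0n.
  have apos : 0 < a by rewrite lt_neqAle eq_sym a00.
  have := q (- b / a); rewrite (_ : _ + _ = (a * c - b ^+ 2) / a); last by field.
  by rewrite pmulr_lge0 ?invr_gt0// subr_ge0.
rewrite -(ler_pXn2r (n := 2))// ?nnegrE ?mulr_ge0 ?n2_ge0//.
by rewrite real_normK ?num_real// exprMn !n2_sqr.
Qed.

Lemma n2_seminorm : seminorm_on [set f | L2 f] n2.
Proof.
split.
- exact: L2_0.
- by move=> c u v; exact: L2_lin.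
- move=> u v Lu Lv; rewrite -(ler_pXn2r (n := 2))// ?nnegrE ?addr_ge0 ?n2_ge0//.
  rewrite n2_sqr sqrrD !n2_sqr.
  rewrite (_ : (fun x => _) = (fun x => 1 * u x ^+ 2 +
     (2 * (u x * v x) + v x ^+ 2))); last by apply/funext => x /=; ring.
  rewrite I_lin; [|exact: L2_sqr|].
    rewrite I_lin; [|exact: L2_mul|exact: L2_sqr].
    have := n2_CS Lu Lv; rewrite ler_norml => /andP[_].
    by rewrite mul1r -[_ *+ 2]mulr_natl; lra.
  by apply: L1_lin; [exact: L2_mul|exact: L2_sqr].
- move=> c u Lu; rewrite /n2.
  under eq_Rintegral do rewrite exprMn.
  by rewrite I_scale; [rewrite sqrtrM ?sqr_ge0// sqrtr_sqr|exact: L2_sqr].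
Qed.

Lemma n2_Lnorm f : L2 f -> ('N[mu]_2%:E[EFin \o f])%E = (n2 f)%:E.
Proof.
move=> Lf; have /integrableP[_ iff] := L1_int (L2_sqr Lf).
rewrite unlock /Lnorm.
rewrite (eq_integral (fun x : T => `|(f x ^+ 2)%:E|)%E); last first.
  move=> x _ /=; rewrite powR_mulrn// real_normK ?num_real//.
  by rewrite ger0_norm// sqr_ge0.
rewrite -[X in (X `^ _)%E]fineK; last by rewrite ge0_fin_numE// integral_ge0.
rewrite poweR_EFin; congr EFin.
have -> : n2 f = Int (fun x => f x ^+ 2) `^ 2^-1 by rewrite powR12_sqrt// I_sqr_ge0.
congr (_ `^ _).
congr fine; apply: eq_integral => x _ /=; by rewrite ger0_norm// sqr_ge0.
Qed.

Lemma n2_eq f g : L2 f -> L2 g -> n2 (f \- g) = 0 -> f = g %[ae mu].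
Proof.
move=> Lf Lg fg0.
have Ls := L2_sqr (L2_sub Lf Lg).
have : Int (fun x => `|(f x - g x) ^+ 2|) = 0.
  transitivity (n2 (f \- g) ^+ 2); last by rewrite fg0 expr0n.
  by rewrite n2_sqr; congr Rintegral; apply/funext => x; rewrite ger0_norm// sqr_ge0.
move/(I_abs0 Ls); apply: filterS => x /= h xT; move/eqP: (h xT).
by rewrite sqrf_eq0 subr_eq0 => /eqP.
Qed.

Lemma eq_n2 f g : L2 f -> L2 g -> f = g %[ae mu] -> n2 (f \- g) = 0.
Proof.
move=> Lf Lg fg; rewrite -(@N0 _ _ _ _ n2_seminorm); congr Num.sqrt; apply: I_eq.
- exact: Lfun_measurable (L2_sqr (L2_sub Lf Lg)).
- exact: Lfun_measurable (L2_sqr L2_0).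
- by apply: filterS fg => x /= h xT; rewrite h// subrr.
Qed.

(** * Convergence theorems and completeness *)

Lemma cvgr_epsP (s : nat -> R) l : s @ \oo --> l <->
  forall e, 0 < e -> exists n0, forall n, (n0 <= n)%N -> `|s n - l| < e.
Proof.
split=> [/cvgrPdist_lt h e e0|h].
  have [n0 _ hn] := h e e0; exists n0 => n /hn /=.
  by rewrite distrC.
apply/cvgrPdist_lt => e e0; have [n0 hn] := h e e0.
by exists n0 => // n /= /hn; rewrite distrC.
Qed.

Lemma ereal_cvg0P (s : nat -> \bar R) (r : nat -> R) :
  (forall n, s n = (r n)%:E) -> s @ \oo --> 0%E <-> r @ \oo --> (0 : R).
Proof.
move=> /funext ->; split => [/fine_cvgP[]//|h].
by apply: cvg_EFin; [exact: nearW|].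
Qed.

Lemma dominated_cvgR u f g : (forall n, mfun (u n)) -> mfun f -> L1 g ->
  (\forall x \ae mu, u ^~ x @ \oo --> f x) ->
  (\forall x \ae mu, forall n, `|u n x| <= g x) ->
  [/\ L1 f, Ncvg n1 u f & (fun n => Int (u n)) @ \oo --> Int f].
Proof.
move=> mu_ mf Lg uf ug.
have [] := @dominated_convergence _ _ _ mu setT measurableT
  (fun n => EFin \o u n) (EFin \o f) (EFin \o g).
- by move=> n; exact/measurable_EFinP.
- exact/measurable_EFinP.
- by apply: filterS uf => x uf _; apply/cvg_EFin => //; exact: nearW.
- exact: L1_int.
- by apply: filterS ug => x ug n _ /=; rewrite lee_fin.
move=> /Lfun1_integrable Lf c1 c2.
have Lu n : L1 (u n).
  by apply: L1_dom Lg => //; apply: filterS ug.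
have Lfu n : L1 (u n \- f) by exact: L1_sub.
have c0 : n1 (u n \- f) @[n --> \oo] --> (0 : R).
  apply: (@ereal_cvg0P (fun n => (\int[mu]_x `|(EFin \o u n) x - (EFin \o f) x|)%E) _ _).1 c1 => n.
  by rewrite -n1_Lnorm// Lnorm1.
have Nc : Ncvg n1 u f.
  move=> e e0; have [n0 hn] := (cvgr_epsP _ _).1 c0 _ e0.
  by exists n0 => n /hn; rewrite subr0; exact: le_lt_trans (ler_norm _).
split=> //; apply/cvgr_epsP => e e0; have [n0 hn] := Nc e e0.
exists n0 => n /hn; apply: le_lt_trans; rewrite -I_sub//.
exact: (I_abs (Lfu n)).
Qed.

(** The sum of the series is integrable, hence finite almost everywhere, and it dominates each of
    its terms. *)
Lemma ae_bounded_seq (g_ : nat -> T -> R) : (forall k, mfun (g_ k)) ->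
  (forall k x, 0 <= g_ k x) ->
  (forall k, (\int[mu]_x (g_ k x)%:E <= (1 / (2 ^ k.+1)%:R)%:E)%E) ->
  \forall x \ae mu, exists C, forall k, g_ k x <= C.
Proof.
move=> mg g0 hg.
pose h x := (\sum_(k <oo) (g_ k x)%:E)%E.
have mh : measurable_fun setT h.
  apply: ge0_emeasurable_sum => //; first by move=> k x _ _; rewrite lee_fin.
  by move=> k _; exact/measurable_EFinP.
have h0 x : (0 <= h x)%E by apply: nneseries_ge0 => k _ _; rewrite lee_fin.
have ih : mu.-integrable setT h.
  apply/integrableP; split => //.
  rewrite (eq_integral h); last by move=> x _; rewrite gee0_abs.
  rewrite /h integral_nneseries//; last 2 first.
    by move=> k; exact/measurable_EFinP.
    by move=> k x _; rewrite lee_fin.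
  apply: (@le_lt_trans _ _ (\sum_(k <oo) (1 / (2 ^ k.+1)%:R)%:E)%E).
    by apply: lee_nneseries => // k _ _; apply: integral_ge0 => x _; rewrite lee_fin.
  by apply: le_lt_trans (epsilon_trick0 xpredT ler01) _; rewrite ltry.
have := integrable_ae measurableT ih; apply: filterS => x /(_ I) hx.
exists (fine (h x)) => k; rewrite -lee_fin fineK// /h.
apply: le_trans (nneseries_lim_ge k.+1 _); last by move=> i _; rewrite lee_fin.
rewrite big_nat_recr//=; apply: leeDr; apply: sume_ge0 => i _.
by rewrite lee_fin.
Qed.

(** Kept extended-real, so that differences can be estimated before their integrability is known;
    one completeness proof then serves for $p=1$ and $p=2$. *)
Definition Np (p : nat) f := (\int[mu]_x (`|f x| ^+ p)%:E)%E.

Lemma root_bound (p : nat) (a C : R) : (0 < p)%N -> 0 <= a -> a ^+ p <= C ->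
  a <= Num.max 1 C.
Proof.
move=> p0 a0 aC; rewrite le_max; have [//|a1] := leP a 1.
rewrite (le_trans _ aC)//= -[leLHS]expr1.
by rewrite ler_eXn2l.
Qed.

(** The prescribed decay leaves $2^{kp}|u_k|^p$ with summable integrals, which upgrades convergence
    in mean to pointwise geometric decay. *)
Lemma ae_fast_bound (p : nat) (u : nat -> T -> R) : (0 < p)%N ->
  (forall k, mfun (u k)) ->
  (forall k, (Np p (u k) <= (1 / (2 ^ k.+1)%:R / (2 ^+ k) ^+ p)%:E)%E) ->
  \forall x \ae mu, exists C, forall k, `|u k x| <= C / 2 ^+ k.
Proof.
move=> p0 mu_ hu.
have h : \forall x \ae mu, exists C, forall k, (2 ^+ k) ^+ p * `|u k x| ^+ p <= C.
  apply: (@ae_bounded_seq (fun k x => (2 ^+ k) ^+ p * `|u k x| ^+ p)).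
  - by move=> k; apply: measurable_funM => //; apply: measurable_funX; exact: measurableT_comp.
  - by move=> k x; rewrite mulr_ge0// !exprn_ge0.
  - move=> k; under eq_integral do rewrite EFinM.
    rewrite ge0_integralZl_EFin ?exprn_ge0//; last first.
      by apply/measurable_EFinP; apply: measurable_funX; exact: measurableT_comp.
    apply: (@le_trans _ _ (((2 ^+ k) ^+ p)%:E * (1 / (2 ^ k.+1)%:R / (2 ^+ k) ^+ p)%:E)%E).
      by rewrite lee_wpmul2l ?hu// lee_fin !exprn_ge0.
    by rewrite -EFinM lee_fin mulrC divfK// !expf_neq0.
apply: filterS h => x [C hC]; exists (Num.max 1 C) => k.
rewrite ler_pdivlMr ?exprn_gt0//; apply: (root_bound p0); first by rewrite mulr_ge0// exprn_ge0.
by rewrite mulrC exprMn.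
Qed.

Lemma pow2_cvg0 (C : R) : (fun k => C / 2 ^+ k) @ \oo --> (0 : R).
Proof.
under eq_fun do rewrite -exprVn mulrC.
rewrite -(mul0r C); apply: cvgM; last exact: cvg_cst.
by apply: cvg_expr; rewrite ger0_norm// invf_lt1// ltr1n.
Qed.

(** Adding the geometric tail $2C2^{-k}$ makes the sequence nonincreasing, while subtracting it
    gives lower bounds. *)
Lemma geo_cvg (s : nat -> R) (C : R) :
  (forall k, `|s k.+1 - s k| <= C / 2 ^+ k) -> cvgn s.
Proof.
move=> hs; have C0 : 0 <= C.
  by have := hs 0%N; rewrite expr0 divr1; apply: le_trans.
have E k : 2 * C / 2 ^+ k - 2 * C / 2 ^+ k.+1 = C / 2 ^+ k.
  by rewrite exprS; field; rewrite expf_neq0.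
pose a k := s k + 2 * C / 2 ^+ k; pose b k := s k - 2 * C / 2 ^+ k.
have b0 k : b 0%N <= b k.
  elim: k => // k; move/le_trans; apply; rewrite /b.
  by have := hs k; rewrite ler_norml => /andP[+ _]; have := E k; lra.
have ca : cvgn a.
  apply: nonincreasing_is_cvgn.
    apply/nonincreasing_seqP => k; rewrite /a.
    by have := hs k; rewrite ler_norml => /andP[_]; have := E k; lra.
  exists (b 0%N) => _ [k _ <-]; apply: le_trans (b0 k) _; rewrite /a /b.
  have : 0 <= 2 * C / 2 ^+ k by rewrite divr_ge0 ?mulr_ge0// exprn_ge0.
  lra.
rewrite (_ : s = (fun k => a k - 2 * C / 2 ^+ k)); last first.
  by apply/funext => k; rewrite /a addrK.
by apply: is_cvgB => //; apply/cvg_ex; exists 0; exact: pow2_cvg0.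
Qed.

Lemma limn_einf_le (v : nat -> \bar R) (e : \bar R) :
  (forall n, (v n <= e)%E) -> (limn_einf v <= e)%E.
Proof.
move=> ve; rewrite limn_einf_lim; apply: lime_le; first exact: is_cvg_einfs.
apply: nearW => n; apply: le_trans (ve n).
by apply: ereal_inf_lbound; exists n => /=.
Qed.

(** Riesz-Fischer: a rapidly converging subsequence has a pointwise limit, and Fatou's lemma gives
    convergence of the whole sequence in mean. *)
Lemma Lp_complete (p : nat) (f_ : nat -> T -> R) : (0 < p)%N ->
  (forall n, mfun (f_ n)) ->
  (forall e : R, 0 < e -> exists n0, forall m n, (n0 <= m)%N -> (n0 <= n)%N ->
     (Np p (f_ m \- f_ n)%R <= e%:E)%E) ->
  exists f (s : nat -> nat), [/\ mfun f, (forall k, (k <= s k)%N),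
    \forall x \ae mu, (fun k => f_ (s k) x) @ \oo --> f x &
    forall e : R, 0 < e -> exists n0, forall n, (n0 <= n)%N ->
      (Np p (f_ n \- f)%R <= e%:E)%E].
Proof.
move=> p0 mf_ cf; pose ep k : R := 1 / (2 ^ k.+1)%:R / (2 ^+ k) ^+ p.
have ep0 k : 0 < ep k by rewrite !divr_gt0// ?exprn_gt0// ltr0n expn_gt0.
have /choice[n0 hn0] : forall k, exists n0, forall m n, (n0 <= m)%N -> (n0 <= n)%N ->
    (Np p (f_ m \- f_ n)%R <= (ep k)%:E)%E by move=> k; exact: cf.
(* The maximum over all $j\le k$ puts both [s k] and [s k.+1] beyond [n0 k]. *)
pose s k := (\max_(j < k.+1) maxn j (n0 j))%N.
have sj k j : (j <= k)%N -> (maxn j (n0 j) <= s k)%N.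
  by move=> jk; rewrite /s (leq_bigmax (Ordinal (jk : (j < k.+1)%N))).
have sk k : (k <= s k)%N by apply: leq_trans (sj k k (leqnn _)); exact: leq_maxl.
have sn0 k j : (j <= k)%N -> (n0 j <= s k)%N.
  by move=> jk; apply: leq_trans (sj k j jk); exact: leq_maxr.
have : \forall x \ae mu, exists C, forall k, `|f_ (s k.+1) x - f_ (s k) x| <= C / 2 ^+ k.
  apply: (@ae_fast_bound p (fun k => f_ (s k.+1) \- f_ (s k))) => //.
  - by move=> k; exact: measurable_funB.
  - by move=> k; apply: hn0; apply: sn0.
move=> [N [mN N0 hN]].
have cN x : ~ N x -> cvgn (fun k => f_ (s k) x).
  move=> Nx; have : exists C, forall k, `|f_ (s k.+1) x - f_ (s k) x| <= C / 2 ^+ k.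
    by apply: contrapT => h; apply: Nx; exact: hN.
  by move=> [C hC]; exact: geo_cvg hC.
(* Set to zero on the exceptional set, so that the limit exists everywhere and is measurable. *)
pose g k x := if x \in N then 0 else f_ (s k) x.
pose f x := limn (fun k => g k x).
have mg k : mfun (g k).
  apply: measurable_fun_ifT => //.
  apply: (measurable_fun_bool true) => /=.
  rewrite setTI (_ : _ @^-1` _ = N)//; apply/seteqP; split=> x /=.
    by move/set_mem.
  by move=> Nx; apply/mem_set.
have gf x : (fun k => g k x) @ \oo --> f x.
  have [xN|/negP xN] := boolP (x \in N).
    by rewrite /f /g xN; exact: is_cvg_cst.
  have Nx : ~ N x by move=> /mem_set.
  by rewrite /f /g memNset//; exact: cN.
have mf : mfun f by apply: (measurable_fun_cvg mg) => x _; exact: gf.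
have gE x : ~ N x -> forall k, g k x = f_ (s k) x.
  by move=> Nx k; rewrite /g memNset.
exists f, s; split=> //.
  exists N; split=> // x /= h; apply: contrapT => Nx; apply: h.
  by have := gf x; rewrite (_ : (fun k => g k x) = (fun k => f_ (s k) x))//;
    apply/funext => k; exact: gE.
move=> e e0; have [m0 hm0] := cf e e0; exists m0 => n mn.
(* The shift by [m0] makes the Cauchy bound hold for every index of the sequence to which Fatou's
   lemma is applied. *)
pose hk k x := (`|f_ n x - g (k + m0)%N x| ^+ p)%:E.
have mhk k : measurable_fun setT (hk k).
  apply/measurable_EFinP; apply: measurable_funX; apply: measurableT_comp => //.
  exact: measurable_funB.
have hk0 k x : setT x -> (0 <= hk k x)%E by move=> _; rewrite lee_fin exprn_ge0.
have := fatou mu measurableT mhk hk0.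
rewrite (_ : (\int[mu]_x _)%E = Np p (f_ n \- f)); last first.
  apply: eq_integral => x _.
  suff /cvg_limn_einf_sup[-> _] : hk^~ x @ \oo --> (`|f_ n x - f x| ^+ p)%:E by [].
  apply: cvg_EFin; first exact: nearW.
  rewrite (_ : fine \o _ = (fun k => `|f_ n x - g (k + m0)%N x| ^+ p))//.
  have c1 : (fun k => g (k + m0)%N x) @ \oo --> f x.
    by have := gf x; rewrite -(cvg_shiftn m0).
  have c2 : (fun k => `|f_ n x - g (k + m0)%N x|) @ \oo --> `|f_ n x - f x|.
    by apply: cvg_norm; apply: cvgB => //; exact: cvg_cst.
  elim: (p) => [|q ih]; first by under eq_fun do rewrite expr0; rewrite expr0; exact: cvg_cst.
  by under eq_fun do rewrite exprS; rewrite exprS; exact: cvgM.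
move/le_trans; apply; apply: limn_einf_le => k.
rewrite (_ : (\int[mu]_x _)%E = Np p (f_ n \- f_ (s (k + m0)%N))); last first.
  apply: ae_eq_integral => //.
    apply/measurable_EFinP; apply: measurable_funX; apply: measurableT_comp => //.
    exact: measurable_funB.
  exists N; split=> // x /= h; apply: contrapT => Nx; apply: h => _.
  by rewrite /hk gE.
apply: hm0 => //; apply: leq_trans (sk _); exact: leq_addl.
Qed.

Lemma Lp_ae_subseq (p : nat) (f_ : nat -> T -> R) f : (0 < p)%N ->
  (forall n, mfun (f_ n)) -> mfun f ->
  (forall e : R, 0 < e -> exists n0, forall n, (n0 <= n)%N ->
      (Np p (f_ n \- f)%R <= e%:E)%E) ->
  exists s : nat -> nat, (forall k, (k <= s k)%N) /\
    \forall x \ae mu, (fun k => f_ (s k) x) @ \oo --> f x.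
Proof.
move=> p0 mf_ mf cf; pose ep k : R := 1 / (2 ^ k.+1)%:R / (2 ^+ k) ^+ p.
have ep0 k : 0 < ep k by rewrite !divr_gt0// ?exprn_gt0// ltr0n expn_gt0.
have /choice[n0 hn0] : forall k, exists n0, forall n, (n0 <= n)%N ->
    (Np p (f_ n \- f)%R <= (ep k)%:E)%E by move=> k; exact: cf.
pose s k := maxn k (n0 k); exists s; split; first by move=> k; exact: leq_maxl.
have : \forall x \ae mu, exists C, forall k, `|f_ (s k) x - f x| <= C / 2 ^+ k.
  apply: (@ae_fast_bound p (fun k => f_ (s k) \- f)) => //.
  - by move=> k; exact: measurable_funB.
  - by move=> k; apply: hn0; exact: leq_maxr.
apply: filterS => x [C hC]; apply/cvgrPdist_le => e e0.
have /cvgrPdist_le/(_ e e0) := pow2_cvg0 C; apply: filterS => k.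
rewrite sub0r normrN distrC => /(le_trans _); apply.
exact: le_trans (hC k) (ler_norm _).
Qed.

Lemma Np1 f : L1 f -> Np 1 f = (n1 f)%:E.
Proof.
move=> Lf; rewrite -n1_Lnorm// Lnorm1; apply: eq_integral => x _.
by rewrite expr1.
Qed.

Lemma Np2 f : L2 f -> Np 2 f = (n2 f ^+ 2)%:E.
Proof.
move=> Lf; rewrite n2_sqr /Rintegral fineK; last first.
  have /integrableP[_ h] := L1_int (L2_sqr Lf).
  rewrite ge0_fin_numE; last by apply: integral_ge0 => x _; rewrite lee_fin sqr_ge0.
  apply: le_lt_trans h; rewrite le_eqVlt; apply/orP; left; apply/eqP.
  by apply: eq_integral => x _ /=; rewrite ger0_norm// sqr_ge0.
by apply: eq_integral => x _; rewrite real_normK ?num_real.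
Qed.

Lemma sqr_le_sqrt (a e : R) : 0 <= a -> 0 <= e -> a <= Num.sqrt e -> a ^+ 2 <= e.
Proof.
by move=> a0 e0 h; rewrite -(sqr_sqrtr e0) ler_sqr// nnegrE sqrtr_ge0.
Qed.

Lemma L1_complete : Ncomplete [set f | L1 f] n1.
Proof.
move=> u Lu_ cu; have Lu n : L1 (u n) by exact: Lu_.
have mu_ n := Lfun_measurable (Lu n).
have cu' e : 0 < e -> exists n0, forall m n, (n0 <= m)%N -> (n0 <= n)%N ->
     (Np 1 (u m \- u n)%R <= e%:E)%E.
  move=> e0; have [n0 hn] := cu e e0; exists n0 => m n hm hn'.
  by rewrite Np1; [rewrite lee_fin ltW// hn|exact: L1_sub].
have [f [s [mf _ _ uf]]] := @Lp_complete 1 u isT mu_ cu'.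
have Luf : exists n0, forall n, (n0 <= n)%N -> L1 (u n \- f).
  have [n0 hn] := uf 1 ltr01; exists n0 => m /hn h; apply/Lfun1_integrable/integrableP.
  split; first by apply/measurable_EFinP; exact: measurable_funB.
  by apply: le_lt_trans (ltry 1); apply: le_trans h; rewrite /Np; under [leRHS]eq_integral do rewrite expr1.
have [n0 hn0] := Luf.
have Lf : L1 f.
  have := L1_sub (Lu n0) (hn0 _ (leqnn _)); apply: Lfun_ext => x /=; ring.
exists f => // e e0; have e2 : 0 < e / 2 by lra.
have [n2 hn2] := uf _ e2; exists n2 => n /hn2.
by rewrite Np1 ?lee_fin; [move/le_lt_trans; apply; lra|exact: L1_sub].
Qed.

Lemma L2_complete : Ncomplete [set f | L2 f] n2.
Proof.
move=> u Lu_ cu; have Lu n : L2 (u n) by exact: Lu_.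
have mu_ n := Lfun_measurable (Lu n).
have cu' e : 0 < e -> exists n0, forall m n, (n0 <= m)%N -> (n0 <= n)%N ->
     (Np 2 (u m \- u n)%R <= e%:E)%E.
  move=> e0; have se : 0 < Num.sqrt e by rewrite sqrtr_gt0.
  have [n0 hn] := cu _ se; exists n0 => m n hm hn'.
  rewrite Np2; last exact: L2_sub.
  by rewrite lee_fin sqr_le_sqrt ?n2_ge0 ?(ltW e0)// ltW// hn.
have [f [s [mf _ _ uf]]] := @Lp_complete 2 u isT mu_ cu'.
have [n0 hn0] : exists n0, forall n, (n0 <= n)%N -> L2 (u n \- f).
  have [n0 hn] := uf 1 ltr01; exists n0 => m /hn h; apply/L2P; split.
    exact: measurable_funB.
  apply/Lfun1_integrable/integrableP.
  split; first by apply/measurable_EFinP; apply: measurable_funX; exact: measurable_funB.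
  apply: le_lt_trans (ltry 1); apply: le_trans h; rewrite le_eqVlt; apply/orP; left.
  by apply/eqP; apply: eq_integral => x _ /=; rewrite normrX.
have Lf : L2 f.
  have := L2_sub (Lu n0) (hn0 _ (leqnn _)); apply: Lfun_ext => x /=; ring.
exists f => // e e0; have e2 : 0 < (e / 2) ^+ 2 by rewrite exprn_gt0//; lra.
have [n2 hn2] := uf _ e2; exists n2 => n /hn2.
rewrite Np2 ?lee_fin; last exact: L2_sub.
rewrite ler_sqr ?nnegrE ?n2_ge0//; last lra.
move/le_lt_trans; apply; lra.
Qed.

Lemma L1_ae_subseq u f : (forall n, L1 (u n)) -> L1 f -> Ncvg n1 u f ->
  exists s : nat -> nat, (forall k, (k <= s k)%N) /\
    \forall x \ae mu, (fun k => u (s k) x) @ \oo --> f x.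
Proof.
move=> Lu Lf uf; apply: (@Lp_ae_subseq 1) => //.
- by move=> n; exact: Lfun_measurable (Lu n).
- exact: Lfun_measurable Lf.
- move=> e e0; have [n0 hn] := uf e e0; exists n0 => n /hn h.
  by rewrite Np1 ?lee_fin ?ltW//; exact: L1_sub.
Qed.

Lemma L2_ae_subseq u f : (forall n, L2 (u n)) -> L2 f -> Ncvg n2 u f ->
  exists s : nat -> nat, (forall k, (k <= s k)%N) /\
    \forall x \ae mu, (fun k => u (s k) x) @ \oo --> f x.
Proof.
move=> Lu Lf uf; apply: (@Lp_ae_subseq 2) => //.
- by move=> n; exact: Lfun_measurable (Lu n).
- exact: Lfun_measurable Lf.
- move=> e e0; have se : 0 < Num.sqrt e by rewrite sqrtr_gt0.
  have [n0 hn] := uf _ se; exists n0 => n /hn h.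
  rewrite Np2; last exact: L2_sub.
  by rewrite lee_fin sqr_le_sqrt ?n2_ge0 ?(ltW e0)// ltW.
Qed.

End Lp_functions.

(** * Smooth functions and cut-offs *)

Section smooth_functions.
Variables (R : realType) (V : normedModType R) (I : Type) (e : I -> V).
Implicit Types (f g : V -> R).

(** Differentiability along the family [e], by recursion on the order, so that products and
    compositions can be treated by induction; the derivatives of order one are themselves of class
    [Cn] one order lower. *)
Fixpoint Cn (n : nat) f : Prop := match n with
  | 0 => continuous f
  | m.+1 => continuous f /\ forall i, (forall x, derivable f x (e i)) /\
      Cn m (fun x => 'D_(e i) f x)
  end.

Lemma Cn_cont n f : Cn n f -> continuous f.
Proof. by case: n => // n []. Qed.

Lemma CnW n f : Cn n.+1 f -> Cn n f.
Proof.
elim: n f => [|n ih] f; first by move=> [].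
by move=> [cf df]; split=> // i; have [dfi /ih] := df i.
Qed.

Lemma CnS n f (g : I -> V -> R) : continuous f ->
  (forall i x, is_derive x (e i) f (g i x)) -> (forall i, Cn n (g i)) -> Cn n.+1 f.
Proof.
move=> cf dg Cg; split=> // i; split=> [x|]; first by have [] := dg i x.
rewrite (_ : (fun x => _) = g i)//; apply/funext => x.
by have [_ ->] := dg i x.
Qed.

Lemma CnS_der n f i x : Cn n.+1 f -> is_derive x (e i) f ('D_(e i) f x).
Proof. by move=> [_ df]; apply/derivableP; have [] := df i. Qed.

Lemma CnS_D n f i : Cn n.+1 f -> Cn n (fun x => 'D_(e i) f x).
Proof. by move=> [_ df]; have [] := df i. Qed.

Lemma Cn_cst n c : Cn n (fun=> c).
Proof.
have cc (k : R) : continuous (fun _ : V => k) by move=> x; exact: cvg_cst.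
elim: n c => [|n ih] c; first exact: cc.
have d0 i x : is_derive x (e i) (fun=> c : R) 0 by exact: is_derive_cst.
exact: (@CnS n _ (fun _ _ => 0) (cc c) d0 (fun=> ih 0)).
Qed.

Lemma Cn_add n f g : Cn n f -> Cn n g -> Cn n (fun x => f x + g x).
Proof.
have cc f0 g0 : continuous f0 -> continuous g0 -> continuous (fun x : V => f0 x + g0 x : R).
  by move=> cf cg x; apply: cvgD; [exact: cf|exact: cg].
elim: n f g => [|n ih] f g Cf Cg; first exact: cc.
apply: (@CnS n _ (fun i x => 'D_(e i) f x + 'D_(e i) g x)).
- by apply: cc; [exact: Cn_cont Cf|exact: Cn_cont Cg].
- by move=> i x; apply: is_deriveD; [exact: CnS_der Cf|exact: CnS_der Cg].
- by move=> i; apply: ih; exact: CnS_D.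
Qed.

Lemma Cn_mul n f g : Cn n f -> Cn n g -> Cn n (fun x => f x * g x).
Proof.
have cc f0 g0 : continuous f0 -> continuous g0 -> continuous (fun x : V => f0 x * g0 x : R).
  by move=> cf cg x; apply: cvgM; [exact: cf|exact: cg].
elim: n f g => [|n ih] f g Cf Cg; first exact: cc.
apply: (@CnS n _ (fun i x => f x * 'D_(e i) g x + g x * 'D_(e i) f x)).
- by apply: cc; [exact: Cn_cont Cf|exact: Cn_cont Cg].
- by move=> i x; apply: is_deriveM; [exact: CnS_der Cf|exact: CnS_der Cg].
- move=> i; apply: Cn_add; apply: ih; [exact: CnW|exact: CnS_D|exact: CnW|exact: CnS_D].
Qed.

End smooth_functions.

Section smooth_composition.
Variables (R : realType).

Definition D1 n (p : R -> R) := @Cn R R^o unit (fun=> 1) n p.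

Lemma D1_id n : D1 n id.
Proof.
have c : continuous (@id R) by move=> x; exact: cvg_id.
case: n => [//|n].
have d (i : unit) (x : R^o) : is_derive x (1 : R^o) (@id R) (1 : R) by exact: is_derive_id.
by apply: (@CnS R R^o _ _ n _ (fun _ _ => 1) c d) => i; exact: Cn_cst.
Qed.

Lemma D1_affine n (a b : R) : D1 n (fun s => a * s + b).
Proof.
apply: Cn_add; last exact: Cn_cst.
by apply: Cn_mul; [exact: Cn_cst|exact: D1_id].
Qed.

(** [f] is only known to be derivable along [v], so the one-variable chain rule is applied on the
    line $t\mapsto tv+x$. *)
Lemma is_derive_comp1 (V : normedModType R) (p : R -> R) (f : V -> R) x v (dp df : R) :
  is_derive (f x) 1 p dp -> is_derive x v f df ->
  is_derive x v (fun y => p (f y)) (dp * df).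
Proof.
move=> [p1 p2] [f1 f2].
pose F (t : R) := f (t *: v + x).
have F0 : F 0 = f x by rewrite /F scale0r add0r.
have dF : derivable F 0 1 by exact: (derivable1P f x v).1 f1.
have E (g : V -> R) : 'D_v g x = 'D_1 (fun t : R => g (t *: v + x)) 0.
  rewrite /derive; set g1 := fun h => h^-1 *: _; set g2 := fun h => h^-1 *: _.
  suff -> : g1 = g2 by [].
  by apply/funext => h; rewrite /g1 /g2 /= addr0 scale0r add0r [_%:A]mulr1.
have p1' : derivable p (F 0) 1 := eq_ind_r (fun z => derivable p z 1) p1 F0.
have dpF : derivable (p \o F) 0 1.
  move/derivable1_diffP : (p1') => d1; move/derivable1_diffP : (dF) => d2.
  exact/derivable1_diffP/differentiable_comp.
apply: DeriveDef; first exact: (derivable1P (fun y => p (f y)) x v).2 dpF.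
transitivity ('D_1 (p \o F) 0); first by rewrite E.
by rewrite -derive1E (derive1_comp dF p1') !derive1E F0 p2 -f2 [in RHS]E.
Qed.

Lemma Cn_comp (V : normedModType R) (I : Type) (e : I -> V) n p f :
  D1 n p -> Cn e n f -> Cn e n (fun x => p (f x)).
Proof.
have cc p0 (f0 : V -> R) : continuous p0 -> continuous f0 ->
    continuous (fun x : V => p0 (f0 x) : R).
  move=> cp cf x; exact: (continuous_comp (cf x) (cp (f0 x))).
elim: n p f => [|n ih] p f Cp Cf; first exact: cc.
apply: (@CnS _ _ _ _ n _ (fun i x => 'D_1 p (f x) * 'D_(e i) f x)).
- by apply: cc; [exact: Cn_cont Cp|exact: Cn_cont Cf].
- move=> i x; apply: is_derive_comp1; last exact: CnS_der Cf.
  exact: (CnS_der tt _ Cp).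
- move=> i; apply: Cn_mul; last exact: CnS_D.
  apply: (ih (fun s => 'D_1 p s)); last exact: CnW.
  exact: (CnS_D tt Cp).
Qed.

End smooth_composition.

(** * Flat functions and smooth truncations on the real line *)

Section flat_functions.
Variable R : realType.
Implicit Types (P : {poly R}) (s y M : R).

Lemma monom_exp_le (i : nat) y : 0 <= y -> y ^+ i * expR (- y) <= i`!%:R.
Proof.
move=> y0; rewrite expRN ler_pdivrMr ?expR_gt0//.
case: i => [|i].
  by rewrite expr0 fact0 mul1r -[leLHS]expR0 ler_expR.
have := expR_ge1Dxn i y0; have f0 : 0 < (i.+1)`!%:R :> R by rewrite ltr0n fact_gt0.
rewrite -ler_pdivrMl//; rewrite mulrC; lra.
Qed.

Lemma flat_bound P : exists2 C : R, 0 <= C & forall y, 0 <= y -> `|P.[y]| * expR (- y) <= C.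
Proof.
exists (\sum_(i < size P) `|P`_i| * (i`!)%:R) => [|y y0].
  by apply: sumr_ge0 => i _; rewrite mulr_ge0.
rewrite horner_coef -[expR _]ger0_norm ?expR_ge0// -normrM mulr_suml.
apply: le_trans (ler_norm_sum _ _ _) _; apply: ler_sum => i _.
rewrite -mulrA normrM ler_wpM2l//.
by rewrite ger0_norm ?monom_exp_le// mulr_ge0 ?exprn_ge0 ?expR_ge0.
Qed.

(** The polynomial parameter makes the class of functions $P(1/s)e^{-1/s}$ closed under
    differentiation, so that smoothness at the origin follows by induction on the order. *)
Definition flat P s := if 0 < s then P.[s^-1] * expR (- s^-1) else 0.

Lemma flat_le0 P s : s <= 0 -> flat P s = 0.
Proof. by rewrite /flat leNgt => /negbTE ->. Qed.

Lemma flat_gt0 P s : 0 < s -> flat P s = P.[s^-1] * expR (- s^-1).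
Proof. by rewrite /flat => ->. Qed.

Lemma flat_bounded P : exists2 C : R, 0 <= C & forall s, `|flat P s| <= C.
Proof.
have [C C0 hC] := flat_bound P; exists C => // s.
rewrite /flat; case: ifPn => [s0|_]; last by rewrite normr0.
by rewrite normrM (ger0_norm (expR_ge0 _)) hC// invr_ge0 ltW.
Qed.

(** Trading a factor $s$ for a factor $X$ of the polynomial yields both the decay at the origin and
    the difference quotient there. *)
Lemma flatX P s : flat ('X * P) s * s = flat P s.
Proof.
have [s0|s0] := ltP 0 s; last by rewrite !flat_le0// mul0r.
by rewrite !flat_gt0// hornerM hornerX; field; rewrite gt_eqF.
Qed.

Lemma flat_lip0 P : exists2 C : R, 0 <= C & forall s, `|flat P s| <= C * `|s|.
Proof.
have [C C0 hC] := flat_bounded ('X * P); exists C => // s.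
by rewrite -flatX normrM ler_wpM2r.
Qed.

(** From $\frac{d}{ds}\bigl(P(1/s)e^{-1/s}\bigr)=s^{-2}(P-P')(1/s)\,e^{-1/s}$. *)
Definition dflat P := 'X ^+ 2 * (P - P^`()).

Lemma flat_cvg0 P : flat P s @[s --> 0] --> (0 : R).
Proof.
have [C C0 hC] := flat_lip0 P.
apply/cvgr0Pnorm_le => ep e0.
have C1 : 0 < C + 1 by rewrite ltr_pwDr.
near=> s; apply: le_trans (hC s) _.
apply: (@le_trans _ _ ((C + 1) * `|s|)); first by rewrite ler_wpM2r// lerDl.
rewrite mulrC -ler_pdivlMr//.
near: s; apply: (@nbhs0_le R R^o (ep / (C + 1))).
by rewrite divr_gt0.
Unshelve. all: by end_near. Qed.

Lemma flat_der P s : is_derive s 1 (flat P) (flat (dflat P) s).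
Proof.
have [s0|s0|s0] := ltgtP s 0.
- rewrite flat_le0 ?ltW//.
  apply: (@near_eq_is_derive _ _ _ (cst 0)) => //.
  + by near=> t; rewrite /= flat_le0// ltW//; near: t; exact: lt_nbhsl.
- rewrite flat_gt0//.
  pose F := (horner P \o (fun t : R => t^-1)) * (expR \o (fun t : R => - t^-1)).
  apply: (@near_eq_is_derive _ _ _ F).
  + near=> t; rewrite /= flat_gt0//; near: t; exact: lt_nbhsr.
  + have dV : is_derive s 1 (fun t : R => t^-1) (- s ^- 2).
      have := @is_derive_id R R^o s 1 => -[di _].
      have sn : (@id R^o) s != 0 by rewrite /= gt_eqF.
      apply: DeriveDef; first exact: (derivableV sn di).
      by rewrite (deriveV sn di) derive_id /= [_ *: _]mulr1.
    have dN : is_derive s 1 (fun t : R => - t^-1) (s ^- 2).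
      by have := is_deriveN dV; rewrite opprK.
    have dP : is_derive s 1 (horner P \o (fun t : R => t^-1)) (P^`().[s^-1] * (- s ^- 2)).
      have dh : is_derive (s^-1) 1 (horner P) P^`().[s^-1].
        apply: DeriveDef; first exact: derivable_horner.
        by rewrite -derive1E -derivE.
      exact: (@is_derive_comp1 R R^o _ _ _ _ _ _ dh dV).
    have dE : is_derive s 1 (expR \o (fun t : R => - t^-1)) (expR (- s^-1) * s ^- 2).
      exact: (@is_derive_comp1 R R^o _ _ _ _ _ _ (is_derive_expR _) dN).
    apply: is_derive_eq (is_deriveM dP dE) _.
    rewrite /= /dflat !hornerE /=.
    by rewrite -[_ *: _]/(_ * _) -[X in _ + X]/(_ * _) exprVn; field; rewrite gt_eqF.
- rewrite s0 flat_le0//.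
  (* At the origin the difference quotient of [flat P] is [flat ('X * P)], which tends to zero. *)
  have h0 : h^-1 *: ((flat P \o shift 0) (h *: (1 : R^o)) - flat P 0) @[h --> 0^'] --> (0 : R).
    have c0 : flat ('X * P) h @[h --> 0^'] --> (0 : R).
      exact: cvg_within_filter (@flat_cvg0 ('X * P)).
    apply: cvg_trans c0; apply: near_eq_cvg; near=> h.
    rewrite /= addr0 (@flat_le0 P 0)// subr0 [h *: 1]mulr1.
    rewrite -[X in _ *: X]flatX -[_ *: _]/(_ * _) mulrCA mulVf ?mulr1//.
    by near: h; exact: nbhs_dnbhs_neq.
  by apply: DeriveDef; [apply/cvg_ex; exists 0|exact: cvg_lim h0].
Unshelve. all: by end_near. Qed.

Lemma flat_continuous P : continuous (flat P).
Proof.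
move=> s; apply: differentiable_continuous; apply/derivable1_diffP.
by have [] := flat_der P s.
Qed.

Lemma flat_D1 n P : D1 n (flat P).
Proof.
elim: n P => [|n ih] P; first exact: flat_continuous.
apply: (@CnS _ _ _ _ n _ (fun _ => flat (dflat P))); first exact: flat_continuous.
  by move=> _ s; exact: flat_der.
by move=> _; exact: ih.
Qed.

(* [Phi s = s e^(-1/s)] for [s > 0], extended by 0; [phi] is its derivative. *)
Definition Phi s := s * flat 1 s.

Definition phi s := flat (1 + 'X) s.

Definition dphi s := flat ('X ^+ 3) s.

Lemma phi_gt0E s : 0 < s -> phi s = (1 + s^-1) * expR (- s^-1).
Proof. by move=> s0; rewrite /phi flat_gt0// !hornerE. Qed.

Lemma phi_le0 s : s <= 0 -> phi s = 0.
Proof. exact: flat_le0. Qed.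

Lemma phi_gt0 s : 0 < s -> 0 < phi s.
Proof.
by move=> s0; rewrite phi_gt0E// mulr_gt0 ?expR_gt0// addr_gt0// invr_gt0.
Qed.

Lemma phi_ge0 s : 0 <= phi s.
Proof. by have [/phi_gt0/ltW//|/phi_le0->] := ltP 0 s. Qed.

(** For $y=1/s$ this is $1+y\le e^y$. *)
Lemma phi_le1 s : phi s <= 1.
Proof.
have [s0|/phi_le0->//] := ltP 0 s.
by rewrite phi_gt0E// expRN ler_pdivrMr ?expR_gt0// mul1r expR_ge1Dx.
Qed.

Lemma phi_bound s : `|phi s| <= 1.
Proof. by rewrite ger0_norm ?phi_ge0// phi_le1. Qed.

Lemma phi_der s : is_derive s 1 phi (dphi s).
Proof.
apply: is_derive_eq (flat_der _ s) _; congr flat.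
rewrite /dflat derivD derivX -[1]/(1%:P) derivC add0r.
by rewrite [X in _ * X](_ : _ = 'X); [rewrite -exprSr|ring].
Qed.

Lemma dphi_ge0 s : 0 <= dphi s.
Proof.
rewrite /dphi; have [s0|s0] := ltP 0 s; last by rewrite flat_le0.
by rewrite flat_gt0// hornerXn mulr_ge0 ?expR_ge0// exprn_ge0// invr_ge0 ltW.
Qed.

Lemma phi_D1 n : D1 n phi. Proof. exact: flat_D1. Qed.

Lemma phi_cont : continuous phi. Proof. exact: flat_continuous. Qed.

Lemma Phi_der s : is_derive s 1 Phi (phi s).
Proof.
apply: is_derive_eq (is_deriveM (is_derive_id s 1) (flat_der 1 s)) _.
rewrite -[_ *: _]/(_ * _) -[X in _ + X]/(_ * _) mulr1 /phi /dflat.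
have [s0|s0] := ltP 0 s; last by rewrite !flat_le0//= mulr0 addr0.
rewrite !flat_gt0// -[1 : {poly R}]/(1%:P) derivC subr0 mulr1 hornerXn hornerD hornerC hornerX.
by rewrite /=; field; rewrite gt_eqF.
Qed.

Lemma Phi_cont : continuous Phi.
Proof.
move=> s; apply: differentiable_continuous; apply/derivable1_diffP.
by have [] := Phi_der s.
Qed.

Lemma Phi_D1 n : D1 n Phi.
Proof.
case: n => [|n]; first exact: Phi_cont.
apply: (@CnS _ _ _ _ n _ (fun _ => phi)); first exact: Phi_cont.
  by move=> _ s; exact: Phi_der.
by move=> _; exact: phi_D1.
Qed.

Lemma Phi_le0 s : s <= 0 -> Phi s = 0.
Proof. by move=> s0; rewrite /Phi flat_le0// mulr0. Qed.

Lemma deriv_le_Lip (p dp : R -> R) (C : R) :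
  (forall s, is_derive s 1 p (dp s)) -> (forall s, `|dp s| <= C) ->
  forall s t, `|p s - p t| <= C * `|s - t|.
Proof.
move=> pd dpC.
have cp : continuous p.
  move=> s; apply: differentiable_continuous; apply/derivable1_diffP.
  by have [] := pd s.
have H s t : s < t -> `|p t - p s| <= C * `|t - s|.
  move=> st; have [c _ ->] := @MVT _ p dp _ _ st (fun x _ => pd x) (continuous_subspaceT cp).
  by rewrite normrM ler_wpM2r.
move=> s t; have [st|st|->] := ltgtP s t; last by rewrite !subrr normr0 mulr0.
- by rewrite distrC [`|s - t|]distrC; exact: H.
- exact: H.
Qed.

Lemma dphi_bounded : exists2 C : R, 0 < C & forall s, `|dphi s| <= C.
Proof.
have [C C0 hC] := flat_bounded ('X ^+ 3).
exists (C + 1) => [|s]; first by rewrite ltr_pwDr.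
by apply: le_trans (hC s) _; rewrite lerDl.
Qed.

(** A smooth step, zero at the origin and one on $[1,\infty)$, with values in $[0,1]$ on
    $[0,\infty)$; for negative arguments it is bounded but negative. *)
Definition theta s := 1 - phi (1 - s) / phi 1.

(** A smooth cut-off, one up to 1 and zero from 2 on: the inner quotient is at least 1 for $s\le1$
    and vanishes for $s\ge2$, and [theta] flattens its upper part to the constant one. *)
Definition kappa s := theta (phi (2 - s) / phi 1).

Lemma theta_der s : is_derive s (1 : R) theta (dphi (1 - s) / phi 1).
Proof.
have h : is_derive s (1 : R) (fun s : R => -1 * s + 1) (-1).
  by apply: is_derive_eq; rewrite /GRing.scale/=; ring.
have h1 := is_derive_comp1 (phi_der _) h.
have -> : theta = (fun r => 1 - phi (-1 * r + 1) * (phi 1)^-1).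
  by apply/funext => r; rewrite /theta mulN1r (addrC (- r)).
have e : -1 * s + 1 = 1 - s by ring.
by apply: is_derive_eq; rewrite /GRing.scale/= e; ring.
Qed.

Lemma theta_bounded s : `|theta s| <= 1 + (phi 1)^-1.
Proof.
rewrite /theta; apply: le_trans (ler_normB _ _) _; rewrite normr1 lerD2l.
have p1 : 0 < phi 1 by exact: phi_gt0.
rewrite normrM (gtr0_norm (_ : 0 < (phi 1)^-1)) ?invr_gt0//.
by rewrite ler_piMl// ?phi_bound// invr_ge0 ltW.
Qed.

Lemma theta_dbounded : exists2 C : R, 0 < C & forall s, `|dphi (1 - s) / phi 1| <= C.
Proof.
have [C C0 hC] := dphi_bounded; have p1 : 0 < phi 1 by exact: phi_gt0.
exists (C / phi 1) => [|s]; first by rewrite divr_gt0.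
rewrite normrM (gtr0_norm (_ : 0 < (phi 1)^-1)) ?invr_gt0//.
by rewrite ler_pM2r ?invr_gt0.
Qed.

Lemma theta_ge1 s : 1 <= s -> theta s = 1.
Proof. by move=> s1; rewrite /theta phi_le0 ?mul0r ?subr0// subr_le0. Qed.

Lemma theta0 : theta 0 = 0.
Proof. by rewrite /theta subr0 divff ?subrr// gt_eqF// phi_gt0. Qed.

Lemma phi_mono s t : s <= t -> phi s <= phi t.
Proof.
rewrite le_eqVlt => /predU1P[->//|st].
have [c _ E] := @MVT _ phi dphi _ _ st (fun x _ => phi_der x) (continuous_subspaceT phi_cont).
by rewrite -subr_ge0 E mulr_ge0 ?dphi_ge0// subr_ge0 ltW.
Qed.

Lemma theta_01 s : 0 <= s -> 0 <= theta s <= 1.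
Proof.
move=> s0; have p1 := phi_gt0 ltr01; rewrite /theta subr_ge0 ler_pdivrMr// mul1r.
apply/andP; split; first by apply: phi_mono; lra.
by have := divr_ge0 (phi_ge0 (1 - s)) (ltW p1); lra.
Qed.

Lemma kappa_le1 s : s <= 1 -> kappa s = 1.
Proof.
move=> s1; apply: theta_ge1; rewrite ler_pdivlMr ?mul1r ?phi_gt0//.
by apply: phi_mono; lra.
Qed.

Lemma kappa_ge2 s : 2 <= s -> kappa s = 0.
Proof. by move=> s2; rewrite /kappa phi_le0 ?mul0r ?theta0//; lra. Qed.

Lemma kappa_01 s : 0 <= kappa s <= 1.
Proof. by apply: theta_01; rewrite divr_ge0 ?phi_ge0. Qed.

Lemma D1_comp n p q : D1 n p -> D1 n q -> D1 n (fun s => p (q s)).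
Proof. by move=> Dp Dq; exact: Cn_comp. Qed.

Lemma theta_D1 n : D1 n theta.
Proof.
rewrite (_ : theta = (fun s => 1 + (- (phi 1)^-1) * phi (-1 * s + 1))); last first.
  by apply/funext => s; rewrite /theta (_ : 1 - s = -1 * s + 1); ring.
apply: Cn_add; first exact: Cn_cst.
apply: Cn_mul; first exact: Cn_cst.
by apply: D1_comp; [exact: phi_D1|exact: D1_affine].
Qed.

Lemma kappa_D1 n : D1 n kappa.
Proof.
rewrite (_ : kappa = (fun s => theta ((phi 1)^-1 * phi (-1 * s + 2)))); last first.
  apply/funext => s; rewrite /kappa mulrC (_ : 2 - s = -1 * s + 2)//; ring.
apply: D1_comp; first exact: theta_D1.
apply: Cn_mul; first exact: Cn_cst.
by apply: D1_comp; [exact: phi_D1|exact: D1_affine].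
Qed.

(** The identity on $[-M,M]$, zero where $|s|\ge2M$, and never larger than $|s|$ in modulus. The
    summands [+ 0] give the arguments the affine form of [D1_affine]. *)
Definition trunc (M : R) s := s * (kappa (M^-1 * s + 0) * kappa (- M^-1 * s + 0)).

Lemma trunc_D1 n M : D1 n (trunc M).
Proof.
apply: Cn_mul; first exact: D1_id.
by apply: Cn_mul; apply: D1_comp; [exact: kappa_D1|exact: D1_affine|exact: kappa_D1|exact: D1_affine].
Qed.

Lemma trunc_id M s : 0 < M -> `|s| <= M -> trunc M s = s.
Proof.
move=> M0; rewrite ler_norml => /andP[h1 h2]; rewrite /trunc !kappa_le1 ?mulr1//.
  by rewrite addr0 mulNr -mulrN ler_pdivrMl// mulr1; lra.
by rewrite addr0 ler_pdivrMl// mulr1.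
Qed.

Lemma trunc_out M s : 0 < M -> 2 * M <= `|s| -> trunc M s = 0.
Proof.
move=> M0; rewrite /trunc; case: (ger0P s) => s0 h.
- by rewrite [kappa (M^-1 * _ + _)]kappa_ge2 ?mul0r ?mulr0// addr0 ler_pdivlMl//; lra.
- rewrite [kappa (- M^-1 * _ + _)]kappa_ge2 ?mulr0// addr0 mulNr -mulrN ler_pdivlMl//; lra.
Qed.

Lemma trunc_at0 M : trunc M 0 = 0. Proof. by rewrite /trunc mul0r. Qed.

Lemma trunc_le M s : `|trunc M s| <= `|s|.
Proof.
have /andP[a0 a1] := kappa_01 (M^-1 * s + 0).
have /andP[b0 b1] := kappa_01 (- M^-1 * s + 0).
have ab0 := mulr_ge0 a0 b0; have ab1 := mulr_ile1 a0 b0 a1 b1.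
by rewrite /trunc normrM; apply: ler_piMr; rewrite ?normr_ge0 ?(ger0_norm ab0).
Qed.

Lemma trunc_bounded M s : 0 < M -> `|trunc M s| <= 2 * M.
Proof.
move=> M0; have [h|h] := leP (2 * M) `|s|.
  by rewrite trunc_out// normr0 mulr_ge0// ltW.
by apply: le_trans (trunc_le M s) (ltW h).
Qed.

Lemma D1_der n (p : R -> R) s : D1 n.+1 p -> is_derive s 1 p ('D_1 p s).
Proof. by move=> Dp; exact: (CnS_der tt s Dp). Qed.

Lemma D1_cont n (p : R -> R) : D1 n p -> continuous p.
Proof. exact: Cn_cont. Qed.

Lemma D1_deriv n (p : R -> R) : D1 n.+1 p -> D1 n (fun s : R => 'D_1 p s).
Proof. by move=> Dp; exact: (CnS_D tt Dp). Qed.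

Lemma trunc_dbounded M : 0 < M -> exists2 C : R, 0 < C & forall s, `|'D_1 (trunc M) s| <= C.
Proof.
move=> M0.
have cd : continuous (fun s : R => 'D_1 (trunc M) s).
  have h (n : nat) : D1 n (fun s : R => 'D_1 (trunc M) s) by exact: (D1_deriv (trunc_D1 n.+1 M)).
  exact: D1_cont (h 0%N).
(* Beyond $3M$ the function vanishes in a whole neighbourhood, hence the margin over $2M$. *)
have [c _ hc] := @EVT_max R (fun s => `|'D_1 (trunc M) s|) (- (3 * M)) (3 * M) ltac:(lra)
  ltac:(apply: continuous_subspaceT => s; apply: cvg_norm; exact: cd).
exists (`|'D_1 (trunc M) c| + 1) => [|s]; first by rewrite ltr_pwDr.
have [sM|sM] := leP `|s| (3 * M).
  have /hc : s \in `[(- (3 * M)), (3 * M)] by rewrite in_itv/=; rewrite ler_norml in sM.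
  by move/le_trans; apply; rewrite lerDl.
have E : is_derive s 1 (trunc M) 0.
  apply: (@near_eq_is_derive _ _ _ (cst 0) (trunc M)).
  have : \forall t \near s, 2 * M < `|t|.
    have : (fun t : R => `|t|) @ s --> `|s| by apply: cvg_norm; exact: cvg_id.
    by move/cvgr_gt; apply; lra.
  by apply: filterS => t h; rewrite /= trunc_out// ltW.
by have [_ ->] := E; rewrite normr0 addr_ge0.
Qed.

End flat_functions.

Local Opaque kappa theta phi flat trunc Phi dphi.

(** * Smooth functions and cut-offs on $\mathbb R^d$ *)

Section smooth_rV.
Import finmap.
Variables (R : realType) (d : nat).
Local Notation X := 'rV[R]_d.
Local Notation ei := (fun i : 'I_d => delta_mx 0 i : X).
Local Notation CN := (@Cn R X 'I_d ei).
Implicit Types (f g : X -> R) (c : X) (r : R).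

Lemma smoothP f : smooth f <-> forall n, CN n f.
Proof.
split=> [sf n|Cf].
  elim: n f sf => [|n ih] f sf; first by have [] := sf [::].
  split; first by have [] := sf [::].
  move=> i; split; first by have [_] := sf [::]; apply.
  by apply: ih => s; have := sf (rcons s i); rewrite foldr_rcons.
move=> s; elim/last_ind: s f Cf => [|s i ih] f Cf.
  by split; [exact: Cn_cont (Cf 0%N)|have [_ h] := Cf 1%N; move=> i; have [] := h i].
by rewrite foldr_rcons; apply: ih => n; exact: (CnS_D i (Cf n.+1)).
Qed.

Lemma smooth_cont f : smooth f -> continuous f.
Proof. by move=> sf; have [] := sf [::]. Qed.

Lemma smooth_derivable f i x : smooth f -> derivable f x (delta_mx 0 i).
Proof. by move=> sf; have [_] := sf [::]; apply. Qed.

Lemma smooth_der f i x : smooth f -> is_derive x (delta_mx 0 i) f (partial i f x).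
Proof. by move=> sf; apply: derivableP; exact: smooth_derivable. Qed.

Lemma smooth_partial f i : smooth f -> smooth (partial i f).
Proof.
by move=> /smoothP sf; apply/smoothP => n; exact: (CnS_D i (sf n.+1)).
Qed.

Lemma smooth_cst (c : R) : smooth (fun _ : X => c).
Proof. by apply/smoothP => n; exact: Cn_cst. Qed.

Lemma smooth_add f g : smooth f -> smooth g -> smooth (fun x => f x + g x).
Proof. by move=> /smoothP sf /smoothP sg; apply/smoothP => n; exact: Cn_add. Qed.

Lemma smooth_mul f g : smooth f -> smooth g -> smooth (fun x => f x * g x).
Proof. by move=> /smoothP sf /smoothP sg; apply/smoothP => n; exact: Cn_mul. Qed.

Lemma smooth_comp p f : (forall n, D1 n p) -> smooth f -> smooth (fun x => p (f x)).
Proof. by move=> Dp /smoothP sf; apply/smoothP => n; exact: Cn_comp. Qed.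

Lemma smooth_lin (c : R) f g : smooth f -> smooth g -> smooth (fun x => c * f x + g x).
Proof.
by move=> sf sg; exact: (smooth_add (smooth_mul (smooth_cst c) sf) sg).
Qed.

Lemma partial_lin (c : R) f g i x : smooth f -> smooth g ->
  partial i (fun y => c * f y + g y) x = c * partial i f x + partial i g x.
Proof.
move=> sf sg; have := is_deriveD (is_deriveM (is_derive_cst c x (delta_mx 0 i)) (smooth_der i x sf)) (smooth_der i x sg).
move=> [_]; rewrite /partial => ->.
by rewrite scaler0 addr0.
Qed.

Lemma partial_mul f g i x : smooth f -> smooth g ->
  partial i (fun y => f y * g y) x = f x * partial i g x + g x * partial i f x.
Proof.
by move=> sf sg; have [_] := is_deriveM (smooth_der i x sf) (smooth_der i x sg).
Qed.

Lemma partial_comp (p dp : R -> R) f i x : (forall s : R, is_derive s 1 p (dp s)) ->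
  smooth f -> partial i (fun y => p (f y)) x = dp (f x) * partial i f x.
Proof.
by move=> dpp sf; have [_] := is_derive_comp1 (dpp (f x)) (smooth_der i x sf).
Qed.

Lemma partial_cst (c : R) i x : partial i (fun _ : X => c) x = 0.
Proof. exact: derive_cst. Qed.

Lemma coord_smooth (j : 'I_d) : smooth (fun x : X => x 0 j).
Proof.
apply/smoothP; case=> [|n]; first by move=> x; exact: coord_continuous.
have dd i x : is_derive x (ei i) (fun x : X => x 0 j) ((i == j)%:R : R).
  have E : (fun h : R => h^-1 *: (((fun x : X => x 0 j) \o shift x) (h *: ei i) - x 0 j)) @ 0^' --> ((i == j)%:R : R).
    have c0 : (fun=> (i == j)%:R : R) h @[h --> (0 : R)^'] --> ((i == j)%:R : R) by exact: cvg_cst.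
    apply: cvg_trans c0.
    apply: near_eq_cvg; near=> h; rewrite /= !mxE /= addrK [j == i]eq_sym.
    rewrite -[_ *: _]/(_ * _) mulrA mulVf ?mul1r//.
    by near: h; exact: nbhs_dnbhs_neq.
  by apply: DeriveDef; [apply/cvg_ex; eexists; exact: E|exact: cvg_lim E].
apply: (@CnS _ _ _ _ n _ (fun i _ => (i == j)%:R) _ dd).
  by move=> x; exact: coord_continuous.
by move=> i; exact: Cn_cst.
Unshelve. all: by end_near. Qed.

Lemma smooth_prod (I : Type) (s : seq I) (F : I -> X -> R) :
  (forall i, smooth (F i)) -> smooth (fun x => \prod_(i <- s) F i x).
Proof.
move=> sF; elim: s => [|i s ih].
  by rewrite (_ : (fun x => _) = (fun=> 1)); [exact: smooth_cst|apply/funext => x; rewrite big_nil].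
rewrite (_ : (fun x => _) = (fun x => F i x * \prod_(i <- s) F i x)).
  exact: smooth_mul.
by apply/funext => x; rewrite big_cons.
Qed.

Lemma partial_near0 f i x : {near x, f =1 cst 0} -> partial i f x = 0.
Proof.
by move=> f0; rewrite /partial (near_eq_derive _ f0) derive_cst.
Qed.

Lemma partial_supp f i x : ~ closure [set y | f y != 0] x -> partial i f x = 0.
Proof.
move=> nx; apply: partial_near0.
have oc : open (~` closure [set y | f y != 0]) by apply: closed_openC; exact: closed_closure.
have : nbhs x (~` closure [set y | f y != 0]) by apply: open_nbhs_nbhs.
apply: filterS => y ny /=; apply/eqP/negPn/negP => fy; apply: ny.
exact: subset_closure.
Qed.

(** Balls of the row space are cubes, so a product over the coordinates is adapted to them: it is
    one on the ball of radius $r/2$ and vanishes off the ball of radius $r$. *)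
Definition bump (c : X) (r : R) (x : X) : R :=
  \prod_(i <- index_enum 'I_d) (kappa ((2 / r) * (x 0 i - c 0 i)) * kappa (- (2 / r) * (x 0 i - c 0 i))).

Lemma bump_smooth c r : smooth (bump c r).
Proof.
apply: smooth_prod => i.
have sm (a : R) : smooth (fun x : X => kappa (a * (x 0 i - c 0 i))).
  have := @smooth_comp (fun s => kappa (a * s + - (a * c 0 i))) _ _ (coord_smooth i).
  rewrite (_ : (fun x : X => kappa (a * x 0 i + _)) = (fun x : X => kappa (a * (x 0 i - c 0 i)))); last first.
    by apply/funext => x; congr kappa; ring.
  by apply => n; apply: D1_comp; [exact: kappa_D1|exact: D1_affine].
exact: smooth_mul.
Qed.

Lemma mul01 (a b : R) : 0 <= a <= 1 -> 0 <= b <= 1 -> 0 <= a * b <= 1.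
Proof. by move=> /andP[a0 a1] /andP[b0 b1]; rewrite mulr_ge0//= mulr_ile1. Qed.

Lemma bump_01 c r x : 0 <= bump c r x <= 1.
Proof.
rewrite /bump; elim/big_ind: _ => [|a b|i _]; [by rewrite ler01 lexx|exact: mul01|].
exact: (mul01 (kappa_01 _) (kappa_01 _)).
Qed.

Lemma ball_coord (c : X) (r : R) x : 0 < r -> ball c r x <-> forall i, `|c 0 i - x 0 i| < r.
Proof.
move=> r0; split=> [[_ h] i|h]; first exact: (h 0 i).
by split=> // i j; rewrite !ord1; exact: h.
Qed.

Lemma bump_eq1 c r x : 0 < r -> ball c (r / 2) x -> bump c r x = 1.
Proof.
move=> r0 /ball_coord h; have {}h i : `|c 0 i - x 0 i| < r / 2 by apply: h; rewrite divr_gt0.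
rewrite /bump big1// => i _; have := h i; rewrite ltr_norml => /andP[h1 h2].
have rr : 0 < 2 / r by rewrite divr_gt0.
rewrite !kappa_le1 ?mulr1//.
- rewrite mulNr -mulrN opprB -ler_pdivlMl// mulr1 invf_div; lra.
- rewrite -ler_pdivlMl// mulr1 invf_div; lra.
Qed.

Lemma bump_supp c r x : 0 < r -> bump c r x != 0 -> ball c r x.
Proof.
move=> r0 bx; apply/ball_coord => // i; rewrite ltNge; apply/negP => h.
have rr : 0 < 2 / r by rewrite divr_gt0.
move/negP: bx; apply; apply/eqP.
have K0 : kappa (2 / r * (x 0 i - c 0 i)) * kappa (- (2 / r) * (x 0 i - c 0 i)) = 0.
  have k1 (t : R) : r <= t -> kappa (2 / r * t) = 0.
    move=> rt; apply: kappa_ge2; rewrite -[leLHS](divfK (lt0r_neq0 r0)).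
    by rewrite ler_wpM2l// ltW.
  have [s0|s0] := ger0P (c 0 i - x 0 i).
    rewrite (ger0_norm s0) in h.
    by rewrite [X in _ * X](_ : _ = 0) ?mulr0// mulNr -mulrN opprB k1.
  rewrite (ltr0_norm s0) opprB in h.
  by rewrite k1 ?mul0r.
by rewrite /bump (bigD1_seq i) ?index_enum_uniq ?mem_index_enum//= K0 mul0r.
Qed.

Lemma closure_ball_sub (c : X) (r s : R) : r < s -> closure (ball c r) `<=` ball c s.
Proof.
move=> rs x cx; have s0 : 0 < (s - r) by rewrite subr_gt0.
have [y [cy xy]] := cx (ball x (s - r)) (nbhsx_ballx x _ s0).
by have := ball_triangle cy (ball_sym xy); rewrite subrKC.
Qed.

Lemma ball_bounded (c : X) (r : R) : bounded_set (ball c r).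
Proof.
exists (`|c| + `|r|); split; first exact: num_real.
move=> M hM x; rewrite -ball_normE /= => cx.
have : `|x| <= `|c| + `|c - x|.
  have {1}-> : x = c - (c - x) by rewrite subKr.
  exact: ler_normB.
move/le_trans; apply; apply/ltW; apply: le_lt_trans hM.
by rewrite lerD2l (le_trans (ltW cx))// ler_norm.
Qed.

Lemma compact_closure_ball (c : X) (r : R) : compact (closure (ball c r)).
Proof.
apply: bounded_closed_compact; last exact: closed_closure.
have [M [Mr hM]] := ball_bounded c (r + 1); exists M; split=> // x Mx y cy.
by apply: (hM x Mx); apply: (closure_ball_sub _ cy); rewrite ltrDl.
Qed.

Lemma compact_subclosed (K F : set X) : compact K -> closed F -> F `<=` K -> compact F.
Proof. by move=> cK cF FK; exact: subclosed_compact cF cK FK. Qed.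

Lemma compact_closed (K : set X) : compact K -> closed K.
Proof. by apply: compact_closed; exact: norm_hausdorff. Qed.

(* [1 - prod (1 - b_c)] for bumps [b_c] around finitely many points of [K] *)
Lemma cutoff (K U : set X) : compact K -> open U -> K `<=` U ->
  exists (chi : X -> R) (O : set X), [/\ smooth chi, (forall x, 0 <= chi x <= 1),
    open O /\ K `<=` O, (forall x, O x -> chi x = 1) &
    compact (closure [set x | chi x != 0]) /\ closure [set x | chi x != 0] `<=` U].
Proof.
move=> cK oU KU.
(* The ball of twice the radius is kept inside [U], because the support of a bump is only known to
   lie in the closed ball. *)
have /choice[r hr] : forall c : X, exists r : R, 0 < r /\ (K c -> ball c (2 * r) `<=` U).
  move=> c; have [Kc|nK] := pselect (K c); last by exists 1.
  have := oU; rewrite openE => /(_ c (KU c Kc)) /nbhs_ballP[e /= e0 eU].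
  exists (e / 2); split; first by rewrite divr_gt0.
  by move=> _; rewrite mulrC divfK.
have r0 c : 0 < r c := (hr c).1.
have cK' := cK; rewrite compact_cover in cK'.
have [c Kc|x Kx|s sK Ks] := cK' X K (fun c => (ball c (r c / 2))°).
- exact: open_interior.
- exists x => //; apply: nbhsx_ballx; by rewrite divr_gt0.
pose F (c x : X) : R := 1 - bump c (r c) x.
have F01 c x : 0 <= F c x <= 1.
  by have /andP[h1 h2] := bump_01 c (r c) x; rewrite /F subr_ge0 h2/= gerBl.
pose P x := \prod_(c <- s) F c x.
have P01 x : 0 <= P x <= 1.
  by rewrite /P; elim/big_ind: _ => [|a b|c _]; [by rewrite ler01 lexx|exact: mul01|exact: F01].
have sF c : smooth (F c).
  have := smooth_lin (-1) (bump_smooth c (r c)) (smooth_cst 1).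
  by rewrite (_ : (fun x => _) = F c)//; apply/funext => x; rewrite /F; ring.
pose chi x := 1 - P x.
have schi : smooth chi.
  have sP : smooth P by exact: smooth_prod.
  have := smooth_lin (-1) sP (smooth_cst 1).
  by rewrite (_ : (fun x => _) = chi)//; apply/funext => x; rewrite /chi; ring.
have suppchi : [set x | chi x != 0] `<=` \bigcup_(c in [set` s]) ball c (r c).
  move=> x /= cx; apply: contrapT => h; move/negP: cx; apply; apply/eqP.
  rewrite /chi /P big_seq big1 ?subrr// => c cs; rewrite /F.
  have [->|/bump_supp h'] := eqVneq (bump c (r c) x) 0; first by rewrite subr0.
  by exfalso; apply: h; exists c => //; exact: h'.
have cl : closed (\bigcup_(c in [set` s]) closure (ball c (r c))).
  apply: closed_bigcup; first exact: finite_fset.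
  by move=> c _; exact: closed_closure.
have suppc : closure [set x | chi x != 0] `<=` \bigcup_(c in [set` s]) closure (ball c (r c)).
  rewrite [X in _ `<=` X](closure_id _).1//; apply: closureS.
  apply: subset_trans suppchi _ => x [c cs cx]; exists c => //; exact: subset_closure.
exists chi, (\bigcup_(c in [set` s]) (ball c (r c / 2))°); split=> //.
- by move=> x; have /andP[h1 h2] := P01 x; rewrite /chi subr_ge0 h2/= gerBl.
- by split=> //; apply: bigcup_open => c _; exact: open_interior.
- move=> x [c /= cs /interior_subset cx]; rewrite /chi /P.
  rewrite (bigD1_seq c) ?fset_uniq//= {1}/F bump_eq1// subrr mul0r subr0//.
- split.
    apply: (@compact_subclosed (\bigcup_(c in [set` s]) closure (ball c (r c)))) => //; last exact: closed_closure.
    by rewrite bigcup_fset; apply: bigsetU_compact => c _; exact: compact_closure_ball.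
  apply: subset_trans suppc _ => x [c cs /closure_ball_sub h].
  have Kc : K c := set_mem (sK c cs).
  by apply: (hr c).2 => //; apply: h; have := r0 c; lra.
Qed.

End smooth_rV.

(** * Theorems of Riesz, Lions and Mazur for semi-inner products *)

Section submodules.
Variables (R : realType) (X : Type).
Local Notation V := (X -> R).
Implicit Types (S : set V) (u v w x y : V) (c t e : R).

Definition submodule S := S (cst 0) /\
  forall c u v, S u -> S v -> S (fun z => c * u z + v z).

Lemma submod0 S : submodule S -> S (cst 0). Proof. by case. Qed.

Lemma submod_lin S c u v : submodule S -> S u -> S v -> S (fun z => c * u z + v z).
Proof. by case=> _; apply. Qed.

Lemma submod_scale S c u : submodule S -> S u -> S (fun z => c * u z).
Proof.
move=> HS Su; rewrite (_ : (fun z => _) = (fun z => c * u z + (cst 0 : V) z)).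
  by apply: submod_lin => //; exact: submod0.
by apply/funext => z; rewrite addr0.
Qed.

Lemma submod_add S u v : submodule S -> S u -> S v -> S (u \+ v).
Proof.
move=> HS Su Sv; rewrite (_ : _ \+ _ = (fun z => 1 * u z + v z)).
  exact: submod_lin.
by apply/funext => z; rewrite mul1r.
Qed.

Lemma submod_sub S u v : submodule S -> S u -> S v -> S (u \- v).
Proof.
move=> HS Su Sv; rewrite (_ : _ \- _ = (fun z => (-1) * v z + u z)).
  exact: submod_lin.
by apply/funext => z /=; ring.
Qed.

Definition linear_on S (l : V -> R) := forall c u v, S u -> S v ->
  l (fun z => c * u z + v z) = c * l u + l v.

Lemma lin_on0 S l : submodule S -> linear_on S l -> l (cst 0) = 0.
Proof.
move=> HS Ll; have S0 := submod0 HS.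
have := Ll 1 _ _ S0 S0; rewrite mul1r.
rewrite (_ : (fun z => _) = cst 0 :> V); last by apply/funext => z /=; rewrite mulr0 addr0.
lra.
Qed.

Lemma lin_on_sub S l u v : linear_on S l -> S u -> S v -> l (u \- v) = l u - l v.
Proof.
move=> Ll Su Sv; rewrite addrC -[X in X + _]mulN1r -Ll//.
by congr l; apply/funext => z /=; ring.
Qed.

Lemma lin_on_scale S l c u : submodule S -> linear_on S l -> S u ->
  l (fun z => c * u z) = c * l u.
Proof.
move=> HS Ll Su; rewrite -[RHS]addr0 -[X in _ + X](lin_on0 HS Ll) -Ll//; last exact: submod0.
by congr l; apply/funext => z /=; rewrite addr0.
Qed.

End submodules.

Section semi_inner_product.
Variables (R : realType) (X : Type).
Local Notation V := (X -> R).
Variables (S : set V) (s : V -> V -> R).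
Implicit Types (u v w x y : V) (c t e : R).

Definition semi_ip := [/\ submodule S, forall v, S v -> linear_on S (s^~ v),
  forall u v, S u -> S v -> s u v = s v u & forall u, S u -> 0 <= s u u].

Definition sn u := Num.sqrt (s u u).

Hypothesis Hs : semi_ip.

Lemma ip_S : submodule S. Proof. by case: Hs. Qed.
Lemma ip_l v : S v -> linear_on S (s^~ v). Proof. by case: Hs => _ + _ _; apply. Qed.
Lemma ip_sym u v : S u -> S v -> s u v = s v u. Proof. by case: Hs => _ _ + _; apply. Qed.
Lemma ip_ge0 u : S u -> 0 <= s u u. Proof. by case: Hs => _ _ _; apply. Qed.

Lemma ip_r u : S u -> linear_on S (s u).
Proof.
move=> Su c v w Sv Sw; rewrite !(ip_sym Su)//; last by apply: submod_lin => //; exact: ip_S.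
exact: (ip_l Su).
Qed.

Lemma sn_sqr u : S u -> sn u ^+ 2 = s u u.
Proof. by move=> Su; rewrite sqr_sqrtr// ip_ge0. Qed.

Lemma sn_ge0 u : 0 <= sn u. Proof. exact: sqrtr_ge0. Qed.

Lemma ip_expand t u v : S u -> S v ->
  s (fun z => t * u z + v z) (fun z => t * u z + v z) =
  t ^+ 2 * s u u + 2 * t * s u v + s v v.
Proof.
move=> Su Sv; have Suv : S (fun z => t * u z + v z) by apply: submod_lin => //; exact: ip_S.
rewrite (ip_l Suv)// !ip_r// (ip_sym Sv Su); ring.
Qed.

Lemma quad_disc (a b c : R) : 0 <= a -> 0 <= c ->
  (forall t, 0 <= t ^+ 2 * a + 2 * t * b + c) -> b ^+ 2 <= a * c.
Proof.
move=> a0 c0 q; have [a00|an0] := eqVneq a 0.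
  have : b = 0.
    apply/eqP/negPn/negP => b0; have := q (- (c + 1) / (2 * b)).
    rewrite a00 mulr0 add0r (_ : 2 * _ * b = - (c + 1)); first lra.
    by field; rewrite b0.
  by move=> ->; rewrite a00 mul0r expr0n.
have apos : 0 < a by rewrite lt_neqAle eq_sym an0.
have := q (- b / a); rewrite (_ : _ + _ = (a * c - b ^+ 2) / a); last by field.
by rewrite pmulr_lge0 ?invr_gt0// subr_ge0.
Qed.

Lemma ip_CS u v : S u -> S v -> `|s u v| <= sn u * sn v.
Proof.
move=> Su Sv; rewrite -(ler_pXn2r (n := 2))// ?nnegrE ?mulr_ge0 ?sn_ge0//.
rewrite real_normK ?num_real// exprMn !sn_sqr//.
apply: quad_disc; [exact: ip_ge0|exact: ip_ge0|move=> t].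
rewrite -ip_expand//; apply: ip_ge0; apply: submod_lin => //; exact: ip_S.
Qed.

Lemma ip_seminorm : seminorm_on S sn.
Proof.
split.
- exact: submod0 ip_S.
- by move=> c u v Su Sv; apply: submod_lin => //; exact: ip_S.
- move=> u v Su Sv; rewrite -(ler_pXn2r (n := 2))// ?nnegrE ?addr_ge0 ?sn_ge0//.
  rewrite sn_sqr; last by apply: submod_add => //; exact: ip_S.
  rewrite (_ : u \+ v = (fun z => 1 * u z + v z)); last first.
    by apply/funext => z /=; rewrite mul1r.
  rewrite ip_expand// sqrrD !sn_sqr//.
  have := ip_CS Su Sv; rewrite ler_norml => /andP[_].
  rewrite -[_ *+ 2]mulr_natl; lra.
- move=> c u Su; rewrite /sn.
  have HS := ip_S.
  have Scu : S (fun z => c * u z) by exact: submod_scale.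
  rewrite (lin_on_scale _ HS (ip_l Scu) Su) (lin_on_scale _ HS (ip_r Su) Su) mulrA -expr2.
  by rewrite sqrtrM ?sqr_ge0// sqrtr_sqr.
Qed.

Definition mid u v : V := fun z => 2^-1 * u z + 2^-1 * v z.

Lemma mid_S u v : S u -> S v -> S (mid u v).
Proof.
move=> Su Sv; apply: submod_lin => //; first exact: ip_S.
by apply: submod_scale => //; exact: ip_S.
Qed.

Lemma parallelogram u v : S u -> S v ->
  sn (u \- v) ^+ 2 = 2 * s u u + 2 * s v v - 4 * s (mid u v) (mid u v).
Proof.
move=> Su Sv; have HS := ip_S; rewrite sn_sqr; last exact: submod_sub.
rewrite (_ : u \- v = (fun z => (-1) * v z + u z)); last by apply/funext => z /=; ring.
rewrite ip_expand// /mid.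
have Sv2 : S (fun z => 2^-1 * v z) by exact: submod_scale.
rewrite ip_expand// (lin_on_scale _ HS (ip_r Su) Sv) (lin_on_scale _ HS (ip_l Sv2) Sv).
by rewrite (lin_on_scale _ HS (ip_r Sv) Sv) (ip_sym Sv Su); field.
Qed.

Lemma inv_small e : 0 < e -> exists n0 : nat, forall n, (n0 <= n)%N -> n.+1%:R^-1 < e.
Proof.
move=> e0; have := near_infty_natSinv_lt (PosNum e0) => -[n0 _ h].
by exists n0 => n /h.
Qed.

(* Minimizing sequences of the quadratic functional [s y y - 2 l y] are Cauchy. *)
Lemma riesz (M : set V) (l : V -> R) C : Ncomplete S sn -> submodule M -> M `<=` S ->
  linear_on M l -> (forall y, M y -> `|l y| <= C * sn y) ->
  exists2 x, S x & forall y, M y -> s x y = l y.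
Proof.
move=> compl HM MS Ll lC.
pose Q y := s y y - 2 * l y.
have Qlb y : M y -> - C ^+ 2 <= Q y.
  move=> My; have := lC y My; rewrite ler_norml => /andP[_].
  have := sn_sqr (MS _ My); rewrite /Q => <- h.
  have : 0 <= (sn y - C) ^+ 2 by exact: sqr_ge0.
  rewrite sqrrB; move: h; rewrite -[_ *+ 2]mulr_natl; lra.
pose A := [set Q y | y in M].
have A0 : A !=set0 by exists (Q (cst 0)), (cst 0) => //; exact: submod0.
have Alb : has_lbound A by exists (- C ^+ 2) => _ [y My <-]; exact: Qlb.
have hA : has_inf A by [].
pose q := inf A.
have qQ y : M y -> q <= Q y by move=> My; apply: ge_inf => //; exists y.
have /choice[y_ hy] : forall n : nat, exists y, M y /\ Q y < q + n.+1%:R^-1.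
  move=> n; have n0 : 0 < n.+1%:R^-1 :> R by rewrite invr_gt0.
  by have [_ [y My <-] h] := inf_adherent n0 hA; exists y.
have My n : M (y_ n) := (hy n).1.
have Sy n : S (y_ n) := MS _ (My n).
have Mmid u v : M u -> M v -> M (mid u v).
  by move=> Mu Mv; apply: submod_lin => //; exact: submod_scale.
have lmid u v : M u -> M v -> l (mid u v) = 2^-1 * l u + 2^-1 * l v.
  move=> Mu Mv; rewrite /mid Ll//; last exact: submod_scale.
  by rewrite (lin_on_scale _ HM Ll Mv).
have dist n m : sn (y_ n \- y_ m) ^+ 2 <= 2 * n.+1%:R^-1 + 2 * m.+1%:R^-1.
  rewrite parallelogram//.
  have := qQ _ (Mmid _ _ (My n) (My m)); have := (hy n).2; have := (hy m).2.
  rewrite /Q lmid//; move: (n.+1%:R^-1) (m.+1%:R^-1) => a b; lra.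
have cy : Ncauchy sn y_.
  move=> e e0; have e4 : 0 < e ^+ 2 / 4 by rewrite divr_gt0// exprn_gt0.
  have [n0 hn] := inv_small e4; exists n0 => m n /hn hm /hn hn'.
  rewrite -(ltr_pXn2r (n := 2))// ?nnegrE ?sn_ge0 ?ltW//.
  by apply: le_lt_trans (dist m n) _; move: (m.+1%:R^-1) (n.+1%:R^-1) hm hn' => a b ? ?; lra.
have [x Sx yx] := compl _ Sy cy; exists x => // y Yy.
have SY := MS _ Yy.
(* The limit [x] lies in [S] but perhaps not in [M], so it is not itself a minimizer. The
   variational inequality is obtained along [y_ n], and a nonnegative quadratic with zero constant
   term has zero linear term. *)
have key t : 0 <= t ^+ 2 * s y y + 2 * t * (s x y - l y) + 0.
  apply: le_eps => e e0.
  have HN := ip_seminorm.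
  have e1 : 0 < e / 2 by lra.
  pose k := 2 * `|t| * sn y + 1.
  have k0 : 0 < k by rewrite ltr_pwDr// !mulr_ge0 ?sn_ge0.
  have ek : 0 < e / 2 / k by rewrite divr_gt0.
  have [n1 h1] := inv_small e1; have [n2 h2] := yx _ ek.
  pose n := maxn n1 n2; have {}h1 := h1 n (leq_maxl _ _); have {}h2 := h2 n (leq_maxr _ _).
  have Mty : M (fun z => t * y z + y_ n z) by exact: submod_lin.
  have := qQ _ Mty; rewrite /Q ip_expand// Ll//.
  have := (hy n).2; rewrite /Q.
  have : `|2 * t * (s (y_ n) y - s x y)| <= e / 2.
    rewrite -(lin_on_sub (ip_l SY) (Sy n) Sx) !normrM (ger0_norm (ler0n R 2)).
    have Sd : S (y_ n \- x) by apply: submod_sub => //; exact: ip_S.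
    have cs := ip_CS Sd SY.
    apply: (@le_trans _ _ (2 * `|t| * (sn (y_ n \- x) * sn y))).
      by rewrite ler_wpM2l// mulr_ge0.
    apply: (@le_trans _ _ (k * sn (y_ n \- x))).
      have := sn_ge0 (y_ n \- x); rewrite /k.
      by move: (sn (y_ n \- x)) (sn y) `|t| => a b c a0; lra.
    by rewrite mulrC -ler_pdivlMr// ltW.
  rewrite (ip_sym SY (Sy n)) ler_norml => /andP[h3 h4]; rewrite addr0.
  move: h1 h4; move: (n.+1%:R^-1) (s (y_ n) (y_ n)) => a b; rewrite !mulrBr; lra.
have := quad_disc (ip_ge0 SY) (lexx 0) key; rewrite mulr0 => h.
by apply/eqP; rewrite -subr_eq0 -sqrf_eq0 eq_le h sqr_ge0.
Qed.

(* Lions' projection theorem: coercivity is only required on [P]. *)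
Lemma lions (P : set V) (b : V -> V -> R) (l : V -> R) (C c : R) : Ncomplete S sn ->
  submodule P -> P `<=` S ->
  (forall v, P v -> linear_on S (b^~ v)) ->
  (forall v, P v -> exists Cv, forall u, S u -> `|b u v| <= Cv * sn u) ->
  (forall u, S u -> linear_on P (b u)) ->
  0 < c -> (forall v, P v -> c * s v v <= b v v) ->
  linear_on P l -> (forall v, P v -> `|l v| <= C * sn v) ->
  exists2 u, S u & forall v, P v -> b u v = l v.
Proof.
move=> compl HP PS bl bC br c0 bcoer Ll lC.
have C0 v : P v -> 0 <= `|C| * sn v by move=> _; rewrite mulr_ge0 ?sn_ge0.
have HS := ip_S.
(* [x] is the Riesz representative of $b(\cdot,v)$. Coercivity bounds $c\|v\|$ by $\|x\|$, so that
   $x\mapsto l(v)$ is well defined and bounded on the space [M] of representatives; its own Riesz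
   representative solves the equation. *)
pose rep x v := P v /\ forall u, S u -> s x u = b u v.
have rep_ex v : P v -> exists2 x, S x & rep x v.
  move=> Pv; have [Cv hCv] := bC v Pv.
  have [x Sx hx] := riesz compl HS (@subset_refl _ S) (bl v Pv) hCv.
  by exists x.
have rep_lin k x v x' v' : S x -> S x' -> rep x v -> rep x' v' ->
    rep (fun z => k * x z + x' z) (fun z => k * v z + v' z).
  move=> Sx Sx' [Pv hv] [Pv' hv']; split; first exact: submod_lin.
  by move=> u Su; rewrite (ip_l Su)// hv// hv'// br.
have rep_bound x v : S x -> rep x v -> c * sn v <= sn x.
  move=> Sx [Pv hv]; have Sv := PS _ Pv.
  have := bcoer v Pv; rewrite -hv// -sn_sqr// => h1.
  have := ip_CS Sx Sv; rewrite ler_norml => /andP[_ h2].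
  have [v0|v0] := eqVneq (sn v) 0; first by rewrite v0 mulr0 sn_ge0.
  have vp : 0 < sn v by rewrite lt_neqAle eq_sym v0 sn_ge0.
  rewrite -(ler_pM2r vp); apply: le_trans h2; by rewrite -mulrA -expr2.
pose M := [set x | S x /\ exists v, rep x v].
pose pre x := xget (cst 0) [set v | rep x v].
have preP x : M x -> rep x (pre x).
  by move=> [Sx [v xv]]; rewrite /pre; case: xgetP => [y -> //|/(_ v)].
have luniq x v v' : S x -> rep x v -> rep x v' -> l v = l v'.
  move=> Sx h1 h2; have h := rep_lin (-1) _ _ _ _ Sx Sx h1 h2.
  have [Pd _] := h.
  have S0 : S (fun z => -1 * x z + x z) by exact: submod_lin.
  have := rep_bound _ _ S0 h.
  rewrite (_ : (fun z => -1 * x z + x z) = cst 0); last by apply/funext => z /=; ring.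
  rewrite (N0 ip_seminorm) pmulr_rle0// => n0.
  have n00 : sn (fun z => -1 * v z + v' z) = 0 by apply/eqP; rewrite eq_le n0 sn_ge0.
  have := lC _ Pd; rewrite n00 mulr0 normr_le0 Ll; [|exact: h1.1|exact: h2.1].
  by move/eqP; lra.
have HM : submodule M.
  split; first by split; [exact: submod0|exists (cst 0); split;
    [exact: submod0|move=> u Su; rewrite (lin_on0 HS (ip_l Su)) (lin_on0 HP (br u Su))]].
  move=> k x x' [Sx [v hv]] [Sx' [v' hv']]; split; first exact: submod_lin.
  by exists (fun z => k * v z + v' z); exact: rep_lin.
have Lpre : linear_on M (fun x => l (pre x)).
  move=> k x x' Mx Mx'; have h1 := preP _ Mx; have h2 := preP _ Mx'.
  have h3 := rep_lin k _ _ _ _ Mx.1 Mx'.1 h1 h2.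
  have M3 : M (fun z => k * x z + x' z) by exact: submod_lin.
  rewrite (luniq _ _ _ M3.1 (preP _ M3) h3) Ll//; [exact: h1.1|exact: h2.1].
have Bpre x : M x -> `|l (pre x)| <= (`|C| / c) * sn x.
  move=> Mx; have h := preP _ Mx; apply: le_trans (lC _ h.1) _.
  apply: (@le_trans _ _ (`|C| * sn (pre x))).
    by rewrite ler_wpM2r ?sn_ge0// ler_norm.
  rewrite -mulrA ler_wpM2l// ler_pdivlMl//; exact: rep_bound Mx.1 h.
have [|u Su hu] := riesz compl HM _ Lpre Bpre; first by move=> x [].
exists u => // v Pv; have [x Sx xv] := rep_ex v Pv.
have Mx : M x by split=> //; exists v.
have := hu x Mx; rewrite (luniq _ _ _ Sx (preP _ Mx) xv) => <-.
by rewrite ip_sym// xv.2.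
Qed.

Definition mid_convex (K : set V) := forall u v, K u -> K v -> K (mid u v).

(** Midpoints are all that the parallelogram law requires. Defining the hull as an intersection lets
    convex properties of the tail pass to its elements without any coefficients. *)
Definition hull (y : nat -> V) k x := forall K : set V, mid_convex K ->
  (forall n, (k <= n)%N -> K (y n)) -> K x.

(* Mazur: norm-minimal points of the tails' convex hulls form a Cauchy sequence. *)
Lemma mazur (y : nat -> V) B : (forall n, S (y n)) -> (forall n, s (y n) (y n) <= B) ->
  exists w : nat -> V, [/\ forall k, S (w k), forall k, hull y k (w k) & Ncauchy sn w].
Proof.
move=> Sy yB.
have hS k x : hull y k x -> S x.
  by apply; [move=> u v; exact: mid_S|move=> n _].
have hy k n : (k <= n)%N -> hull y k (y n) by move=> kn K _; apply.
have hmid k u v : hull y k u -> hull y k v -> hull y k (mid u v).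
  by move=> hu hv K cK yK; exact: (cK _ _ (hu K cK yK) (hv K cK yK)).
have hle k m x : (k <= m)%N -> hull y m x -> hull y k x.
  by move=> km hx K cK yK; apply: hx => // n mn; apply: yK; exact: leq_trans mn.
pose A k := [set s x x | x in hull y k].
have A0 k : A k !=set0 by exists (s (y k) (y k)), (y k) => //; exact: hy.
have Alb k : lbound (A k) 0 by move=> _ [x hx <-]; apply: ip_ge0; exact: hS hx.
have hA k : has_inf (A k) by split; [exact: A0|exists 0; exact: Alb].
pose q k := inf (A k).
have qB k : q k <= B.
  by apply: le_trans (yB k); apply: ge_inf; [exact: (hA k).2|exists (y k) => //; exact: hy].
have qmono k m : (k <= m)%N -> q k <= q m.
  move=> km; apply: lb_le_inf; first exact: A0.
  by move=> _ [x hx <-]; apply: ge_inf; [exact: (hA k).2|exists x => //; exact: hle hx].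
have /choice[w hw] : forall k : nat, exists x, hull y k x /\ s x x < q k + k.+1%:R^-1.
  move=> k; have n0 : 0 < k.+1%:R^-1 :> R by rewrite invr_gt0.
  by have [_ [x hx <-] h] := inf_adherent n0 (hA k); exists x.
have Sw k : S (w k) := hS _ _ (hw k).1.
exists w; split=> // [k|]; first exact: (hw k).1.
have cq : cvgn q.
  apply: nondecreasing_is_cvgn; first by move=> k m; exact: qmono.
  by exists B => _ [k _ <-].
have qlim k : q k <= limn q by apply: nondecreasing_cvgn_le => //; move=> ? ?; exact: qmono.
have bound k m : (k <= m)%N -> sn (w k \- w m) ^+ 2 <=
    2 * (limn q - q k) + 2 * k.+1%:R^-1 + 2 * m.+1%:R^-1.
  move=> km; rewrite parallelogram//.
  have : q k <= s (mid (w k) (w m)) (mid (w k) (w m)).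
    apply: ge_inf; first exact: (hA k).2.
    exists (mid (w k) (w m)) => //; apply: hmid; first exact: (hw k).1.
    by apply: hle (hw m).1.
  have := (hw k).2; have := (hw m).2; have := qlim m.
  move: (k.+1%:R^-1) (m.+1%:R^-1) => a b; lra.
move=> e e0; have e8 : 0 < e ^+ 2 / 8 by rewrite divr_gt0// exprn_gt0.
have [n1 h1] := inv_small e8.
have [n2 h2] : exists n2, forall k, (n2 <= k)%N -> limn q - q k < e ^+ 2 / 8.
  have /cvgrPdist_lt/(_ _ e8)[n2 _ h] := cq; exists n2 => k /h /=.
  by rewrite ger0_norm// subr_ge0.
have main k m : (maxn n1 n2 <= k)%N -> (k <= m)%N -> sn (w k \- w m) < e.
  rewrite geq_max => /andP[/[dup] k1 /h1 {}h1k /h2 {}h2] km.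
  have {}h1m := h1 m (leq_trans k1 km).
  rewrite -(ltr_pXn2r (n := 2))// ?nnegrE ?sn_ge0 ?(ltW e0)//.
  apply: le_lt_trans (bound k m km) _.
  move: (k.+1%:R^-1) (m.+1%:R^-1) h1k h1m => a b ? ?; lra.
exists (maxn n1 n2) => m n hm hn; have [mn|/ltnW nm] := leqP m n; first exact: main.
by rewrite (NdC ip_seminorm)//; exact: main.
Qed.

End semi_inner_product.

(** * Limits of real sequences *)

Section real_sequences.
Variable R : realType.

Lemma cauchy_cvgn (s : nat -> R) : (forall e, 0 < e -> exists n0, forall m n,
  (n0 <= m)%N -> (n0 <= n)%N -> `|s m - s n| < e) -> cvgn s.
Proof.
move=> cs; apply/cauchy_cvgP/cauchy_exP => e e0; have [n0 hn] := cs e e0.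
by exists (s n0); exists n0 => // n /= n0n; rewrite /ball/=; exact: hn.
Qed.

Lemma cvgr0_le (s r : nat -> R) : (forall n, `|s n| <= r n) ->
  r @ \oo --> (0 : R) -> s @ \oo --> (0 : R).
Proof.
move=> sr /cvgr_epsP r0; apply/cvgr_epsP => e e0; have [n0 hn] := r0 e e0.
exists n0 => n /hn; rewrite !subr0; apply: le_lt_trans.
exact: le_trans (sr n) (ler_norm _).
Qed.

Lemma cvgn_uniq (s : nat -> R) (l l' : R) : s @ \oo --> l -> s @ \oo --> l' -> l = l'.
Proof. by move=> h1 h2; apply: (cvg_unique _ h1 h2); exact: norm_hausdorff. Qed.

Lemma cvgr_add (s r : nat -> R) (l l' : R) : s @ \oo --> l -> r @ \oo --> l' ->
  (fun n => s n + r n) @ \oo --> l + l'.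
Proof. exact: cvgD. Qed.

Lemma cvgr_mul (s r : nat -> R) (l l' : R) : s @ \oo --> l -> r @ \oo --> l' ->
  (fun n => s n * r n) @ \oo --> l * l'.
Proof. exact: cvgM. Qed.

Lemma cvgr_mulc (c : R) (s : nat -> R) (l : R) : s @ \oo --> l ->
  (fun n => c * s n) @ \oo --> c * l.
Proof. by apply: cvgr_mul; exact: cvg_cst. Qed.

Lemma cvgr_ub (s : nat -> R) (l M : R) : s @ \oo --> l ->
  (exists n0, forall n, (n0 <= n)%N -> s n <= M) -> l <= M.
Proof.
move=> sl [n0 h]; rewrite -(cvg_lim (@norm_hausdorff _ R) sl).
apply: limr_le; first by apply/cvg_ex; exists l.
by exists n0 => // n /=; exact: h.
Qed.

Lemma cvgr_ler (s r : nat -> R) (l l' : R) : s @ \oo --> l -> r @ \oo --> l' ->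
  (forall n, s n <= r n) -> l <= l'.
Proof. by move=> sl rl h; apply: ler_cvg_to sl rl _; exact: nearW. Qed.

Lemma cvgr_ext (s r : nat -> R) (l : R) : s =1 r -> s @ \oo --> l -> r @ \oo --> l.
Proof. by move=> /funext->. Qed.

Lemma cvgr_sqrt0 (s : nat -> R) : s @ \oo --> (0 : R) ->
  (fun n => Num.sqrt (s n)) @ \oo --> (0 : R).
Proof.
by move=> s0; rewrite -[X in _ --> X]sqrtr0; apply: continuous_cvg => //; exact: sqrt_continuous.
Qed.

End real_sequences.

(** * Closures of forms *)

Section form_closure.
Variables (R : realType) (d : nat).
Local Notation X := 'rV[R]_d.
Variable mu : {measure set X -> \bar R}.
Local Notation L1 f := (f \in Lfun mu 1).
Local Notation L2 f := (f \in Lfun mu 2%:E).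
Local Notation n1 := (n1 mu).
Local Notation n2 := (n2 mu).
Implicit Types (f g h : X -> R) (u v w : nat -> X -> R) (e : R).

Lemma Lcvg1P u f : (forall n, L1 (u n)) -> L1 f -> (Lcvg mu 1 u f <-> Ncvg n1 u f).
Proof.
move=> Lu Lf; rewrite /Lcvg.
have E n : ('N[mu]_1[EFin \o (u n \- f)%R])%E = (n1 (u n \- f))%:E.
  by apply: n1_Lnorm; exact: L1_sub.
rewrite (ereal_cvg0P E); rewrite cvgr_epsP; split=> h e /h [n0 hn]; exists n0 => n /hn.
  by rewrite subr0; exact: le_lt_trans (ler_norm _).
by rewrite subr0 ger0_norm// (N_ge0 (n1_seminorm mu))//; exact: L1_sub.
Qed.

Lemma Lcvg2P u f : (forall n, L2 (u n)) -> L2 f -> (Lcvg mu 2%:E u f <-> Ncvg n2 u f).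
Proof.
move=> Lu Lf; rewrite /Lcvg.
have E n : ('N[mu]_2%:E[EFin \o (u n \- f)%R])%E = (n2 (u n \- f))%:E.
  by apply: n2_Lnorm; exact: L2_sub.
rewrite (ereal_cvg0P E); rewrite cvgr_epsP; split=> h e /h [n0 hn]; exists n0 => n /hn.
  by rewrite subr0; exact: le_lt_trans (ler_norm _).
by rewrite subr0 ger0_norm// n2_ge0.
Qed.

Variables (a : (X -> R) -> (X -> R) -> R) (D : set (X -> R)).

Definition good_form := [/\ submodule D, (forall f, D f -> L2 f),
  (forall g, D g -> linear_on D (a^~ g)) /\ (forall f, D f -> linear_on D (a f)) &
  forall f, D f -> 0 <= a f f].

Hypothesis HF : good_form.
Hypothesis sect : strong_sector a D.
Hypothesis clos : closable mu a D.

Local Notation DD := (closure_dom mu a D).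
Local Notation E := (closure_form mu a D).
Local Notation appr := (approximates mu a D).

(** The symmetric part has the same diagonal as [a] and is a semi-inner product, so that Hilbert
    space arguments apply to the non-symmetric form. *)
Definition sa f g := 2^-1 * (a f g + a g f).

Lemma D_sub : submodule D. Proof. by case: HF. Qed.
Lemma D_L2 f : D f -> L2 f. Proof. by case: HF => _ + _ _; apply. Qed.
Lemma a_l g : D g -> linear_on D (a^~ g). Proof. by case: HF => _ _ [+ _] _; apply. Qed.
Lemma a_r f : D f -> linear_on D (a f). Proof. by case: HF => _ _ [_ +] _; apply. Qed.
Lemma a_ge0 f : D f -> 0 <= a f f. Proof. by case: HF => _ _ _; apply. Qed.

Lemma saE f : sa f f = a f f. Proof. by rewrite /sa; field. Qed.

Lemma sa_ip : semi_ip D sa.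
Proof.
split.
- exact: D_sub.
- move=> g Dg c f f' Df Df'; rewrite /sa (a_l Dg)// (a_r Dg)//; ring.
- by move=> f g _ _; rewrite /sa; congr (_ * _); rewrite addrC.
- by move=> f Df; rewrite saE; exact: a_ge0.
Qed.

Local Notation q := (sn sa).

Lemma q_sqr f : D f -> q f ^+ 2 = a f f.
Proof. by move=> Df; rewrite (sn_sqr sa_ip)// saE. Qed.

Lemma qE f : q f = Num.sqrt (a f f). Proof. by rewrite /sn saE. Qed.

Lemma sectP : exists2 K, 0 < K & forall f g, D f -> D g -> `|a f g| <= K * (q f * q g).
Proof.
by have [K K0 h] := sect; exists K => // f g Df Dg; rewrite !qE mulrA; exact: h.
Qed.

Lemma apprP u f : L2 f -> appr u f <-> [/\ forall n, D (u n), Ncauchy q u & Ncvg n2 u f].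
Proof.
move=> Lf; split=> [[Du cu lu]|[Du cu lu]].
  have Lu n : L2 (u n) := D_L2 (Du n).
  split=> //; last exact/(Lcvg2P Lu Lf).
  move=> e e0; have [n0 h] := cu (e ^+ 2) (exprn_gt0 2 e0); exists n0 => m n hm hn.
  have Dmn : D (u m \- u n) := submod_sub D_sub (Du m) (Du n).
  rewrite -(ltr_pXn2r (n := 2))// ?nnegrE ?sn_ge0 ?(ltW e0)// q_sqr//.
  exact: h.
have Lu n : L2 (u n) := D_L2 (Du n).
split=> //; last exact/(Lcvg2P Lu Lf).
move=> e e0; have se : 0 < Num.sqrt e by rewrite sqrtr_gt0.
have [n0 h] := cu _ se; exists n0 => m n hm hn.
have Dmn : D (u m \- u n) := submod_sub D_sub (Du m) (Du n).
rewrite -q_sqr// -[ltRHS](sqr_sqrtr (ltW e0)).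
by rewrite (ltr_pXn2r (n := 2)) ?nnegrE ?sn_ge0 ?sqrtr_ge0//; exact: h.
Qed.

Lemma appr_D u f : appr u f -> forall n, D (u n). Proof. by case. Qed.

Lemma appr_cst f : D f -> appr (fun=> f) f.
Proof.
move=> Df; apply/(apprP _ (D_L2 Df)); split=> //.
  by move=> e e0; exists 0%N => m n _ _; rewrite (Ndxx (ip_seminorm sa_ip)).
exact: (Ncvg_cst (n2_seminorm mu)).
Qed.

Lemma Ncauchy_lin (S : set (X -> R)) (N : (X -> R) -> R) c u v : seminorm_on S N ->
  (forall n, S (u n)) -> (forall n, S (v n)) -> Ncauchy N u -> Ncauchy N v ->
  Ncauchy N (fun n x => c * u n x + v n x).
Proof.
move=> HN Su Sv cu cv e e0; have e2 : 0 < e / 2 by lra.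
have c1 : 0 < `|c| + 1 by rewrite ltr_pwDr.
have ec : 0 < e / 2 / (`|c| + 1) by rewrite divr_gt0.
have [n1' h1] := cu _ ec; have [n2' h2] := cv _ e2.
exists (maxn n1' n2') => m n; rewrite !geq_max => /andP[m1 m2] /andP[n1'' n2''].
rewrite (_ : _ \- _ = (fun x => c * (u m \- u n) x) \+ (v m \- v n)); last first.
  by apply/funext => x /=; ring.
have Sd := sn_sub HN (Su m) (Su n); have Sd' := sn_sub HN (Sv m) (Sv n).
apply: le_lt_trans (N_add HN (sn_scale HN c Sd) Sd') _.
rewrite (N_scale HN)//.
have : `|c| * N (u m \- u n) <= e / 2.
  apply: (@le_trans _ _ ((`|c| + 1) * N (u m \- u n))).
    by rewrite ler_wpM2r// ?lerDl// (N_ge0 HN).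
  by rewrite mulrC -ler_pdivlMr// ltW// h1.
have := h2 m n m2 n2''; lra.
Qed.

Lemma appr_lin c u v f g : L2 f -> L2 g -> appr u f -> appr v g ->
  appr (fun n x => c * u n x + v n x) (fun x => c * f x + g x).
Proof.
move=> Lf Lg /(apprP _ Lf)[Du cu lu] /(apprP _ Lg)[Dv cv lv].
apply/(apprP _ (L2_lin c Lf Lg)); split.
- by move=> n; apply: submod_lin => //; exact: D_sub.
- exact: (Ncauchy_lin c (ip_seminorm sa_ip)).
- apply: (Ncvg_lin (n2_seminorm mu)) => // n; exact: D_L2.
Qed.

Lemma cauchy_bounded (S : set (X -> R)) (N : (X -> R) -> R) u : seminorm_on S N ->
  (forall n, S (u n)) -> Ncauchy N u -> exists2 B, 0 < B & forall n, N (u n) <= B.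
Proof.
move=> HN Su cu; have [n0 h] := cu 1 ltr01.
pose B0 := \sum_(i < n0.+1) N (u i).
have B00 n : (n <= n0)%N -> N (u n) <= B0.
  move=> nn0; rewrite /B0 (bigD1 (Ordinal (nn0 : (n < n0.+1)%N)))//= lerDl.
  by apply: sumr_ge0 => i _; exact: N_ge0 HN _ (Su i).
have B0p : 0 <= B0 by apply: sumr_ge0 => i _; exact: N_ge0 HN _ (Su i).
exists (B0 + 1) => [|n]; first by rewrite ltr_pwDr.
have [nn0|/ltnW nn0] := leqP n n0; first by apply: le_trans (B00 _ nn0) _; rewrite lerDl.
apply: le_trans (N_leD HN (Su n) (Su n0)) _; apply: lerD; first exact: B00.
by apply: ltW; apply: h.
Qed.

Lemma appr_bounded u f : L2 f -> appr u f -> exists2 B, 0 < B & forall n, q (u n) <= B.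
Proof.
move=> Lf /(apprP _ Lf)[Du cu _]; exact: cauchy_bounded (ip_seminorm sa_ip) Du cu.
Qed.

Lemma a_cvg u v f g : L2 f -> L2 g -> appr u f -> appr v g ->
  cvgn (fun n => a (u n) (v n)).
Proof.
move=> Lf Lg uf vg; have [K K0 hK] := sectP.
have [B B0 hB] := appr_bounded Lf uf; have [B' B'0 hB'] := appr_bounded Lg vg.
have [Du cu _] := (apprP _ Lf).1 uf; have [Dv cv _] := (apprP _ Lg).1 vg.
apply: cauchy_cvgn => e e0.
have eB : 0 < e / 2 / (K * B') by rewrite !divr_gt0// mulr_gt0.
have eB' : 0 < e / 2 / (K * B) by rewrite !divr_gt0// mulr_gt0.
have [n0 h0] := cu _ eB; have [n1' h1] := cv _ eB'.
exists (maxn n0 n1') => m n; rewrite !geq_max => /andP[m1 m2] /andP[k1 k2].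
have Du' : D (u m \- u n) := submod_sub D_sub (Du m) (Du n).
have Dv' : D (v m \- v n) := submod_sub D_sub (Dv m) (Dv n).
have -> : a (u m) (v m) - a (u n) (v n) = a (u m \- u n) (v m) + a (u n) (v m \- v n).
  rewrite (lin_on_sub (a_l (Dv m)) (Du m) (Du n)) (lin_on_sub (a_r (Du n)) (Dv m) (Dv n)); ring.
apply: le_lt_trans (ler_normD _ _) _.
have t1 : `|a (u m \- u n) (v m)| < e / 2.
  apply: le_lt_trans (hK _ _ Du' (Dv m)) _.
  apply: (@le_lt_trans _ _ (K * B' * q (u m \- u n))).
    rewrite -mulrA ler_pM2l// mulrC ler_wpM2r ?sn_ge0//.
  by rewrite mulrC -ltr_pdivlMr ?mulr_gt0//; exact: h0.
have t2 : `|a (u n) (v m \- v n)| < e / 2.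
  apply: le_lt_trans (hK _ _ (Du n) Dv') _.
  apply: (@le_lt_trans _ _ (K * B * q (v m \- v n))).
    rewrite -mulrA ler_pM2l// ler_wpM2r ?sn_ge0//.
  by rewrite mulrC -ltr_pdivlMr ?mulr_gt0//; exact: h1.
by rewrite [ltRHS]splitr; exact: ltrD.
Qed.

Lemma a_null w v g : appr w (cst 0) -> L2 g -> appr v g ->
  (fun n => a (w n) (v n)) @ \oo --> (0 : R) /\
  (fun n => a (v n) (w n)) @ \oo --> (0 : R).
Proof.
move=> w0 Lg vg; have [K K0 hK] := sectP; have [B B0 hB] := appr_bounded Lg vg.
have L0 : L2 (cst 0) := L2_0 mu.
have [Dw cw _] := (apprP _ L0).1 w0; have [Dv cv _] := (apprP _ Lg).1 vg.
have q0 : (fun n => K * B * q (w n)) @ \oo --> (0 : R).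
  rewrite -(mulr0 (K * B)); apply: cvgM; first exact: cvg_cst.
  under eq_fun do rewrite qE; exact/cvgr_sqrt0/clos.
split; apply: cvgr0_le q0 => n.
- apply: le_trans (hK _ _ (Dw n) (Dv n)) _.
  by rewrite -mulrA ler_pM2l// mulrC ler_wpM2r ?sn_ge0.
- apply: le_trans (hK _ _ (Dv n) (Dw n)) _.
  by rewrite -mulrA ler_pM2l// ler_wpM2r ?sn_ge0.
Qed.

Lemma appr_ae u f g : f = g %[ae mu] -> L2 f -> L2 g -> appr u f -> appr u g.
Proof.
move=> fg Lf Lg /(apprP _ Lf)[Du cu lu]; apply/(apprP _ Lg); split=> // e e0.
have [n0 h] := lu e e0; exists n0 => n /h.
have Lu := D_L2 (Du n).
apply: le_lt_trans; apply: le_trans (Nd_tri (n2_seminorm mu) Lu Lf Lg) _.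
by rewrite (eq_n2 Lf Lg fg) addr0.
Qed.

Lemma appr_sub u v f : L2 f -> appr u f -> appr v f ->
  appr (fun n => u n \- v n) (cst 0).
Proof.
move=> Lf uf vf; have := appr_lin (-1) Lf Lf vf uf.
rewrite (_ : (fun x => -1 * f x + f x) = cst 0); last by apply/funext => x /=; ring.
by congr (appr _ _); apply/funext => n; apply/funext => x /=; ring.
Qed.

(** [closure_form] is a choice among limits. Two approximating sequences of the same function differ
    by one of zero, so [a_null] makes all limits agree. *)
Lemma E_lim u v f g : L2 f -> L2 g -> appr u f -> appr v g ->
  (fun n => a (u n) (v n)) @ \oo --> E f g.
Proof.
move=> Lf Lg uf vg.
have key u' v' (r : R) : appr u' f -> appr v' g -> (fun n => a (u' n) (v' n)) @ \oo --> r ->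
    (fun n => a (u n) (v n)) @ \oo --> r.
  move=> uf' vg' cr.
  have w0 := appr_sub Lf uf uf'; have w1 := appr_sub Lg vg vg'.
  have [c1 _] := a_null w0 Lg vg; have [_ c2] := a_null w1 Lf uf'.
  have := cvgr_add (cvgr_add c1 c2) cr; rewrite !add0r.
  apply: cvgr_ext => n.
  have Du := appr_D uf n; have Du' := appr_D uf' n.
  have Dv := appr_D vg n; have Dv' := appr_D vg' n.
  rewrite (lin_on_sub (a_l Dv) Du Du') (lin_on_sub (a_r Du') Dv Dv'); ring.
rewrite /closure_form; case: xgetP => [r _ [u' [v' [uf' vg' cr]]]|/(_ _)/= no].
  exact: key cr.
have cr := a_cvg Lf Lg uf vg.
by exfalso; apply: (no (limn (fun n => a (u n) (v n)))); exists u, v; split.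
Qed.

Lemma DD_L2 f : DD f -> L2 f. Proof. by case. Qed.

Lemma DD_sub : submodule DD.
Proof.
split.
  split; first exact: L2_0.
  by exists (fun=> cst 0); apply: appr_cst; exact: submod0 D_sub.
move=> c f g [Lf [u uf]] [Lg [v vg]]; split; first exact: L2_lin.
by exists (fun n x => c * u n x + v n x); exact: appr_lin.
Qed.

Lemma D_DD f : D f -> DD f.
Proof. by move=> Df; split; [exact: D_L2|exists (fun=> f); exact: appr_cst]. Qed.

Lemma E_D f g : D f -> D g -> E f g = a f g.
Proof.
move=> Df Dg; have := E_lim (D_L2 Df) (D_L2 Dg) (appr_cst Df) (appr_cst Dg).
by move/cvgn_uniq; apply; exact: cvg_cst.
Qed.

Lemma E_l g : DD g -> linear_on DD (E^~ g).
Proof.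
move=> [Lg [w wg]] c f f' [Lf [u uf]] [Lf' [v vf']].
have := E_lim (L2_lin c Lf Lf') Lg (appr_lin c Lf Lf' uf vf') wg.
move/cvgn_uniq; apply.
have c1 := E_lim Lf Lg uf wg; have c2 := E_lim Lf' Lg vf' wg.
have := cvgr_add (cvgr_mulc (c := c) c1) c2.
apply: cvgr_ext => n /=.
by rewrite (a_l (appr_D wg n) c (appr_D uf n) (appr_D vf' n)).
Qed.

Lemma E_r f : DD f -> linear_on DD (E f).
Proof.
move=> [Lf [w wf]] c g g' [Lg [u ug]] [Lg' [v vg']].
have := E_lim Lf (L2_lin c Lg Lg') wf (appr_lin c Lg Lg' ug vg').
move/cvgn_uniq; apply.
have c1 := E_lim Lf Lg wf ug; have c2 := E_lim Lf Lg' wf vg'.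
have := cvgr_add (cvgr_mulc (c := c) c1) c2.
apply: cvgr_ext => n /=.
by rewrite (a_r (appr_D wf n) c (appr_D ug n) (appr_D vg' n)).
Qed.

Lemma E_ge0 f : DD f -> 0 <= E f f.
Proof.
move=> [Lf [u uf]]; have h := E_lim Lf Lf uf uf.
rewrite -(cvg_lim _ h)//; apply: limr_ge; first by apply/cvg_ex; exists (E f f).
by apply: nearW => n; apply: a_ge0; exact: appr_D uf n.
Qed.

Lemma E_sector : exists2 K, 0 < K & forall f g, DD f -> DD g ->
  `|E f g| <= K * (Num.sqrt (E f f) * Num.sqrt (E g g)).
Proof.
have [K K0 hK] := sectP; exists K => // f g [Lf [u uf]] [Lg [v vg]].
have h1 : (fun n => `|a (u n) (v n)|) @ \oo --> `|E f g|.
  by apply: cvg_norm; exact: E_lim.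
have sq (w : nat -> X -> R) h : L2 h -> appr w h -> (fun n => q (w n)) @ \oo --> Num.sqrt (E h h).
  move=> Lh wh; under eq_fun do rewrite qE.
  by apply: continuous_cvg; [exact: sqrt_continuous|exact: E_lim].
have h2 := cvgr_mulc (c := K) (cvgr_mul (sq _ _ Lf uf) (sq _ _ Lg vg)).
apply: cvgr_ler h1 h2 _ => n /=.
by apply: hK; [exact: appr_D uf n|exact: appr_D vg n].
Qed.

(** The symmetric part of $\mathcal E^0_1$; its norm is the energy norm. *)
Definition s1 f g := 2^-1 * (E f g + E g f) + Rintegral mu setT (fun x => f x * g x).

Lemma I_l g : L2 g -> linear_on [set f | L2 f] (fun f => Rintegral mu setT (fun x => f x * g x)).
Proof.
move=> Lg c f f' Lf Lf'.
have L1f := L2_mul Lf Lg; have L1f' := L2_mul Lf' Lg.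
rewrite -(I_lin c L1f L1f'); congr Rintegral; apply/funext => x; ring.
Qed.

Lemma s1E f : s1 f f = E f f + n2 f ^+ 2.
Proof.
rewrite /s1 n2_sqr; congr (_ + _); first by field.
Qed.

Lemma s1_ip : semi_ip DD s1.
Proof.
split.
- exact: DD_sub.
- move=> g Dg c f f' Df Df'; rewrite /s1 (E_l Dg)// (E_r Dg)//.
  rewrite (I_l (DD_L2 Dg) c (DD_L2 Df) (DD_L2 Df')); ring.
- move=> f g _ _; rewrite /s1; congr (_ * _ + _); first by rewrite addrC.
  by congr Rintegral; apply/funext => x; rewrite mulrC.
- by move=> f Df; rewrite s1E addr_ge0 ?E_ge0 ?sqr_ge0.
Qed.

Local Notation nE := (sn s1).

Lemma nE_sqr f : DD f -> nE f ^+ 2 = E f f + n2 f ^+ 2.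
Proof. by move=> Df; rewrite (sn_sqr s1_ip)// s1E. Qed.

Lemma n2_le_nE f : DD f -> n2 f <= nE f.
Proof.
move=> Df; rewrite -(ler_pXn2r (n := 2))// ?nnegrE ?sn_ge0 ?n2_ge0//.
by rewrite nE_sqr// lerDr E_ge0.
Qed.

Lemma sqrtE_le_nE f : DD f -> Num.sqrt (E f f) <= nE f.
Proof.
move=> Df; rewrite -(ler_pXn2r (n := 2))// ?nnegrE ?sn_ge0 ?sqrtr_ge0//.
by rewrite nE_sqr// sqr_sqrtr ?E_ge0// lerDl sqr_ge0.
Qed.

Lemma E_le_nE : exists2 K, 0 < K & forall f g, DD f -> DD g -> `|E f g| <= K * (nE f * nE g).
Proof.
have [K K0 hK] := E_sector; exists K => // f g Df Dg; apply: le_trans (hK f g Df Dg) _.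
by rewrite ler_pM2l// ler_pM ?sqrtr_ge0// sqrtE_le_nE.
Qed.

(** $\mathcal E(u_n-f,u_n-f)$ is the limit in $m$ of $a(u_n-u_m,u_n-u_m)$, to which the Cauchy bound
    applies. *)
Lemma appr_nE u f : L2 f -> appr u f -> Ncvg nE u f.
Proof.
move=> Lf uf e e0; have e2 : 0 < e ^+ 2 / 4 by rewrite divr_gt0// exprn_gt0.
have [Du _ lu] := (apprP _ Lf).1 uf; have Df : DD f by split=> //; exists u.
have [_ cu _] := uf; have [n1' h1] := cu _ e2.
have e3 : 0 < e / 2 by lra.
have [n2' h2] := lu _ e3; exists (maxn n1' n2') => n; rewrite geq_max => /andP[hn1 hn2].
have Duf : DD (u n \- f) by apply: submod_sub; [exact: DD_sub|exact: D_DD|].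
rewrite -(ltr_pXn2r (n := 2))// ?nnegrE ?sn_ge0 ?(ltW e0)// nE_sqr//.
have : n2 (u n \- f) ^+ 2 < (e / 2) ^+ 2.
  by rewrite ltr_pXn2r ?nnegrE ?n2_ge0 ?(ltW e3)//; exact: h2.
suff : E (u n \- f) (u n \- f) <= e ^+ 2 / 4.
  by rewrite expr_div_n (_ : 2 ^+ 2 = 4 :> R); [lra|rewrite expr2; lra].
have Lu n' : L2 (u n') := D_L2 (Du n').
have un : appr (fun m => u n \- u m) (u n \- f).
  have := appr_lin (-1) Lf (Lu n) uf (appr_cst (Du n)).
  rewrite (_ : (fun x => -1 * f x + u n x) = u n \- f); last by apply/funext => x /=; ring.
  by congr (appr _ _); apply/funext => m; apply/funext => x /=; ring.
have L' := L2_sub (Lu n) Lf.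
have c := E_lim L' L' un un.
by apply: cvgr_ub c _; exists n1' => m hm; apply/ltW; exact: h1.
Qed.

Lemma D_dense f e : DD f -> 0 < e -> exists2 g, D g & nE (g \- f) < e.
Proof.
move=> [Lf [u uf]] e0; have [n0 h] := appr_nE Lf uf e0.
by exists (u n0); [exact: appr_D uf n0|exact: h].
Qed.

Lemma nE_appr u f : (forall n, D (u n)) -> L2 f -> Ncauchy nE u -> Ncvg n2 u f -> appr u f.
Proof.
move=> Du Lf cu lu; apply/(apprP _ Lf); split=> // e e0.
have [n0 h] := cu e e0; exists n0 => m n hm hn.
have Dmn : D (u m \- u n) := submod_sub D_sub (Du m) (Du n).
apply: le_lt_trans (h m n hm hn); rewrite qE -E_D//.
by apply: sqrtE_le_nE; exact: D_DD.
Qed.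

Lemma DD_complete : Ncomplete DD nE.
Proof.
move=> f_ Df cf.
have HN := ip_seminorm s1_ip.
have c2 : Ncauchy n2 f_.
  move=> e e0; have [n0 h] := cf e e0; exists n0 => m n hm hn.
  apply: le_lt_trans (h m n hm hn); apply: n2_le_nE.
  by apply: submod_sub => //; exact: DD_sub.
have [f Lf lf] := L2_complete (fun n => DD_L2 (Df n)) c2.
have /choice[g hg] : forall n : nat, exists g, D g /\ nE (g \- f_ n) < n.+1%:R^-1.
  move=> n; have n0 : 0 < n.+1%:R^-1 :> R by rewrite invr_gt0.
  by have [g Dg h] := D_dense (Df n) n0; exists g.
have Dg n : D (g n) := (hg n).1.
have DDg n : DD (g n) := D_DD (Dg n).
have small e : 0 < e -> exists n0, forall n, (n0 <= n)%N -> nE (g n \- f_ n) < e.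
  move=> /inv_small[n0 h]; exists n0 => n /h; exact: lt_trans (hg n).2.
have cg : Ncauchy nE g.
  move=> e e0; have e3 : 0 < e / 3 by lra.
  have [n0 h0] := cf _ e3; have [n1' h1] := small _ e3.
  exists (maxn n0 n1') => m n; rewrite !geq_max => /andP[m1 /h1 m2] /andP[k1 /h1 k2].
  have := h0 m n m1 k1.
  have := Nd_tri HN (DDg m) (Df m) (DDg n); have := Nd_tri HN (Df m) (Df n) (DDg n).
  rewrite (NdC HN (Df n)); last exact: DDg.
  move: m2 k2; lra.
have lg : Ncvg n2 g f.
  move=> e e0; have e2 : 0 < e / 2 by lra.
  have [n0 h0] := lf _ e2; have [n1' h1] := small _ e2.
  exists (maxn n0 n1') => n; rewrite geq_max => /andP[/h0 m1 /h1 m2].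
  have := Nd_tri (n2_seminorm mu) (DD_L2 (DDg n)) (DD_L2 (Df n)) Lf.
  have : n2 (g n \- f_ n) <= nE (g n \- f_ n).
    by apply: n2_le_nE; apply: submod_sub => //; exact: DD_sub.
  lra.
have gf := nE_appr Dg Lf cg lg.
have DDf : DD f by split=> //; exists g.
exists f => // e e0; have e2 : 0 < e / 2 by lra.
have [n0 h0] := appr_nE Lf gf e2; have [n1' h1] := small _ e2.
exists (maxn n0 n1') => n; rewrite geq_max => /andP[/h0 m1 /h1 m2].
have := Nd_tri HN (Df n) (DDg n) DDf; rewrite (NdC HN (Df n) (DDg n)); lra.
Qed.

Lemma E_ae f f' g : DD f -> f = f' %[ae mu] -> L2 f' -> DD g ->
  [/\ DD f', E f g = E f' g & E g f = E g f'].
Proof.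
move=> [Lf [u uf]] ff' Lf' [Lg [v vg]]; have uf' := appr_ae ff' Lf Lf' uf.
split.
- by split=> //; exists u.
- exact: (cvgn_uniq (E_lim Lf Lg uf vg) (E_lim Lf' Lg uf' vg)).
- exact: (cvgn_uniq (E_lim Lg Lf vg uf) (E_lim Lg Lf' vg uf')).
Qed.

End form_closure.

Section closure_mono.
Variables (R : realType) (d : nat).
Local Notation X := 'rV[R]_d.
Variables (mu : {measure set X -> \bar R}) (a : (X -> R) -> (X -> R) -> R).
Variables D D' : set (X -> R).
Hypotheses (HF : good_form mu a D) (D'D : D' `<=` D) (D'sub : submodule D').

Lemma appr_mono u f : approximates mu a D' u f -> approximates mu a D u f.
Proof. by move=> [Du cu lu]; split=> // n; exact: D'D. Qed.

Lemma closure_dom_mono f : closure_dom mu a D' f -> closure_dom mu a D f.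
Proof. by move=> [Lf [u uf]]; split=> //; exists u; exact: appr_mono. Qed.

Lemma good_form_mono : good_form mu a D'.
Proof.
case: HF => HD DL [al ar] a0; split=> //.
- by move=> u /D'D/DL.
- split=> [v /D'D Dv|u /D'D Du] c f g /D'D Df /D'D Dg; [exact: al|exact: ar].
- by move=> u /D'D/a0.
Qed.

End closure_mono.

(** * The form and the drift on an exhaustion of E *)

Section lower_order_perturbation.
Variables (R : realType) (d : nat).
Local Notation X := 'rV[R]_d.
Variables (E : set X) (mu : {measure set X -> \bar R}) (A : X -> 'M[R]_d) (B : X -> X).
Hypotheses (HE : open E \/ closed E) (muE0 : mu (~` interior E) = 0%E)
  (muK : forall K, compact K -> K `<=` E -> (mu K < +oo)%E)
  (hA_loc : forall i j, Lloc E mu 1 (fun x => A x i j)) (hA_ell : locally_elliptic E A)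
  (h_closable : closable mu (pre_form E mu A) (Ccoo E))
  (h_sector : strong_sector (pre_form E mu A) (Ccoo E))
  (hB_loc : forall i, Lloc E mu 2%:E (fun x => B x 0 i))
  (hB_div : forall f, Ccoo E f -> \int[mu]_(x in E) dotv (B x) (grad f x) = 0)
  (h_dense : dense_in_L1 mu (D_L0_0b E mu A)).
Local Notation L1 f := (f \in Lfun mu 1).
Local Notation L2 f := (f \in Lfun mu 2%:E).
Local Notation n1 := (n1 mu).
Local Notation n2 := (n2 mu).
Local Notation n1s := (n1_seminorm mu).
Local Notation mfun f := (measurable_fun [set: X] f).
Local Notation Int f := (Rintegral mu setT f).
Local Notation pf := (pre_form E mu A).
Local Notation DD := (D_E0 E mu A).
Local Notation EE := (E0 E mu A).
Local Notation CE := (Ccoo E).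
Local Notation appr := (approximates mu (pre_form E mu A) (Ccoo E)).
Local Notation nE := (sn (s1 mu (pre_form E mu A) (Ccoo E))).
Local Notation qn := (sn (sa (pre_form E mu A))).
Implicit Types (f g h u v w : X -> R) (i j : 'I_d).

(** * Measurability and the exhaustion of $E$ *)

Lemma open_meas (U : set X) : open U -> measurable U.
Proof. exact: sub_sigma_algebra. Qed.

Lemma closed_meas (F : set X) : closed F -> measurable F.
Proof. by rewrite -openC => /open_meas; rewrite -[X in _ -> measurable X]setCK; exact: measurableC. Qed.

Lemma compact_meas (K : set X) : compact K -> measurable K.
Proof. by move/compact_closed/closed_meas. Qed.

Lemma cont_meas f : continuous f -> mfun f.
Proof.
move=> cf; apply: (measurability _ (RGenOpens.measurableE R)).
move=> _ [D [a [b ->]] <-]; rewrite setTI; apply: sub_sigma_algebra.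
by apply: open_comp; [move=> x _; exact: cf|exact: interval_open].
Qed.

Lemma mE : measurable E.
Proof. by case: HE => [/open_meas|/closed_meas]. Qed.

Lemma ae_intE : \forall x \ae mu, interior E x.
Proof.
exists (~` interior E); split => //; try exact: muE0.
by apply: measurableC; apply: open_meas; exact: open_interior.
Qed.

Lemma ae_E : \forall x \ae mu, E x.
Proof. by apply: filterS ae_intE => x; exact: interior_subset. Qed.

(** The open set in which supports must stay: for closed [E] supports in the ambient space are
    unrestricted, so the whole space takes this role and both cases run in parallel. *)
Definition W : set X := if `[< open E >] then E else setT.

Lemma W_open : open W.
Proof. by rewrite /W; case: asboolP => // _; exact: openT. Qed.

Lemma E_W : E `<=` W.
Proof. by rewrite /W; case: asboolP => _ x. Qed.

(** Points at distance more than $1/(n+1)$ from the complement of [W]. The strict inequality on [r]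
    makes the set open and keeps its closure inside [W]. *)
Definition Un (n : nat) : set X := ball 0 (n.+1%:R : R) `&`
  [set x | exists2 r, n.+1%:R^-1 < r & ball x r `<=` W].

Definition Vn n := Un n `&` E.

Lemma Un_open n : open (Un n).
Proof.
rewrite openE => x [x1 [r nr rW]]; rewrite /interior.
pose e := (r - n.+1%:R^-1) / 2.
have e0 : 0 < e by rewrite divr_gt0// subr_gt0.
have o1 : nbhs x (ball 0 (n.+1%:R : R)).
  have n0 : 0 < n.+1%:R :> R by rewrite ltr0n.
  by have := ball_open (0 : X) (n.+1%:R : R); rewrite openE; apply.
have o2 : nbhs x (ball x e) by exact: nbhsx_ballx.
apply: filterS (filterI o1 o2) => y [y1 y2]; split=> //.
exists (r - e); first by rewrite /e; move: (n.+1%:R^-1) nr => a ?; lra.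
move=> z yz; apply: rW; rewrite -(subrK e r) addrC; exact: ball_triangle y2 yz.
Qed.

Lemma Un_mono n m : (n <= m)%N -> Un n `<=` Un m.
Proof.
move=> nm x [x1 [r nr rW]]; split; first by apply: le_ball x1; rewrite ler_nat ltnS.
by exists r => //; apply: le_lt_trans nr; rewrite lef_pV2 ?posrE ?ltr0Sn// ler_nat ltnS.
Qed.

Lemma Un_closure n : closure (Un n) `<=` W.
Proof.
move=> x cx; have n0 : 0 < n.+1%:R^-1 :> R by rewrite invr_gt0.
have [y [[_ [r nr rW]] xy]] := cx _ (nbhsx_ballx x (PosNum n0)%:num (gt0 _)).
by apply: rW; apply: ball_sym; apply: le_ball xy; exact: ltW.
Qed.

Lemma Vn_mono n m : (n <= m)%N -> Vn n `<=` Vn m.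
Proof. by move=> nm x [h Ex]; split=> //; exact: Un_mono h. Qed.

Lemma Vn_E n : Vn n `<=` E. Proof. by move=> x []. Qed.

Lemma Vn_closure n : closure (Vn n) `<=` E.
Proof.
have [oE|oE] := pselect (open E).
  have WE : W = E by rewrite /W; case: asboolP.
  by rewrite -[X in _ `<=` X]WE => x h; apply: (@Un_closure n); apply: closureS h => y [].
case: HE => // /closure_id EE; rewrite [X in _ `<=` X]EE; apply: closureS; exact: Vn_E.
Qed.

Lemma Vn_compact n : compact (closure (Vn n)).
Proof.
apply: (compact_subclosed (@compact_closure_ball _ _ 0 (n.+1%:R : R))).
  exact: closed_closure.
by apply: closureS => x [[]].
Qed.

Lemma Vn_subsub n : subsubset (Vn n) E.
Proof.
split; [|exact: Vn_compact|exact: Vn_closure].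
by exists (Un n) => //; exact: Un_open.
Qed.

Lemma Vn_meas n : measurable (Vn n).
Proof. by apply: measurableI; [apply: open_meas; exact: Un_open|exact: mE]. Qed.

Lemma W_Un x : W x -> exists n, Un n x.
Proof.
move=> Wx; have := W_open; rewrite openE => /(_ _ Wx) /nbhs_ballP[r r0 rW].
have [n0 hn] := inv_small r0.
have [m hm] : exists m : nat, `|x| < m%:R.
  by exists (Num.bound `|x|); exact: archi_boundP.
exists (maxn n0 m); split.
  rewrite -ball_normE /= sub0r normrN; apply: lt_le_trans hm _.
  by rewrite ler_nat leqW// leq_maxr.
by exists r => //; apply: hn; exact: leq_maxl.
Qed.

Lemma compact_Vn (K : set X) : compact K -> K `<=` E -> exists n, K `<=` Vn n.
Proof.
move=> cK KE.
suff [n hn] : exists n, K `<=` Un n by exists n => x Kx; split; [exact: hn|exact: KE].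
have /compact_near_coveringP h := cK.
have := h nat \oo Un _; case.
  move=> x Kx; have [n hn] := W_Un (E_W (KE _ Kx)).
  have := @Un_open n; rewrite openE => /(_ _ hn) nx.
  exists (Un n, [set m | (n <= m)%N]) => /=.
    by split=> //; exists n.
  by move=> [y m] /= [Uy nm]; exact: Un_mono Uy.
by move=> n _ hn; exists n; apply: (hn n) => /=.
Qed.

Lemma E_Vn x : E x -> exists n, Vn n x.
Proof. by move=> Ex; have [n hn] := W_Un (E_W Ex); exists n. Qed.

(** * Stability of the spaces of test functions *)

Lemma closure_supp_mono f g : (forall x, g x != 0 -> f x != 0) ->
  closure [set x | g x != 0] `<=` closure [set x | f x != 0].
Proof. by move=> gf; apply: closureS. Qed.

Lemma Ccoo_sub f g : Ccoo E f -> smooth g -> (forall x, g x != 0 -> f x != 0) -> Ccoo E g.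
Proof.
move=> [sf cf oE] sg gf; split=> //.
  by apply: (compact_subclosed cf); [exact: closed_closure|exact: closure_supp_mono].
by move=> /oE; apply: subset_trans; exact: closure_supp_mono.
Qed.

Lemma Ccoo_in_sub V f g : Ccoo_in E V f -> smooth g -> (forall x, g x != 0 -> f x != 0) ->
  Ccoo_in E V g.
Proof.
move=> [cf fV] sg gf; split; first exact: Ccoo_sub cf sg gf.
apply: subset_trans fV => x [Ex cx]; split=> //; apply: closureS cx => y [Ey /=].
by move=> h; split=> //; exact: gf.
Qed.

Lemma Ccoo_smooth f : Ccoo E f -> smooth f. Proof. by case. Qed.

Lemma supp0 : closure [set x : X | cst (0 : R) x != 0] = set0.
Proof. by rewrite -[RHS]closure0; congr closure; apply/seteqP; split=> x //=; rewrite eqxx. Qed.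

Lemma Ccoo0 : Ccoo E (cst 0).
Proof. split; [exact: smooth_cst|by rewrite supp0; exact: compact0|by rewrite supp0 => _ x]. Qed.

Lemma supp_lin (c : R) f g x : c * f x + g x != 0 -> f x != 0 \/ g x != 0.
Proof.
have [->|?] := eqVneq (f x) 0; last by left.
by rewrite mulr0 add0r; right.
Qed.

Lemma Ccoo_lin (c : R) f g : Ccoo E f -> Ccoo E g -> Ccoo E (fun x => c * f x + g x).
Proof.
move=> [sf cf oE] [sg cg oE'].
have sub : closure [set x | c * f x + g x != 0] `<=`
    closure [set x | f x != 0] `|` closure [set x | g x != 0].
  by rewrite -closureU; apply: closureS => x /supp_lin.
split; first exact: smooth_lin.
- apply: (compact_subclosed (compactU cf cg)) => //; exact: closed_closure.
- by move=> oo x /sub[/(oE oo)|/(oE' oo)].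
Qed.

Lemma Ccoo_in_lin V (c : R) f g : Ccoo_in E V f -> Ccoo_in E V g ->
  Ccoo_in E V (fun x => c * f x + g x).
Proof.
move=> [cf fV] [cg gV]; split; first exact: Ccoo_lin.
move=> x [Ex cx]; have : (closure (E `&` [set x | f x != 0]) `|`
    closure (E `&` [set x | g x != 0])) x.
  rewrite -closureU; apply: closureS cx => y [Ey /= /supp_lin[]] h; [left|right]; by split.
by case=> h; [apply: fV|apply: gV].
Qed.

Lemma Ccoo_submod : submodule (Ccoo E).
Proof. by split; [exact: Ccoo0|move=> c u v; exact: Ccoo_lin]. Qed.

Lemma Ccoo_in0 V : Ccoo_in E V (cst 0).
Proof.
split; first exact: Ccoo0.
move=> x [_]; rewrite (_ : E `&` _ = set0) ?closure0//.
by apply/seteqP; split=> y //= [_]; rewrite eqxx.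
Qed.

Lemma Ccoo_in_submod V : submodule (Ccoo_in E V).
Proof. by split; [exact: Ccoo_in0|move=> c u v; exact: Ccoo_in_lin]. Qed.

Lemma Ccoo_in_Ccoo V : Ccoo_in E V `<=` Ccoo E. Proof. by move=> f []. Qed.

Lemma Ccoo_in_mono V V' : V `<=` V' -> Ccoo_in E V `<=` Ccoo_in E V'.
Proof. by move=> VV' f [cf fV]; split=> //; exact: subset_trans VV'. Qed.

Lemma comp_supp (p : R -> R) f x : p 0 = 0 -> p (f x) != 0 -> f x != 0.
Proof. by move=> p0; apply: contraNneq => ->; rewrite p0. Qed.

Lemma Ccoo_comp (p : R -> R) f : (forall n, D1 n p) -> p 0 = 0 -> Ccoo E f ->
  Ccoo E (fun x => p (f x)).
Proof.
move=> dp p0 cf; apply: (Ccoo_sub cf); first by apply: smooth_comp => //; case: cf.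
by move=> x; exact: comp_supp.
Qed.

Lemma Ccoo_in_comp V (p : R -> R) f : (forall n, D1 n p) -> p 0 = 0 -> Ccoo_in E V f ->
  Ccoo_in E V (fun x => p (f x)).
Proof.
move=> dp p0 cf; apply: (Ccoo_in_sub cf).
  by apply: smooth_comp => //; case: cf => -[].
by move=> x; exact: comp_supp.
Qed.

Lemma Ccoo_mul f g : Ccoo E f -> smooth g -> Ccoo E (fun x => f x * g x).
Proof.
move=> cf sg; apply: (Ccoo_sub cf); first by apply: smooth_mul => //; case: cf.
by move=> x; rewrite mulf_eq0 negb_or => /andP[].
Qed.

Lemma Ccoo_in_mul V f g : Ccoo_in E V f -> smooth g -> Ccoo_in E V (fun x => f x * g x).
Proof.
move=> cf sg; apply: (Ccoo_in_sub cf); first by apply: smooth_mul => //; case: cf => -[].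
by move=> x; rewrite mulf_eq0 negb_or => /andP[].
Qed.

Definition suppE f := E `&` closure [set x | f x != 0].

Lemma suppE_compact f : Ccoo E f -> compact (suppE f).
Proof.
move=> [sf cf oE].
have [/oE h|nE] := pselect (open E).
  by rewrite /suppE setIC (setIidl h).
have cE : closed E by case: HE.
apply: (compact_subclosed cf) => [|x []//]; apply: closedI => //; exact: closed_closure.
Qed.

Lemma suppE_E f : suppE f `<=` E. Proof. by move=> x []. Qed.

(** The support is taken relative to [E], so vanishing on a full neighbourhood, and with it
    vanishing of the derivatives, is available at interior points of [E]; the boundary is a null
    set. *)
Lemma Ccoo_in_off V f x : Ccoo_in E V f -> interior E x -> ~ V x ->
  f x = 0 /\ forall i, partial i f x = 0.
Proof.
move=> [cf fV] iEx nVx; have Ex := interior_subset iEx.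
have nc : ~ closure (E `&` [set y | f y != 0]) x by move=> h; apply: nVx; exact: fV.
have nf : {near x, f =1 cst 0}.
  apply/not_notP => hn; apply: nc => U nU.
  apply/not_notP => /set0P/negP/negPn/eqP e0; apply: hn.
  apply: filterS (filterI nU iEx) => y [Uy iEy] /=.
  apply/eqP/negPn/negP => fy.
  have : set0 y by rewrite -e0; split=> //; split.
  by [].
split; last by move=> i; exact: partial_near0.
exact: (nbhs_singleton nf).
Qed.

Lemma Ccoo_Vn f : Ccoo E f -> exists n, Ccoo_in E (Vn n) f.
Proof.
move=> cf; have [n hn] := compact_Vn (suppE_compact cf) (@suppE_E f).
exists n; split=> // x [Ex cx]; apply: hn; split=> //.
by apply: closureS cx => y [].
Qed.

Local Notation CV n := (Ccoo_in E (Vn n)).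
Local Notation DV n := (D_E0V E mu A (Vn n)).

(** * Integrability of test functions and coefficients *)

Lemma ind_meas (S : set X) : measurable S -> mfun (\1_S : X -> R).
Proof. by move=> mS; exact: measurable_indic. Qed.

Lemma ind1 (S : set X) x : S x -> \1_S x = 1 :> R.
Proof. by move=> Sx; rewrite indicE mem_set. Qed.

Lemma ind0 (S : set X) x : ~ S x -> \1_S x = 0 :> R.
Proof. by move=> Sx; rewrite indicE memNset. Qed.

Lemma ind_01 (S : set X) x : 0 <= (\1_S x : R) <= 1.
Proof. by rewrite indicE; case: (x \in S); rewrite lexx ler01. Qed.

Lemma L1_ind (S : set X) : measurable S -> (mu S < +oo)%E -> L1 (\1_S : X -> R).
Proof.
move=> mS S1; apply/Lfun1_integrable/integrableP; split.
  by apply/measurable_EFinP; exact: ind_meas.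
rewrite (eq_integral (fun x => (\1_S x)%:E)); first by rewrite integral_indic// setIT.
by move=> x _ /=; have /andP[a _] := ind_01 S x; rewrite ger0_norm.
Qed.

Lemma Vn_fin n : (mu (Vn n) < +oo)%E.
Proof.
apply: (@le_lt_trans _ _ (mu (closure (Vn n)))).
  apply: le_measure; rewrite ?inE; [exact: Vn_meas|apply: closed_meas; exact: closed_closure|].
  exact: subset_closure.
by apply: muK; [exact: Vn_compact|exact: Vn_closure].
Qed.

Lemma bdd_L1 n f (M : R) : mfun f -> (\forall x \ae mu, `|f x| <= M) ->
  (\forall x \ae mu, ~ Vn n x -> f x = 0) -> L1 f.
Proof.
move=> mf fM f0; apply: (@L1_dom _ _ _ _ _ (fun x => `|M| * \1_(Vn n) x)) => //.
  apply: filterS2 fM f0 => x h1 h2; have [Vx|/[dup] /h2 -> nV] := pselect (Vn n x).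
    by rewrite ind1// mulr1 (le_trans h1)// ler_norm.
  by rewrite ind0// mulr0 normr0.
by apply: L1_scale; apply: L1_ind; [exact: Vn_meas|exact: Vn_fin].
Qed.

Lemma bdd_L2 n f (M : R) : mfun f -> (\forall x \ae mu, `|f x| <= M) ->
  (\forall x \ae mu, ~ Vn n x -> f x = 0) -> L2 f.
Proof. by move=> mf fM f0; apply: L12_dom (bdd_L1 mf fM f0) fM. Qed.

Lemma L2_L1 n f : L2 f -> (\forall x \ae mu, ~ Vn n x -> f x = 0) -> L1 f.
Proof.
move=> Lf f0; have mf := Lfun_measurable Lf.
apply: (@L1_eq _ _ _ _ (fun x => f x * \1_(Vn n) x)) => //.
  apply: L2_mul => //; apply: (@bdd_L2 n _ 1).
  - by apply: ind_meas; exact: Vn_meas.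
  - by apply: nearW => x; have /andP[a b] := ind_01 (Vn n) x; rewrite ger0_norm.
  - by apply: nearW => x; exact: ind0.
apply: filterS f0 => x h _; have [Vx|/[dup] /h -> nV] := pselect (Vn n x).
  by rewrite ind1// mulr1.
by rewrite mul0r.
Qed.

Lemma L1_sum (I : Type) (s : seq I) (F : I -> X -> R) : (forall a, L1 (F a)) ->
  L1 (fun x => \sum_(i <- s) F i x).
Proof.
move=> LF; elim: s => [|a s IH].
  by apply: Lfun_ext (L1_0 mu) => x; rewrite big_nil.
by apply: Lfun_ext (L1_add (LF a) IH) => x; rewrite big_cons.
Qed.

Lemma I_sum (I : Type) (s : seq I) (F : I -> X -> R) : (forall a, L1 (F a)) ->
  Int (fun x => \sum_(i <- s) F i x) = \sum_(i <- s) Int (F i).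
Proof.
move=> LF; elim: s => [|a s IH].
  rewrite big_nil; under [LHS]eq_Rintegral do rewrite big_nil.
  by rewrite Rintegral_cst// mul0r.
rewrite big_cons -IH -(I_add (LF a) (L1_sum s LF)).
by congr Rintegral; apply/funext => x; rewrite big_cons.
Qed.

Lemma cont_cpt_bdd f : continuous f -> compact (closure [set x | f x != 0]) ->
  exists2 M : R, 0 <= M & forall x, `|f x| <= M.
Proof.
move=> cf cK.
have [M [_ hM]] : bounded_set (f @` closure [set x | f x != 0]).
  apply: compact_bounded; apply: continuous_compact => //.
  exact: continuous_subspaceT.
have M1 : M < `|M| + 1 by rewrite (le_lt_trans (ler_norm _))// ltrDl.
exists (`|M| + 1) => [|x]; first by rewrite addr_ge0.
have [fx|fx] := eqVneq (f x) 0; first by rewrite fx normr0 addr_ge0.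
by apply: (hM _ M1); exists x => //; exact: subset_closure.
Qed.

Lemma Ccoo_bdd f : Ccoo E f -> exists2 M : R, 0 <= M & forall x, `|f x| <= M.
Proof. by move=> [sf cf _]; apply: cont_cpt_bdd => //; exact: smooth_cont. Qed.

Lemma partial_bdd f i : Ccoo E f -> exists2 M : R, 0 <= M & forall x, `|partial i f x| <= M.
Proof.
move=> [sf cf _]; apply: cont_cpt_bdd.
  by apply: smooth_cont; exact: smooth_partial.
apply: (compact_subclosed cf); first exact: closed_closure.
rewrite [X in _ `<=` X](closure_id _).1; last exact: closed_closure.
apply: closureS => x /= h; apply/not_notP => nc; move/eqP: h; apply.
exact: partial_supp.
Qed.

Lemma partial_meas f i : smooth f -> mfun (partial i f).
Proof. by move=> sf; apply: cont_meas; apply: smooth_cont; exact: smooth_partial. Qed.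

Lemma smooth_meas f : smooth f -> mfun f.
Proof. by move=> sf; apply: cont_meas; exact: smooth_cont. Qed.

Lemma Ccoo_in_ae n f : Ccoo_in E (Vn n) f ->
  (\forall x \ae mu, ~ Vn n x -> f x = 0) /\
  (forall i, \forall x \ae mu, ~ Vn n x -> partial i f x = 0).
Proof.
move=> cf; split=> [|i]; apply: filterS ae_intE => x iEx nV;
  by have [h1 h2] := Ccoo_in_off cf iEx nV.
Qed.

Lemma Ccoo_L2 f : Ccoo E f -> L2 f.
Proof.
move=> cf; have [n cn] := Ccoo_Vn cf; have [M M0 fM] := Ccoo_bdd cf.
apply: (@bdd_L2 n _ M) => //; first by apply: smooth_meas; case: cf.
  exact: nearW.
exact: (Ccoo_in_ae cn).1.
Qed.

Lemma partial_L2 f i : Ccoo E f -> L2 (partial i f).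
Proof.
move=> cf; have [n cn] := Ccoo_Vn cf; have [M M0 fM] := partial_bdd i cf.
apply: (@bdd_L2 n _ M) => //; first by apply: partial_meas; case: cf.
  exact: nearW.
exact: (Ccoo_in_ae cn).2.
Qed.

(** Extension by zero turns integrals over [E] into integrals over the whole space. *)
Definition Am i j : X -> R := (fun x => A x i j) \_ E.
Definition Bm i : X -> R := (fun x => B x 0 i) \_ E.

Lemma patch_meas f : measurable_fun E f -> mfun (f \_ E).
Proof. by move=> mf; apply/(measurable_restrictT _ mE). Qed.

Lemma Am_meas i j : mfun (Am i j).
Proof. by apply: patch_meas; have [] := hA_loc i j. Qed.

Lemma Bm_meas i : mfun (Bm i).
Proof. by apply: patch_meas; have [] := hB_loc i. Qed.

Lemma patch_in f (S : set X) x : S x -> (f \_ S) x = f x.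
Proof. by move=> Sx; rewrite patchE mem_set. Qed.

Lemma patch_out f (S : set X) x : ~ S x -> (f \_ S) x = 0.
Proof. by move=> Sx; rewrite patchE memNset. Qed.

Lemma patch_ind f n x : (f \_ E) x * \1_(Vn n) x = (f \_ (closure (Vn n))) x * \1_(Vn n) x.
Proof.
have [Vx|nV] := pselect (Vn n x); last by rewrite ind0// !mulr0.
rewrite !patch_in//; first exact: subset_closure.
exact: Vn_E Vx.
Qed.

Lemma ind_bdd (S : set X) x : `|\1_S x : R| <= 1.
Proof. by have /andP[a b] := ind_01 S x; rewrite ger0_norm. Qed.

Lemma Am_L1 i j n : L1 (fun x => Am i j x * \1_(Vn n) x).
Proof.
have [mA hA] := hA_loc i j.
have LA := hA _ (@Vn_compact n) (@Vn_closure n).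
apply: (@Lfun_ext _ _ _ _ _ (fun x => ((fun x => A x i j) \_ (closure (Vn n))) x * \1_(Vn n) x)).
  by move=> x; rewrite -patch_ind.
apply: (L1_mulB (M := 1)) => //; first by apply: ind_meas; exact: Vn_meas.
by apply: nearW => x; exact: ind_bdd.
Qed.

Lemma Bm_L2 i n : L2 (fun x => Bm i x * \1_(Vn n) x).
Proof.
have [mB hB] := hB_loc i.
have LB := hB _ (@Vn_compact n) (@Vn_closure n).
apply: (@Lfun_ext _ _ _ _ _ (fun x => ((fun x => B x 0 i) \_ (closure (Vn n))) x * \1_(Vn n) x)).
  by move=> x; rewrite -patch_ind.
apply: (L2_mulB (M := 1)) => //; first by apply: ind_meas; exact: Vn_meas.
by apply: nearW => x; exact: ind_bdd.
Qed.

(** * The form on test functions and local ellipticity *)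

Lemma Rint_E f : \int[mu]_(x in E) f x = Int (f \_ E).
Proof. by rewrite Rintegral_mkcond. Qed.

Definition qf f g x : R := dotv (grad f x *m (A x)^T) (grad g x).

Lemma qfE f g x : qf f g x = \sum_i \sum_j A x i j * partial j f x * partial i g x.
Proof.
rewrite /qf /dotv; apply: eq_bigr => i _; rewrite !mxE mulr_suml; apply: eq_bigr => j _.
by rewrite !mxE; ring.
Qed.

Definition qfm f g x : R := \sum_i \sum_j Am i j x * partial j f x * partial i g x.

Lemma qfmE f g : qf f g \_ E = qfm f g.
Proof.
apply/funext => x; rewrite /qfm /Am; have [Ex|Ex] := pselect (E x).
  rewrite patch_in// qfE; apply: eq_bigr => i _; apply: eq_bigr => j _.
  by rewrite patch_in.
rewrite patch_out// big1// => i _; rewrite big1// => j _.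
by rewrite patch_out// !mul0r.
Qed.

Lemma AdfL1 f g i j : Ccoo E f -> Ccoo E g ->
  L1 (fun x => Am i j x * partial j f x * partial i g x).
Proof.
move=> cf cg; have [n cn] := Ccoo_Vn cg.
have [M M0 fM] := partial_bdd j cf; have [M' M'0 gM] := partial_bdd i cg.
have mf : mfun (partial j f) by apply: partial_meas; case: cf.
have mg : mfun (partial i g) by apply: partial_meas; case: cg.
have h : L1 (fun x => Am i j x * \1_(Vn n) x * (partial j f x * partial i g x)).
  apply: (L1_mulB (M := M * M')); first exact: Am_L1.
    exact: measurable_funM.
  by apply: nearW => x; rewrite normrM ler_pM.
apply: (L1_eq h).
  by apply: measurable_funM => //; apply: measurable_funM => //; exact: Am_meas.
apply: filterS ((Ccoo_in_ae cn).2 i) => x k _.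
have [Vx|/[dup] nV /k ->] := pselect (Vn n x).
  by rewrite ind1// mulr1 mulrA.
by rewrite !mulr0.
Qed.

Lemma qfm_L1 f g : Ccoo E f -> Ccoo E g -> L1 (qfm f g).
Proof. by move=> cf cg; apply: L1_sum => i; apply: L1_sum => j; exact: AdfL1. Qed.

Lemma pfE f g : pf f g = Int (qfm f g).
Proof. by rewrite /pre_form Rint_E; congr Rintegral; exact: qfmE. Qed.

Lemma qfm_l (c : R) f f' g x : smooth f -> smooth f' ->
  qfm (fun y => c * f y + f' y) g x = c * qfm f g x + qfm f' g x.
Proof.
move=> sf sf'; rewrite /qfm mulr_sumr -big_split; apply: eq_bigr => i _.
rewrite mulr_sumr -big_split; apply: eq_bigr => j _.
by rewrite partial_lin//= !mulrDr mulrDl; congr (_ + _); ring.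
Qed.

Lemma qfm_r (c : R) f g g' x : smooth g -> smooth g' ->
  qfm f (fun y => c * g y + g' y) x = c * qfm f g x + qfm f g' x.
Proof.
move=> sf sf'; rewrite /qfm mulr_sumr -big_split; apply: eq_bigr => i _.
rewrite mulr_sumr -big_split; apply: eq_bigr => j _.
by rewrite partial_lin//= mulrDr; congr (_ + _); ring.
Qed.

Lemma dotv_mx (u v : X) : dotv u v = (u *m v^T) 0 0.
Proof. by rewrite /dotv mxE; apply: eq_bigr => i _; rewrite mxE. Qed.

Lemma dotv_sym (M : 'M[R]_d) (xi : X) : dotv (xi *m sym_part M) xi = dotv (xi *m M^T) xi.
Proof.
rewrite !dotv_mx /sym_part -scalemxAr mulmxDr -scalemxAl mulmxDl mxE mxE.
have -> : (xi *m M *m xi^T) 0 0 = (xi *m M^T *m xi^T) 0 0.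
  rewrite -[in LHS](trmxK (xi *m M *m xi^T)) mxE.
  by rewrite !trmx_mul trmxK mulmxA.
by field.
Qed.

(** One plus the partial sums of the ellipticity constants of the [Vn] is again admissible, and
    moreover monotone and at least one. *)
Lemma nu_seq : exists nu : nat -> R, [/\ forall n, 1 <= nu n,
  forall n m, (n <= m)%N -> nu n <= nu m &
  forall n (xi x : X), Vn n x -> dotv xi xi <= nu n * dotv (xi *m (A x)^T) xi /\
    dotv (xi *m (A x)^T) xi <= nu n * dotv xi xi].
Proof.
have /choice[c hc] : forall n, exists c : R, 0 < c /\ forall (xi x : X), Vn n x ->
    c^-1 * dotv xi xi <= dotv (xi *m sym_part (A x)) xi <= c * dotv xi xi.
  by move=> n; have [c c0 h] := hA_ell (@Vn_subsub n); exists c.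
have c0 n : 0 <= c n by apply: ltW; exact: (hc n).1.
pose nu n : R := 1 + \sum_(k < n.+1) c k.
have cnu n : c n <= nu n.
  rewrite /nu big_ord_recr/= addrA lerDr addr_ge0//.
  by apply: sumr_ge0 => k _.
have d0 (xi : X) : 0 <= dotv xi xi by apply: sumr_ge0 => i _; rewrite -expr2 sqr_ge0.
exists nu; split.
- by move=> n; rewrite /nu lerDl; apply: sumr_ge0 => k _.
- move=> n m nm; rewrite /nu lerD2l.
  rewrite (big_ord_widen m.+1 (fun k => c k))// [leRHS](bigID (fun k : 'I_m.+1 => (k < n.+1)%N))/=.
  by rewrite lerDl sumr_ge0.
- move=> n xi x Vx; have [cn h] := hc n; have := h xi x Vx; rewrite dotv_sym => /andP[h1 h2].
  have q0 : 0 <= dotv (xi *m (A x)^T) xi.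
    by apply: le_trans h1; rewrite mulr_ge0// invr_ge0.
  split; last by apply: le_trans h2 _; rewrite ler_wpM2r.
  apply: (@le_trans _ _ (c n * dotv (xi *m (A x)^T) xi)); last by rewrite ler_wpM2r.
  by rewrite -ler_pdivrMl.
Qed.

Definition nu : nat -> R := xget (fun=> 0) [set nu : nat -> R | [/\ forall n, 1 <= nu n,
  forall n m, (n <= m)%N -> nu n <= nu m &
  forall n (xi x : X), Vn n x -> dotv xi xi <= nu n * dotv (xi *m (A x)^T) xi /\
    dotv (xi *m (A x)^T) xi <= nu n * dotv xi xi]].

Lemma nuP : [/\ forall n, 1 <= nu n, forall n m, (n <= m)%N -> nu n <= nu m &
  forall n (xi x : X), Vn n x -> dotv xi xi <= nu n * dotv (xi *m (A x)^T) xi /\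
    dotv (xi *m (A x)^T) xi <= nu n * dotv xi xi].
Proof.
rewrite /nu; case: xgetP => [c _ //|/= no]; exfalso.
by have [c hc] := nu_seq; exact: (no c).
Qed.

Lemma nu_ge1 n : 1 <= nu n. Proof. by have [] := nuP. Qed.
Lemma nu_gt0 n : 0 < nu n. Proof. exact: lt_le_trans ltr01 (nu_ge1 n). Qed.
Lemma nu_mono n m : (n <= m)%N -> nu n <= nu m. Proof. by have [_ + _] := nuP; apply. Qed.

Lemma qf_lower n f x : Vn n x -> \sum_i partial i f x ^+ 2 <= nu n * qf f f x.
Proof.
move=> Vx; have [_ _ /(_ n (grad f x) x Vx)[+ _]] := nuP.
by congr (_ <= _); apply: eq_bigr => i _; rewrite mxE expr2.
Qed.

Lemma qf_ge0 f x : E x -> 0 <= qf f f x.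
Proof.
move=> Ex; have [n Vx] := E_Vn Ex; have := qf_lower f Vx.
move=> h; rewrite -(pmulr_rge0 _ (nu_gt0 n)); apply: le_trans h.
by apply: sumr_ge0 => i _; exact: sqr_ge0.
Qed.

Lemma qfm_ge0 f x : 0 <= qfm f f x.
Proof.
rewrite -qfmE; have [Ex|Ex] := pselect (E x); first by rewrite patch_in// qf_ge0.
by rewrite patch_out.
Qed.

Lemma pf_good : good_form mu pf (Ccoo E).
Proof.
split.
- exact: Ccoo_submod.
- exact: Ccoo_L2.
- split=> [g cg|f cf] c h h' ch ch'.
  + rewrite !pfE -I_lin; [|exact: qfm_L1..].
    by congr Rintegral; apply/funext => x; apply: qfm_l; exact: Ccoo_smooth.
  + rewrite !pfE -I_lin; [|exact: qfm_L1..].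
    by congr Rintegral; apply/funext => x; apply: qfm_r; exact: Ccoo_smooth.
- move=> f cf; rewrite pfE; apply: I_ge0.
    by apply: Lfun_measurable (qfm_L1 cf cf).
  by apply: nearW => x; exact: qfm_ge0.
Qed.

(** * The weight and the weak gradient *)

Definition rank (x : X) : nat := xget 0%N [set n | seqDU Vn n x].

Lemma rankP n x : seqDU Vn n x -> rank x = n.
Proof.
move=> h; rewrite /rank; case: xgetP => [m _ hm|/(_ n)//].
exact: (trivIset_seqDU Vn) m n I I (ex_intro _ x (conj hm h)).
Qed.

Lemma rank_le n x : Vn n x -> (rank x <= n)%N /\ seqDU Vn (rank x) x.
Proof.
move=> Vx; have : (\bigcup_(k in [set k | (k <= n)%N]) seqDU Vn k) x.
  move: n Vx; apply: ltn_ind => n IH Vx.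
  have [[k /= kn Vk]|nV] := pselect (exists2 k, (k < n)%N & Vn k x).
    by have [m /= mk hm] := IH k kn Vk; exists m => //=; rewrite (leq_trans mk)// ltnW.
  exists n => //=; rewrite /seqDU; split=> //.
  by rewrite -bigcup_mkord => -[k /= kn Vk]; apply: nV; exists k.
by move=> [k /= kn hk]; rewrite (rankP hk).
Qed.

(* The weight makes [f |-> rho * grad f] bounded from the energy space to [L^2(E, mu)]. *)
Definition rho : X -> R := (fun x => (Num.sqrt (nu (rank x)))^-1) \_ E.

Lemma sqrt_nu_ge1 n : 1 <= Num.sqrt (nu n).
Proof. by rewrite -sqrtr1; apply: ler_wsqrtr; exact: nu_ge1. Qed.

Lemma rank_meas (c : nat -> R) : measurable_fun E (fun x => c (rank x)).
Proof.
have EV : E = \bigcup_n seqDU Vn n.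
  rewrite -seqDU_bigcup_eq; apply/seteqP; split=> x.
    by move=> Ex; have [n hn] := E_Vn Ex; exists n.
  by move=> [n _]; exact: Vn_E.
have mD n : measurable (seqDU Vn n).
  by apply: measurableD; [exact: Vn_meas|apply: bigsetU_measurable => k _; exact: Vn_meas].
rewrite EV; apply/measurable_fun_bigcup => // n.
apply: (eq_measurable_fun (fun=> c n)); last exact: measurable_cst.
by move=> x; rewrite inE => /rankP ->.
Qed.

Lemma rho_meas : mfun rho.
Proof. by apply: patch_meas; exact: (rank_meas (fun n => (Num.sqrt (nu n))^-1)). Qed.

Lemma rho_ge0 x : 0 <= rho x.
Proof.
have [Ex|Ex] := pselect (E x); last by rewrite /rho patch_out.
by rewrite /rho patch_in// invr_ge0 sqrtr_ge0.
Qed.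

Lemma rho_le1 x : rho x <= 1.
Proof.
have [Ex|Ex] := pselect (E x); last by rewrite /rho patch_out// ler01.
rewrite /rho patch_in// invf_le1 ?sqrt_nu_ge1//.
exact: lt_le_trans ltr01 (sqrt_nu_ge1 _).
Qed.

Lemma rho_gt0 x : E x -> 0 < rho x.
Proof.
move=> Ex; rewrite /rho patch_in// invr_gt0.
exact: lt_le_trans ltr01 (sqrt_nu_ge1 _).
Qed.

Lemma rho_lower n x : Vn n x -> 1 <= Num.sqrt (nu n) * rho x.
Proof.
move=> Vx; have Ex := Vn_E Vx; rewrite /rho patch_in// ler_pdivlMr; last first.
  exact: lt_le_trans ltr01 (sqrt_nu_ge1 _).
rewrite mul1r; apply: ler_wsqrtr; apply: nu_mono.
exact: (rank_le Vx).1.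
Qed.

Lemma rho_qf f x : rho x ^+ 2 * \sum_i partial i f x ^+ 2 <= qfm f f x.
Proof.
have [Ex|Ex] := pselect (E x); last first.
  by rewrite /rho patch_out// expr0n mul0r qfm_ge0.
have [n Vx] := E_Vn Ex; have [_ hr] := rank_le Vx.
have Vr : Vn (rank x) x by case: hr.
rewrite -qfmE patch_in// /rho patch_in// exprVn sqr_sqrtr ?(ltW (nu_gt0 _))//.
by rewrite ler_pdivrMl ?nu_gt0//; exact: qf_lower.
Qed.

Lemma sqr_le (a b : R) : `|a| <= `|b| -> a ^+ 2 <= b ^+ 2.
Proof.
rewrite -(real_normK (num_real a)) -(real_normK (num_real b)) => h.
by rewrite lerXn2r ?nnegrE.
Qed.

Lemma n2_mono f g (c : R) : 0 <= c -> mfun f -> L2 g ->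
  (\forall x \ae mu, `|f x| <= c * `|g x|) -> L2 f /\ n2 f <= c * n2 g.
Proof.
move=> c0 mf Lg fg.
have Lg' : L2 (fun x => c * g x) by exact: L2_scale.
have Lf : L2 f.
  apply/L2P; split=> //; apply: (L1_dom _ _ (L2_sqr Lg')); first exact: measurable_funX.
  apply: filterS fg => x h; rewrite ger0_norm ?sqr_ge0//; apply: sqr_le.
  by rewrite normrM (ger0_norm c0).
split=> //; have := N_scale (n2_seminorm mu) c Lg; rewrite ger0_norm// => <-.
rewrite /n2; apply: ler_wsqrtr; apply: I_le; [exact: L2_sqr|exact: L2_sqr|].
by apply: filterS fg => x h; apply: sqr_le; rewrite normrM (ger0_norm c0).
Qed.

Lemma n2_monoT f g (c : R) : 0 <= c -> mfun f -> L2 g -> (forall x, `|f x| <= c * `|g x|) ->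
  L2 f /\ n2 f <= c * n2 g.
Proof. by move=> c0 mf Lg h; apply: n2_mono => //; exact: nearW. Qed.

Lemma Ncvg2_ae (s : nat -> X -> R) f g : (forall n, L2 (s n)) -> L2 f -> L2 g ->
  f = g %[ae mu] -> Ncvg n2 s f -> Ncvg n2 s g.
Proof.
move=> Ls Lf Lg fg sf e e0; have [n0 h] := sf e e0; exists n0 => n /h.
apply: le_lt_trans; apply: le_trans (Nd_tri (n2_seminorm mu) (Ls n) Lf Lg) _.
by rewrite (eq_n2 Lf Lg fg) addr0.
Qed.

Lemma Ncvg2_sub0 (s r : nat -> X -> R) f : (forall n, L2 (s n)) -> (forall n, L2 (r n)) ->
  L2 f -> Ncvg n2 s f -> (forall e, 0 < e -> exists n0, forall n, (n0 <= n)%N ->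
    n2 (r n \- s n) < e) -> Ncvg n2 r f.
Proof.
move=> Ls Lr Lf sf rs e e0; have e2 : 0 < e / 2 by lra.
have [n0 h0] := sf _ e2; have [n1' h1] := rs _ e2.
exists (maxn n0 n1') => n; rewrite geq_max => /andP[/h0 a /h1 b].
have := Nd_tri (n2_seminorm mu) (Lr n) (Ls n) Lf; lra.
Qed.

Lemma Ncvg_comp_le (N N' : (X -> R) -> R) (s r : nat -> X -> R) f g (c : R) : 0 <= c ->
  (forall n, N' (r n \- g) <= c * N (s n \- f)) -> Ncvg N s f -> Ncvg N' r g.
Proof.
move=> c0 h sf e e0; have c1 : 0 < c + 1 by rewrite ltr_wpDl.
have ec : 0 < e / (c + 1) by rewrite divr_gt0.
have [n0 hn] := sf _ ec; exists n0 => n /hn; rewrite ltr_pdivlMr// => a.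
apply: le_lt_trans (h n) _.
have [N0|N0] := leP 0 (N (s n \- f)).
  by apply: le_lt_trans a; rewrite mulrC ler_wpM2l// lerDl.
by apply: le_lt_trans e0; rewrite mulr_ge0_le0// ltW.
Qed.

Lemma DD_CE f : CE f -> DD f. Proof. exact: (D_DD pf_good). Qed.
Lemma DDL2 f : DD f -> L2 f. Proof. by case. Qed.
Lemma DD_submod : submodule DD. Proof. exact: (DD_sub pf_good). Qed.
Lemma s1ip : semi_ip DD (s1 mu pf CE).
Proof. exact: (s1_ip pf_good h_sector h_closable). Qed.
Lemma nE_sn : seminorm_on DD nE. Proof. exact: (ip_seminorm s1ip). Qed.
Lemma n2_nE f : DD f -> n2 f <= nE f.
Proof. exact: (n2_le_nE pf_good h_sector h_closable). Qed.
Lemma nE_CE f : CE f -> nE f ^+ 2 = pf f f + n2 f ^+ 2.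
Proof.
move=> cf; rewrite (nE_sqr pf_good h_sector h_closable); last exact: DD_CE.
by rewrite (E_D pf_good h_sector h_closable).
Qed.

Lemma q_le_nE f : CE f -> qn f <= nE f.
Proof.
move=> cf; rewrite -(ler_pXn2r (n := 2))// ?nnegrE ?sn_ge0// nE_CE// (q_sqr pf_good cf).
by rewrite lerDl sqr_ge0.
Qed.

Definition wg i f x := rho x * partial i f x.

Lemma wg_meas i f : smooth f -> mfun (wg i f).
Proof. by move=> sf; apply: measurable_funM; [exact: rho_meas|exact: partial_meas]. Qed.

Lemma wg_L2 i f : CE f -> L2 (wg i f).
Proof.
move=> cf; have := @n2_mono (wg i f) (partial i f) 1 ler01 (wg_meas i (Ccoo_smooth cf)) (partial_L2 i cf).
case=> //; apply: nearW => x; rewrite /wg normrM mul1r ger0_norm ?rho_ge0//.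
by rewrite ler_piMl// rho_le1.
Qed.

Lemma wg_lin i (c : R) f g : smooth f -> smooth g ->
  wg i (fun x => c * f x + g x) = (fun x => c * wg i f x + wg i g x).
Proof. by move=> sf sg; apply/funext => x; rewrite /wg partial_lin//; ring. Qed.

Lemma wg_sub i f g : smooth f -> smooth g -> wg i (f \- g) = wg i f \- wg i g.
Proof.
move=> sf sg; rewrite (_ : f \- g = (fun x => -1 * g x + f x)).
  by rewrite wg_lin//; apply/funext => x /=; ring.
by apply/funext => x /=; ring.
Qed.

Lemma wg_le i f : CE f -> n2 (wg i f) <= qn f.
Proof.
move=> cf; rewrite -(ler_pXn2r (n := 2))// ?nnegrE ?sn_ge0 ?n2_ge0// (q_sqr pf_good cf).
rewrite n2_sqr pfE; apply: I_le; [by apply: L2_sqr; exact: wg_L2|exact: qfm_L1|].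
apply: nearW => x; apply: le_trans (rho_qf f x); rewrite /wg exprMn ler_wpM2l ?sqr_ge0//.
by rewrite (bigD1 i)//= lerDl; apply: sumr_ge0 => j _; exact: sqr_ge0.
Qed.

Lemma CE_sub f g : CE f -> CE g -> CE (f \- g).
Proof. exact: (submod_sub Ccoo_submod). Qed.

Lemma wg_cauchy i (u : nat -> X -> R) : (forall n, CE (u n)) -> Ncauchy qn u ->
  Ncauchy n2 (fun n => wg i (u n)).
Proof.
move=> cu h e e0; have [n0 hn] := h e e0; exists n0 => m n hm hn'.
rewrite -wg_sub; [|exact: Ccoo_smooth..].
by apply: le_lt_trans (hn m n hm hn'); apply: wg_le; exact: CE_sub.
Qed.

Lemma wg_lim i (u : nat -> X -> R) f : L2 f -> appr u f ->
  exists2 H, L2 H & Ncvg n2 (fun n => wg i (u n)) H.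
Proof.
move=> Lf uf; have [cu qu _] := (apprP pf_good u Lf).1 uf.
by apply: (@L2_complete _ _ _ mu) => [n|]; [exact: wg_L2|exact: wg_cauchy].
Qed.

(** Closability sends the energies of a null sequence to zero, and the energy dominates the weighted
    gradient. Hence limits of gradients do not depend on the approximating sequence. *)
Lemma wg_null i (w : nat -> X -> R) : appr w (cst 0) ->
  forall e, 0 < e -> exists n0, forall n, (n0 <= n)%N -> n2 (wg i (w n)) < e.
Proof.
move=> w0 e e0; have cw := appr_D w0.
have /cvgr_epsP h : (fun n => qn (w n)) @ \oo --> (0 : R).
  by under eq_fun do rewrite qE; apply: cvgr_sqrt0; exact: h_closable.
have [n0 hn] := h e e0; exists n0 => n /hn; rewrite subr0 ger0_norm ?sn_ge0//.
by apply: le_lt_trans; apply: wg_le.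
Qed.

Lemma wg_lim_indep i (u v : nat -> X -> R) f H : L2 f -> appr u f -> appr v f -> L2 H ->
  Ncvg n2 (fun n => wg i (u n)) H -> Ncvg n2 (fun n => wg i (v n)) H.
Proof.
move=> Lf uf vf LH; have cu := appr_D uf; have cv := appr_D vf.
move=> /Ncvg2_sub0; apply => //.
- by move=> n; exact: wg_L2.
- by move=> n; exact: wg_L2.
- move=> e e0; have [n0 h] := wg_null i (appr_sub pf_good Lf vf uf) e0.
  exists n0 => n /h; rewrite wg_sub//; exact: Ccoo_smooth.
Qed.

Lemma patch_bound (n : nat) f g (K : set X) : K `<=` Vn n ->
  (forall x, E x -> rho x * f x = g x) ->
  forall x, `|(f \_ K) x| <= Num.sqrt (nu n) * `|g x|.
Proof.
move=> KV fg x; have [Kx|Kx] := pselect (K x); last first.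
  by rewrite patch_out// normr0 mulr_ge0// sqrtr_ge0.
have Vx := KV _ Kx.
rewrite patch_in// -fg; last exact: Vn_E Vx.
rewrite normrM ger0_norm ?rho_ge0// mulrA ler_peMl//; exact: rho_lower.
Qed.

Lemma rho_inv_meas : measurable_fun E (fun x => (rho x)^-1).
Proof.
apply: (eq_measurable_fun (fun x => Num.sqrt (nu (rank x)))).
  by move=> x; rewrite inE => Ex; rewrite /rho patch_in// invrK.
exact: (rank_meas (fun n => Num.sqrt (nu n))).
Qed.

(** The weighted gradients converge in $L^2(E,\mu)$; dividing the limit by the weight gives [G], and
    $1/\rho$ is bounded on each [Vn], hence on compact subsets of [E]. *)
Lemma weak_grad_exists f : DD f -> exists G, is_weak_grad E mu pf CE f G.
Proof.
move=> [Lf [u uf]]; have cu := appr_D uf.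
have /choice[H hH] : forall i, exists H, L2 H /\ Ncvg n2 (fun n => wg i (u n)) H.
  by move=> i; have [H LH h] := wg_lim i Lf uf; exists H.
pose G (x : X) : X := \row_i ((rho x)^-1 * H i x).
have rG i x : E x -> rho x * G x 0 i = H i x.
  by move=> Ex; rewrite mxE mulrA mulfV ?mul1r// gt_eqF// rho_gt0.
have LH i : L2 (H i) := (hH i).1.
have mG i : measurable_fun E (fun x => G x 0 i).
  under eq_fun do rewrite mxE.
  apply: measurable_funM; first exact: rho_inv_meas.
  by apply: (measurable_funS measurableT) => //; exact: Lfun_measurable (LH i).
exists G; exists u => // i; split.
  split=> // K cK KE; have [n KV] := compact_Vn cK KE.
  have [//|h _] := n2_monoT (sqrtr_ge0 (nu n)) _ (LH i) (patch_bound KV (rG i)).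
  apply/(measurable_restrictT _ (compact_meas cK)).
    by apply: measurable_funS (mG i) => //; exact: mE.
  exact: h.
move=> K cK KE; have [n KV] := compact_Vn cK KE.
have mK := compact_meas cK.
have b m x : `|((fun x => partial i (u m) x - G x 0 i) \_ K) x| <=
    Num.sqrt (nu n) * `|(wg i (u m) \- H i) x|.
  apply: (patch_bound KV) => y Ey; rewrite mulrBr rG//.
have Lwh m : L2 (wg i (u m) \- H i) by apply: L2_sub => //; exact: wg_L2.
have mp m : mfun ((fun x => partial i (u m) x - G x 0 i) \_ K).
  apply/(measurable_restrictT _ mK); apply: measurable_funB.
    by apply: measurable_funTS; apply: partial_meas; exact: Ccoo_smooth.
  by apply: measurable_funS (mG i) => //; exact: mE.
have key m := n2_monoT (sqrtr_ge0 (nu n)) (mp m) (Lwh m) (b m).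
have eqm m : (fun x => grad (u m) x 0 i - G x 0 i) = (fun x => partial i (u m) x - G x 0 i).
  by apply/funext => x; rewrite /grad mxE.
apply/(@ereal_cvg0P _ _ (fun m => n2 ((fun x => partial i (u m) x - G x 0 i) \_ K))) => [m|].
  by rewrite -(n2_Lnorm (key m).1) -eqm.
apply/cvgr_epsP => e e0.
have := Ncvg_comp_le (N' := n2) (r := fun m => (fun x => partial i (u m) x - G x 0 i) \_ K) (g := cst 0) (sqrtr_ge0 (nu n)) _ (hH i).2.
case/(_ _ e e0) => [m|n0 h].
  rewrite (_ : _ \- cst 0 = (fun x => partial i (u m) x - G x 0 i) \_ K); first exact: (key m).2.
  by apply/funext => x /=; rewrite subr0.
exists n0 => m /h; rewrite subr0 ger0_norm ?n2_ge0//.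
rewrite (_ : _ \- cst 0 = (fun x => partial i (u m) x - G x 0 i) \_ K)//.
by apply/funext => x /=; rewrite subr0.
Qed.

Definition Nb i f : X -> R := (fun x => nabla E mu A f x 0 i) \_ E.
Definition wN i f x := rho x * Nb i f x.

(** A weak gradient refers to some approximating sequence and to local convergence. Comparison on
    each [Vn] identifies its weighted version with the global $L^2$-limit, which [wg_lim_indep] then
    gives along every sequence. *)
Lemma is_wg_lim i f G (v : nat -> X -> R) : L2 f -> is_weak_grad E mu pf CE f G -> appr v f ->
  let W i x := rho x * ((fun x => G x 0 i) \_ E) x in
  [/\ mfun ((fun x => G x 0 i) \_ E), L2 (W i) & Ncvg n2 (fun n => wg i (v n)) (W i)].
Proof.
move=> Lf [u uf hG] vf W; have cu := appr_D uf.
have [[mG LG] cG] := hG i.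
have mGE : mfun ((fun x => G x 0 i) \_ E) by exact: patch_meas.
have mW : mfun (W i) by apply: measurable_funM => //; exact: rho_meas.
have [H LH uH] := wg_lim i Lf uf.
have HW : H = W i %[ae mu].
  have key n : \forall x \ae mu, Vn n x -> H x = W i x.
    pose K := closure (Vn n).
    have cK : compact K by exact: Vn_compact.
    have KE : K `<=` E by exact: Vn_closure.
    have mI := ind_meas (@Vn_meas n).
    pose z := (fun x => H x - W i x) \* \1_(Vn n).
    pose GK := (fun x => G x 0 i) \_ K.
    have LGK : L2 GK := LG K cK KE.
    have zE x : z x = H x * \1_(Vn n) x - rho x * GK x * \1_(Vn n) x.
      by rewrite /z/= mulrBl /W -!mulrA patch_ind.
    have indB : \forall x \ae mu, `|\1_(Vn n) x : R| <= 1 by apply: nearW => x; exact: ind_bdd.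
    have LHI : L2 (fun x => H x * \1_(Vn n) x) := L2_mulB LH mI indB.
    have LrG : L2 (fun x => rho x * GK x * \1_(Vn n) x).
      apply: (L2_mulB _ mI indB); apply: (Lfun_ext (f := fun x => GK x * rho x)).
        by move=> x; rewrite mulrC.
      apply: (L2_mulB (M := 1) LGK rho_meas); apply: nearW => x.
      by rewrite ger0_norm ?rho_ge0// rho_le1.
    have Lz : L2 z by apply: (Lfun_ext (f := fun x => H x * \1_(Vn n) x - rho x * GK x * \1_(Vn n) x)); [move=> x; rewrite zE|exact: L2_sub].
    (* On [Vn n] the difference splits as $(H-\rho\,\partial_iu_m)+\rho(\partial_iu_m-G_i)$: the
       first part is small by global convergence, the second by convergence on the compact [K]. *)
    have z0 : n2 z <= 0.
      apply: le_eps => e e0; rewrite add0r; have e2 : 0 < e / 2 by lra.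
      have [n0 h0] := uH _ e2.
      have Lp m : L2 (((fun x => grad (u m) x 0 i - G x 0 i) \_ K)).
        have LpK : L2 ((partial i (u m)) \_ K).
          have mK := compact_meas cK.
          have [] // := n2_mono ler01 _ (partial_L2 i (cu m)) (_ : \forall x \ae mu, `|((partial i (u m)) \_ K) x| <= 1 * `|partial i (u m) x|).
          + apply/(measurable_restrictT _ mK); apply: measurable_funTS.
            by apply: partial_meas; exact: Ccoo_smooth.
          + apply: nearW => x; rewrite mul1r; have [Kx|Kx] := pselect (K x).
              by rewrite patch_in.
            by rewrite patch_out// normr0.
        apply: Lfun_ext (L2_sub LpK LGK) => x; rewrite /GK.
        have [Kx|Kx] := pselect (K x); first by rewrite !patch_in// /grad mxE.
        by rewrite !patch_out// subr0.
      have /(ereal_cvg0P (fun m => n2_Lnorm (Lp m))) /cvgr_epsP/(_ _ e2)[n1' h1] := cG K cK KE.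
      pose m := maxn n0 n1'.
      have {}h0 := h0 m (leq_maxl _ _); have {}h1 := h1 m (leq_maxr _ _).
      move: h1; rewrite subr0 ger0_norm ?n2_ge0// => h1.
      have Lw : L2 (wg i (u m)) := wg_L2 i (cu m).
      have [La ha] : let a := (fun x => (H x - wg i (u m) x) * \1_(Vn n) x) in L2 a /\ n2 a <= 1 * n2 (H \- wg i (u m)).
        have Ls : L2 (H \- wg i (u m)) := L2_sub LH Lw.
        apply: n2_mono => //; first by apply: measurable_funM => //; exact: Lfun_measurable Ls.
        apply: nearW => x; rewrite normrM mul1r ler_piMr//; exact: ind_bdd.
      have [Lb hb] : let b := (fun x => (wg i (u m) x - rho x * GK x) * \1_(Vn n) x) in L2 b /\
          n2 b <= 1 * n2 ((fun x => grad (u m) x 0 i - G x 0 i) \_ K).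
        apply: n2_mono => //.
          apply: measurable_funM => //; apply: measurable_funB; first exact: Lfun_measurable Lw.
          by apply: measurable_funM; [exact: rho_meas|exact: Lfun_measurable LGK].
        apply: nearW => x; rewrite mul1r; have [Vx|Vx] := pselect (Vn n x); last first.
          by rewrite ind0// mulr0 normr0.
        have Kx : K x by exact: subset_closure.
        rewrite ind1// mulr1 /GK !patch_in// /wg /grad mxE -mulrBr normrM ger0_norm ?rho_ge0//.
        by rewrite ler_piMl// rho_le1.
      have := N_add (n2_seminorm mu) La Lb.
      rewrite (_ : _ \+ _ = z); last by apply/funext => x; rewrite zE/=; ring.
      have := NdC (n2_seminorm mu) LH Lw.
      lra.
    have z0' : n2 (z \- cst 0) = 0.
      rewrite (_ : z \- cst 0 = z); last by apply/funext => x /=; rewrite subr0.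
      by apply/eqP; rewrite eq_le z0 n2_ge0.
    apply: filterS (n2_eq Lz (L2_0 mu) z0') => x /= /(_ I); rewrite /z/= => h Vx.
    by move: h; rewrite ind1// mulr1 => /eqP; rewrite subr_eq0 => /eqP.
  apply: filterS2 (ae_foralln key) ae_E => x h Ex _.
  by have [n Vx] := E_Vn Ex; exact: h Vx.
have LW : L2 (W i) := L2_eq LH mW HW.
split=> //; apply: (wg_lim_indep Lf uf vf LW).
by apply: (Ncvg2_ae _ LH LW HW) => // n; exact: wg_L2.
Qed.

Lemma nablaP f : DD f -> is_weak_grad E mu pf CE f (nabla E mu A f).
Proof.
move=> /weak_grad_exists[G hG]; rewrite /nabla /weak_grad.
by case: xgetP => [y _ //|/(_ G)].
Qed.

Lemma wN_lim i f (v : nat -> X -> R) : DD f -> appr v f ->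
  Ncvg n2 (fun n => wg i (v n)) (wN i f).
Proof. by move=> Df vf; have [] := is_wg_lim i (DDL2 Df) (nablaP Df) vf. Qed.

Lemma Nb_meas i f : DD f -> mfun (Nb i f).
Proof. by move=> Df; have [Lf [v vf]] := Df; have [] := is_wg_lim i Lf (nablaP Df) vf. Qed.

Lemma wN_L2 i f : DD f -> L2 (wN i f).
Proof. by move=> Df; have [Lf [v vf]] := Df; have [] := is_wg_lim i Lf (nablaP Df) vf. Qed.

Lemma DD_appr f : DD f -> exists s, appr s f /\ Ncvg nE s f.
Proof.
move=> [Lf [v vf]]; exists v; split=> //.
exact: (appr_nE pf_good h_sector h_closable Lf vf).
Qed.

Lemma Ncvg_N (S : set (X -> R)) (N : (X -> R) -> R) (s : nat -> X -> R) f :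
  seminorm_on S N -> (forall n, S (s n)) -> S f -> Ncvg N s f ->
  (fun n => N (s n)) @ \oo --> N f.
Proof.
move=> HN Ss Sf sf; apply/cvgr_epsP => e /sf[n0 h]; exists n0 => n /h.
apply: le_lt_trans; exact: (N_dist HN (Ss n) Sf).
Qed.

Lemma wN_nE i f : DD f -> n2 (wN i f) <= nE f.
Proof.
move=> Df; have [v [vf vn]] := DD_appr Df; have cv := appr_D vf.
have h1 := Ncvg_N (n2_seminorm mu) (fun n => wg_L2 i (cv n)) (wN_L2 i Df) (wN_lim i Df vf).
have h2 := Ncvg_N nE_sn (fun n => DD_CE (cv n)) Df vn.
apply: cvgr_ler h1 h2 _ => n; apply: le_trans (wg_le i (cv n)) _; exact: q_le_nE.
Qed.

Lemma cvgr_sum (I : Type) (s : seq I) (F : I -> nat -> R) (l : I -> R) :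
  (forall a, F a @ \oo --> l a) ->
  (fun n => \sum_(a <- s) F a n) @ \oo --> \sum_(a <- s) l a.
Proof.
move=> h; elim: s => [|a s IH].
  by rewrite big_nil; under eq_fun do rewrite big_nil; exact: cvg_cst.
by rewrite big_cons; under eq_fun do rewrite big_cons; exact: cvgr_add.
Qed.

Lemma rho_cancel (f g : X -> R) : (fun x => rho x * f x) = (fun x => rho x * g x) %[ae mu] ->
  f = g %[ae mu].
Proof.
apply: filterS2 ae_E => x Ex /(_ I) h _; apply: (mulfI _ h).
by rewrite gt_eqF// rho_gt0.
Qed.

Lemma Ncvg2_uniq (s : nat -> X -> R) f g : (forall n, L2 (s n)) -> L2 f -> L2 g ->
  Ncvg n2 s f -> Ncvg n2 s g -> f = g %[ae mu].
Proof.
move=> Ls Lf Lg sf sg; apply: n2_eq => //.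
exact: (Ncvg_unique (n2_seminorm mu) (s := s)).
Qed.

Lemma Nb_lin i (c : R) f g : DD f -> DD g ->
  Nb i (fun x => c * f x + g x) = (fun x => c * Nb i f x + Nb i g x) %[ae mu].
Proof.
move=> Df Dg; have Dfg : DD (fun x => c * f x + g x) := submod_lin c DD_submod Df Dg.
have [u [uf _]] := DD_appr Df; have [v [vg _]] := DD_appr Dg.
have cu := appr_D uf; have cv := appr_D vg.
have uv := appr_lin pf_good c (DDL2 Df) (DDL2 Dg) uf vg.
have h1 := wN_lim i Dfg uv.
have h2 := Ncvg_lin (n2_seminorm mu) c (fun n => wg_L2 i (cu n)) (fun n => wg_L2 i (cv n))
  (wN_L2 i Df) (wN_L2 i Dg) (wN_lim i Df uf) (wN_lim i Dg vg).
apply: rho_cancel.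
have h : wN i (fun x => c * f x + g x) = (fun x => c * wN i f x + wN i g x) %[ae mu].
  apply: (Ncvg2_uniq (s := fun n => wg i (fun x => c * u n x + v n x))) => //.
  - by move=> n; apply: wg_L2; exact: (submod_lin c Ccoo_submod (cu n) (cv n)).
  - exact: (wN_L2 i Dfg).
  - exact: (L2_lin c (wN_L2 i Df) (wN_L2 i Dg)).
  - move=> e /h2[n0 hn]; exists n0 => n /hn.
    by rewrite wg_lin//; exact: Ccoo_smooth.
by apply: filterS h => x k /k; rewrite /wN => ->; ring.
Qed.

Lemma Nb_CE i f : CE f -> Nb i f = partial i f %[ae mu].
Proof.
move=> cf; have Df := DD_CE cf.
apply: rho_cancel; change (wN i f = wg i f %[ae mu]).
apply: (Ncvg2_uniq (s := fun=> wg i f)).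
- by move=> n; exact: wg_L2.
- exact: (wN_L2 i Df).
- exact: wg_L2.
- by apply: wN_lim => //; exact: (appr_cst pf_good).
- exact: (Ncvg_cst (n2_seminorm mu)).
Qed.

(** * The drift form *)

Definition dN n i f x := Nb i f x * \1_(Vn n) x.

Lemma dN_bound n i f : DD f -> L2 (dN n i f) /\ n2 (dN n i f) <= Num.sqrt (nu n) * nE f.
Proof.
move=> Df; have [] := @n2_monoT (dN n i f) (wN i f) (Num.sqrt (nu n)) (sqrtr_ge0 _) _ (wN_L2 i Df).
- by apply: measurable_funM; [exact: Nb_meas|apply: ind_meas; exact: Vn_meas].
- move=> x; rewrite /dN /wN; have [Vx|Vx] := pselect (Vn n x); last first.
    by rewrite ind0// mulr0 normr0 mulr_ge0// sqrtr_ge0.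
  by rewrite ind1// mulr1 normrM ger0_norm ?rho_ge0// mulrA ler_peMl//; exact: rho_lower.
- move=> L b; split=> //; apply: le_trans b _; rewrite ler_wpM2l ?sqrtr_ge0//; exact: wN_nE.
Qed.

Definition bfun u v x := \sum_i Bm i x * Nb i u x * v x.
Definition bt u v := \int[mu]_(x in E) (dotv (B x) (nabla E mu A u x) * v x).

Lemma btE u v : bt u v = Int (bfun u v).
Proof.
rewrite /bt Rint_E; congr Rintegral; apply/funext => x; rewrite /bfun /Bm /Nb.
have [Ex|Ex] := pselect (E x).
  by rewrite patch_in// /dotv mulr_suml; apply: eq_bigr => i _; rewrite !patch_in.
by rewrite patch_out// big1// => i _; rewrite patch_out// !mul0r.
Qed.

(** The admissible second arguments of the drift form: on [Vn n] both $B$ and $\nabla u$ are square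
    integrable, so that their product is integrable against a bounded function. *)
Definition adm n (M : R) v := [/\ mfun v, 0 <= M, \forall x \ae mu, `|v x| <= M &
  \forall x \ae mu, ~ Vn n x -> v x = 0].

Definition Cb n i := n2 (fun x => Bm i x * \1_(Vn n) x) * Num.sqrt (nu n).

Lemma bterm_ae n (M : R) i u v : adm n M v ->
  (fun x => (Bm i x * \1_(Vn n) x * v x) * dN n i u x) =
  (fun x => Bm i x * Nb i u x * v x) %[ae mu].
Proof.
move=> [_ _ _]; apply: filterS => x h _; rewrite /dN.
have [Vx|/[dup] /h -> nV] := pselect (Vn n x); last by rewrite !mulr0 mul0r.
by rewrite ind1// !mulr1 mulrAC.
Qed.

Lemma bterm n (M : R) i u v : DD u -> adm n M v ->
  L1 (fun x => Bm i x * Nb i u x * v x) /\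
  `|Int (fun x => Bm i x * Nb i u x * v x)| <= M * (Cb n i * nE u).
Proof.
move=> Du av; have [mv M0 vM v0] := av; have [Ld nd] := dN_bound n i Du.
have LB := Bm_L2 i n.
have [LBv nBv] := n2_mono (f := fun x => Bm i x * \1_(Vn n) x * v x) M0
  (measurable_funM (Lfun_measurable LB) mv) LB
  (filterS (fun x (h : `|v x| <= M) => eq_ind_r (fun t => t <= _) (eq_ind_r (fun t => t <= _)
     (ler_wpM2r (normr_ge0 _) h) (mulrC _ _)) (normrM _ _)) vM).
have L' := L2_mul LBv Ld.
have m2 : mfun (fun x => Bm i x * Nb i u x * v x).
  apply: measurable_funM => //; apply: measurable_funM; [exact: Bm_meas|exact: Nb_meas].
have ae := bterm_ae i u av.
split; first exact: (L1_eq L' m2 ae).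
rewrite -(I_eq (Lfun_measurable L') m2 ae).
apply: le_trans (n2_CS LBv Ld) _.
rewrite (_ : M * (Cb n i * nE u) = M * n2 (fun x => Bm i x * \1_(Vn n) x) *
  (Num.sqrt (nu n) * nE u)); last by rewrite /Cb; ring.
by apply: ler_pM; [exact: n2_ge0|exact: n2_ge0|exact: nBv|exact: nd].
Qed.

Lemma bfun_L1 n (M : R) u v : DD u -> adm n M v -> L1 (bfun u v).
Proof. by move=> Du av; apply: L1_sum => i; exact: (bterm i Du av).1. Qed.

Definition CB n := \sum_i Cb n i.

Lemma bt_bound n (M : R) u v : DD u -> adm n M v -> `|bt u v| <= M * CB n * nE u.
Proof.
move=> Du av; rewrite btE I_sum; last by move=> i; exact: (bterm i Du av).1.
apply: le_trans (ler_norm_sum _ _ _) _.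
rewrite /CB mulr_sumr mulr_suml; apply: ler_sum => i _.
by rewrite -mulrA; exact: (bterm i Du av).2.
Qed.

Lemma bt_linl n (M : R) (c : R) u u' v : DD u -> DD u' -> adm n M v ->
  bt (fun x => c * u x + u' x) v = c * bt u v + bt u' v.
Proof.
move=> Du Du' av; rewrite !btE -I_lin; [|exact: (bfun_L1 Du av)|exact: (bfun_L1 Du' av)].
have Duu := submod_lin c DD_submod Du Du'.
apply: I_eq; [exact: Lfun_measurable (bfun_L1 Duu av)| |].
  exact: Lfun_measurable (L1_lin c (bfun_L1 Du av) (bfun_L1 Du' av)).
have h i : Nb i (fun x => c * u x + u' x) = (fun x => c * Nb i u x + Nb i u' x) %[ae mu] := Nb_lin i c Du Du'.
have : \forall x \ae mu, forall i, Nb i (fun x => c * u x + u' x) x = c * Nb i u x + Nb i u' x.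
  by apply: filter_forall => i; apply: filterS (h i) => x; apply.
apply: filterS => x k _; rewrite /bfun mulr_sumr -big_split; apply: eq_bigr => i _ /=.
by rewrite k; ring.
Qed.

Lemma bt_linr n (M M' : R) (c : R) u v v' : DD u -> adm n M v -> adm n M' v' ->
  bt u (fun x => c * v x + v' x) = c * bt u v + bt u v'.
Proof.
move=> Du av av'; rewrite !btE -I_lin; [|exact: (bfun_L1 Du av)|exact: (bfun_L1 Du av')].
congr Rintegral; apply/funext => x; rewrite /bfun mulr_sumr -big_split; apply: eq_bigr => i _ /=.
ring.
Qed.

Lemma bt_cvgr n (M : R) u (v_ : nat -> X -> R) v : DD u -> (forall k, adm n M (v_ k)) -> adm n M v ->
  (\forall x \ae mu, v_ ^~ x @ \oo --> v x) -> (fun k => bt u (v_ k)) @ \oo --> bt u v.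
Proof.
move=> Du avk av cv; under eq_fun do rewrite btE; rewrite btE.
pose g x := \sum_i `|Bm i x * Nb i u x * (M * \1_(Vn n) x)|.
have a1 : adm n M (fun x => M * \1_(Vn n) x).
  have [_ M0 _ _] := av; split=> //.
  - by apply: measurable_funM => //; apply: ind_meas; exact: Vn_meas.
  - apply: nearW => x; rewrite normrM ger0_norm// ler_piMr//; exact: ind_bdd.
  - by apply: nearW => x nV; rewrite ind0// mulr0.
have Lg : L1 g by apply: L1_sum => i; apply: L1_abs; exact: (bterm i Du a1).1.
have [] := dominated_cvgR (u := fun k => bfun u (v_ k)) (f := bfun u v) (g := g) _ _ Lg _ _.
- by move=> k; exact: Lfun_measurable (bfun_L1 Du (avk k)).
- exact: (Lfun_measurable (bfun_L1 Du av)).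
- apply: filterS cv => x h; rewrite /bfun.
  under eq_fun do under eq_bigr do rewrite mulrC.
  rewrite (_ : \sum_i _ = \sum_i v x * (Bm i x * Nb i u x)); last first.
    by apply: eq_bigr => i _; rewrite mulrC.
  by apply: cvgr_sum => i; apply: cvgr_mul => //; exact: cvg_cst.
- have := ae_foralln (fun k => let: And4 _ _ h _ := avk k in h).
  have := ae_foralln (fun k => let: And4 _ _ _ h := avk k in h).
  apply: filterS2 => x h0 hM k; rewrite /bfun /g.
  apply: le_trans (ler_norm_sum _ _ _) _; apply: ler_sum => i _.
  rewrite !normrM ler_wpM2l ?mulr_ge0//.
  have [Vx|Vx] := pselect (Vn n x); last by rewrite (h0 k Vx) normr0 mulr_ge0.
  by rewrite ind1// normr1 mulr1; apply: le_trans (hM k) _; exact: ler_norm.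
- by move=> _ _.
Qed.

(** * Mazur's theorem in the energy space, and the spaces $D(\mathcal E^{0,V})$ *)

Lemma mid_ball (S : set (X -> R)) (N : (X -> R) -> R) f (e : R) : seminorm_on S N -> S f ->
  mid_convex [set g | S g /\ N (g \- f) <= e].
Proof.
move=> HN Sf u v [Su Nu] [Sv Nv]; split.
  by apply: (sn_lin HN) => //; exact: (sn_scale HN).
rewrite (_ : _ \- f = (fun x => 2^-1 * (u \- f) x) \+ (fun x => 2^-1 * (v \- f) x)); last first.
  by apply/funext => x /=; rewrite /mid; field.
have Suf := sn_sub HN Su Sf; have Svf := sn_sub HN Sv Sf.
apply: le_trans (N_add HN (sn_scale HN _ Suf) (sn_scale HN _ Svf)) _.
rewrite !(N_scale HN)// ger0_norm ?invr_ge0//; lra.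
Qed.

Lemma mid_submod (S : set (X -> R)) : submodule S -> mid_convex S.
Proof. by move=> HS u v Su Sv; apply: submod_lin => //; exact: submod_scale. Qed.

(** Balls are midpoint-convex, so the hull of a tail lies in any ball that contains the tail. *)
Lemma hull_cvg (S : set (X -> R)) (N : (X -> R) -> R) (v w : nat -> X -> R) f :
  seminorm_on S N -> S f -> (forall k, S (v k)) -> (forall k, hull v k (w k)) ->
  Ncvg N v f -> Ncvg N w f.
Proof.
move=> HN Sf Sv vw vf e e0; have e2 : 0 < e / 2 by lra.
have [n0 h] := vf _ e2; exists n0 => n n0n.
have [_ hw] := vw n _ (mid_ball (e := e / 2) HN Sf) (fun m (nm : (n <= m)%N) =>
  conj (Sv m) (ltW (h m (leq_trans n0n nm)))).
by apply: le_lt_trans hw _; lra.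
Qed.

Lemma nE_ae f g : DD f -> L2 g -> f = g %[ae mu] -> DD g /\ nE (f \- g) = 0.
Proof.
move=> Df Lg fg; have [Dg _ _] := E_ae pf_good h_sector h_closable Df fg Lg Df.
split=> //; have Dz : DD (f \- g) := submod_sub DD_submod Df Dg.
have z0 : (f \- g) = cst 0 %[ae mu].
  by apply: filterS fg => x h xT /=; rewrite h// subrr.
have D0 : DD (cst 0) := DD_CE Ccoo0.
have [_ e1 _] := E_ae pf_good h_sector h_closable Dz z0 (L2_0 mu) Dz.
apply/eqP; rewrite -sqrf_eq0 (nE_sqr pf_good h_sector h_closable Dz) e1.
rewrite (lin_on0 DD_submod (E_l pf_good h_sector h_closable Dz)) add0r.
have := eq_n2 (DDL2 Dz) (L2_0 mu) z0.
rewrite (_ : _ \- cst 0 = f \- g); last by apply/funext => x /=; rewrite subr0.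
by move=> ->; rewrite expr0n.
Qed.

(** The substitute for weak compactness: bounded energy and $L^2$-convergence put the limit into the
    domain, and hull elements converge to it in energy. *)
Lemma maz (v : nat -> X -> R) (K : R) f : (forall k, DD (v k)) -> (forall k, nE (v k) <= K) ->
  L2 f -> Ncvg n2 v f ->
  DD f /\ exists w : nat -> X -> R, [/\ forall m, DD (w m), forall m, hull v m (w m) & Ncvg nE w f].
Proof.
move=> Dv vK Lf vf.
have [k|w [Dw hw cw]] := mazur s1ip Dv (B := K ^+ 2).
  rewrite -(sn_sqr s1ip (Dv k)) lerXn2r ?nnegrE ?sn_ge0//.
  exact: le_trans (sn_ge0 _ _) (vK k).
have [g Dg wg] := DD_complete pf_good h_sector h_closable Dw cw.
have wg2 : Ncvg n2 w g.
  move=> e /wg[n0 h]; exists n0 => n /h; apply: le_lt_trans; apply: n2_nE.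
  exact: (submod_sub DD_submod (Dw n) Dg).
have wf2 : Ncvg n2 w f := hull_cvg (n2_seminorm mu) Lf (fun k => DDL2 (Dv k)) hw vf.
have gf := Ncvg2_uniq (fun k => DDL2 (Dw k)) (DDL2 Dg) Lf wg2 wf2.
have [Df gf0] := nE_ae Dg Lf gf.
split=> //; exists w; split=> // e /wg[n0 h]; exists n0 => n /h.
apply: le_lt_trans; apply: le_trans (Nd_tri nE_sn (Dw n) Dg Df) _.
by rewrite gf0 addr0.
Qed.

Lemma CV_CE n f : CV n f -> CE f. Proof. exact: Ccoo_in_Ccoo. Qed.

Lemma DV_DD n f : DV n f -> DD f. Proof. exact: (closure_dom_mono (@Ccoo_in_Ccoo (Vn n))). Qed.

Lemma DV_mono n m f : (n <= m)%N -> DV n f -> DV m f.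
Proof. by move=> nm; apply: closure_dom_mono; apply: Ccoo_in_mono; exact: Vn_mono. Qed.

Lemma pfV_good n : good_form mu pf (CV n).
Proof. exact: (good_form_mono pf_good (@Ccoo_in_Ccoo (Vn n)) (Ccoo_in_submod (Vn n))). Qed.

Lemma DV_submod n : submodule (DV n). Proof. exact: (DD_sub (pfV_good n)). Qed.

Lemma CV_DV n f : CV n f -> DV n f. Proof. exact: (D_DD (pfV_good n)). Qed.

Lemma DV_appr n f : DV n f -> exists s, [/\ forall k, CV n (s k), appr s f & Ncvg nE s f].
Proof.
move=> [Lf [s sf]]; exists s; have sf' := appr_mono (@Ccoo_in_Ccoo (Vn n)) sf.
split=> //; first exact: appr_D sf.
exact: (appr_nE pf_good h_sector h_closable Lf sf').
Qed.

Lemma DV_of n (s : nat -> X -> R) f : (forall k, CV n (s k)) -> DD f -> Ncvg nE s f -> DV n f.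
Proof.
move=> cs Df sf; have cE k := CV_CE (cs k); have Ds k := DD_CE (cE k).
have c1 : Ncauchy nE s := Ncvg_cauchy nE_sn Ds Df sf.
have c2 : Ncvg n2 s f.
  move=> e /sf[n0 h]; exists n0 => k /h; apply: le_lt_trans; apply: n2_nE.
  exact: (submod_sub DD_submod (Ds k) Df).
have [_ b c] := nE_appr pf_good h_sector h_closable cE (DDL2 Df) c1 c2.
by split; [exact: DDL2|exists s].
Qed.

Lemma DV_maz n (v : nat -> X -> R) (K : R) f : (forall k, CV n (v k)) -> (forall k, nE (v k) <= K) ->
  L2 f -> Ncvg n2 v f ->
  DV n f /\ exists w : nat -> X -> R, [/\ forall m, CV n (w m), forall m, hull v m (w m) & Ncvg nE w f].
Proof.
move=> cv vK Lf vf; have Dv k := DD_CE (CV_CE (cv k)).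
have [Df [w [Dw hw wf]]] := maz Dv vK Lf vf.
have cw m : CV n (w m).
  by apply: (hw m); [apply: mid_submod; exact: Ccoo_in_submod|move=> k _; exact: cv].
by split; [exact: DV_of cw Df wf|exists w].
Qed.

Lemma DV_ae n f g : DV n f -> L2 g -> f = g %[ae mu] -> DV n g.
Proof.
move=> [Lf [s sf]] Lg fg; split=> //; exists s.
exact: (appr_ae (pfV_good n) fg Lf Lg sf).
Qed.

Lemma L2lim_off (S : set X) (s : nat -> X -> R) f : (forall k, L2 (s k)) -> L2 f ->
  (forall k, \forall x \ae mu, ~ S x -> s k x = 0) -> Ncvg n2 s f ->
  \forall x \ae mu, ~ S x -> f x = 0.
Proof.
move=> Ls Lf s0 sf; have [r [_ rc]] := L2_ae_subseq Ls Lf sf.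
apply: filterS2 rc (ae_foralln s0) => x cx h nS.
apply: (cvgn_uniq cx); under eq_fun do rewrite h//.
exact: cvg_cst.
Qed.

Lemma nE_n2 (s : nat -> X -> R) f : (forall k, DD (s k)) -> DD f -> Ncvg nE s f -> Ncvg n2 s f.
Proof.
move=> Ds Df sf e /sf[n0 h]; exists n0 => k /h; apply: le_lt_trans; apply: n2_nE.
exact: (submod_sub DD_submod (Ds k) Df).
Qed.

Lemma DV_off n f : DV n f -> \forall x \ae mu, ~ Vn n x -> f x = 0.
Proof.
move=> Df; have [s [cs sa sf]] := DV_appr Df.
have Ds k := DD_CE (CV_CE (cs k)).
apply: (L2lim_off _ _ _ (nE_n2 Ds (DV_DD Df) sf)) => [k||k].
- exact: DDL2.
- exact: (DDL2 (DV_DD Df)).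
- exact: (Ccoo_in_ae (cs k)).1.
Qed.

Lemma DV_Nb_off n i f : DV n f -> \forall x \ae mu, ~ Vn n x -> Nb i f x = 0.
Proof.
move=> Df; have [s [cs sa sf]] := DV_appr Df; have DDf := DV_DD Df.
have : \forall x \ae mu, ~ Vn n x -> wN i f x = 0.
  apply: (L2lim_off _ _ _ (wN_lim i DDf sa)) => [k||k].
  - by apply: wg_L2; exact: CV_CE (cs k).
  - exact: (wN_L2 i DDf).
  - by apply: filterS ((Ccoo_in_ae (cs k)).2 i) => x h /h; rewrite /wg => ->; rewrite mulr0.
apply: filterS2 ae_E => x Ex h /h /eqP; rewrite mulf_eq0 gt_eqF ?rho_gt0//= => /eqP.
exact.
Qed.

Lemma DV_L1 n f : DV n f -> L1 f.
Proof. by move=> Df; apply: (L2_L1 (DDL2 (DV_DD Df))); exact: DV_off Df. Qed.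

Lemma DV_adm n (M : R) f : 0 <= M -> DV n f -> (\forall x \ae mu, `|f x| <= M) -> adm n M f.
Proof.
move=> M0 Df fM; split=> //; last exact: DV_off.
exact: Lfun_measurable (DDL2 (DV_DD Df)).
Qed.

(** * Products and compositions with smooth functions *)

Lemma qfm_partial f g f' g' x : (forall i, partial i f x = partial i f' x) ->
  (forall i, partial i g x = partial i g' x) -> qfm f g x = qfm f' g' x.
Proof.
move=> h h'; rewrite /qfm; apply: eq_bigr => i _; apply: eq_bigr => j _.
by rewrite h h'.
Qed.

Lemma smooth_scale (c : R) f : smooth f -> smooth (fun y => c * f y).
Proof. by move=> sf; exact: (smooth_mul (@smooth_cst R d c) sf). Qed.

Lemma qfm_expand (a b : R) f g x : smooth f -> smooth g ->
  qfm (fun y => a * f y + b * g y) (fun y => a * f y + b * g y) x =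
  a ^+ 2 * qfm f f x + a * b * (qfm f g x + qfm g f x) + b ^+ 2 * qfm g g x.
Proof.
move=> sf sg; have sbg : smooth (fun y => b * g y).
  exact: smooth_scale.
have l h : qfm (fun y => b * g y) h x = b * qfm g h x.
  have s0 : smooth (fun _ : X => 0 : R) := @smooth_cst R d 0.
  have := qfm_l b h x sg s0; rewrite [X in _ = _ + X]big1 ?addr0; last first.
    by move=> i _; rewrite big1// => j _; rewrite partial_cst mulr0 mul0r.
  by rewrite (_ : (fun y => b * g y + 0) = fun y => b * g y)//; apply/funext => y; rewrite addr0.
have r h : qfm h (fun y => b * g y) x = b * qfm h g x.
  have s0 : smooth (fun _ : X => 0 : R) := @smooth_cst R d 0.
  have := qfm_r b h x sg s0; rewrite [X in _ = _ + X]big1 ?addr0; last first.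
    by move=> i _; rewrite big1// => j _; rewrite partial_cst mulr0.
  by rewrite (_ : (fun y => b * g y + 0) = fun y => b * g y)//; apply/funext => y; rewrite addr0.
rewrite qfm_l// !qfm_r// !l !r; ring.
Qed.

(** At the point [x] the gradient of the product is that of $bf+ag$ with frozen values $a=f(x)$ and
    $b=g(x)$; the mixed terms are removed by positivity of the form at $bf-ag$. *)
Lemma qfm_mul f g x : smooth f -> smooth g ->
  qfm (fun y => f y * g y) (fun y => f y * g y) x <=
  2 * (f x ^+ 2 * qfm g g x + g x ^+ 2 * qfm f f x).
Proof.
move=> sf sg; pose a := f x; pose b := g x.
have sl (c e : R) : smooth (fun y => c * f y + e * g y).
  by exact: (smooth_lin _ sf (smooth_scale _ sg)).
have -> : qfm (fun y => f y * g y) (fun y => f y * g y) x =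
    qfm (fun y => b * f y + a * g y) (fun y => b * f y + a * g y) x.
  have h i : partial i (fun y => f y * g y) x = partial i (fun y => b * f y + a * g y) x.
    rewrite partial_mul//.
    rewrite (_ : (fun y => b * f y + a * g y) = (fun y => b * f y + (fun z => a * g z) y))//.
    have sag : smooth (fun z => a * g z) by exact: smooth_scale.
    rewrite partial_lin// (_ : (fun z => a * g z) = fun z => cst a z * g z)//.
    by rewrite partial_mul ?partial_cst ?mulr0 ?addr0; [rewrite addrC|exact: smooth_cst|].
  exact: qfm_partial.
have := qfm_ge0 (fun y => b * f y + (- a) * g y) x.
rewrite !qfm_expand// -/a -/b sqrrN.
move: (qfm f f x) (qfm f g x) (qfm g f x) (qfm g g x) => p q r s; lra.
Qed.

Lemma pf_mul f g (M : R) : CE f -> CE g -> (forall x, `|f x| <= M) -> (forall x, `|g x| <= M) ->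
  pf (fun y => f y * g y) (fun y => f y * g y) <= 2 * M ^+ 2 * (pf f f + pf g g).
Proof.
move=> cf cg fM gM; have cfg : CE (fun y => f y * g y) by apply: Ccoo_mul => //; exact: Ccoo_smooth.
have Lf := qfm_L1 cf cf; have Lg := qfm_L1 cg cg.
rewrite !pfE -I_add// -I_scale; last exact: L1_add.
apply: I_le; [exact: qfm_L1|by apply: L1_scale; exact: L1_add|].
apply: nearW => x; apply: le_trans (qfm_mul x (Ccoo_smooth cf) (Ccoo_smooth cg)) _.
rewrite -mulrA ler_wpM2l// mulrDr addrC.
have M0 : 0 <= M by exact: le_trans (fM x).
apply: lerD; rewrite ler_wpM2r ?qfm_ge0//; apply: sqr_le; rewrite (ger0_norm M0)//.
Qed.

Lemma n2_mulB f g (M : R) : 0 <= M -> mfun g -> L2 f -> (forall x, `|g x| <= M) ->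
  L2 (fun x => f x * g x) /\ n2 (fun x => f x * g x) <= M * n2 f.
Proof.
move=> M0 mg Lf gM; apply: n2_monoT => //.
  by apply: measurable_funM => //; exact: Lfun_measurable Lf.
by move=> x; rewrite normrM mulrC ler_wpM2r.
Qed.

Lemma nE_mul f g (M : R) : CE f -> CE g -> (forall x, `|f x| <= M) -> (forall x, `|g x| <= M) ->
  nE (fun y => f y * g y) ^+ 2 <= 2 * M ^+ 2 * (nE f ^+ 2 + nE g ^+ 2).
Proof.
move=> cf cg fM gM; have cfg : CE (fun y => f y * g y) by apply: Ccoo_mul => //; exact: Ccoo_smooth.
have M0 : 0 <= M by exact: le_trans (fM 0).
rewrite !nE_CE//.
have [_ h] := n2_mulB M0 (smooth_meas (Ccoo_smooth cg)) (Ccoo_L2 cf) gM.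
have h2 : n2 (fun x => f x * g x) ^+ 2 <= M ^+ 2 * n2 f ^+ 2.
  by rewrite -exprMn; apply: sqr_le; rewrite !ger0_norm ?n2_ge0 ?mulr_ge0 ?n2_ge0.
have h3 := pf_mul cf cg fM gM.
have h4 : 0 <= M ^+ 2 * n2 f ^+ 2 by rewrite mulr_ge0 ?sqr_ge0.
have h5 : 0 <= M ^+ 2 * n2 g ^+ 2 by rewrite mulr_ge0 ?sqr_ge0.
move: h2 h3 h4 h5.
move: (pf (fun y => _) _) (pf f f) (pf g g) (n2 (fun y => _) ^+ 2) (n2 f ^+ 2) (n2 g ^+ 2) (M ^+ 2).
by move=> a b c e k l m; lra.
Qed.

Section composition.
Variables (p dp : R -> R) (C : R).
Hypotheses (pD : forall n, D1 n p) (p0 : p 0 = 0) (pdp : forall s : R, is_derive s (1 : R) p (dp s))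
  (dpC : forall s, `|dp s| <= C).

Let C0 : 0 <= C. Proof. exact: le_trans (dpC 0). Qed.

Lemma comp_le s : `|p s| <= C * `|s|.
Proof. by have := deriv_le_Lip pdp dpC s 0; rewrite p0 !subr0. Qed.

Lemma comp_meas f : mfun f -> mfun (fun x => p (f x)).
Proof.
move=> mf; apply: (measurableT_comp (f := p)) => //.
by apply: continuous_measurable_fun; exact: (D1_cont (pD 0)).
Qed.

Lemma comp_n2 f : L2 f -> L2 (fun x => p (f x)) /\ n2 (fun x => p (f x)) <= C * n2 f.
Proof.
move=> Lf; apply: n2_monoT => //; last by move=> x; exact: comp_le.
by apply: comp_meas; exact: Lfun_measurable Lf.
Qed.

Lemma comp_cvg (s : nat -> X -> R) f : (forall k, L2 (s k)) -> L2 f -> Ncvg n2 s f ->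
  Ncvg n2 (fun k x => p (s k x)) (fun x => p (f x)).
Proof.
move=> Ls Lf sf.
apply: (Ncvg_comp_le (N := n2) (c := C) C0 _ sf) => k.
have [] := @n2_monoT ((fun x => p (s k x)) \- (fun x => p (f x))) (s k \- f) C C0 _ (L2_sub (Ls k) Lf) _.
- by apply: measurable_funB; apply: comp_meas; apply: (Lfun_measurable (p := 2%:E) (mu := mu)).
- by move=> x /=; exact: deriv_le_Lip pdp dpC _ _.
- by [].
Qed.

Lemma qfm_comp f x : smooth f ->
  qfm (fun y => p (f y)) (fun y => p (f y)) x = dp (f x) ^+ 2 * qfm f f x /\
  qfm f (fun y => p (f y)) x = dp (f x) * qfm f f x.
Proof.
move=> sf; split; rewrite /qfm mulr_sumr; apply: eq_bigr => i _; rewrite mulr_sumr;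
  apply: eq_bigr => j _; rewrite !(partial_comp _ _ pdp sf); ring.
Qed.

Lemma pf_comp f : CE f -> pf (fun y => p (f y)) (fun y => p (f y)) <= C ^+ 2 * pf f f.
Proof.
move=> cf; have cpf := Ccoo_comp pD p0 cf; rewrite !pfE -I_scale; last exact: qfm_L1.
apply: I_le; [exact: qfm_L1|by apply: L1_scale; exact: qfm_L1|].
apply: nearW => x; rewrite (qfm_comp x (Ccoo_smooth cf)).1 ler_wpM2r ?qfm_ge0//.
by apply: sqr_le; rewrite (ger0_norm C0).
Qed.

Lemma pf_comp_ge0 f : (forall s, 0 <= dp s) -> CE f -> 0 <= pf f (fun y => p (f y)).
Proof.
move=> dp0 cf; have cpf := Ccoo_comp pD p0 cf; rewrite pfE; apply: I_ge0.
  by apply: Lfun_measurable (qfm_L1 cf cpf).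
by apply: nearW => x; rewrite (qfm_comp x (Ccoo_smooth cf)).2 mulr_ge0 ?qfm_ge0.
Qed.

Lemma nE_comp f : CE f -> nE (fun y => p (f y)) <= C * nE f.
Proof.
move=> cf; have cpf := Ccoo_comp pD p0 cf.
rewrite -(ler_pXn2r (n := 2))// ?nnegrE ?mulr_ge0 ?sn_ge0// exprMn !nE_CE// mulrDr.
apply: lerD; first exact: pf_comp.
rewrite -exprMn; apply: sqr_le; rewrite !ger0_norm ?n2_ge0 ?mulr_ge0 ?n2_ge0//.
exact: (comp_n2 (Ccoo_L2 cf)).2.
Qed.

End composition.

Lemma EE_nE : exists2 K, 0 < K & forall f g, DD f -> DD g -> `|EE f g| <= K * (nE f * nE g).
Proof. exact: (E_le_nE pf_good h_sector h_closable). Qed.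

Lemma EEl g : DD g -> linear_on DD (EE^~ g).
Proof. exact: (E_l pf_good h_sector h_closable). Qed.

Lemma EEr f : DD f -> linear_on DD (EE f).
Proof. exact: (E_r pf_good h_sector h_closable). Qed.

Lemma EE_CE f g : CE f -> CE g -> EE f g = pf f g.
Proof. exact: (E_D pf_good h_sector h_closable). Qed.

Lemma nE_cvg0 (w : nat -> X -> R) v : (forall k, DD (w k)) -> DD v -> Ncvg nE w v ->
  (fun k => nE (w k \- v)) @ \oo --> (0 : R).
Proof.
move=> Dw Dv wv; apply/cvgr_epsP => e /wv[n0 h]; exists n0 => k /h.
by rewrite subr0 ger0_norm// sn_ge0.
Qed.

Lemma cvgr_dist0 (s r : nat -> R) (l : R) : (forall k, `|s k - l| <= r k) -> r @ \oo --> (0 : R) ->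
  s @ \oo --> l.
Proof.
move=> h r0; have h0 := cvgr0_le h r0.
have hl : (fun _ : nat => l) @ \oo --> l by exact: cvg_cst.
by have := cvgr_add h0 hl; rewrite add0r; apply: cvgr_ext => k; rewrite subrK.
Qed.

Lemma EE_cvgr u (w : nat -> X -> R) v : DD u -> (forall k, DD (w k)) -> DD v -> Ncvg nE w v ->
  (fun k => EE u (w k)) @ \oo --> EE u v.
Proof.
move=> Du Dw Dv /(nE_cvg0 Dw Dv) wv; have [K K0 hK] := EE_nE.
apply: (cvgr_dist0 (r := fun k => K * nE u * nE (w k \- v))) => [k|].
  rewrite -(lin_on_sub (EEr Du) (Dw k) Dv) -mulrA; apply: hK => //.
  exact: (submod_sub DD_submod (Dw k) Dv).
by rewrite -(mulr0 (K * nE u)); exact: cvgr_mulc.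
Qed.

Lemma EE_cvgl u (w : nat -> X -> R) v : DD u -> (forall k, DD (w k)) -> DD v -> Ncvg nE w v ->
  (fun k => EE (w k) u) @ \oo --> EE v u.
Proof.
move=> Du Dw Dv /(nE_cvg0 Dw Dv) wv; have [K K0 hK] := EE_nE.
apply: (cvgr_dist0 (r := fun k => K * nE u * nE (w k \- v))) => [k|].
  rewrite -(lin_on_sub (EEl Du) (Dw k) Dv) -mulrA [nE u * _]mulrC; apply: hK => //.
  exact: (submod_sub DD_submod (Dw k) Dv).
by rewrite -(mulr0 (K * nE u)); exact: cvgr_mulc.
Qed.

Lemma bt_lim n (M : R) (w_ v_ : nat -> X -> R) w v : (forall k, DD (w_ k)) -> DD w -> Ncvg nE w_ w ->
  (forall k, adm n M (v_ k)) -> adm n M v -> (\forall x \ae mu, v_ ^~ x @ \oo --> v x) ->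
  (fun k => bt (w_ k) (v_ k)) @ \oo --> bt w v.
Proof.
move=> Dwk Dw /(nE_cvg0 Dwk Dw) cw avk av cv.
have M0 : 0 <= M by case: av.
have h1 : (fun k => bt (w_ k \- w) (v_ k)) @ \oo --> (0 : R).
  apply: (cvgr0_le (r := fun k => M * CB n * nE (w_ k \- w))) => [k|].
    by apply: bt_bound => //; exact: (submod_sub DD_submod (Dwk k) Dw).
  by rewrite -(mulr0 (M * CB n)); exact: cvgr_mulc.
have := cvgr_add h1 (bt_cvgr Dw avk av cv); rewrite add0r; apply: cvgr_ext => k.
have Dd : DD (w_ k \- w) := submod_sub DD_submod (Dwk k) Dw.
have := bt_linl 1 Dd Dw (avk k); rewrite mul1r => <-.
have -> // : (fun x => 1 * (w_ k \- w) x + w x) = w_ k.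
by apply/funext => x /=; rewrite mul1r subrK.
Qed.

Lemma nE_bounded (s : nat -> X -> R) f : (forall k, DD (s k)) -> DD f -> Ncvg nE s f ->
  exists2 K, 0 < K & forall k, nE (s k) <= K.
Proof.
by move=> Ds Df sf; exact: (cauchy_bounded nE_sn Ds (Ncvg_cauchy nE_sn Ds Df sf)).
Qed.

Lemma Ncvg_subseq (N : (X -> R) -> R) (s : nat -> X -> R) f (r : nat -> nat) :
  (forall k, (k <= r k)%N) -> Ncvg N s f -> Ncvg N (fun k => s (r k)) f.
Proof.
move=> kr sf e /sf[n0 h]; exists n0 => k hk; apply: h.
exact: leq_trans hk (kr k).
Qed.

(** Truncation keeps the energies of an approximating sequence bounded, though perhaps not
    convergent in energy; Mazur's theorem restores strong convergence, and the hull keeps both the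
    bound $2M$ and the support in [Vn n]. *)
Lemma bounded_appr n (M : R) v : 0 < M -> DV n v -> (\forall x \ae mu, `|v x| <= M) ->
  exists w : nat -> X -> R, [/\ forall k, CV n (w k), forall k x, `|w k x| <= 2 * M,
    Ncvg nE w v & \forall x \ae mu, w ^~ x @ \oo --> v x].
Proof.
move=> M0 Dv vM; have [s [cs sa sv]] := DV_appr Dv; have DDv := DV_DD Dv.
have cE k := CV_CE (cs k); have Ds k := DD_CE (cE k).
have [C C0 hC] := trunc_dbounded M0.
have tD m : D1 m (trunc M) := trunc_D1 m M.
have tdp (r : R) : is_derive r (1 : R) (trunc M) ('D_1 (trunc M) r) := D1_der r (tD 1%N).
have t0 : trunc M 0 = 0 by exact: trunc_at0.
have [K K0 hK] := nE_bounded Ds DDv sv.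
have Lv := DDL2 DDv; have [Lt _] := comp_n2 tD t0 tdp hC Lv.
have tv : (fun x => trunc M (v x)) = v %[ae mu] by apply: filterS vM => x h _; exact: trunc_id.
have ct := comp_cvg tD tdp hC (fun k => DDL2 (Ds k)) Lv (nE_n2 Ds DDv sv).
have ctk k : CV n (fun x => trunc M (s k x)) := Ccoo_in_comp tD t0 (cs k).
have bk k : nE (fun x => trunc M (s k x)) <= C * K.
  by apply: le_trans (nE_comp tD t0 tdp hC (cE k)) _; rewrite ler_wpM2l// ltW.
have ct' := Ncvg2_ae (fun k => DDL2 (DD_CE (CV_CE (ctk k)))) Lt Lv tv ct.
have [_ [w [cw hw wv]]] := DV_maz ctk bk Lv ct'.
have wM k x : `|w k x| <= 2 * M.
  apply: (hw k [set f | forall x, `|f x| <= 2 * M]) => [f g hf hg y|m _ y]; last first.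
    exact: trunc_bounded.
  rewrite /mid; apply: le_trans (ler_normD _ _) _; rewrite !normrM.
  have := hf y; have := hg y; rewrite ger0_norm ?invr_ge0//.
  move: `|f y| `|g y| => a b; lra.
have Dw k := DD_CE (CV_CE (cw k)).
have [r [kr rc]] := L2_ae_subseq (fun k => DDL2 (Dw k)) Lv (nE_n2 Dw DDv wv).
exists (fun k => w (r k)); split=> //; exact: Ncvg_subseq kr wv.
Qed.

Lemma CV_adm n (M : R) f : 0 <= M -> CV n f -> (forall x, `|f x| <= M) -> adm n M f.
Proof.
move=> M0 cf fM; split=> //; last exact: (Ccoo_in_ae cf).1.
  by apply: smooth_meas; exact: Ccoo_smooth (CV_CE cf).
exact: nearW.
Qed.

Section composition2.
Variables (p dp P : R -> R) (C M : R).
Hypotheses (pD : forall n, D1 n p) (p0 : p 0 = 0) (pdp : forall s : R, is_derive s (1 : R) p (dp s))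
  (dpC : forall s, `|dp s| <= C) (PD : forall n, D1 n P) (P0 : P 0 = 0)
  (Pp : forall s : R, is_derive s (1 : R) P (p s)) (M0 : 0 <= M) (pM : forall s, `|p s| <= M).

(** $p(f)\nabla f=\nabla P(f)$, and $P(f)$ is a test function for the divergence condition because
    $P(0)=0$. *)
Lemma bt_CE n f (K : R) : CE f -> adm n K (fun x => p (f x)) -> bt f (fun x => p (f x)) = 0.
Proof.
move=> cf av; have cPf := Ccoo_comp PD P0 cf; rewrite -(hB_div cPf) btE Rint_E.
have mB : mfun ((fun x => dotv (B x) (grad (fun y => P (f y)) x)) \_ E).
  apply: patch_meas; rewrite /dotv; apply: measurable_sum => i; apply: measurable_funM.
    by have [] := hB_loc i.
  rewrite /grad; under eq_fun do rewrite mxE.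
  by apply: measurable_funTS; apply: partial_meas; exact: Ccoo_smooth cPf.
apply: I_eq => //; first exact: (Lfun_measurable (bfun_L1 (DD_CE cf) av)).
have : \forall x \ae mu, forall i, Nb i f x = partial i f x.
  by apply: filter_forall => i; apply: filterS (Nb_CE i cf) => x; apply.
apply: filterS2 ae_E => x Ex h _; rewrite /bfun patch_in// /dotv; apply: eq_bigr => i _.
rewrite h /Bm patch_in// /grad mxE (partial_comp _ _ Pp (Ccoo_smooth cf)); ring.
Qed.

Lemma comp_bt n u : DV n u -> bt u (fun x => p (u x)) = 0.
Proof.
move=> Du; have [s [cs sa su]] := DV_appr Du; have DDu := DV_DD Du.
have Ds k := DD_CE (CV_CE (cs k)).
have [r [kr rc]] := L2_ae_subseq (fun k => DDL2 (Ds k)) (DDL2 DDu) (nE_n2 Ds DDu su).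
have av k : adm n M (fun x => p (s (r k) x)).
  by apply: CV_adm => //; exact: Ccoo_in_comp pD p0 (cs (r k)).
have au : adm n M (fun x => p (u x)).
  split=> //; [|exact: nearW|by apply: filterS (DV_off Du) => x h /h ->].
  by apply: (comp_meas pD); exact: Lfun_measurable (DDL2 DDu).
have cc : \forall x \ae mu, (fun k => p (s (r k) x)) @ \oo --> p (u x).
  apply: filterS rc => x h; apply: continuous_cvg => //; exact: (D1_cont (pD 0)).
have := bt_lim (fun k => Ds (r k)) DDu (Ncvg_subseq kr su) av au cc.
move=> h; apply: (cvgn_uniq h); under eq_fun => k do rewrite (bt_CE (CV_CE (cs (r k))) (av k)).
exact: cvg_cst.
Qed.

(** For test functions $\mathcal E^0(f,p(f))$ is the integral of $p'(f)\langle A\nabla f,\nabla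
    f\rangle$. The compositions $p(s_k)$ are only bounded in energy, so both claims pass to the
    limit through their hulls. *)
Lemma comp_DV n u : DV n u -> DV n (fun x => p (u x)) /\
  ((forall s, 0 <= dp s) -> 0 <= EE u (fun x => p (u x))).
Proof.
move=> Du; have [s [cs sa su]] := DV_appr Du; have DDu := DV_DD Du.
have cE k := CV_CE (cs k); have Ds k := DD_CE (cE k).
have [K K0 hK] := nE_bounded Ds DDu su.
have Lu := DDL2 DDu; have [Lp _] := comp_n2 pD p0 pdp dpC Lu.
have cp := comp_cvg pD pdp dpC (fun k => DDL2 (Ds k)) Lu (nE_n2 Ds DDu su).
have cpk k : CV n (fun x => p (s k x)) := Ccoo_in_comp pD p0 (cs k).
have C0 : 0 <= C := le_trans (normr_ge0 _) (dpC 0).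
have bk k : nE (fun x => p (s k x)) <= C * K.
  by apply: le_trans (nE_comp pD p0 pdp dpC (cE k)) _; rewrite ler_wpM2l.
have [Dp [w [cw hw wp]]] := DV_maz cpk bk Lp cp.
split=> // dp0.
have Dpk k := DD_CE (CV_CE (cpk k)).
have [K' K'0 hK'] := EE_nE.
have Dw k := DD_CE (CV_CE (cw k)).
(* With the first argument frozen at [u], the condition $\mathcal E^0(u,\cdot)\ge-e$ is convex and
   hence passes from the tail of $p(s_m)$ to its hull; replacing $s_m$ by [u] costs at most [e]. *)
have key e : 0 < e -> exists n0, forall k, (n0 <= k)%N -> - e <= EE u (w k).
  move=> e0; have CK : 0 < K' * (C * K + 1) by rewrite mulr_gt0// ltr_wpDl// mulr_ge0// ltW.
  have e1 : 0 < e / (K' * (C * K + 1)) by rewrite divr_gt0.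
  have [n0 h] := su _ e1; exists n0 => k n0k.
  apply: (hw k [set f | DD f /\ - e <= EE u f] _ _).2 => [f g [Df ef] [Dg eg]|m km].
    have D2g : DD (fun x => 2^-1 * g x) := submod_scale 2^-1 DD_submod Dg.
    split; first exact: (submod_lin _ DD_submod Df D2g).
    rewrite /mid (EEr DDu)// (lin_on_scale _ DD_submod (EEr DDu) Dg).
    move: (EE u f) (EE u g) ef eg => a b; lra.
  split=> //; have {}h := h m (leq_trans n0k km).
  have Dd : DD (s m \- u) := submod_sub DD_submod (Ds m) DDu.
  have h1 := hK' _ _ Dd (Dpk m).
  have h2 := pf_comp_ge0 pD p0 pdp dp0 (cE m).
  rewrite -(EE_CE (cE m) (CV_CE (cpk m))) in h2.
  rewrite (lin_on_sub (EEl (Dpk m)) (Ds m) DDu) in h1.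
  have h3 : K' * (nE (s m \- u) * nE (fun x => p (s m x))) <= e.
    apply: (@le_trans _ _ (K' * (C * K + 1) * nE (s m \- u))).
      rewrite -mulrA ler_pM2l// mulrC ler_wpM2r ?sn_ge0//.
      by apply: le_trans (bk m) _; rewrite lerDl.
    by rewrite mulrC -ler_pdivlMr// ltW.
  move: h1; rewrite ler_norml => /andP[_ h1].
  move: h1 h2 h3; move: (EE _ _) (EE _ _) (K' * _) => a b c; lra.
apply: le_eps => e e0.
have h := EE_cvgr DDu Dw (DV_DD Dp) wp; have [n0 hn] := key e e0.
have h' := cvgr_mulc (c := -1) h.
have : -1 * EE u (fun x => p (u x)) <= e.
  by apply: cvgr_ub h' _; exists n0 => k /hn; rewrite mulN1r; lra.
by rewrite mulN1r; lra.
Qed.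

End composition2.

(** The antisymmetry of the drift on its diagonal, with $P(s)=s^2/2$. The identity is an unbounded
    [p], so uniformly bounded approximants are needed. *)
Lemma bt_self n (M : R) w : DV n w -> (\forall x \ae mu, `|w x| <= M) -> bt w w = 0.
Proof.
move=> Dw wM; pose M' := `|M| + 1.
have M'0 : 0 < M' by rewrite ltr_wpDl.
have wM' : \forall x \ae mu, `|w x| <= M'.
  by apply: filterS wM => x h; apply: le_trans h _; rewrite /M' ler_wpDr// ler_norm.
have [s [cs sM sw cw]] := bounded_appr M'0 Dw wM'; have DDw := DV_DD Dw.
have Ds k := DD_CE (CV_CE (cs k)).
have M2 : 0 <= 2 * M' by rewrite mulr_ge0// ltW.
have av k : adm n (2 * M') (s k) by exact: CV_adm.
have aw : adm n (2 * M') w.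
  by apply: DV_adm => //; apply: filterS wM' => x h; apply: le_trans h _; lra.
have h := bt_lim Ds DDw sw av aw cw; apply: (cvgn_uniq h).
have PD m : D1 m (fun r : R => 2^-1 * (r * r)).
  apply: Cn_mul; first exact: Cn_cst.
  by apply: Cn_mul; exact: D1_id.
have Pp (r : R) : is_derive r (1 : R) (fun r : R => 2^-1 * (r * r)) r.
  by apply: is_derive_eq; rewrite /GRing.scale/=; field.
under eq_fun => k do rewrite (bt_CE (p := id) (P := fun r => 2^-1 * (r * r)) PD _ Pp (CV_CE (cs k)) (av k)) ?mulr0//.
exact: cvg_cst.
Qed.

Lemma bounded_int (f v : X -> R) (v_ : nat -> X -> R) (M : R) : L1 f -> mfun v ->
  (forall k, mfun (v_ k)) -> (forall k x, `|v_ k x| <= M) ->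
  (\forall x \ae mu, v_ ^~ x @ \oo --> v x) ->
  L1 (fun x => f x * v x) /\ (fun k => Int (fun x => f x * v_ k x)) @ \oo --> Int (fun x => f x * v x).
Proof.
move=> Lf mv mvk vM cv; have mf := Lfun_measurable Lf.
have [] := dominated_cvgR (u := fun k x => f x * v_ k x) (f := fun x => f x * v x)
  (g := fun x => `|M| * `|f x|) (mu := mu).
- by move=> k; exact: measurable_funM.
- exact: measurable_funM.
- by apply: L1_scale; exact: L1_abs.
- by apply: filterS cv => x h; exact: cvgr_mulc.
- apply: nearW => x k; rewrite normrM mulrC ler_wpM2r//.
  by apply: le_trans (vM k x) _; exact: ler_norm.
- by [].
Qed.

(** * Realizations of L on relatively compact sets *)

(* [u] lies in the domain of the L^1-realization of [L] on [Vn n] and is mapped to [g]. *)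
Definition sol n u g := [/\ DV n u, L1 g &
  forall v, CV n v -> EE u v - bt u v = - Int (fun x => g x * v x)].

(** Along the bounded approximants of [v] the form converges by energy, the drift and the right-hand
    side by dominated convergence. *)
Lemma sol_ext n u g v (M : R) : sol n u g -> DV n v -> (\forall x \ae mu, `|v x| <= M) ->
  EE u v - bt u v = - Int (fun x => g x * v x).
Proof.
move=> [Du Lg ug] Dv vM; pose M' := `|M| + 1.
have M'0 : 0 < M' by rewrite ltr_wpDl.
have vM' : \forall x \ae mu, `|v x| <= M'.
  by apply: filterS vM => x h; apply: le_trans h _; rewrite /M' ler_wpDr// ler_norm.
have [s [cs sM sv cv]] := bounded_appr M'0 Dv vM'; have DDv := DV_DD Dv; have DDu := DV_DD Du.
have Ds k := DD_CE (CV_CE (cs k)).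
have M2 : 0 <= 2 * M' by rewrite mulr_ge0// ltW.
have av k : adm n (2 * M') (s k) by exact: CV_adm.
have aw : adm n (2 * M') v.
  by apply: DV_adm => //; apply: filterS vM' => x h; apply: le_trans h _; lra.
have mv : mfun v := Lfun_measurable (DDL2 DDv).
have ms k : mfun (s k) by have [] := av k.
have [_ h1] := bounded_int Lg mv ms sM cv.
have h2 := EE_cvgr DDu Ds DDv sv.
have h3 := bt_cvgr DDu av aw cv.
have h4 := cvgr_add h2 (cvgr_mulc (c := -1) h3).
apply: (cvgn_uniq (s := fun k => - Int (fun x => g x * s k x))).
  by have := h4; rewrite mulN1r; apply: cvgr_ext => k; rewrite mulN1r; exact: ug.
by have := cvgr_mulc (c := -1) h1; rewrite mulN1r; apply: cvgr_ext => k; rewrite mulN1r.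
Qed.

Lemma sol_lin n (c : R) u g u' g' : sol n u g -> sol n u' g' ->
  sol n (fun x => c * u x + u' x) (fun x => c * g x + g' x).
Proof.
move=> [Du Lg ug] [Du' Lg' ug']; split.
- exact: (submod_lin _ (DV_submod n) Du Du').
- exact: L1_lin.
- move=> v cv; have Dv := DD_CE (CV_CE cv); have [M M0 vM] := Ccoo_bdd (CV_CE cv).
  have av := CV_adm M0 cv vM.
  rewrite (EEl Dv c (DV_DD Du) (DV_DD Du')) (bt_linl c (DV_DD Du) (DV_DD Du') av).
  have mv : mfun v by case: av.
  have vM' : \forall x \ae mu, `|v x| <= M by exact: nearW.
  have h1 := ug v cv; have h2 := ug' v cv.
  have Lgv := L1_mulB Lg mv vM'; have Lgv' := L1_mulB Lg' mv vM'.
  rewrite (_ : Int _ = c * Int (fun x => g x * v x) + Int (fun x => g' x * v x)); last first.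
    by rewrite -I_lin//; congr Rintegral; apply/funext => x; ring.
  move: h1 h2; move: (EE u v) (EE u' v) (bt u v) (bt u' v) (Int _) (Int _) => a b e f k l h1 h2.
have -> : l = e - a by lra.
have -> : k = f - b by lra.
ring.
Qed.

Lemma sol0 n : sol n (cst 0) (cst 0).
Proof.
split; [exact: CV_DV (Ccoo_in0 _)|exact: L1_0|move=> v cv].
have Dv := DD_CE (CV_CE cv); have [M M0 vM] := Ccoo_bdd (CV_CE cv).
have av := CV_adm M0 cv vM; have D0 := DD_CE Ccoo0.
rewrite (lin_on0 DD_submod (EEl Dv)).
have := bt_linl 1 D0 D0 av; rewrite (_ : (fun x : X => _) = cst 0); last first.
  by apply/funext => x /=; rewrite mulr0 addr0.
rewrite (_ : Int _ = 0); first by lra.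
by rewrite (_ : (fun x => _) = cst 0) ?Rintegral_cst ?mul0r//; apply/funext => x /=; rewrite mul0r.
Qed.

(** * The comparison inequality for positive parts *)

Definition pos (t : R) := (t + `|t|) / 2.

Lemma pos_ge0 t : 0 <= pos t.
Proof. by rewrite /pos divr_ge0//; have := ler_norm (- t); rewrite normrN; lra. Qed.

Lemma pos_ge t : t <= pos t.
Proof. by rewrite /pos; have := ler_norm t; lra. Qed.

Lemma pos_id t : 0 <= t -> pos t = t.
Proof. by move=> t0; rewrite /pos ger0_norm//; lra. Qed.

Lemma pos_le0 t : t <= 0 -> pos t = 0.
Proof. by move=> t0; rewrite /pos ler0_norm//; lra. Qed.

Lemma pos_le t : pos t <= `|t|.
Proof. by rewrite /pos; have := ler_norm t; lra. Qed.

Lemma pos_shift (t c : R) : 0 <= c -> pos (t - c) <= `|t|.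
Proof.
move=> c0; have [h|h] := leP (t - c) 0; first by rewrite pos_le0.
by rewrite (pos_id (ltW h)); have := ler_norm t; lra.
Qed.

Lemma pos_lip s t : `|pos s - pos t| <= `|s - t|.
Proof.
rewrite /pos (_ : _ - _ = ((s - t) + (`|s| - `|t|)) / 2); last by field.
rewrite normrM (ger0_norm (_ : 0 <= 2^-1))// ler_pdivrMr// mulr_natr mulr2n.
by apply: le_trans (ler_normD _ _) _; rewrite lerD2l; exact: ler_dist_dist.
Qed.

Lemma pos_meas f : mfun f -> mfun (fun x => pos (f x)).
Proof.
move=> mf; apply: measurable_funM => //; apply: measurable_funD => //.
exact: measurableT_comp.
Qed.

Lemma pos_L1 f c : 0 <= c -> L1 f -> L1 (fun x => pos (f x - c)).
Proof.
move=> c0 Lf; apply: (L1_dom _ _ (L1_abs Lf)).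
  by apply: pos_meas; apply: measurable_funB => //; exact: Lfun_measurable Lf.
by apply: nearW => x; rewrite ger0_norm ?pos_ge0// pos_shift.
Qed.

Lemma phi_cvg1 (t : R) : 0 < t -> (fun k : nat => phi (k.+1%:R * t)) @ \oo --> (1 : R).
Proof.
move=> t0; apply: (cvgr_dist0 (r := fun k => t^-1 * k.+1%:R^-1)) => [k|].
  have kt : 0 < k.+1%:R * t by rewrite mulr_gt0.
  rewrite distrC ger0_norm ?subr_ge0 ?phi_le1// -invfM [t * _]mulrC.
  rewrite phi_gt0E//; set y := (_ * t)^-1.
  have y0 : 0 < y by rewrite invr_gt0.
  have h := expR_ge1Dx (- y).
  have : expR (- y) <= (1 + y) * expR (- y) by rewrite ler_peMl ?expR_ge0// lerDl ltW.
  by move: h; lra.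
rewrite -(mulr0 t^-1); apply: cvgr_mulc; apply/cvgr_epsP => e e0.
have [n0 h] := inv_small e0; exists n0 => n /h; rewrite subr0 ger0_norm//.
Qed.

(** Tested with smooth approximations of the indicator of $\{u>c\}$, the drift vanishes and the form
    is nonnegative, whence $\int_{\{u>c\}}g\,d\mu\le0$. *)
Lemma star n u g (h c : R) : sol n u g -> 0 < h -> 0 <= c ->
  Int (fun x => pos (u x - c)) <= Int (fun x => pos (u x - h * g x - c)).
Proof.
move=> ug h0 c0; have [Du Lg eq] := ug.
have [C C0 hC] := @dphi_bounded R.
have Lu := DV_L1 Du; have mu_ := Lfun_measurable Lu.
have mS : measurable [set x | c < u x].
  have := mu_ measurableT `]c, +oo[%classic; rewrite setTI; move=> /(_ (measurable_itv _)).
  by congr measurable; apply/seteqP; split=> x /=; rewrite in_itv/= andbT.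
pose chi : X -> R := \1_[set x | c < u x].
have mchi : mfun chi := ind_meas mS.
(* Since $c\ge0$, [p k] vanishes at the origin and composition with it preserves [DV n]; as [k]
   grows, it tends to the indicator of $(c,\infty)$. *)
pose p (k : nat) s := phi (k.+1%:R * s + (- (k.+1%:R * c)) : R).
have step k : Int (fun x => g x * p k (u x)) <= 0.
  pose K : R := k.+1%:R; have K0 : 0 < K by rewrite ltr0n.
  have pD m : D1 m (p k) by apply: D1_comp; [exact: phi_D1|exact: D1_affine].
  have arg0 : K * 0 + - (K * c) <= 0 by rewrite mulr0 add0r oppr_le0 mulr_ge0// ltW.
  have p0 : p k 0 = 0 by rewrite /p phi_le0.
  have daff (s : R) : is_derive s (1 : R) (fun s => K * s + - (K * c)) K.
    by apply: is_derive_eq; rewrite /GRing.scale/=; ring.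
  have pdp (s : R) : is_derive s (1 : R) (p k) (dphi (K * s + - (K * c)) * K).
    by apply: (is_derive_comp1 (phi_der _) (daff s)).
  have dpC s : `|dphi (K * s + - (K * c)) * K| <= C * K.
    by rewrite normrM (gtr0_norm K0) ler_wpM2r// ltW.
  pose P s := K^-1 * Phi (K * s + - (K * c)).
  have PD m : D1 m P.
    apply: Cn_mul; first exact: Cn_cst.
    by apply: D1_comp; [exact: Phi_D1|exact: D1_affine].
  have P0 : P 0 = 0.
    by rewrite /P Phi_le0// mulr0.
  have Pp (s : R) : is_derive s (1 : R) P (p k s).
    have h1 := is_derive_comp1 (Phi_der _) (daff s).
    by apply: is_derive_eq; rewrite /GRing.scale/= /p -/K; field; rewrite gt_eqF.
  have dp0 s : 0 <= dphi (K * s + - (K * c)) * K by rewrite mulr_ge0 ?dphi_ge0// ltW.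
  have pM (s : R) : `|p k s| <= 1 by exact: phi_bound.
  have [Dp Epos] := comp_DV pD p0 pdp dpC Du.
  have b0 := comp_bt pD p0 PD P0 Pp ler01 pM Du.
  have pMae : \forall x \ae mu, `|p k (u x)| <= 1 by exact: nearW.
  by have := sol_ext ug Dp pMae; rewrite b0 subr0; have := Epos dp0; lra.
have pc x : (fun k => p k (u x)) @ \oo --> chi x.
  have arg k : p k (u x) = phi (k.+1%:R * (u x - c)) by rewrite /p mulrBr.
  under eq_fun do rewrite arg; rewrite /chi; have [uc|uc] := ltP c (u x).
    by rewrite ind1//; apply: phi_cvg1; rewrite subr_gt0.
  rewrite ind0//=; last by apply/negP; rewrite -leNgt.
  under eq_fun do rewrite phi_le0 ?mulr_ge0_le0 ?subr_le0//.
  exact: cvg_cst.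
have mp k : mfun (fun x => p k (u x)).
  apply: (measurableT_comp (f := p k)) => //; apply: continuous_measurable_fun.
  by apply: (@D1_cont _ 0%N); apply: D1_comp; [exact: phi_D1|exact: D1_affine].
have [Lgc hc] := bounded_int (M := 1) Lg mchi mp (fun k x => phi_bound _) (nearW _ pc).
have neg : Int (fun x => g x * chi x) <= 0.
  by apply: cvgr_ub hc _; exists 0%N => k _; exact: step.
have Lf : L1 (fun x => u x - h * g x) by apply: L1_sub => //; exact: L1_scale.
have Lp := pos_L1 c0 Lf.
(* Pointwise, $(u-c)^+\le hg\,1_{\{u>c\}}+(u-hg-c)^+$. *)
apply: (@le_trans _ _ (h * Int (fun x => g x * chi x) + Int (fun x => pos (u x - h * g x - c)))).
  rewrite -I_lin//; apply: I_le; [exact: pos_L1|exact: L1_lin|].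
  apply: nearW => x; rewrite /chi; have [uc|uc] := ltP c (u x).
    rewrite ind1// mulr1 pos_id; last by rewrite subr_ge0 ltW.
    by have := pos_ge (u x - h * g x - c); lra.
  by rewrite pos_le0 ?subr_le0// ind0 ?mulr0 ?add0r ?pos_ge0//; apply/negP; rewrite -leNgt.
have : h * Int (fun x => g x * chi x) <= 0 by rewrite pmulr_rle0.
by lra.
Qed.

Lemma n1_pos u f : L1 u -> L1 f -> Int (fun x => pos (u x)) <= Int (fun x => pos (f x)) ->
  Int (fun x => pos (- u x)) <= Int (fun x => pos (- f x)) -> n1 u <= n1 f.
Proof.
have L0 (w : X -> R) : L1 w -> L1 (fun x => pos (w x)).
  by move=> Lw; apply: Lfun_ext (pos_L1 (lexx 0) Lw) => x; rewrite subr0.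
have LN (w : X -> R) : L1 w -> L1 (fun x => - w x).
  by move=> Lw; apply: Lfun_ext (L1_scale (-1) Lw) => x; rewrite mulN1r.
have nE (w : X -> R) : L1 w -> n1 w = Int (fun x => pos (w x)) + Int (fun x => pos (- w x)).
  move=> Lw; rewrite -I_add; [|exact: L0|by apply: L0; exact: LN].
  congr Rintegral; apply/funext => x; by rewrite /pos normrN; field.
by move=> Lu Lf h1 h2; rewrite !nE//; exact: lerD.
Qed.

Lemma sol_diss n u g (h : R) : sol n u g -> 0 < h -> n1 u <= n1 (fun x => u x - h * g x).
Proof.
move=> ug h0; have [Du Lg _] := ug; have Lu := DV_L1 Du.
have Lf : L1 (fun x => u x - h * g x) by apply: L1_sub => //; exact: L1_scale.
have z (w : X -> R) : Int (fun x => pos (w x - 0)) = Int (fun x => pos (w x)).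
  by congr Rintegral; apply/funext => x; rewrite subr0.
apply: n1_pos => //.
  by have := star ug h0 (lexx 0); rewrite !z.
have := star (sol_lin (-1) ug (sol0 n)) h0 (lexx 0); rewrite !z.
rewrite (_ : (fun x => pos (-1 * u x + cst 0 x)) = (fun x => pos (- u x))); last first.
  by apply/funext => x /=; rewrite mulN1r addr0.
rewrite (_ : (fun x => pos (-1 * u x + cst 0 x - h * (-1 * g x + cst 0 x))) =
  (fun x => pos (- (u x - h * g x))))//.
by apply/funext => x /=; congr pos; ring.
Qed.

(** * Local resolvents: existence and monotonicity *)

Lemma DV_ip n : semi_ip (DV n) (s1 mu pf CE).
Proof.
have [HD l s p] := s1ip; split.
- exact: DV_submod.
- by move=> v Dv c f g Df Dg; exact: (l v (DV_DD Dv) c f g (DV_DD Df) (DV_DD Dg)).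
- by move=> u v Du Dv; exact: (s u v (DV_DD Du) (DV_DD Dv)).
- by move=> u Du; apply: p; exact: DV_DD Du.
Qed.

Lemma DV_complete n : Ncomplete (DV n) nE.
Proof.
move=> s Ds cs; have DDs k := DV_DD (Ds k).
have [f Df sf] := DD_complete pf_good h_sector h_closable DDs cs.
have /choice[g hg] : forall k : nat, exists g, CV n g /\ nE (g \- s k) < k.+1%:R^-1.
  move=> k; have k0 : 0 < k.+1%:R^-1 :> R by rewrite invr_gt0.
  by have [r [cr _ rs]] := DV_appr (Ds k); have [m hm] := rs _ k0; exists (r m); split; [|exact: hm].
have cg k : CV n (g k) := (hg k).1.
have Dg k := DD_CE (CV_CE (cg k)).
exists f => //; apply: (DV_of cg Df) => e e0; have e2 : 0 < e / 2 by lra.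
have [n1' h1] := inv_small e2; have [n2' h2] := sf _ e2.
exists (maxn n1' n2') => k; rewrite geq_max => /andP[/h1 a /h2 b].
have := Nd_tri nE_sn (Dg k) (DDs k) Df; have := (hg k).2.
move: (k.+1%:R^-1) a => r a; lra.
Qed.

Lemma sol_exists n f (h : R) : L1 f -> L2 f -> 0 < h ->
  exists u, sol n u (fun x => h^-1 * (u x - f x)).
Proof.
move=> Lf1 Lf h0; have hi0 : 0 < h^-1 by rewrite invr_gt0.
pose b u v := EE u v - bt u v + h^-1 * Int (fun x => u x * v x).
pose l v := h^-1 * Int (fun x => f x * v x).
have CVadm v : CV n v -> exists M, adm n M v.
  by move=> cv; have [M M0 vM] := Ccoo_bdd (CV_CE cv); exists M; exact: CV_adm.
have CVDD v : CV n v -> DD v by move=> cv; exact: DD_CE (CV_CE cv).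
have CVDV : CV n `<=` DV n by move=> v; exact: CV_DV.
have b1 v : CV n v -> linear_on (DV n) (b^~ v).
  move=> cv c u u' Du Du'; have [M av] := CVadm v cv.
  have Dv := CVDD v cv.
  rewrite /b (EEl Dv c (DV_DD Du) (DV_DD Du')) (bt_linl c (DV_DD Du) (DV_DD Du') av).
  rewrite (_ : Int _ = c * Int (fun x => u x * v x) + Int (fun x => u' x * v x)).
    by move: (EE u v) (EE u' v) (bt u v) (bt u' v) (Int _) (Int _) => a1 a2 a3 a4 a5 a6; ring.
  rewrite -I_lin; [|exact: L2_mul (DDL2 (DV_DD Du)) (DDL2 Dv)|exact: L2_mul (DDL2 (DV_DD Du')) (DDL2 Dv)].
  by congr Rintegral; apply/funext => x; ring.
have b2 v : CV n v -> exists Cv, forall u, DV n u -> `|b u v| <= Cv * nE u.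
  move=> cv; have [M av] := CVadm v cv; have Dv := CVDD v cv; have [K K0 hK] := EE_nE.
  exists (K * nE v + M * CB n + h^-1 * n2 v) => u /DV_DD Du.
  rewrite /b; apply: le_trans (ler_normD _ _) _.
  have i1 := hK _ _ Du Dv; have i2 := bt_bound Du av.
  have i3 : `|h^-1 * Int (fun x => u x * v x)| <= h^-1 * n2 v * nE u.
    rewrite normrM gtr0_norm// -mulrA ler_pM2l//; apply: le_trans (n2_CS (DDL2 Du) (DDL2 Dv)) _.
    by rewrite mulrC ler_wpM2l ?n2_ge0//; exact: n2_nE.
  have := ler_normB (EE u v) (bt u v).
  rewrite !mulrDl (_ : K * nE v * nE u = K * (nE u * nE v)); last by rewrite -mulrA [nE v * _]mulrC.
  move: i1 i2 i3; move: `|EE u v - _| `|EE u v| `|bt u v| `|h^-1 * _| (K * _) (_ * nE u) (_ * nE u).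
  by move=> a1 a2 a3 a4 a5 a6 a7; lra.
have b3 u : DV n u -> linear_on (CV n) (b u).
  move=> /DV_DD Du c v v' cv cv'; have [M av] := CVadm v cv; have [M' av'] := CVadm v' cv'.
  have Dv := CVDD v cv; have Dv' := CVDD v' cv'.
  rewrite /b (EEr Du c Dv Dv') (bt_linr c Du av av').
  rewrite (_ : Int _ = c * Int (fun x => u x * v x) + Int (fun x => u x * v' x)); first ring.
  rewrite -I_lin; [|exact: L2_mul (DDL2 Du) (DDL2 Dv)|exact: L2_mul (DDL2 Du) (DDL2 Dv')].
  by congr Rintegral; apply/funext => x; ring.
(* $(1+h)^{-1}$ lies below both 1 and $h^{-1}$, the coefficients of the energy and of the $L^2$
   part. *)
pose c : R := (1 + h)^-1.
have c0 : 0 < c by rewrite invr_gt0 addr_gt0.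
have b4 v : CV n v -> c * s1 mu pf CE v v <= b v v.
  move=> cv; have [M M0 vM] := Ccoo_bdd (CV_CE cv).
  have vMae : \forall x \ae mu, `|v x| <= M by exact: nearW.
  rewrite /b (bt_self (CV_DV cv) vMae) subr0 s1E.
  have -> : Int (fun x => v x * v x) = n2 v ^+ 2.
    by rewrite n2_sqr; congr Rintegral; apply/funext => x; rewrite expr2.
  rewrite mulrDr; apply: lerD.
    apply: ler_piMl; first exact: (E_ge0 pf_good h_sector h_closable (CVDD v cv)).
    by rewrite invf_le1 ?lerDl ?ltW// addr_gt0.
  by rewrite ler_wpM2r ?sqr_ge0// lef_pV2 ?posrE ?addr_gt0// lerDr.
have l1 : linear_on (CV n) l.
  move=> k v v' cv cv'; rewrite /l.
  rewrite (_ : Int _ = k * Int (fun x => f x * v x) + Int (fun x => f x * v' x)); first ring.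
  have Lv := DDL2 (CVDD v cv); have Lv' := DDL2 (CVDD v' cv').
  rewrite -I_lin; [|exact: L2_mul|exact: L2_mul].
  by congr Rintegral; apply/funext => x; ring.
have l2 v : CV n v -> `|l v| <= (h^-1 * n2 f) * nE v.
  move=> cv; have Dv := CVDD v cv; rewrite /l normrM gtr0_norm// -mulrA ler_pM2l//.
  apply: le_trans (n2_CS Lf (DDL2 Dv)) _.
  by rewrite ler_wpM2l ?n2_ge0//; exact: n2_nE.
have [u Du hu] := lions (DV_ip n) (@DV_complete n) (Ccoo_in_submod (Vn n)) CVDV b1 b2 b3 c0 b4 l1 l2.
have Lu := DV_L1 Du.
exists u; split=> //; first by apply: L1_scale; exact: L1_sub.
move=> v cv; have := hu v cv; rewrite /b /l.
have Lv := DDL2 (CVDD v cv).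
have -> : Int (fun x => h^-1 * (u x - f x) * v x) =
    h^-1 * Int (fun x => u x * v x) - h^-1 * Int (fun x => f x * v x).
  have Luv := L2_mul (DDL2 (DV_DD Du)) Lv; have Lfv := L2_mul Lf Lv.
  rewrite -mulrBr -I_sub// -I_scale; last exact: L1_sub.
  by congr Rintegral; apply/funext => x; ring.
move: (EE u v) (bt u v) (Int _) (Int _) => a b' e e'; lra.
Qed.

Lemma mul_cvg (s r : nat -> X -> R) f g (M : R) : 0 <= M -> (forall k, L2 (s k)) ->
  (forall k, L2 (r k)) -> L2 f -> L2 g -> (forall k x, `|s k x| <= M) -> (forall x, `|g x| <= M) ->
  Ncvg n2 s f -> Ncvg n2 r g ->
  L2 (fun x => f x * g x) /\ Ncvg n2 (fun k x => s k x * r k x) (fun x => f x * g x).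
Proof.
move=> M0 Ls Lr Lf Lg sM gM sf rg.
have [Lfg _] := n2_mulB M0 (Lfun_measurable Lg) Lf gM.
split=> // e e0; have M1 : 0 < M + 1 by lra.
have e1 : 0 < e / 2 / (M + 1) by rewrite !divr_gt0.
have [n1' h1] := sf _ e1; have [n2' h2] := rg _ e1.
exists (maxn n1' n2') => k; rewrite geq_max => /andP[/h1 a /h2 b'].
have La := L2_sub (Ls k) Lf; have Lb := L2_sub (Lr k) Lg.
have [L1' i1] := n2_mulB M0 (Lfun_measurable Lg) La gM.
have [L2' i2] := n2_mulB M0 (Lfun_measurable (Ls k)) Lb (sM k).
rewrite (_ : _ \- _ = (fun x => (s k x - f x) * g x) \+ (fun x => (r k x - g x) * s k x)); last first.
  by apply/funext => x /=; ring.
apply: le_lt_trans (N_add (n2_seminorm mu) L1' L2') _.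
have j (t : R) : 0 <= t -> t < e / 2 / (M + 1) -> M * t < e / 2.
  move=> t0; rewrite ltr_pdivlMr// => ht; apply: le_lt_trans ht.
  by rewrite mulrC ler_wpM2l// lerDl.
have := j _ (n2_ge0 _ _) a; have := j _ (n2_ge0 _ _) b'.
move: i1 i2; rewrite [X in _ + X < _]/=; lra.
Qed.

Lemma sol_ge0 n u f (h : R) : 0 < h -> L1 f -> sol n u (fun x => h^-1 * (u x - f x)) ->
  (\forall x \ae mu, 0 <= f x) -> \forall x \ae mu, 0 <= u x.
Proof.
move=> h0 Lf us f0; have Lu := DV_L1 (let: And3 a _ _ := us in a).
have Lnu : L1 (fun x => - u x) by apply: Lfun_ext (L1_scale (-1) Lu) => x; rewrite mulN1r.
have := star (sol_lin (-1) us (sol0 n)) h0 (lexx 0).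
rewrite (_ : (fun x => pos (-1 * u x + cst 0 x - 0)) = (fun x => pos (- u x))); last first.
  by apply/funext => x /=; congr pos; ring.
rewrite (_ : (fun x => pos (-1 * u x + cst 0 x - h * (-1 * (h^-1 * (u x - f x)) + cst 0 x) - 0)) =
  (fun x => pos (- f x))); last first.
  apply/funext => x /=; by congr pos; field; rewrite gt_eqF.
have Lp : L1 (fun x => pos (- u x)) by apply: Lfun_ext (pos_L1 (lexx 0) Lnu) => x; rewrite subr0.
rewrite [leRHS](@I_eq _ _ _ _ _ (cst 0)).
- rewrite Rintegral_cst// mul0r => le0.
  have : Int (fun x => `|pos (- u x)|) = 0.
    apply/eqP; rewrite eq_le; apply/andP; split.
      by rewrite (_ : (fun x => _) = (fun x => pos (- u x)))//; apply/funext => x; rewrite ger0_norm// pos_ge0.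
    by apply: I_ge0; [exact: Lfun_measurable (L1_abs Lp)|exact: nearW].
  move/(I_abs0 Lp); apply: filterS => x /(_ I) /= hx.
  by have := pos_ge (- u x); rewrite hx oppr_le0.
- by apply: pos_meas; apply: measurableT_comp => //; exact: Lfun_measurable Lf.
- exact: measurable_cst.
- by apply: filterS f0 => x fx _; rewrite pos_le0// oppr_le0.
Qed.

(** The difference of the equations is to be tested with $p(w)$, $w=u-u'$, where [p] vanishes up to
    a level [dl]. The equation of [u] admits only elements of [DV n], while [w] lies in [DV m]. As
    $u'\ge0$, the set $\{w>dl\}$ is contained in $\{u>dl\}$, so $p(w)=q(u)p(w)$ for a cut-off [q]
    that is one from [dl] on, and the factor $q(u)$ brings the product into [DV n]. *)
Lemma sol_mono n m u u' f (h : R) : (n <= m)%N -> 0 < h -> L1 f -> (\forall x \ae mu, 0 <= f x) ->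
  sol n u (fun x => h^-1 * (u x - f x)) -> sol m u' (fun x => h^-1 * (u' x - f x)) ->
  \forall x \ae mu, u x <= u' x.
Proof.
move=> nm h0 Lf f0 us us'; have u'0 := sol_ge0 h0 Lf us' f0.
have hi0 : 0 < h^-1 by rewrite invr_gt0.
have [Du Lg _] := us; have [Du' Lg' _] := us'; have Du_m := DV_mono nm Du.
pose w := u \- u'.
have Dw : DV m w := submod_sub (DV_submod m) Du_m Du'.
have Lw := DV_L1 Dw.
suff key (k : nat) : \forall x \ae mu, w x <= k.+1%:R^-1.
  apply: filterS (ae_foralln key) => x hx; rewrite -subr_le0.
  apply: le_eps => e e0; have [n0 hn] := inv_small e0.
  by rewrite add0r; apply: le_trans (hx n0) _; apply: ltW; exact: hn.
pose dl : R := k.+1%:R^-1; have dl0 : 0 < dl by rewrite invr_gt0.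
have [C C0 hC] := @dphi_bounded R.
pose p s : R := phi (1 * s + (- dl)).
have pD a : D1 a p by apply: D1_comp; [exact: phi_D1|exact: D1_affine].
have p0 : p 0 = 0 by rewrite /p phi_le0// mulr0 add0r oppr_le0 ltW.
have daff (a b s : R) : is_derive s (1 : R) (fun s => a * s + b) a.
  by apply: is_derive_eq; rewrite /GRing.scale/=; ring.
have pdp (s : R) : is_derive s (1 : R) p (dphi (1 * s + - dl) * 1).
  by apply: (is_derive_comp1 (phi_der _) (daff _ _ s)).
have dpC (s : R) : `|dphi (1 * s + - dl) * 1| <= C by rewrite mulr1.
pose P s : R := Phi (1 * s + - dl).
have PD a : D1 a P by apply: D1_comp; [exact: Phi_D1|exact: D1_affine].
have P0 : P 0 = 0 by rewrite /P Phi_le0// mulr0 add0r oppr_le0 ltW.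
have Pp (s : R) : is_derive s (1 : R) P (p s).
  by have := is_derive_comp1 (Phi_der _) (daff 1 (- dl) s); rewrite mulr1.
have dp0 (s : R) : 0 <= dphi (1 * s + - dl) * 1 by rewrite mulr1 dphi_ge0.
have pM (s : R) : `|p s| <= 1 by exact: phi_bound.
have [Dpm Epos] := comp_DV pD p0 pdp dpC Dw.
have b0 := comp_bt pD p0 PD P0 Pp ler01 pM Dw.
(* [theta], rescaled to vanish at zero and to equal one from [dl] on. *)
pose q s : R := theta (dl^-1 * s + 0).
pose c1 : R := phi 1; have c10 : 0 < c1 by exact: phi_gt0.
have qD a : D1 a q by apply: D1_comp; [exact: theta_D1|exact: D1_affine].
have q0 : q 0 = 0 by rewrite /q mulr0 addr0 theta0.
have [Cq Cq0 hCq] : exists2 Cq : R, 0 < Cq & forall s, `|'D_1 q s| <= Cq.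
  have [C' C'0 hC'] := @theta_dbounded R.
  exists (C' * dl^-1) => [|s]; first by rewrite mulr_gt0// invr_gt0.
  have -> : 'D_1 q s = dphi (1 - (dl^-1 * s + 0)) / phi 1 * dl^-1.
    have hd := is_derive_comp1 (theta_der _) (daff dl^-1 0 s).
    exact: (@derive_val _ _ _ _ _ _ _ hd).
  rewrite normrM (gtr0_norm (_ : 0 < dl^-1)) ?invr_gt0//.
  by rewrite ler_pM2r ?invr_gt0.
have qdq (s : R) : is_derive s (1 : R) q ('D_1 q s) := D1_der s (qD 1%N).
pose M : R := 1 + c1^-1; have M1 : 1 <= M by rewrite lerDl invr_ge0 ltW.
have M0 : 0 <= M by lra.
have qM (s : R) : `|q s| <= M.
  exact: theta_bounded.
have pM' (s : R) : `|p s| <= M by apply: le_trans (pM s) _.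
have [a_ [ca aa au]] := DV_appr Du; have [b_ [cb bb bw]] := DV_appr Dw.
have DDu := DV_DD Du; have DDw := DV_DD Dw.
have Da (i : nat) := DD_CE (CV_CE (ca i)); have Db (i : nat) := DD_CE (CV_CE (cb i)).
have cqa (i : nat) : CV n (fun x => q (a_ i x)) := Ccoo_in_comp qD q0 (ca i).
have cpb (i : nat) : CV m (fun x => p (b_ i x)) := Ccoo_in_comp pD p0 (cb i).
(* The first factor confines the support to [Vn n]; the products have bounded energy and converge in
   $L^2$, so Mazur's theorem puts their limit into [DV n]. *)
pose v_ (i : nat) x := q (a_ i x) * p (b_ i x).
have cv (i : nat) : CV n (v_ i) := Ccoo_in_mul (cqa i) (Ccoo_smooth (CV_CE (cpb i))).
have [Ka Ka0 hKa] := nE_bounded Da DDu au; have [Kb Kb0 hKb] := nE_bounded Db DDw bw.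
pose K2 := 2 * M ^+ 2 * ((Cq * Ka) ^+ 2 + (C * Kb) ^+ 2).
have K20 : 0 <= K2.
  by apply: mulr_ge0; [apply: mulr_ge0 => //; exact: sqr_ge0|apply: addr_ge0; exact: sqr_ge0].
have vK (i : nat) : nE (v_ i) <= Num.sqrt K2.
  rewrite -(ler_pXn2r (n := 2))// ?nnegrE ?sn_ge0 ?sqrtr_ge0// (sqr_sqrtr K20).
  have h1 := nE_mul (CV_CE (cqa i)) (CV_CE (cpb i)) (fun x => qM (a_ i x)) (fun x => pM' (b_ i x)).
  apply: le_trans h1 _.
  rewrite ler_wpM2l ?mulr_ge0 ?sqr_ge0//.
  have j1 : nE (fun x => q (a_ i x)) <= Cq * Ka.
    by apply: le_trans (nE_comp qD q0 qdq hCq (CV_CE (ca i))) _; rewrite ler_wpM2l// ltW.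
  have j2 : nE (fun x => p (b_ i x)) <= C * Kb.
    by apply: le_trans (nE_comp pD p0 pdp dpC (CV_CE (cb i))) _; rewrite ler_wpM2l// ltW.
  by apply: lerD; apply: sqr_le; rewrite !ger0_norm ?sn_ge0 ?mulr_ge0// ltW.
have v2 : L2 (fun x => q (u x) * p (w x)) /\ Ncvg n2 v_ (fun x => q (u x) * p (w x)).
  have [La _] := comp_n2 qD q0 qdq hCq (DDL2 DDu).
  have [Lb _] := comp_n2 pD p0 pdp dpC (DDL2 DDw).
  apply: (mul_cvg M0) => //.
  - by move=> i; exact: (DDL2 (DD_CE (CV_CE (cqa i)))).
  - by move=> i; exact: (DDL2 (DD_CE (CV_CE (cpb i)))).
  - exact: (comp_cvg qD qdq hCq (fun r => DDL2 (Da r)) (DDL2 DDu) (nE_n2 Da DDu au)).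
  - exact: (comp_cvg pD pdp dpC (fun r => DDL2 (Db r)) (DDL2 DDw) (nE_n2 Db DDw bw)).
have [Dv _] := DV_maz cv vK v2.1 v2.2.
have vE : (fun x => q (u x) * p (w x)) = (fun x => p (w x)) %[ae mu].
  apply: filterS u'0 => x u'x _; have [wd|wd] := leP (w x) dl.
    by rewrite /p phi_le0 ?mulr0// mul1r subr_le0.
  have ux : dl <= u x by move: wd; rewrite /w/= => wd; lra.
  by rewrite /q theta_ge1 ?mul1r// addr0 ler_pdivlMl// mulr1.
have Dpn : DV n (fun x => p (w x)) := DV_ae Dv (DDL2 (DV_DD Dpm)) vE.
have pMae : \forall x \ae mu, `|p (w x)| <= 1 by exact: nearW.
have e1 := sol_ext us Dpn pMae; have e2 := sol_ext us' Dpm pMae.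
have DDp := DV_DD Dpm.
have apm : adm m 1 (fun x => p (w x)) := DV_adm ler01 Dpm pMae.
have mp : mfun (fun x => p (w x)) by case: apm.
have Lwp : L1 (fun x => w x * p (w x)) := L1_mulB Lw mp pMae.
(* The difference of the two equations reads $\mathcal E^0(w,p(w))=-h^{-1}\int w\,p(w)\,d\mu$, the
   drift being zero, and its left side is nonnegative. *)
have le0 : Int (fun x => w x * p (w x)) <= 0.
  have E1 : EE w (fun x => p (w x)) = EE u (fun x => p (w x)) - EE u' (fun x => p (w x)).
    exact: (lin_on_sub (EEl DDp) DDu (DV_DD Du')).
  have E2 : bt w (fun x => p (w x)) = bt u (fun x => p (w x)) - bt u' (fun x => p (w x)).
    have := bt_linl (-1) (DV_DD Du') DDu apm; rewrite (_ : (fun x => _) = w); last first.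
      by apply/funext => x; rewrite /w/=; ring.
    by move=> ->; ring.
  have E3 : Int (fun x => h^-1 * (u x - f x) * p (w x)) - Int (fun x => h^-1 * (u' x - f x) * p (w x)) =
      h^-1 * Int (fun x => w x * p (w x)).
    rewrite -I_sub; [|exact: L1_mulB Lg mp pMae|exact: L1_mulB Lg' mp pMae].
    rewrite -I_scale//; congr Rintegral; apply/funext => x; rewrite /w/=; ring.
  have := Epos dp0; rewrite -(pmulr_rle0 _ hi0) -E3.
  move: e1 e2 E2 b0; rewrite E1.
  move: (EE u _) (EE u' _) (bt u _) (bt u' _) (bt w _) (Int _) (Int _) => t1 t2 t3 t4 t5 t6 t7; lra.
have wp0 x : 0 <= w x * p (w x).
  have [wd|wd] := leP (w x) dl; first by rewrite /p phi_le0 ?mulr0// mul1r subr_le0.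
  by rewrite mulr_ge0 ?phi_ge0// (le_trans _ (ltW wd))// ltW.
have z : Int (fun x => `|w x * p (w x)|) = 0.
  apply/eqP; rewrite eq_le; apply/andP; split.
    by rewrite (_ : (fun x => _) = (fun x => w x * p (w x)))//; apply/funext => x; rewrite ger0_norm.
  by apply: I_ge0; [exact: Lfun_measurable (L1_abs Lwp)|exact: nearW].
apply: filterS (I_abs0 Lwp z) => x /(_ I) /= /eqP; rewrite mulf_eq0 => /orP[/eqP ->|]; first exact: ltW.
have [//|wd] := leP (w x) dl.
by rewrite gt_eqF// phi_gt0// mul1r subr_gt0.
Qed.

(** * The generator on L^1(E, mu) *)

(* The graph of the generator, as the limit of the graphs of its realizations on [Vn n]. *)
Definition Gam u g := [/\ L1 u, L1 g & forall e, 0 < e -> exists N, forall n, (N <= n)%N ->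
  exists u' g', [/\ sol n u' g', n1 (u' \- u) < e & n1 (g' \- g) < e]].

Lemma sol_L1 n u g : sol n u g -> L1 u /\ L1 g.
Proof. by move=> [Du Lg _]; split=> //; exact: DV_L1 Du. Qed.

Lemma Gam_S u g : Gam u g -> L1 u /\ L1 g. Proof. by case. Qed.

Lemma Gam0 : Gam (cst 0) (cst 0).
Proof.
split; [exact: L1_0|exact: L1_0|move=> e e0; exists 0%N => n _].
by exists (cst 0), (cst 0); split; [exact: sol0|rewrite (Ndxx n1s)..].
Qed.

Lemma n1_lin_dist (c : R) u v u' v' : L1 u -> L1 v -> L1 u' -> L1 v' ->
  n1 ((fun x => c * u' x + v' x) \- (fun x => c * u x + v x)) <= `|c| * n1 (u' \- u) + n1 (v' \- v).
Proof.
move=> Lu Lv Lu' Lv'.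
rewrite (_ : _ \- _ = (fun x => c * (u' \- u) x) \+ (v' \- v)); last first.
  by apply/funext => x /=; ring.
have La := L1_sub Lu' Lu; have Lb := L1_sub Lv' Lv.
apply: le_trans (N_add n1s (L1_scale c La) Lb) _.
by rewrite (N_scale n1s).
Qed.

(** The graph asks for approximants at every large [n], not merely along a subsequence, so those of
    two pairs can be added at the same [n]. *)
Lemma Gam_lin (c : R) u g v k : Gam u g -> Gam v k ->
  Gam (fun x => c * u x + v x) (fun x => c * g x + k x).
Proof.
move=> [Lu Lg hu] [Lv Lk hv]; split; [exact: L1_lin|exact: L1_lin|move=> e e0].
have c1 : 0 < `|c| + 1 by rewrite ltr_wpDl.
have e1 : 0 < e / (`|c| + 1) by rewrite divr_gt0.
have [N1 h1] := hu _ e1; have [N2 h2] := hv _ e1; exists (maxn N1 N2) => n.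
rewrite geq_max => /andP[/h1 [u' [g' [s' a1 a2]]] /h2 [v' [k' [s2 b1 b2]]]].
exists (fun x => c * u' x + v' x), (fun x => c * g' x + k' x).
have [Lu' Lg'] := sol_L1 s'; have [Lv' Lk'] := sol_L1 s2.
have fin a b : a < e / (`|c| + 1) -> b < e / (`|c| + 1) -> `|c| * a + b < e.
  move=> ae be; have -> : e = `|c| * (e / (`|c| + 1)) + e / (`|c| + 1).
    by field; rewrite gt_eqF.
  by apply: ler_ltD => //; rewrite ler_wpM2l// ltW.
split; first exact: sol_lin.
- exact: le_lt_trans (n1_lin_dist c Lu Lv Lu' Lv') (fin _ _ a1 b1).
- exact: le_lt_trans (n1_lin_dist c Lg Lk Lg' Lk') (fin _ _ a2 b2).
Qed.

Lemma Gam_closed (s r : nat -> X -> R) u g : (forall k, Gam (s k) (r k)) -> L1 u -> L1 g ->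
  Ncvg n1 s u -> Ncvg n1 r g -> Gam u g.
Proof.
move=> hG Lu Lg su rg; split=> // e e0; have e2 : 0 < e / 2 by lra.
have [k1 h1] := su _ e2; have [k2 h2] := rg _ e2.
pose k := maxn k1 k2; have {}h1 := h1 k (leq_maxl _ _); have {}h2 := h2 k (leq_maxr _ _).
have [Ls Lr hk] := hG k; have [N hN] := hk _ e2; exists N => n /hN[u' [g' [s' a b]]].
have [Lu' Lg'] := sol_L1 s'; exists u', g'; split=> //.
- by have := Nd_tri n1s Lu' Ls Lu; lra.
- by have := Nd_tri n1s Lg' Lr Lg; lra.
Qed.

Lemma pos_dist f f' (c : R) : 0 <= c -> L1 f -> L1 f' ->
  `|Int (fun x => pos (f x - c)) - Int (fun x => pos (f' x - c))| <= n1 (f \- f').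
Proof.
move=> c0 Lf Lf'; have Lp := pos_L1 c0 Lf; have Lp' := pos_L1 c0 Lf'.
rewrite -I_sub//; apply: le_trans (I_abs (L1_sub Lp Lp')) _.
apply: I_le; [exact: L1_abs (L1_sub Lp Lp')|exact: L1_abs (L1_sub Lf Lf')|].
apply: nearW => x; apply: le_trans (pos_lip _ _) _.
by rewrite (_ : f x - c - (f' x - c) = f x - f' x)//; ring.
Qed.

Lemma Gam_star u g (h c : R) : Gam u g -> 0 < h -> 0 <= c ->
  Int (fun x => pos (u x - c)) <= Int (fun x => pos (u x - h * g x - c)).
Proof.
move=> [Lu Lg hu] h0 c0; apply: le_eps => e e0.
(* The error of [u'] enters twice, on the left and inside $u'-hg'$, and that of [g'] with weight
   [h]. *)
have h2 : 0 < 2 + h by lra.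
have e1 : 0 < e / (2 + h) by rewrite divr_gt0.
have [N hN] := hu _ e1; have [u' [g' [s' a b]]] := hN N (leqnn N).
have [Lu' Lg'] := sol_L1 s'.
have Lf : L1 (fun x => u x - h * g x) by apply: L1_sub => //; exact: L1_scale.
have Lf' : L1 (fun x => u' x - h * g' x) by apply: L1_sub => //; exact: L1_scale.
have i1 := star s' h0 c0; have i2 := pos_dist c0 Lu' Lu; have i3 := pos_dist c0 Lf' Lf.
have i4 : n1 ((fun x => u' x - h * g' x) \- (fun x => u x - h * g x)) <= h * n1 (g' \- g) + n1 (u' \- u).
  have := n1_lin_dist (- h) Lg Lu Lg' Lu'; rewrite normrN (gtr0_norm h0).
  rewrite (_ : (fun x => - h * g' x + u' x) = (fun x => u' x - h * g' x)); last by apply/funext => x; ring.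
  by rewrite (_ : (fun x => - h * g x + u x) = (fun x => u x - h * g x))//; apply/funext => x; ring.
have i5 : h * n1 (g' \- g) <= h * (e / (2 + h)) by rewrite ler_wpM2l// ltW.
have i6 : h * (e / (2 + h)) + (e / (2 + h)) + (e / (2 + h)) = e by field; rewrite gt_eqF.
move: i2 i3; rewrite !ler_norml => /andP[i2 _] /andP[_ i3].
move: i1 i2 i3 i4 i5 i6 a b; move: (Int _) (Int _) (Int _) (Int _) (e / _) (n1 _) (n1 _) (n1 _) => *; lra.
Qed.

Lemma Gam_diss (h : R) u g : 0 < h -> Gam u g -> n1 u <= n1 (fun x => u x - h * g x).
Proof.
move=> h0 ug; have [Lu Lg _] := ug.
have Lf : L1 (fun x => u x - h * g x) by apply: L1_sub => //; exact: L1_scale.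
have z (w : X -> R) : Int (fun x => pos (w x - 0)) = Int (fun x => pos (w x)).
  by congr Rintegral; apply/funext => x; rewrite subr0.
apply: n1_pos => //.
  by have := Gam_star ug h0 (lexx 0); rewrite !z.
have := Gam_star (Gam_lin (-1) ug Gam0) h0 (lexx 0); rewrite !z.
rewrite (_ : (fun x => pos (-1 * u x + cst 0 x)) = (fun x => pos (- u x))); last first.
  by apply/funext => x /=; rewrite mulN1r addr0.
rewrite (_ : (fun x => pos (-1 * u x + cst 0 x - h * (-1 * g x + cst 0 x))) =
  (fun x => pos (- (u x - h * g x))))//.
by apply/funext => x /=; congr pos; ring.
Qed.

(** The local resolvents of $f\ge0$ increase with [n], so their $L^1$-distances are differences of
    integrals; these integrals are bounded by $\|f\|_1$, and the resolvents form a Cauchy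
    sequence. *)
Lemma Gam_range_pos (h : R) f : 0 < h -> L1 f -> L2 f -> (\forall x \ae mu, 0 <= f x) ->
  exists u, Gam u (fun x => h^-1 * (u x - f x)).
Proof.
move=> h0 Lf Lf2 f0; have hi0 : 0 < h^-1 by rewrite invr_gt0.
have /choice[s hs] : forall n, exists u, sol n u (fun x => h^-1 * (u x - f x)).
  by move=> n; exact: sol_exists.
have Ls n : L1 (s n) := (sol_L1 (hs n)).1.
have s0 n := sol_ge0 h0 Lf (hs n) f0.
have Ef n : (fun x => s n x - h * (h^-1 * (s n x - f x))) = f.
  by apply/funext => x; rewrite mulrA mulfV ?gt_eqF//; ring.
have bd n : Int (s n) <= n1 f.
  have := sol_diss (hs n) h0; rewrite Ef; apply: le_trans.
  by apply: I_le => //; [exact: L1_abs|apply: nearW => x; exact: ler_norm].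
have mono n m : (n <= m)%N -> Int (s n) <= Int (s m) /\ n1 (s m \- s n) = Int (s m) - Int (s n).
  move=> nm; have sm := sol_mono nm h0 Lf f0 (hs n) (hs m).
  split; first exact: I_le.
  rewrite -I_sub//; apply: I_eq.
  - exact: Lfun_measurable (L1_abs (L1_sub (Ls m) (Ls n))).
  - exact: Lfun_measurable (L1_sub (Ls m) (Ls n)).
  - by apply: filterS sm => x sx _; rewrite ger0_norm// subr_ge0.
have cI : cvgn (fun n => Int (s n)).
  apply: nondecreasing_is_cvgn; first by move=> n m /mono[].
  by exists (n1 f) => _ [n _ <-].
have cs : Ncauchy n1 s.
  move=> e e0; have e2 : 0 < e / 2 by lra.
  have /cvgr_epsP/(_ _ e2)[n0 h1] := cI; exists n0 => m n hm hn.
  have hm' := h1 m hm; have hn' := h1 n hn; move: hm' hn'.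
  rewrite !ltr_norml => /andP[a1 a2] /andP[b1 b2].
  have [mn|/ltnW nm] := leqP m n.
    by rewrite (NdC n1s (Ls m) (Ls n)) (mono _ _ mn).2; move: (Int (s n)) (Int (s m)) a1 a2 b1 b2 => *; lra.
  by rewrite (mono _ _ nm).2; move: (Int (s n)) (Int (s m)) a1 a2 b1 b2 => *; lra.
have [u Lu su] := L1_complete Ls cs.
exists u; split=> //; first by apply: L1_scale; exact: L1_sub.
move=> e e0; have he : 0 < h * e by rewrite mulr_gt0.
have [n1' h1] := su _ e0; have [n2' h2] := su _ he; exists (maxn n1' n2') => n.
rewrite geq_max => /andP[/h1 a /h2 b].
exists (s n), (fun x => h^-1 * (s n x - f x)); split=> //.
rewrite (_ : _ \- _ = (fun x => h^-1 * (s n \- u) x)); last by apply/funext => x /=; ring.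
by rewrite (N_scale n1s) ?gtr0_norm//; [rewrite ltr_pdivrMl|exact: L1_sub].
Qed.

Lemma Gam_range12 (h : R) f : 0 < h -> L1 f -> L2 f -> exists u, Gam u (fun x => h^-1 * (u x - f x)).
Proof.
move=> h0 Lf Lf2.
have mf := Lfun_measurable Lf.
have Lp : L1 (fun x => pos (f x)) by apply: Lfun_ext (pos_L1 (lexx 0) Lf) => x; rewrite subr0.
have Lnf : L1 (fun x => - f x) by apply: Lfun_ext (L1_scale (-1) Lf) => x; rewrite mulN1r.
have Ln : L1 (fun x => pos (- f x)) by apply: Lfun_ext (pos_L1 (lexx 0) Lnf) => x; rewrite subr0.
have Lp2 : L2 (fun x => pos (f x)).
  have [] // := @n2_monoT (fun x => pos (f x)) f 1 ler01 (Lfun_measurable Lp) Lf2.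
  by move=> x; rewrite mul1r ger0_norm ?pos_ge0// pos_le.
have Ln2 : L2 (fun x => pos (- f x)).
  have [] // := @n2_monoT (fun x => pos (- f x)) f 1 ler01 (Lfun_measurable Ln) Lf2.
  by move=> x; rewrite mul1r ger0_norm ?pos_ge0// -[leRHS]normrN pos_le.
have P0 w : \forall x \ae mu, 0 <= pos (w x) by apply: nearW => x; exact: pos_ge0.
have [u hu] := Gam_range_pos h0 Lp Lp2 (P0 f).
have [v hv] := Gam_range_pos h0 Ln Ln2 (P0 (fun x => - f x)).
exists (fun x => -1 * v x + u x); have := Gam_lin (-1) hv hu.
rewrite (_ : (fun x => _ + _ * (_ - pos (f x))) = (fun x => h^-1 * (-1 * v x + u x - f x)))//.
by apply/funext => x; rewrite /pos normrN; field; rewrite gt_eqF.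
Qed.

Lemma clip f : L1 f -> exists f_ : nat -> X -> R, [/\ forall k, L1 (f_ k), forall k, L2 (f_ k) & Ncvg n1 f_ f].
Proof.
move=> Lf; have mf := Lfun_measurable Lf.
have mS (k : nat) : measurable [set x | `|f x| <= k%:R].
  have mn : mfun (fun x => `|f x|) by exact: measurableT_comp.
  have := mn measurableT `]-oo, k%:R]%classic; rewrite setTI; move=> /(_ (measurable_itv _)).
  by congr measurable; apply/seteqP; split=> x /=; rewrite in_itv.
pose f_ k x := f x * \1_[set x | `|f x| <= k%:R] x.
have mk k : mfun (f_ k) by apply: measurable_funM => //; apply: ind_meas; exact: mS.
have le k x : `|f_ k x| <= `|f x| by rewrite normrM ler_piMr//; exact: ind_bdd.
have L1k k : L1 (f_ k) by apply: (L1_dom _ _ (L1_abs Lf)) => //; apply: nearW => x; exact: le.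
exists f_; split=> // [k|].
  apply: (L12_dom (L1k k) (M := k%:R)); apply: nearW => x; rewrite /f_.
  have [h|h] := leP `|f x| k%:R; first by rewrite ind1// mulr1.
  by rewrite ind0 ?mulr0 ?normr0//=; apply/negP; rewrite -ltNge.
have [] // := dominated_cvgR (u := f_) (f := f) (g := fun x => `|f x|) mk mf (L1_abs Lf).
  apply: nearW => x; apply/cvgr_epsP => e e0.
  exists (Num.bound `|f x|) => n hn; rewrite /f_ ind1 ?mulr1 ?subrr ?normr0//=.
  apply: ltW; apply: lt_le_trans (archi_boundP (normr_ge0 (f x))) _.
  by rewrite ler_nat.
by apply: nearW => x k; exact: le.
Qed.

(** Dissipativity makes the resolvents of a convergent sequence of right-hand sides Cauchy, and the
    graph is closed. *)
Lemma Gam_range (h : R) f : 0 < h -> L1 f -> exists u, Gam u (fun x => h^-1 * (u x - f x)).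
Proof.
move=> h0 Lf; have [f_ [L1k L2k fk]] := clip Lf.
have /choice[s hs] : forall k, exists u, Gam u (fun x => h^-1 * (u x - f_ k x)).
  by move=> k; exact: Gam_range12.
have Ls k : L1 (s k) := (Gam_S (hs k)).1.
have cs : Ncauchy n1 s.
  move=> e /(Ncvg_cauchy n1s L1k Lf fk)[n0 hn]; exists n0 => m n hm hn'.
  apply: le_lt_trans (hn m n hm hn').
  have := Gam_diss h0 (Gam_lin (-1) (hs n) (hs m)).
  rewrite (_ : (fun x => -1 * s n x + s m x) = s m \- s n); last by apply/funext => x /=; ring.
  congr (_ <= n1 _); apply/funext => x /=.
  by field; rewrite gt_eqF.
have [u Lu su] := L1_complete Ls cs.
exists u; apply: (Gam_closed hs Lu _ su); first by apply: L1_scale; exact: L1_sub.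
have := Ncvg_lin n1s (- 1) (s := f_) (s' := s) L1k Ls Lf Lu fk su.
move=> hh e e0; have he : 0 < h * e by rewrite mulr_gt0.
have [n0 hn] := hh _ he; exists n0 => n /hn a.
rewrite (_ : _ \- _ = (fun x => h^-1 * ((fun x => -1 * f_ n x + s n x) \- (fun x => -1 * f x + u x)) x)); last first.
  by apply/funext => x /=; ring.
rewrite (N_scale n1s); last by apply: L1_sub; exact: L1_lin.
by rewrite gtr0_norm ?invr_gt0// ltr_pdivrMl.
Qed.

(** * Locality of $L^0$ and compactly supported elements of its domain *)

Lemma genP u : D_L0 E mu A u -> [/\ DD u, L2 (L0 E mu A u) &
  forall v, DD v -> EE u v = - \int[mu]_(x in E) (L0 E mu A u x * v x)].
Proof.
move=> [h hh]; rewrite /L0 /generator.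
have [Du Lh ev] : form_generator E mu pf CE u (xget (cst 0) [set h | form_generator E mu pf CE u h]).
  by case: xgetP => [y _ //|/(_ h)].
by split.
Qed.

Lemma Rint_setT f g : mfun f -> mfun g -> \int[mu]_(x in E) (f x * g x) = Int (fun x => f x * g x).
Proof.
move=> mf mg; rewrite Rint_E; apply: I_eq.
- by apply: patch_meas; apply: measurable_funTS; exact: measurable_funM.
- exact: measurable_funM.
- by apply: filterS ae_E => x Ex _; rewrite patch_in.
Qed.

Lemma ae_seq (I : eqType) (s : seq I) (P : I -> set X) :
  (forall a, a \in s -> \forall x \ae mu, P a x) -> \forall x \ae mu, forall a, a \in s -> P a x.
Proof.
elim: s => [|b s IH] h; first exact: nearW.
have h1 : \forall x \ae mu, P b x by apply: h; rewrite mem_head.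
have h2 : \forall x \ae mu, forall a, a \in s -> P a x.
  by apply: IH => a sa; apply: h; rewrite in_cons sa orbT.
apply: filterS2 h1 h2 => x Pb Ps a; rewrite in_cons => /orP[/eqP ->//|]; exact: Ps.
Qed.

(** Each point of [E] off the support has a neighbourhood on which [u] vanishes almost everywhere,
    but uncountably many such neighbourhoods occur; the complement is therefore exhausted by compact
    sets. *)
Lemma msupp_off u : mfun u -> compact (msupp E mu u) ->
  \forall x \ae mu, ~ msupp E mu u x -> u x = 0.
Proof.
move=> mu_ cK; set K := msupp E mu u.
have loc x : E x -> ~ K x -> exists2 U, open U /\ U x & \forall y \ae mu, U y -> u y = 0.
  move=> Ex nK; apply/not_notP => nU; apply: nK; split=> // U oU Ux.
  rewrite lt0e integral_ge0 ?andbT//; apply/eqP => I0; apply: nU; exists U => //.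
  have mUE : measurable (U `&` E) by apply: measurableI; [exact: open_meas|exact: mE].
  have mu' : measurable_fun (U `&` E) (EFin \o u).
    by apply/measurable_EFinP; exact: measurable_funTS.
  have := (ae_eq_integral_abs mu mUE mu').1 I0.
  by apply: filterS2 ae_E => y Ey h Uy; have [] := h (conj Uy Ey).
(* [closure (Vn n)] without the $1/(n+1)$-neighbourhood of [K] is compact and misses [K]; these sets
   exhaust $E\setminus K$ because [K] is closed. *)
pose O (n : nat) := \bigcup_(y in K) ball y (n.+1%:R^-1 : R).
have oO n : open (O n) by apply: bigcup_open => y _; exact: ball_open.
pose C n := closure (Vn n) `&` ~` O n.
have cC n : compact (C n).
  apply: (compact_subclosed (@Vn_compact n)); last by move=> x [].
  by apply: closedI; [exact: closed_closure|rewrite closedC].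
have CE_ n : C n `<=` E by move=> x [/Vn_closure].
have CK n x : C n x -> ~ K x.
  move=> [_ nO] Kx; apply: nO; exists x => //; apply: ballxx.
  by rewrite invr_gt0.
have key n : \forall x \ae mu, C n x -> u x = 0.
  have /choice[U hU] : forall x, exists U : set X, [/\ open U, (C n x -> U x) & \forall y \ae mu, U y -> u y = 0].
    move=> x; have [Cx|nC] := pselect (C n x).
      by have [U [oU Ux] h] := loc x (@CE_ n x Cx) (@CK n x Cx); exists U; split.
    by exists set0; split; [exact: open0|by []|exact: nearW].
  have cCn := cC n.
  move: cCn; rewrite compact_cover => /(_ X (C n) U) [x _|x Cx|D sD CD].
  - by have [] := hU x.
  - by exists x => //; have [_ h _] := hU x; exact: h.
  - have := @ae_seq X (finmap.enum_fset D) (fun a => [set y | U a y -> u y = 0]).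
    case/(_ _) => [a _|S hS]; first by have [] := hU a.
    exists S; move: hS => [mS S0 hS]; split=> // x /= h; apply: hS => /= k; apply: h => Cx.
    by have [a aD Ua] := CD _ Cx; exact: k Ua.
apply: filterS2 ae_E (ae_foralln key) => x Ex h nK.
have Kc : closed K := compact_closed cK.
have : nbhs x (~` K) by move: Kc; rewrite -openC openE => /(_ _ nK).
move=> /nbhs_ballP[r /= r0 rK]; have [n0 hn] := inv_small r0; have [m Vm] := E_Vn Ex.
apply: (h (maxn n0 m)); split; first by apply: subset_closure; apply: Vn_mono Vm; exact: leq_maxr.
move=> [y Ky yx]; apply: (rK y) => //; apply: ball_sym; apply: le_ball yx.
by apply: ltW; apply: hn; exact: leq_maxl.
Qed.

Lemma cutoff_E (K O : set X) : compact K -> K `<=` E -> open O -> K `<=` O ->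
  exists (chi : X -> R) (O' : set X), [/\ CE chi, (forall x, 0 <= chi x <= 1),
    open O' /\ K `<=` O', (forall x, O' x -> chi x = 1) & closure [set x | chi x != 0] `<=` O].
Proof.
move=> cK KE oO KO; have [|x Kx|chi [Q' [sc c01 oO' c1 [cc cs]]]] := cutoff (U := W `&` O) cK.
- by apply: openI => //; exact: W_open.
- by split; [apply: E_W; exact: KE|exact: KO].
exists chi, Q'; split=> //; last by move=> x /cs[].
split=> // oE x /cs[+ _]; rewrite /W; case: asboolP => //.
Qed.

(** The products of [chi] with truncated approximants have bounded energy and converge to [u] in
    $L^2$. Their hull elements converge in energy and still vanish wherever [chi] does. *)
Lemma cut_appr u chi (M : R) : DD u -> 0 < M -> (\forall x \ae mu, `|u x| <= M) -> CE chi ->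
  (forall x, 0 <= chi x <= 1) -> (\forall x \ae mu, chi x * u x = u x) ->
  exists w : nat -> X -> R, [/\ forall k, CE (w k), forall k x, w k x != 0 -> chi x != 0 & Ncvg nE w u].
Proof.
move=> Du M0 uM cchi c01 cu; have [s [sa su]] := DD_appr Du.
have cs := appr_D sa; have Ds k := DD_CE (cs k).
have [C C0 hC] := trunc_dbounded M0.
have tD m : D1 m (trunc M) := trunc_D1 m M.
have tdp (r : R) : is_derive r (1 : R) (trunc M) ('D_1 (trunc M) r) := D1_der r (tD 1%N).
have t0 : trunc M 0 = 0 by exact: trunc_at0.
have [K K0 hK] := nE_bounded Ds Du su.
have Lu := DDL2 Du.
have ct k : CE (fun x => trunc M (s k x)) := Ccoo_comp tD t0 (cs k).
pose v_ (k : nat) x := chi x * trunc M (s k x).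
have cv k : CE (v_ k) := Ccoo_mul cchi (Ccoo_smooth (ct k)).
(* One constant for both factors, in the form that [nE_mul] takes: $2M+1$ dominates the truncation
   and the cut-off. *)
have tM (r : R) : `|trunc M r| <= 2 * M + 1.
  by apply: le_trans (trunc_bounded r M0) _; rewrite lerDl.
have chiM x : `|chi x| <= 2 * M + 1.
  by have /andP[a b] := c01 x; rewrite ger0_norm//; lra.
pose K2 := 2 * (2 * M + 1) ^+ 2 * (nE chi ^+ 2 + (C * K) ^+ 2).
have K20 : 0 <= K2.
  by apply: mulr_ge0; [apply: mulr_ge0 => //; exact: sqr_ge0|apply: addr_ge0; exact: sqr_ge0].
have vK k : nE (v_ k) <= Num.sqrt K2.
  rewrite -(ler_pXn2r (n := 2))// ?nnegrE ?sn_ge0 ?sqrtr_ge0// (sqr_sqrtr K20).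
  have h1 := nE_mul cchi (ct k) chiM (fun x => tM (s k x)).
  apply: le_trans h1 _.
  apply: ler_wpM2l; first by apply: mulr_ge0 => //; exact: sqr_ge0.
  rewrite lerD2l.
  have j1 : nE (fun x => trunc M (s k x)) <= C * K.
    by apply: le_trans (nE_comp tD t0 tdp hC (cs k)) _; rewrite ler_wpM2l// ltW.
  by apply: sqr_le; rewrite !ger0_norm ?sn_ge0 ?mulr_ge0// ltW.
have Lchi := Ccoo_L2 cchi.
have [Lt _] := comp_n2 tD t0 tdp hC Lu.
have tc := comp_cvg tD tdp hC (fun k => DDL2 (Ds k)) Lu (nE_n2 Ds Du su).
have M20 : 0 <= 2 * M + 1 by lra.
have [Lv vc] := mul_cvg M20 (fun=> Lchi) (fun k => Ccoo_L2 (ct k)) Lchi Lt (fun k x => chiM x)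
  (fun x => tM (u x)) (Ncvg_cst (n2_seminorm mu) chi) tc.
have vu : (fun x => chi x * trunc M (u x)) = u %[ae mu].
  by apply: filterS2 uM cu => x a b _; rewrite trunc_id.
have vc' := Ncvg2_ae (fun k => Ccoo_L2 (cv k)) Lv Lu vu vc.
have [_ [w [Dw hw wu]]] := maz (fun k => DD_CE (cv k)) vK Lu vc'.
exists w; split=> // [k|k x].
  by apply: (hw k); [apply: mid_submod; exact: Ccoo_submod|move=> m _; exact: cv].
apply: contraNneq => cx; apply/eqP.
apply: (hw k [set f | f x = 0]) => [f g /= f0 g0|m _ /=]; first by rewrite /mid f0 g0 !mulr0 addr0.
by rewrite /v_ cx mul0r.
Qed.

Section supported.
Variable u : X -> R.
Hypothesis hu : D_L0_0b E mu A u.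

Let K := msupp E mu u.
Let cK : compact K. Proof. by case: hu. Qed.
Let KE : K `<=` E. Proof. by move=> x []. Qed.
Let Du : DD u. Proof. by have [/genP[]] := hu. Qed.
Let LL : L2 (L0 E mu A u). Proof. by have [/genP[]] := hu. Qed.

Lemma bound_pos : exists2 M : R, 0 < M & \forall x \ae mu, `|u x| <= M.
Proof.
have [_ _ [M hM]] := hu; exists (`|M| + 1); first by rewrite ltr_wpDl.
by apply: filterS hM => x h; apply: le_trans h _; rewrite ler_wpDr// ler_norm.
Qed.

Lemma chi_u chi : (forall x, K x -> chi x = 1) -> \forall x \ae mu, chi x * u x = u x.
Proof.
move=> c1; apply: filterS (msupp_off (Lfun_measurable (DDL2 Du)) cK) => x h.
have [Kx|/h ->] := pselect (K x); first by rewrite c1// mul1r.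
by rewrite mulr0.
Qed.

Lemma supp_DV : exists n, DV n u.
Proof.
have [M M0 uM] := bound_pos.
have [chi [Q' [cc c01 [oO KO] c1 _]]] := cutoff_E cK KE openT (@subsetT _ K).
have [n cn] := Ccoo_Vn cc; exists n.
have c1K x : K x -> chi x = 1 by move=> /KO; exact: c1.
have [w [cw ws wu]] := cut_appr Du M0 uM cc c01 (chi_u c1K).
apply: (DV_of _ Du wu) => k; apply: (Ccoo_in_sub cn); first exact: Ccoo_smooth.
exact: ws.
Qed.

(** [u] is approximated in energy by test functions supported in [O], where the gradient of [v]
    vanishes. *)
Lemma EE_local v (O : set X) : CE v -> open O -> K `<=` O -> (forall x, O x -> v x = 0) -> EE u v = 0.
Proof.
move=> cv oO KO v0; have [M M0 uM] := bound_pos.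
have [chi [Q' [cc c01 [oO' KO'] c1 cO]]] := cutoff_E cK KE oO KO.
have c1K x : K x -> chi x = 1 by move=> /KO'; exact: c1.
have [w [cw ws wu]] := cut_appr Du M0 uM cc c01 (chi_u c1K).
have h := EE_cvgl (DD_CE cv) (fun k => DD_CE (cw k)) Du wu.
apply: (cvgn_uniq h).
have e0 k : EE (w k) v = 0.
  rewrite EE_CE// pfE (_ : qfm (w k) v = cst 0) ?Rintegral_cst ?mul0r//.
  apply/funext => x; have [Ox|nO] := pselect (O x).
    rewrite /qfm big1// => i _; rewrite big1// => j _.
    rewrite (partial_near0 (f := v)) ?mulr0//.
    by move: oO; rewrite openE => /(_ _ Ox); apply: filterS => y; exact: v0.
  rewrite /qfm big1// => i _; rewrite big1// => j _.
  rewrite (partial_supp (f := w k)) ?mulr0 ?mul0r// => wx; apply: nO; apply: cO.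
  by apply: closureS wx => y; exact: ws.
under eq_fun do rewrite e0; exact: cvg_cst.
Qed.

Lemma ind_ae0 (F : X -> R) n : L1 F -> (forall S, measurable S -> S `<=` Vn n -> Int (fun x => F x * \1_S x) = 0) ->
  \forall x \ae mu, Vn n x -> F x = 0.
Proof.
move=> LF hS; have mF := Lfun_measurable LF.
have half (G : X -> R) : L1 G -> (forall S, measurable S -> S `<=` Vn n -> Int (fun x => G x * \1_S x) = 0) ->
    \forall x \ae mu, Vn n x -> G x <= 0.
  move=> LG hG; have mG := Lfun_measurable LG.
  pose S := [set x | 0 < G x] `&` Vn n.
  have mS : measurable S.
    apply: measurableI; last exact: Vn_meas.
    have := mG measurableT `]0, +oo[%classic; rewrite setTI; move=> /(_ (measurable_itv _)).
    by congr measurable; apply/seteqP; split=> x /=; rewrite in_itv/= andbT.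
  have S0 : Int (fun x => G x * \1_S x) = 0 by apply: hG => // x [].
  have LGS : L1 (fun x => G x * \1_S x).
    by apply: (L1_mulB (M := 1) LG (ind_meas mS)); apply: nearW => x; exact: ind_bdd.
  have : Int (fun x => `|G x * \1_S x|) = 0.
    rewrite -S0; congr Rintegral; apply/funext => x.
    have [Sx|Sx] := pselect (S x); last by rewrite ind0// mulr0 normr0.
    by rewrite ind1// mulr1 ger0_norm//; case: Sx => /ltW.
  move=> /(I_abs0 LGS); apply: filterS => x /(_ I) /= h Vx.
  have [//|Gx] := leP (G x) 0.
  have Sx : S x by [].
  by move: h Gx; rewrite (ind1 Sx) mulr1 => ->; rewrite ltxx.
have LN : L1 (fun x => - F x) by apply: Lfun_ext (L1_scale (-1) LF) => x; rewrite mulN1r.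
have h1 := half F LF hS; have h2 := half _ LN _.
suff h3 : \forall x \ae mu, Vn n x -> - F x <= 0.
  apply: filterS2 h1 h3 => x a b Vx; apply/eqP; rewrite eq_le a//=.
  by rewrite -oppr_le0 b.
apply: h2 => S mS SV.
rewrite (_ : (fun x => _) = (fun x => -1 * (F x * \1_S x))); last first.
  by apply/funext => x; ring.
rewrite I_scale ?hS ?mulr0//.
by apply: (L1_mulB (M := 1) LF (ind_meas mS)); apply: nearW => x; exact: ind_bdd.
Qed.

(** By locality $L^0u$ annihilates test functions vanishing near the support of [u]. Hence
    $F=L^0u\cdot\psi\cdot(1-\chi)$ integrates to zero against truncated test functions, then against
    truncated elements of $D(\mathcal E^0)$, and finally against indicators; [psi] only serves to
    make [F] integrable. *)
Lemma L0_off : exists n, \forall x \ae mu, ~ Vn n x -> L0 E mu A u x = 0.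
Proof.
have [chi [Q [cc c01 [oO KO] c1 _]]] := cutoff_E cK KE openT (@subsetT _ K).
have [n cn] := Ccoo_Vn cc; exists n.
pose l0 := L0 E mu A u; have ml0 : mfun l0 := Lfun_measurable LL.
have schi := Ccoo_smooth cc.
pose ch x : R := -1 * chi x + 1.
have sch : smooth ch by exact: (smooth_lin (-1) schi (@smooth_cst R d 1)).
have chM x : `|ch x| <= 1.
  by rewrite /ch ler_norml; have /andP[a b] := c01 x; lra.
have key m : \forall x \ae mu, Vn m x -> l0 x * ch x = 0.
  have [psi [Q2 [cp p01 [oO2 KO2] p1 _]]] := cutoff_E (@Vn_compact m) (@Vn_closure m) openT (@subsetT _ _).
  pose F x := l0 x * psi x * ch x.
  have LF : L1 F.
    apply: (L1_mulB (M := 1) (L2_mul LL (Ccoo_L2 cp))); first exact: smooth_meas.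
    exact: nearW.
  have one0 : 0 < 1 :> R by [].
  have [C C0 hC] := trunc_dbounded one0.
  have tD k : D1 k (trunc (1 : R)) := trunc_D1 k 1.
  have tc : continuous (trunc (1 : R)) := D1_cont (tD 0%N).
  have t0 : trunc 1 0 = 0 :> R by exact: trunc_at0.
  have tm (w : X -> R) : mfun w -> mfun (fun x => trunc 1 (w x)).
    by move=> mw; exact: (comp_meas tD mw).
  (* [F] is merely integrable, so convergence in energy cannot be used directly; almost everywhere
     convergence along a subsequence and the uniform bound of the truncation allow dominated
     convergence. *)
  have step1 w : DD w -> Int (fun x => F x * trunc 1 (w x)) = 0.
    move=> Dw; have [q [qa qw]] := DD_appr Dw.
    have cq := appr_D qa; have Dq k := DD_CE (cq k).
    have [r [kr rc]] := L2_ae_subseq (fun k => DDL2 (Dq k)) (DDL2 Dw) (nE_n2 Dq Dw qw).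
    have cc' : \forall x \ae mu, (fun k => trunc 1 (q (r k) x)) @ \oo --> trunc 1 (w x).
      by apply: filterS rc => x h; apply: continuous_cvg => //; exact: tc.
    have [_ lim] := bounded_int (M := 2 * 1) LF (tm _ (Lfun_measurable (DDL2 Dw)))
      (fun k => tm _ (Lfun_measurable (DDL2 (Dq (r k))))) (fun k x => trunc_bounded (q (r k) x) one0) cc'.
    apply: (cvgn_uniq lim).
    have e0 k : Int (fun x => F x * trunc 1 (q (r k) x)) = 0.
      pose v x := psi x * ch x * trunc 1 (q (r k) x).
      have st : smooth (fun x => trunc 1 (q (r k) x)) by exact: (smooth_comp tD (Ccoo_smooth (cq _))).
      have cv : CE v := Ccoo_mul (Ccoo_mul cp sch) st.
      have v0 x : Q x -> v x = 0 by move=> Ox; rewrite /v /ch c1// mulr1 addNr mulr0 mul0r.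
      have ev := EE_local cv oO KO v0.
      have [Dl0 _ _] := hu; have [_ _ gen] := genP Dl0.
      have := gen v (DD_CE cv); rewrite ev (Rint_setT ml0 (smooth_meas (Ccoo_smooth cv))) => /eqP.
      rewrite eq_sym oppr_eq0 => /eqP <-; congr Rintegral; apply/funext => x.
      by rewrite /F /v /l0; ring.
    under eq_fun do rewrite e0; exact: cvg_cst.
  have : \forall x \ae mu, Vn m x -> F x = 0.
    apply: ind_ae0 => // S mS SV.
    have LS : L1 (\1_S : X -> R).
      apply: (@bdd_L1 m _ 1); [exact: ind_meas|by apply: nearW => x; exact: ind_bdd|].
      by apply: nearW => x nV; apply: ind0 => /SV.
    have [hS1 hS2] := h_dense.
    (* The density hypothesis provides elements of $D(\mathcal E^0)$ that approach an indicator in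
       $L^1$; the truncation at level 1 leaves the indicator itself unchanged. *)
    have /choice[w hw] : forall k : nat, exists w, D_L0_0b E mu A w /\ n1 (\1_S \- w) < k.+1%:R^-1.
      move=> k; have k0 : 0 < k.+1%:R^-1 :> R by rewrite invr_gt0.
      have [w Dw] := hS2 _ LS _ k0; have Lw := hS1 w Dw.
      by rewrite n1_Lnorm ?lte_fin; [exists w|exact: L1_sub].
    have Lw k : L1 (w k) := hS1 _ (hw k).1.
    have cw : Ncvg n1 w \1_S.
      move=> e /inv_small[n0 h]; exists n0 => k /h.
      by apply: lt_trans; rewrite (NdC n1s (Lw k) LS); exact: (hw k).2.
    have [r [kr rc]] := L1_ae_subseq Lw LS cw.
    have t1 x : trunc 1 (\1_S x) = \1_S x :> R by apply: trunc_id => //; exact: ind_bdd.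
    have cc' : \forall x \ae mu, (fun k => trunc 1 (w (r k) x)) @ \oo --> (\1_S x : R).
      by apply: filterS rc => x h; rewrite -t1; apply: continuous_cvg => //; exact: tc.
    have [_ lim] := bounded_int (M := 2 * 1) LF (ind_meas mS)
      (fun k => tm _ (Lfun_measurable (Lw (r k)))) (fun k x => trunc_bounded (w (r k) x) one0) cc'.
    apply: (cvgn_uniq lim).
    under eq_fun => k.
      rewrite step1; last by have [[/genP[]]] := hw (r k).
      over.
    exact: cvg_cst.
  apply: filterS => x h Vx; have := h Vx; rewrite /F p1 ?mulr1//.
  by apply: KO2; exact: subset_closure.
have c0 := (Ccoo_in_ae cn).1.
apply: filterS2 c0 (filterI ae_E (ae_foralln key)) => x a [Ex b] nV.
have [m Vm] := E_Vn Ex.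
by have := b m Vm; rewrite /ch a// mulr0 add0r mulr1.
Qed.

Definition Lval x : R := L0 E mu A u x + \sum_i Bm i x * Nb i u x.

Lemma Lval_ae : Lval = (fun x => L0 E mu A u x + dotv (B x) (nabla E mu A u x)) %[ae mu].
Proof.
apply: filterS ae_E => x Ex _; rewrite /Lval /dotv; congr (_ + _); apply: eq_bigr => i _.
by rewrite /Bm /Nb !patch_in.
Qed.

(** Compact support puts both terms of $Lu$ into $L^1$, and the pair then solves the local equation
    for every large [n], so that the constant sequence is an approximation. *)
Lemma Gam_L0 : Gam u Lval.
Proof.
have [n1' Dn] := supp_DV; have [n2' off] := L0_off.
have L1l : L1 (L0 E mu A u) := L2_L1 LL off.
have L1b i : L1 (fun x => Bm i x * Nb i u x).
  have h := L2_mul (Bm_L2 i n1') (dN_bound n1' i Du).1.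
  apply: (L1_eq h).
    by apply: measurable_funM; [exact: Bm_meas|exact: Nb_meas].
  apply: filterS (DV_Nb_off i Dn) => x k _; rewrite /dN.
  have [Vx|Vx] := pselect (Vn n1' x); first by rewrite ind1// !mulr1.
  by rewrite k// mul0r !mulr0.
have L1s := L1_sum (index_enum 'I_d) L1b.
have LLv : L1 Lval by exact: L1_add.
split=> //; first exact: DV_L1 Dn.
move=> e e0; exists n1' => n nn; exists u, Lval; split; [|by rewrite (Ndxx n1s)..].
split=> //; first exact: DV_mono nn Dn.
move=> v cv; have [Dl0 _ _] := hu; have [_ _ gen] := genP Dl0.
have [M M0 vM] := Ccoo_bdd (CV_CE cv); have av := CV_adm M0 cv vM.
have mv : mfun v by case: av.
have vMae : \forall x \ae mu, `|v x| <= M by exact: nearW.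
rewrite (gen v (DD_CE (CV_CE cv))) (Rint_setT (Lfun_measurable LL) mv) btE.
rewrite -opprD -I_add; [|exact: L1_mulB L1l mv vMae|exact: bfun_L1 Du av].
congr (- _); congr Rintegral; apply/funext => x; rewrite /Lval /bfun mulrDl mulr_suml//.
Qed.

End supported.

Lemma Gam_dense f (e : R) : L1 f -> 0 < e -> exists u g, Gam u g /\ n1 (f \- u) < e.
Proof.
move=> Lf e0; have [h1 h2] := h_dense; have [u Du] := h2 f Lf e e0.
rewrite n1_Lnorm ?lte_fin => [ue|]; last by apply: L1_sub => //; exact: h1.
by exists u, (Lval u); split=> //; exact: Gam_L0.
Qed.

(** * Bounded elements of the domain *)

Lemma bounded_int_ae (f v : X -> R) (v_ : nat -> X -> R) (M : R) : L1 f -> mfun v ->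
  (forall k, mfun (v_ k)) -> (forall k, \forall x \ae mu, `|v_ k x| <= M) ->
  (\forall x \ae mu, v_ ^~ x @ \oo --> v x) ->
  (fun k => Int (fun x => f x * v_ k x)) @ \oo --> Int (fun x => f x * v x).
Proof.
move=> Lf mv mvk vM cv; have mf := Lfun_measurable Lf.
have [] // := dominated_cvgR (u := fun k x => f x * v_ k x) (f := fun x => f x * v x)
  (g := fun x => `|M| * `|f x|) (mu := mu).
- by move=> k; exact: measurable_funM.
- exact: measurable_funM.
- by apply: L1_scale; exact: L1_abs.
- by apply: filterS cv => x h; exact: cvgr_mulc.
- apply: filterS (ae_foralln vM) => x h k; rewrite normrM mulrC ler_wpM2r//.
  by apply: le_trans (h k) _; exact: ler_norm.
Qed.

Lemma pos_int0 f (c : R) : 0 <= c -> L1 f -> Int (fun x => pos (f x - c)) <= 0 ->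
  \forall x \ae mu, f x <= c.
Proof.
move=> c0 Lf le0; have Lp := pos_L1 c0 Lf.
have : Int (fun x => `|pos (f x - c)|) = 0.
  apply/eqP; rewrite eq_le; apply/andP; split.
    by rewrite (_ : (fun x => _) = (fun x => pos (f x - c)))//; apply/funext => x; rewrite ger0_norm// pos_ge0.
  by apply: I_ge0; [exact: Lfun_measurable (L1_abs Lp)|exact: nearW].
move/(I_abs0 Lp); apply: filterS => x /(_ I) /= hx.
by have := pos_ge (f x - c); rewrite hx subr_le0.
Qed.

Lemma pos_int_eq0 f (c : R) : mfun f -> (\forall x \ae mu, f x <= c) ->
  Int (fun x => pos (f x - c)) = 0.
Proof.
move=> mf fc; rewrite (@I_eq _ _ _ _ _ (cst 0)) ?Rintegral_cst ?mul0r//.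
- by apply: pos_meas; exact: measurable_funB.
- by apply: filterS fc => x h _; rewrite pos_le0// subr_le0.
Qed.

Lemma sol_bdd n w u (h M : R) : 0 < h -> 0 <= M -> L1 u -> (\forall x \ae mu, `|u x| <= M) ->
  sol n w (fun x => h^-1 * (w x - u x)) -> \forall x \ae mu, `|w x| <= M.
Proof.
move=> h0 M0 Lu uM sw; have [Lw _] := sol_L1 sw; have mu_ := Lfun_measurable Lu.
have h1 : \forall x \ae mu, w x <= M.
  apply: pos_int0 => //; apply: le_trans (star sw h0 M0) _.
  rewrite (_ : (fun x => _) = (fun x => pos (u x - M))); last first.
    by apply/funext => x; congr pos; field; rewrite gt_eqF.
  by rewrite pos_int_eq0//; apply: filterS uM => x; rewrite ler_norml => /andP[].
have h2 : \forall x \ae mu, - w x <= M.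
  apply: pos_int0 => //; first by apply: Lfun_ext (L1_scale (-1) Lw) => x; rewrite mulN1r.
  have := star (sol_lin (-1) sw (sol0 n)) h0 M0.
  rewrite (_ : (fun x => pos (-1 * w x + cst 0 x - M)) = (fun x => pos (- w x - M))); last first.
    by apply/funext => x /=; rewrite addr0 mulN1r.
  move=> i; apply: le_trans i _.
  rewrite (_ : (fun x => _) = (fun x => pos (- u x - M))); last first.
    by apply/funext => x /=; congr pos; field; rewrite gt_eqF.
  rewrite pos_int_eq0//; first exact: measurableT_comp.
  by apply: filterS uM => x; rewrite ler_norml => /andP[]; rewrite lerNl.
by apply: filterS2 h1 h2 => x a b; rewrite ler_norml a andbT lerNl.
Qed.

Lemma n1_tri3 (a b c : X -> R) : L1 a -> L1 b -> L1 c ->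
  n1 (fun x => a x + b x + c x) <= n1 a + n1 b + n1 c.
Proof.
move=> La Lb Lc; apply: le_trans (N_add n1s (L1_add La Lb) Lc) _.
by rewrite lerD2r; exact: (N_add n1s La Lb).
Qed.

(** The approximant is $w=(1-hL_n)^{-1}u$, which inherits the bound of [u]; what must be shown is
    that $r=h^{-1}(w-u)$ is near [g]. Let $(z,k)$ be in the graph with [z] near [g], and write
    $u_n,g_n,z_n,k_n$ for the local approximants. Then [w] is compared with $u_n+hz_n$: the defect
    $u-(1-hL_n)(u_n+hz_n)$ equals $(u-u_n)+h(g_n-z_n)+h^2k_n$, which remains small after division by
    [h]. *)
Lemma resolvent_near u g (M e : R) N : Gam u g -> 0 < M -> (\forall x \ae mu, `|u x| <= M) -> 0 < e ->
  exists n w r, [/\ (N <= n)%N, sol n w r, \forall x \ae mu, `|w x| <= M, n1 (w \- u) < e & n1 (r \- g) < e].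
Proof.
move=> [Lu Lg hu] M0 uM e0.
(* Eight multiples of [e1] are spent on $r-g$: five on the comparison of [w] with $u_n+hz_n$, one on
   $u_n-u$ and two on $z_n-g$. *)
have [e1 e10 ee] : exists2 e1, 0 < e1 & e = 10 * e1.
  by exists (e / 10); [rewrite divr_gt0|field].
have [z [kk [[Lz Lk hz] gz]]] := Gam_dense Lg e10.
(* [D] dominates the norms of both [kn] and [r], so that $h=e_1/D$ controls $h\|k_n\|$ as well as
   $\|w-u\|=h\|r\|$. *)
pose D := 1 + n1 kk + n1 g + e.
have nk0 : 0 <= n1 kk := N_ge0 n1s Lk; have ng0 : 0 <= n1 g := N_ge0 n1s Lg.
have D0 : 0 < D by rewrite /D; lra.
pose h := e1 / D; have h0 : 0 < h by rewrite divr_gt0.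
have hD : h * D = e1 by rewrite /h mulfVK// gt_eqF.
have he1 : 0 < h * e1 by rewrite mulr_gt0.
have [e2 e20 e2le] : exists2 e2, 0 < e2 & e2 <= e1 /\ e2 <= 1.
  by exists (Num.min e1 1); rewrite ?lt_min ?e10 ?ltr01// !ge_min !lexx orbT.
(* The error of [un] will be divided by [h], so it is chosen after [h] and below $h\,e_1$. *)
have [e3 e30 e3le] : exists2 e3, 0 < e3 & e3 <= h * e1 /\ e3 <= e1.
  by exists (Num.min (h * e1) e1); rewrite ?lt_min ?e10 ?he1// !ge_min !lexx orbT.
have [N1 h1] := hu _ e30; have [N2 h2] := hz _ e20.
pose n := maxn N (maxn N1 N2).
have Nn : (N <= n)%N := leq_maxl _ _.
have N1n : (N1 <= n)%N by rewrite /n !leq_max leqnn orbT.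
have N2n : (N2 <= n)%N by rewrite /n !leq_max leqnn !orbT.
have [un [gn [su ua ga]]] := h1 n N1n; have [zn [kn [sz za ka]]] := h2 n N2n.
have [Lun Lgn] := sol_L1 su; have [Lzn Lkn] := sol_L1 sz.
have Lu2 := L12_dom Lu uM.
have [w sw] := sol_exists n Lu Lu2 h0.
have [Lw Lr] := sol_L1 sw; set r := (fun x => _) in sw Lr.
have wM := sol_bdd h0 (ltW M0) Lu uM sw.
have sd := sol_diss (sol_lin (-1) (sol_lin h sz su) sw) h0.
pose wy x := -1 * (h * zn x + un x) + w x.
have Lwy : L1 wy by apply: L1_lin => //; exact: L1_lin.
have dE : (fun x => -1 * (h * zn x + un x) + w x - h * (-1 * (h * kn x + gn x) + r x)) =
    (fun x => (h * h) * kn x + h * (gn \- zn) x + (u \- un) x).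
  by apply/funext => x /=; rewrite /r; field; rewrite gt_eqF.
rewrite dE -/wy in sd.
have Lgz : L1 (gn \- zn) by exact: L1_sub.
have Luu : L1 (u \- un) by exact: L1_sub.
have t1 := n1_tri3 (L1_scale (h * h) Lkn) (L1_scale h Lgz) Luu.
rewrite !(N_scale n1s)// (gtr0_norm h0) (gtr0_norm (mulr_gt0 h0 h0)) in t1.
have t2 : n1 (gn \- zn) <= 3 * e1.
  have L1' := L1_sub Lgn Lg; have L2' := L1_sub Lg Lz; have L3' := L1_sub Lz Lzn.
  have := n1_tri3 L1' L2' L3'.
  rewrite (_ : (fun x => _) = gn \- zn); last by apply/funext => x /=; ring.
  have := NdC n1s Lz Lzn; have : n1 (g \- z) < e1 by exact: gz.
  move: ga za e2le.1 e3le.2.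
  move: (n1 (gn \- g)) (n1 (g \- z)) (n1 (z \- zn)) (n1 (zn \- z)) (n1 (gn \- zn)).
  by clear=> *; lra.
have t3 : n1 kn <= n1 kk + 1.
  have := N_leD n1s Lkn Lk; have := e2le.2; move: ka.
  by move=> k1 k2 k3; apply: (le_trans k3); rewrite lerD2l; exact: ltW (lt_le_trans k1 k2).
have t4 : h * n1 kn <= e1.
  rewrite -hD ler_pM2l//; apply: le_trans t3 _; rewrite /D.
  by move: ng0 e0; move: (n1 kk) (n1 g) => a1 a2 *; lra.
have t5 : n1 wy <= h * (5 * e1).
  have h5 : h * h * n1 kn <= h * e1 by rewrite -mulrA ler_pM2l.
  have h6 : h * n1 (gn \- zn) <= h * (3 * e1) by rewrite ler_pM2l.
  have h7 : n1 (u \- un) <= h * e1.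
    by rewrite (NdC n1s Lu Lun); apply: le_trans (ltW ua) e3le.1.
  apply: le_trans sd _; apply: le_trans t1 _.
  rewrite (_ : h * (5 * e1) = h * e1 + h * (3 * e1) + h * e1); last by ring.
  by apply: lerD h7; exact: lerD h5 h6.
have Lrg := L1_sub Lr Lg.
have t6 : n1 (r \- g) < e.
  have La := L1_sub Lun Lu; have Lb := L1_sub Lzn Lg.
  have t := n1_tri3 (L1_scale h^-1 Lwy) (L1_scale h^-1 La) Lb.
  rewrite (_ : (fun x => _) = r \- g) in t; last first.
    by apply/funext => x /=; rewrite /r /wy; field; rewrite gt_eqF.
  have hi : 0 < h^-1 by rewrite invr_gt0.
  rewrite !(N_scale n1s)// (gtr0_norm hi) in t.
  have h5 : h^-1 * n1 wy <= 5 * e1 by rewrite ler_pdivrMl.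
  have h6 : h^-1 * n1 (fun x => un x - u x) <= e1.
    by rewrite ler_pdivrMl//; apply: le_trans (ltW ua) e3le.1.
  have h7 : n1 (fun x => zn x - g x) <= e1 + e1.
    have := Nd_tri n1s Lzn Lz Lg; have := NdC n1s Lz Lg.
    have : n1 (g \- z) < e1 by exact: gz.
    have := e2le.1; move: za.
    move: (n1 (zn \- z)) (n1 (g \- z)) (n1 (z \- g)); clear=> b1 b2 b3 c1 c2 c3 c4 c5.
    by apply: (le_trans c5); rewrite c4; apply: lerD; [exact: ltW (lt_le_trans c1 c2)|exact: ltW].
  rewrite ee; apply: le_lt_trans t _.
  apply: le_lt_trans (lerD (lerD h5 h6) h7) _.
  by rewrite (_ : _ + _ = 8 * e1); [rewrite ltr_pM2r// ltr_nat|ring].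
exists n, w, r; split=> //.
rewrite (_ : w \- u = (fun x => h * r x)); last by apply/funext => x /=; rewrite /r; field; rewrite gt_eqF.
rewrite (N_scale n1s)// (gtr0_norm h0).
have t7 : n1 r <= D.
  have := N_leD n1s Lr Lg; rewrite /D; move: (n1 (r \- g)) (n1 r) (n1 g) (n1 kk) t6 nk0 => *; lra.
apply: (@le_lt_trans _ _ (h * D)); first by rewrite ler_pM2l.
by rewrite hD ee; lra.
Qed.

Lemma DD_bilin_sq f g : DD f -> DD g ->
  EE (mid f g) (mid f g) <= 2^-1 * EE f f + 2^-1 * EE g g.
Proof.
move=> Df Dg; have Dm := mid_S s1ip Df Dg; have D2g : DD (fun x => 2^-1 * g x) := submod_scale 2^-1 DD_submod Dg.
have Dd := submod_sub DD_submod Df Dg.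
have := E_ge0 pf_good h_sector h_closable Dd.
have -> : closure_form mu pf CE (f \- g) (f \- g) = EE (f \- g) (f \- g) by [].
rewrite (lin_on_sub (EEl Dd) Df Dg) !(lin_on_sub (EEr _) Df Dg)//.
have -> : EE (mid f g) (mid f g) = 2^-1 * (2^-1 * EE f f + 2^-1 * EE f g) + 2^-1 * (2^-1 * EE g f + 2^-1 * EE g g).
  have e1 w : DD w -> EE w (mid f g) = 2^-1 * EE w f + 2^-1 * EE w g.
    by move=> Dw; rewrite /mid (EEr Dw)// (lin_on_scale _ DD_submod (EEr Dw) Dg).
  rewrite {1}/mid (EEl Dm)// (lin_on_scale _ DD_submod (EEl Dm) Dg) !e1//.
move: (EE f f) (EE f g) (EE g f) (EE g g) => a b c k; lra.
Qed.

Lemma mid_lin (S : set (X -> R)) (l : (X -> R) -> R) (I e : R) : submodule S -> linear_on S l ->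
  mid_convex [set f | S f /\ `|l f + I| <= e].
Proof.
move=> HS Ll f g [Sf hf] [Sg hg]; split; first exact: (mid_submod HS Sf Sg).
have Sg2 : S (fun x => 2^-1 * g x) := submod_scale 2^-1 HS Sg.
rewrite /mid Ll// (lin_on_scale _ HS Ll Sg).
move: hf hg; rewrite !ler_norml; move: (l f) (l g) => a b /andP[a1 a2] /andP[b1 b2].
by apply/andP; split; lra.
Qed.

(** For the bounded approximants the drift vanishes on the diagonal, so $\mathcal E^0(w_k,w_k)=-\int
    r_kw_k\,d\mu$ stays bounded and Mazur's theorem applies. The equation is affine and the diagonal
    of the form convex in the first argument, so both pass to the hull; for the diagonal this is
    lower semicontinuity, hence an inequality. *)
Lemma Gam_bounded u g (M : R) : Gam u g -> 0 < M -> (\forall x \ae mu, `|u x| <= M) ->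
  [/\ DD u, forall n v (M' : R), DV n v -> (\forall x \ae mu, `|v x| <= M') ->
        EE u v - bt u v = - Int (fun x => g x * v x) &
      EE u u <= - Int (fun x => g x * u x)].
Proof.
move=> ug M0 uM; have [Lu Lg _] := ug.
have /choice[W hW] : forall k : nat, exists p : nat * (X -> R) * (X -> R), [/\ (k <= p.1.1)%N,
    sol p.1.1 p.1.2 p.2, \forall x \ae mu, `|p.1.2 x| <= M, n1 (p.1.2 \- u) < k.+1%:R^-1 &
    n1 (p.2 \- g) < k.+1%:R^-1].
  move=> k; have k0 : 0 < k.+1%:R^-1 :> R by rewrite invr_gt0.
  by have [n [w [r h]]] := resolvent_near k ug M0 uM k0; exists (n, w, r).
pose m0 k := (W k).1.1; pose w0 k := (W k).1.2; pose r0 k := (W k).2.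
have L0 k := let: And5 _ h _ _ _ := hW k in sol_L1 h.
have cw0 : Ncvg n1 w0 u.
  move=> e /inv_small[n0 h]; exists n0 => k /h; apply: lt_trans.
  by have [] := hW k.
have [s [ks sc]] := L1_ae_subseq (fun k => (L0 k).1) Lu cw0.
pose w k := w0 (s k); pose r k := r0 (s k); pose m k := m0 (s k).
have km k : (k <= m k)%N by have [h _ _ _ _] := hW (s k); exact: leq_trans (ks k) h.
have sw k : sol (m k) (w k) (r k) by have [] := hW (s k).
have wM k : \forall x \ae mu, `|w k x| <= M by have [] := hW (s k).
have Lw k : L1 (w k) := (sol_L1 (sw k)).1.
have Lr k : L1 (r k) := (sol_L1 (sw k)).2.
have cw : Ncvg n1 w u := Ncvg_subseq ks cw0.
have cr : Ncvg n1 r g.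
  apply: (Ncvg_subseq (s := r0) ks) => e /inv_small[n0 h]; exists n0 => k /h; apply: lt_trans.
  by have [] := hW k.
have Dw k : DV (m k) (w k) by case: (sw k).
have DDw k : DD (w k) := DV_DD (Dw k).
have mw k := Lfun_measurable (Lw k).
have mu_ := Lfun_measurable Lu.
have Lu2 : L2 u := L12_dom Lu uM.
have pair (f v : X -> R) (K : R) : L1 f -> mfun v -> 0 <= K -> (\forall x \ae mu, `|v x| <= K) ->
    L1 (fun x => f x * v x) /\ `|Int (fun x => f x * v x)| <= K * n1 f.
  move=> Lf mv K0 vK; have Lfv := L1_mulB Lf mv vK; split=> //.
  apply: le_trans (I_abs Lfv) _; rewrite /n1 -I_scale; last exact: L1_abs.
  apply: I_le; [exact: L1_abs|by apply: L1_scale; exact: L1_abs|].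
  by apply: filterS vK => x h; rewrite normrM mulrC ler_wpM2r.
(* [r] converges in $L^1$ and [w] is bounded and converges almost everywhere, which suffices for the
   product. *)
have diag : (fun k => Int (fun x => r k x * w k x)) @ \oo --> Int (fun x => g x * u x).
  have c1 := bounded_int_ae Lg mu_ mw wM sc.
  have c2 : (fun k => Int (fun x => (r k \- g) x * w k x)) @ \oo --> (0 : R).
    apply: (cvgr0_le (r := fun k => M * n1 (r k \- g))) => [k|].
      exact: (pair _ _ _ (L1_sub (Lr k) Lg) (mw k) (ltW M0) (wM k)).2.
    rewrite -(mulr0 M); apply: cvgr_mulc; apply/cvgr_epsP => e /cr[n0 h]; exists n0 => k /h.
    by rewrite subr0 ger0_norm// (N_ge0 n1s)//; exact: L1_sub.
  have := cvgr_add c2 c1; rewrite add0r; apply: cvgr_ext => k.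
  have [La _] := pair _ _ _ (L1_sub (Lr k) Lg) (mw k) (ltW M0) (wM k).
  have [Lb _] := pair _ _ _ Lg (mw k) (ltW M0) (wM k).
  by rewrite -(I_add La Lb); congr Rintegral; apply/funext => x /=; ring.
have EEw k : EE (w k) (w k) = - Int (fun x => r k x * w k x).
  have := sol_ext (sw k) (Dw k) (wM k).
  by rewrite (bt_self (Dw k) (wM k)) subr0.
have [K1 K10 hK1] := cauchy_bounded n1s Lw (Ncvg_cauchy n1s Lw Lu cw).
have [K2 K20 hK2] := cauchy_bounded n1s Lr (Ncvg_cauchy n1s Lr Lg cr).
have nEb k : nE (w k) <= Num.sqrt (M * K2 + M * K1).
  have MK : 0 <= M * K2 + M * K1 by rewrite addr_ge0// mulr_ge0// ltW.
  rewrite -(ler_pXn2r (n := 2))// ?nnegrE ?sn_ge0 ?sqrtr_ge0// (sqr_sqrtr MK).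
  rewrite (nE_sqr pf_good h_sector h_closable (DDw k)).
  have -> : closure_form mu pf CE (w k) (w k) = EE (w k) (w k) by [].
  rewrite EEw n2_sqr; apply: lerD.
    have [_ h] := pair _ _ _ (Lr k) (mw k) (ltW M0) (wM k).
    apply: le_trans (ler_norm _) _; rewrite normrN; apply: le_trans h _.
    by rewrite ler_pM2l.
  have [_ h] := pair _ _ _ (Lw k) (mw k) (ltW M0) (wM k).
  apply: le_trans (ler_norm _) _; apply: (@le_trans _ _ (M * n1 (w k))).
    by under eq_Rintegral do rewrite expr2.
  by rewrite ler_pM2l.
have cw2 : Ncvg n2 w u.
  move=> e e0; have M2 : 0 < 2 * M by rewrite mulr_gt0.
  have e1 : 0 < e ^+ 2 / (2 * M) by rewrite divr_gt0// exprn_gt0.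
  have [n0 h] := cw _ e1; exists n0 => k /h; rewrite ltr_pdivlMr// => hk.
  have Ld := L1_sub (Lw k) Lu.
  have dM : \forall x \ae mu, `|(w k \- u) x| <= 2 * M.
    apply: filterS2 (wM k) uM => x a b; apply: le_trans (ler_normB _ _) _.
    by move: `|w k x| `|u x| a b => *; lra.
  rewrite -(ltr_pXn2r (n := 2))// ?nnegrE ?n2_ge0 ?(ltW e0)//; apply: le_lt_trans hk.
  rewrite n2_sqr mulrC; have [_ h'] := pair _ _ _ Ld (Lfun_measurable Ld) (ltW M2) dM.
  apply: le_trans (ler_norm _) _; apply: le_trans h'.
  by under eq_Rintegral do rewrite expr2.
have [Du [y [Dy hy yu]]] := maz DDw nEb Lu2 cw2.
split=> //.
- move=> n v M' Dv vM'0; pose K := `|M'| + 1.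
  have K0 : 0 < K by rewrite ltr_wpDl.
  have vM' : \forall x \ae mu, `|v x| <= K.
    by apply: filterS vM'0 => x h; apply: le_trans h _; rewrite /K ler_wpDr// ler_norm.
  have DDv := DV_DD Dv; have av := DV_adm (ltW K0) Dv vM'.
  have mv : mfun v by case: av.
  pose I := Int (fun x => g x * v x).
  pose psi f := EE f v - bt f v.
  have lpsi : linear_on DD psi.
    move=> c f f' Df Df'; rewrite /psi (EEl DDv c Df Df') (bt_linl c Df Df' av).
    by move: (EE f v) (EE f' v) (bt f v) (bt f' v) => *; ring.
  have cpsi : (fun k => psi (y k)) @ \oo --> psi u.
    have c1 := EE_cvgl DDv Dy Du yu.
    have cv : \forall x \ae mu, (fun _ : nat => v x) @ \oo --> v x by apply: nearW => x; exact: cvg_cst.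
    have c2 := bt_lim Dy Du yu (fun _ : nat => av) av cv.
    have := cvgr_add c1 (cvgr_mulc (c := -1) c2); rewrite mulN1r.
    by apply: cvgr_ext => k; rewrite mulN1r.
  (* For fixed [v] the error in the equation is an affine function of its first argument, so its
     smallness on a tail of [w] is inherited by the hull elements [y]. *)
  suff key e : 0 < e -> `|psi u + I| <= e.
    have : `|psi u + I| <= 0 by apply: le_eps => e e0; rewrite add0r; exact: key.
    by rewrite normr_le0 addr_eq0 => /eqP.
  move=> e0; have eK : 0 < e / K by rewrite divr_gt0.
  have [n0 h0] := cr _ eK.
  have hk k : (maxn n n0 <= k)%N -> `|psi (w k) + I| <= e.
    rewrite geq_max => /andP[nk n0k].
    rewrite /psi (sol_ext (sw k) (DV_mono (leq_trans nk (km k)) Dv) vM').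
    have [La _] := pair _ _ _ (Lr k) mv (ltW K0) vM'.
    have [Lb _] := pair _ _ _ Lg mv (ltW K0) vM'.
    rewrite addrC -(I_sub Lb La).
    have [_ h] := pair _ _ _ (L1_sub Lg (Lr k)) mv (ltW K0) vM'.
    rewrite (_ : (fun x => _) = (fun x => (g x - r k x) * v x)); last by apply/funext => x; ring.
    apply: le_trans h _.
    have := h0 k n0k; rewrite -(NdC n1s Lg (Lr k)) ltr_pdivlMr// => /ltW.
    by rewrite mulrC.
  have hyk k : (maxn n n0 <= k)%N -> `|psi (y k) + I| <= e.
    move=> kk; apply: (hy k _ (mid_lin DD_submod lpsi) _).2 => j kj.
    by split=> //; apply: hk; exact: leq_trans kk kj.
  have hI : (fun _ : nat => I) @ \oo --> I by exact: cvg_cst.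
  have cabs : (fun k => `|psi (y k) + I|) @ \oo --> `|psi u + I|.
    by apply: cvg_norm; exact: cvgr_add.
  by apply: cvgr_ub cabs _; exists (maxn n n0).
- apply: le_eps => e e0; set I := Int _.
  have /cvgr_epsP/(_ _ e0)[n0 h0] := diag.
  (* Sublevel sets of the diagonal are midpoint-convex by [DD_bilin_sq]. *)
  have hyk k : (n0 <= k)%N -> EE (y k) (y k) <= - I + e.
    move=> kk; apply: (hy k [set f | DD f /\ EE f f <= - I + e] _ _).2 => [f f' [Df hf] [Df' hf']|j kj].
      split; first exact: (mid_S s1ip Df Df').
      apply: le_trans (DD_bilin_sq Df Df') _.
      by move: (EE f f) (EE f' f') hf hf' => *; lra.
    split=> //; rewrite EEw; have := h0 j (leq_trans kk kj).
    by rewrite ltr_norml -/I => /andP[]; move: (Int _) I => *; lra.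
  have c1 := Ncvg_N nE_sn Dy Du yu.
  have c2 := Ncvg_N (n2_seminorm mu) (fun k => DDL2 (Dy k)) Lu2 (nE_n2 Dy Du yu).
  have c3 := cvgr_add (cvgr_mul c1 c1) (cvgr_mulc (c := -1) (cvgr_mul c2 c2)).
  have EN f : DD f -> nE f * nE f + -1 * (n2 f * n2 f) = EE f f.
    by move=> Df; rewrite -!expr2 (nE_sqr pf_good h_sector h_closable Df) /E0; ring.
  rewrite EN// in c3.
  apply: cvgr_ub c3 _; exists n0 => k /hyk; rewrite EN//.
Qed.

(** * The semigroup and its generator *)

Local Notation S1 := [set f : X -> R | f \in Lfun mu 1].

Lemma right_cvg0P (F : R -> \bar R) (r : R -> R) :
  (forall t, 0 < t -> F t = (r t)%:E /\ 0 <= r t) ->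
  (F @ 0^'+ --> 0%E <-> forall e, 0 < e -> exists2 dl, 0 < dl & forall t, 0 < t -> t < dl -> r t < e).
Proof.
move=> Fr; split=> [h e e0|h].
  have /fine_cvgP[_ /cvgrPdist_lt/(_ _ e0)] := h.
  rewrite near_withinE => /nbhs_ballP[dl /= dl0 hd]; exists dl => // t t0 tdl.
  have [Ft rt] := Fr t t0.
  have : ball (0 : R) dl t by rewrite /ball/= sub0r normrN gtr0_norm.
  by move=> /hd/(_ t0); rewrite /= Ft/= sub0r normrN ger0_norm.
apply/fine_cvgP; split.
  near=> t; rewrite (Fr t _).1//.
apply/cvgrPdist_lt => e e0; have [dl dl0 hd] := h e e0.
near=> t; have t0 : 0 < t by [].
have [Ft rt] := Fr t t0; rewrite /= Ft /= sub0r normrN ger0_norm//.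
by apply: hd.
Unshelve. all: by end_near.
Qed.

Lemma L1cvg (u : nat -> X -> R) f : (forall n, L1 (u n)) -> L1 f -> Lcvg mu 1 u f <-> Ncvg n1 u f.
Proof. exact: Lcvg1P. Qed.

Definition Tbar := semi S1 n1 Gam.
Definition DLbar : set (X -> R) := [set u | exists g, Gam u g].
Definition Lbar u : X -> R := xget (cst 0) [set g | Gam u g].

Lemma LP u : DLbar u -> Gam u (Lbar u).
Proof. by move=> [g hg]; rewrite /Lbar; case: xgetP => [y _ //|/(_ g)]. Qed.

Lemma Gam_ae u g u' g' : Gam u g -> L1 u' -> L1 g' -> u = u' %[ae mu] -> g = g' %[ae mu] -> Gam u' g'.
Proof.
move=> hG Lu' Lg' uu gg; have [Lu Lg _] := hG.
apply: (Gam_closed (s := fun=> u) (r := fun=> g)) => // e e0; exists 0%N => _ _.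
  by rewrite (eq_n1 Lu Lu' uu).
by rewrite (eq_n1 Lg Lg' gg).
Qed.

Lemma Gam_fun u g k : Gam u g -> Gam u k -> g = k %[ae mu].
Proof.
move=> hg hk; have [_ Lg _] := hg; have [_ Lk _] := hk; apply: n1_eq => //.
exact: (G_fun n1s Gam_S Gam_lin Gam_diss Gam_dense hg hk).
Qed.

Lemma L1_op : L1_operator mu DLbar Lbar.
Proof.
split.
- by move=> u /LP/Gam_S.
- move=> u v Du Lv uv; have hu := LP Du; have [Lu Lg _] := hu.
  have gg : Lbar u = Lbar u %[ae mu] by exact: nearW.
  have hv := Gam_ae hu Lv Lg uv gg.
  have Dv : DLbar v by exists (Lbar u).
  by split=> //; exact: Gam_fun hv (LP Dv).
- by exists (cst 0); exact: Gam0.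
- move=> c u v /LP hu /LP hv; have h := Gam_lin c hu hv.
  have Dw : DLbar (fun x => c * u x + v x) by exists (fun x => c * Lbar u x + Lbar v x).
  by split=> //; exact: Gam_fun (LP Dw) h.
Qed.

Lemma L_closed : L1_closed mu DLbar Lbar.
Proof.
move=> u f g Du Lf Lg; have Lu n := (Gam_S (LP (Du n))).1; have LLu n := (Gam_S (LP (Du n))).2.
move=> /(L1cvg Lu Lf) uf /(L1cvg LLu Lg) ug.
have h := Gam_closed (fun n => LP (Du n)) Lf Lg uf ug.
have Df : DLbar f by exists g.
by split=> //; exact: Gam_fun (LP Df) h.
Qed.

Let compl := @L1_complete _ _ _ mu.

Lemma T_L1 t f : 0 < t -> L1 f -> L1 (Tbar t f).
Proof. exact: (semi_S n1s compl Gam_S Gam_lin Gam_closed Gam_diss Gam_range Gam_dense). Qed.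

Lemma T_semigroup : C0_contraction_semigroup mu Tbar.
Proof.
split.
- move=> t t0; split.
  + by move=> u Lu; split=> //; exact: T_L1.
  + move=> u v Lu Lv uv; split=> //; apply: n1_eq; [exact: T_L1|exact: T_L1|].
    have := semi_Lip n1s compl Gam_S Gam_lin Gam_closed Gam_diss Gam_range Gam_dense t0 Lu Lv.
    rewrite (eq_n1 Lu Lv uv) -/Tbar => h; apply/eqP; rewrite eq_le h (N_ge0 n1s)//.
    by apply: L1_sub; exact: T_L1.
  + exact: L1_0.
  + move=> c u v Lu Lv; split; first exact: L1_lin.
    apply: n1_eq; [by apply: T_L1 => //; exact: L1_lin|by apply: L1_lin; exact: T_L1|].
    exact: (semi_lin n1s compl Gam_S Gam_lin Gam_closed Gam_diss Gam_range Gam_dense).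
- move=> t f t0 Lf; rewrite !n1_Lnorm ?lee_fin//; last exact: T_L1.
  exact: (semi_contr n1s compl Gam_S Gam_lin Gam_closed Gam_diss Gam_range Gam_dense).
- move=> s t f s0 t0 Lf; apply: n1_eq; [by apply: T_L1 => //; rewrite addr_gt0|by apply: T_L1 => //; exact: T_L1|].
  exact: (semi_add n1s compl Gam_S Gam_lin Gam_closed Gam_diss Gam_range Gam_dense).
- move=> f Lf; apply/(right_cvg0P (r := fun t => n1 (Tbar t f \- f))) => [t t0|e e0].
    have Ld : L1 (Tbar t f \- f) by apply: L1_sub => //; exact: T_L1.
    by split; [exact: n1_Lnorm|exact: (N_ge0 n1s)].
  exact: (semi_cont0 n1s compl Gam_S Gam_lin Gam_closed Gam_diss Gam_range Gam_dense Lf e0).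
Qed.

Lemma deriv0P u g : L1 u -> L1 g -> right_derivative0 mu Tbar u g <-> Nderiv0 n1 Tbar u g.
Proof.
move=> Lu Lg; rewrite /right_derivative0.
apply: (right_cvg0P (r := fun t => n1 (fun x => t^-1 * (Tbar t u x - u x) - g x))) => t t0.
have Ld : L1 (fun x => t^-1 * (Tbar t u x - u x) - g x).
  by apply: L1_sub => //; apply: L1_scale; apply: L1_sub => //; exact: T_L1.
by split; [exact: n1_Lnorm|exact: (N_ge0 n1s)].
Qed.

Lemma T_generator : is_generator mu Tbar DLbar Lbar.
Proof.
have d1 u g : Gam u g -> right_derivative0 mu Tbar u g.
  move=> hG; have [Lu Lg _] := hG; apply/(deriv0P Lu Lg).
  exact: (semi_deriv n1s compl Gam_S Gam_lin Gam_closed Gam_diss Gam_range Gam_dense).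
split=> [u|u /LP hu]; last by split; [exact: (Gam_S hu).2|exact: d1].
split=> [/LP hu|[Lu [g Lg /(deriv0P Lu Lg) h]]].
  by have [Lu Lg] := Gam_S hu; split=> //; exists (Lbar u) => //; exact: d1.
by exists g; exact: (deriv_dom n1s compl Gam_S Gam_lin Gam_closed Gam_diss Gam_range Gam_dense Lu Lg h).
Qed.

(** For the resolvent, the upper bound is the comparison inequality at level 1 for [u], and the
    lower bound the one at level 0 for $-u$. *)
Lemma T_subMarkov : sub_Markovian mu Tbar.
Proof.
move=> t f t0 Lf f01; pose Q := [set u : X -> R | \forall x \ae mu, 0 <= u x <= 1].
apply: (semi_invariant n1s compl Gam_S Gam_lin Gam_closed Gam_diss Gam_range Gam_dense (Q := Q)) => //.
- move=> s u Ls Lu Qs su; have [r [_ rc]] := L1_ae_subseq Ls Lu su.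
  apply: filterS2 rc (ae_foralln Qs) => x cx h.
  have c0 : (fun _ : nat => 0 : R) @ \oo --> (0 : R) by exact: cvg_cst.
  have c1 : (fun _ : nat => 1 : R) @ \oo --> (1 : R) by exact: cvg_cst.
  apply/andP; split.
    by apply: (cvgr_ler c0 cx) => k; have /andP[] := h (r k).
  by apply: (cvgr_ler cx c1) => k; have /andP[] := h (r k).
- move=> h u g h0 hG Qf; have [Lu Lg _] := hG.
  have Lf' : L1 (fun x => u x - h * g x) by apply: L1_sub => //; exact: L1_scale.
  have mf' := Lfun_measurable Lf'.
  have h1 : \forall x \ae mu, u x <= 1.
    apply: (pos_int0 ler01 Lu); apply: le_trans (Gam_star hG h0 ler01) _.
    by rewrite (pos_int_eq0 mf')//; apply: filterS Qf => x /andP[].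
  have h2 : \forall x \ae mu, -1 * u x + cst 0 x <= 0.
    have hG' := Gam_lin (-1) hG Gam0; have [Lu' _ _] := hG'.
    apply: (pos_int0 (lexx 0) Lu'); apply: le_trans (Gam_star hG' h0 (lexx 0)) _.
    rewrite (_ : (fun x => _) = (fun x => pos (- (u x - h * g x) - 0))); last first.
      by apply/funext => x /=; congr pos; ring.
    rewrite pos_int_eq0//; first exact: measurableT_comp.
    by apply: filterS Qf => x /andP[]; rewrite oppr_le0.
  by apply: filterS2 h1 h2 => x a b; rewrite a andbT; move: b; rewrite /= addr0 mulN1r oppr_le0.
Qed.

Lemma ae_bounded_pos u : ae_bounded mu u -> exists2 M : R, 0 < M & \forall x \ae mu, `|u x| <= M.
Proof.
move=> [M hM]; exists (`|M| + 1); first by rewrite ltr_wpDl.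
by apply: filterS hM => x h; apply: le_trans h _; rewrite ler_wpDr// ler_norm.
Qed.

Lemma D_E0E_DV v : D_E0E E mu A v -> exists n, DV n v.
Proof.
move=> [V [_ cV cVE] Dv]; have [n hn] := compact_Vn cV cVE; exists n.
apply: closure_dom_mono Dv; apply: Ccoo_in_mono; apply: subset_trans hn.
exact: subset_closure.
Qed.

Lemma conclusion :
  exists (DLbar : set (X -> R)) (Lbar : (X -> R) -> X -> R) (Tbar : R -> (X -> R) -> X -> R),
    [/\ L1_operator mu DLbar Lbar /\ L1_closed mu DLbar Lbar,
        [/\ C0_contraction_semigroup mu Tbar, sub_Markovian mu Tbar & is_generator mu Tbar DLbar Lbar],
        forall u, D_L0_0b E mu A u -> DLbar u /\
          Lbar u = (fun x => L0 E mu A u x + dotv (B x) (nabla E mu A u x)) %[ae mu] &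
        (forall u, DLbar u -> ae_bounded mu u -> D_E0 E mu A u) /\
        (forall u, DLbar u -> ae_bounded mu u ->
          (forall v, D_E0E E mu A v -> ae_bounded mu v ->
            E0 E mu A u v - \int[mu]_(x in E) (dotv (B x) (nabla E mu A u x) * v x) =
            - \int[mu]_(x in E) (Lbar u x * v x)) /\
          E0 E mu A u u <= - \int[mu]_(x in E) (Lbar u x * u x))].
Proof.
exists DLbar, Lbar, Tbar; split.
- by split; [exact: L1_op|exact: L_closed].
- by split; [exact: T_semigroup|exact: T_subMarkov|exact: T_generator].
- move=> u Du; have hG := Gam_L0 Du; have Dlu : DLbar u by exists (Lval u).
  split=> //; apply: filterS2 (Gam_fun (LP Dlu) hG) (Lval_ae u) => x a b xT.
  by rewrite a// b.
- have b u : DLbar u -> ae_bounded mu u -> exists2 M, 0 < M & \forall x \ae mu, `|u x| <= M.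
    by move=> _; exact: ae_bounded_pos.
  split=> u Du bu; have [M M0 uM] := b u Du bu; have hG := LP Du; have [Lu Lg _] := hG;
    have [Eu eqn en] := Gam_bounded hG M0 uM => //.
  have mL := Lfun_measurable Lg.
  split=> [v /D_E0E_DV[n Dv] bv|].
    have [M' _ vM] := ae_bounded_pos bv.
    rewrite (Rint_setT mL (Lfun_measurable (DDL2 (DV_DD Dv)))).
    exact: eqn Dv vM.
  by rewrite (Rint_setT mL (Lfun_measurable Lu)).
Qed.

End lower_order_perturbation.

Theorem lemma13 (R : realType) (d : nat) (hd : (0 < d)%N)
    (E : set 'rV[R]_d)
    (hE : open E \/
          closed E /\ lebesgue_rV R d (closure E `\` interior E) = 0%E)
    (phi : 'rV[R]_d -> R)
    (hphi : Lloc E (lebesgue_rV R d) 1 phi)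
    (hphi_gt0 : \forall x \ae lebesgue_rV R d, E x -> 0 < phi x)
    (mu : {sigma_finite_measure set 'rV[R]_d -> \bar R})
    (hmu : forall S, measurable S ->
       mu S = (\int[lebesgue_rV R d]_(x in S `&` E) (phi x)%:E)%E)
    (hmu_supp : forall U, open U -> U `&` E !=set0 -> (0 < mu (U `&` E))%E)
    (A : 'rV[R]_d -> 'M[R]_d)
    (hA_loc : forall i j, Lloc E mu 1 (fun x => A x i j))
    (hA_ell : locally_elliptic E A)
    (h_closable : closable mu (pre_form E mu A) (Ccoo E))
    (h_sector : strong_sector (pre_form E mu A) (Ccoo E))
    (B : 'rV[R]_d -> 'rV[R]_d)
    (hB_loc : forall i, Lloc E mu 2%:E (fun x => B x 0 i))
    (hB_div : forall f, Ccoo E f ->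
       \int[mu]_(x in E) dotv (B x) (grad f x) = 0)
    (h_dense : dense_in_L1 mu (D_L0_0b E mu A)) :
  exists (DL : set ('rV[R]_d -> R)) (L : ('rV[R]_d -> R) -> 'rV[R]_d -> R)
         (T : R -> ('rV[R]_d -> R) -> 'rV[R]_d -> R),
    [/\ L1_operator mu DL L /\ L1_closed mu DL L,
        [/\ C0_contraction_semigroup mu T, sub_Markovian mu T &
            is_generator mu T DL L],
        forall u, D_L0_0b E mu A u ->
          DL u /\
          L u = (fun x => L0 E mu A u x + dotv (B x) (nabla E mu A u x))
            %[ae mu] &
        (forall u, DL u -> ae_bounded mu u -> D_E0 E mu A u) /\
        (forall u, DL u -> ae_bounded mu u ->
          (forall v, D_E0E E mu A v -> ae_bounded mu v ->
            E0 E mu A u v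
              - \int[mu]_(x in E) (dotv (B x) (nabla E mu A u x) * v x) =
            - \int[mu]_(x in E) (L u x * v x)) /\
          E0 E mu A u u <= - \int[mu]_(x in E) (L u x * u x))].
Proof.
have mE : measurable E by case: hE => [/open_meas|[/closed_meas]].
have [mphi phiK] := hphi.
(* By [hmu] only the part of the complement of the interior inside [E] is charged: it is empty for
   open [E], and the Lebesgue-null boundary for closed [E]. *)
have muE0 : mu (~` interior E) = 0%E.
  have [oE|[cE null]] := hE.
    by rewrite (interior_id E).1// hmu ?setICl ?integral_set0//; exact: measurableC.
  rewrite hmu; last by apply: measurableC; apply: open_meas; exact: open_interior.
  rewrite (_ : ~` interior E `&` E = closure E `\` interior E); last first.
    by rewrite -(closure_id E).1// setIC.
  have mD : measurable (closure E `\` interior E).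
    by rewrite -(closure_id E).1//; apply: measurableD => //; apply: open_meas;
       exact: open_interior.
  apply: null_set_integral null => //; apply/measurable_EFinP.
  by apply: measurable_funS mphi => // x [/=]; rewrite -(closure_id E).1.
have muK K : compact K -> K `<=` E -> (mu K < +oo)%E.
  move=> cK KE; rewrite hmu; last exact: compact_meas.
  rewrite (setIidl KE).
  have mK := compact_meas cK.
  have := (Lfun1_integrable _ _).1 (phiK K cK KE); rewrite -restrict_EFin => iK.
  by apply: (integrable_lty mK); rewrite (integrable_mkcond _ mK).
have HE : open E \/ closed E by case: hE => [|[]]; [left|right].
exact: (conclusion HE muE0 muK hA_loc hA_ell h_closable h_sector hB_loc hB_div h_dense).
Qed.
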